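(* Model checking $\mathcal{L}_{\mathsf{DEL}}$ on knowledge structures is PSPACE-complete. That is, the following problem is PSPACE-complete: given a finite set of agents $A$, a knowledge structure $\mathcal{F}=(V,\theta,O)$ with $\theta$ given as a BDD, a state $s$ of $\mathcal{F}$ and $\phi\in\mathcal{L}_{\mathsf{DEL}}(V)$ (whose transformers carry observables $O_i^+$), decide whether $\mathcal{F},s\vDash\phi$ (input size $|V|+|\theta|+\sum_{i\in A}|O_i|+|\phi|$).
   Context: Vocabularies are finite linearly ordered sets of atoms; $A$ is a finite set of agents. Boolean formulas over a vocabulary $W$: $\beta::=\top\mid\bot\mid p\mid\neg\beta\mid\beta\land\beta$ ($p\in W$), with usual abbreviations; a valuation/state is a subset $s\subseteq W$ and $s\vDash\beta$ ordinary satisfaction. $W'=\{p'\mid p\in W\}$ is a fresh copy and $s'=\{p'\mid p\in s\}$. $[A\mapsto B]\beta$ is simultaneous substitution (for copies via the obvious bijection); $\forall p\,\beta:=[p\mapsto\top]\beta\land[p\mapsto\bot]\beta$, extended to finite sets; for $x\subseteq W$, $[x\sqsubseteq W]\beta$ substitutes $\top$ for atoms in $x$ and $\bot$ for atoms of $W\setminus x$. BDDs are reduced ordered binary decision diagrams; size = number of nodes. $\mathcal{L}_{\mathsf{DEL}}$: $\phi::=\top\mid\bot\mid p\mid\neg\phi\mid\phi\land\phi\mid K_i\phi\mid[\mathcal{X},x]\phi$ with events $(\mathcal{X},x)$ as below (mutual recursion). Length: $|\top|=|\bot|=|p|=1$, $|\neg\phi|=|K_i\phi|=|\phi|+1$,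 $|\phi_1\land\phi_2|=|\phi_1|+|\phi_2|+1$, $|[\mathcal{X},x]\phi|=|\mathcal{X}|+|\phi|+1$. A knowledge structure is $\mathcal{F}=(V,\theta,O)$ with $\theta$ Boolean over $V$ and $O_i\subseteq V$ ($i\in A$); its states are $s\subseteq V$ with $s\vDash\theta$. For the semantics it is identified with the belief structure $(V,\theta,\Omega)$, $\Omega_i:=\bigwedge_{p\in O_i}(p\leftrightarrow p')$ (so $s\cup t'\vDash\Omega_i$ iff $s\cap O_i=t\cap O_i$). In general a belief structure is $(V,\theta,\Omega)$ with $\Omega_i$ Boolean over $V\cup V'$. A transformer (for knowledge structures) is $\mathcal{X}=(V^+,\theta^+,V_-,\theta_-,O^+)$ with $V^+\cap V=\varnothing$, $\theta^+\in\mathcal{L}_{\mathsf{DEL}}(V\cup V^+)$, $V_-\subseteq V$, $\theta_-:V_-\to$ Boolean formulas over $V\cup V^+$, and $O_i^+\subseteq V^+$, identified with $\Omega_i^+:=\bigwedge_{p\in O_i^+}(p\leftrightarrow p')$; an event is $(\mathcal{X},x)$ with $x\subseteq V^+$; $|\mathcal{X}|=|V^+|+|\theta^+|+|V_-|+\sum_{p\in V_-}|\theta_-(p)|+\sum_i|O_i^+|$. With $V_-^\circ$ a fresh copy of $V_-$: $\mathcal{F}\times\mathcal{X}=(V\cup V^+\cup V_-^\circ,\theta^{new},\Omega^{new})$ with $\theta^{new}=[V_-\mapsto V_-^\circ](\theta\land\|\theta^+\|_{\mathcal{F}})\land\bigwedge_{q\in V_-}(q\leftrightarrow[V_-\mapsto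 V_-^\circ]\theta_-(q))$, $\Omega_i^{new}=[V_-\mapsto V_-^\circ][(V_-)'\mapsto(V_-^\circ)']\Omega_i\land\Omega_i^+$, and $s^x=(s\setminus V_-)\cup(s\cap V_-)^\circ\cup x\cup\{p\in V_-\mid s\cup x\vDash\theta_-(p)\}$. Semantics (on belief structures): Boolean cases as usual; $\mathcal{F},s\vDash K_i\phi$ iff for all states $t$ of $\mathcal{F}$ with $s\cup t'\vDash\Omega_i$, $\mathcal{F},t\vDash\phi$; $\mathcal{F},s\vDash[\mathcal{X},x]\phi$ iff $\mathcal{F},s\vDash[x\sqsubseteq V^+]\theta^+$ implies $\mathcal{F}\times\mathcal{X},s^x\vDash\phi$. Local Boolean translation: identity on $\top,\bot,p$, commutes with $\neg,\land$; $\|K_i\psi\|_{\mathcal{F}}=\forall V'(\theta'\to(\Omega_i\to(\|\psi\|_{\mathcal{F}})'))$; $\|[\mathcal{X},x]\phi\|_{\mathcal{F}}=\|[x\sqsubseteq V^+]\theta^+\|_{\mathcal{F}}\to[V_-^\circ\mapsto V_-][x\sqsubseteq V^+][V_-\mapsto\theta_-(V_-)]\|\phi\|_{\mathcal{F}\times\mathcal{X}}$. *)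

(* Defs.v *)
From HB Require Import structures.
From mathcomp Require Import all_boot zify.

Set Implicit Arguments.
Unset Strict Implicit.
Unset Printing Implicit Defensive.

Inductive move := MLeft | MStay | MRight.

(* A machine has [tm_tapes.+1] two-way infinite tapes over the alphabet
   [option (bool + tm_aux)]: [None] is the blank, [Some (inl b)] are the input
   bits and [Some (inr a)] the auxiliary symbols.  [tm_verdict q = Some b] says
   that [q] is a halting state, accepting iff [b]. *)
Record tm := TM {
  tm_tapes : nat;
  tm_state : finType;
  tm_aux : finType;
  tm_start : tm_state;
  tm_verdict : tm_state -> option bool;
  tm_delta : tm_state -> {ffun 'I_tm_tapes.+1 -> option (bool + tm_aux)} ->
    tm_state * {ffun 'I_tm_tapes.+1 -> option (bool + tm_aux) * move}
}.

(* The cells visited so far (and the cells of the input): those to the left of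
   the head, nearest first, the scanned cell, and those to its right. *)
Record tape (S : Type) := Tape {
  t_left : seq (option S); t_cur : option S; t_right : seq (option S) }.

Definition tape_size S (t : tape S) := (size (t_left t) + size (t_right t)).+1.

Definition tape_of S (w : seq S) : tape S :=
  if w is a :: w' then Tape [::] (Some a) (map Some w')
  else Tape [::] None [::].

Definition write_move S (t : tape S) (a : option S) (m : move) : tape S :=
  match m with
  | MStay => Tape (t_left t) a (t_right t)
  | MLeft => if t_left t is b :: l then Tape l b (a :: t_right t)
             else Tape [::] None (a :: t_right t)
  | MRight => if t_right t is b :: r then Tape (a :: t_left t) b r
              else Tape (a :: t_left t) None [::]
  end.

(* The longest blank-free word starting at the head. *)
Definition tape_word S (t : tape S) : seq S :=
  (fix word (s : seq (option S)) : seq S :=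
     if s is Some a :: s' then a :: word s' else [::])
  (t_cur t :: t_right t).

Record config (M : tm) := Config {
  c_state : tm_state M;
  c_tapes : {ffun 'I_(tm_tapes M).+1 -> tape (bool + tm_aux M)} }.

Definition tm_init (M : tm) (w : seq bool) : config M :=
  Config (tm_start M)
    [ffun j => if j == ord0 then tape_of (map inl w) else tape_of [::]].

Definition tm_step (M : tm) (c : config M) : config M :=
  if tm_verdict (c_state c) is Some _ then c else
  let: (q, act) := tm_delta (c_state c) [ffun j => t_cur (c_tapes c j)] in
  Config q [ffun j => write_move (c_tapes c j) (act j).1 (act j).2].

Definition tm_run (M : tm) (w : seq bool) (n : nat) : config M :=
  iter n (@tm_step M) (tm_init M w).

Definition config_space (M : tm) (c : config M) : nat :=
  \sum_(j < (tm_tapes M).+1) tape_size (c_tapes c j).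

Definition language := seq bool -> Prop.

Definition decides_in_space (M : tm) (L : language) (f : nat -> nat) : Prop :=
  forall w : seq bool,
    (exists n b, tm_verdict (c_state (tm_run M w n)) = Some b /\ (b <-> L w)) /\
    (forall n, config_space (tm_run M w n) <= f (size w)).

Definition computes_in_time (M : tm) (g : seq bool -> seq bool)
    (f : nat -> nat) : Prop :=
  forall w : seq bool, exists n, [/\ n <= f (size w),
    isSome (tm_verdict (c_state (tm_run M w n))) &
    tape_word (c_tapes (tm_run M w n) ord0) = map inl (g w)].

Definition PSPACE (L : language) : Prop :=
  exists (M : tm) (c k : nat), decides_in_space M L (fun n => c * n ^ k + c).

Definition polytime (g : seq bool -> seq bool) : Prop :=
  exists (M : tm) (c k : nat), computes_in_time M g (fun n => c * n ^ k + c).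

Definition poly_reducible (L1 L2 : language) : Prop :=
  exists g, polytime g /\ forall w, L1 w <-> L2 (g w).

Definition PSPACE_hard (L : language) : Prop :=
  forall L', PSPACE L' -> poly_reducible L' L.

Definition PSPACE_complete (L : language) : Prop := PSPACE L /\ PSPACE_hard L.

(* [Atom n] are the atoms proper, named by bit strings.  [Prime p] is p', and
   [Circ k p] is the copy p° made by an update; the stamp [k] separates the
   copies made by successive updates (the same p may be changed repeatedly).
   The vocabulary of an instance and the sets V^+ consist of [Atom]s. *)
Inductive atom := Atom (n : seq bool) | Circ (k : nat) (p : atom) | Prime (p : atom).

Lemma atom_eq_dec (p q : atom) : decidable (p = q).
Proof.
rewrite /decidable; decide equality; first exact: (decP eqP).
exact: (decP eqP).
Defined.

HB.instance Definition _ := hasDecEq.Build atom (compareP atom_eq_dec).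

Definition is_name (p : atom) := if p is Atom _ then true else false.

Fixpoint stamp (p : atom) : nat :=
  match p with
  | Atom _ => 0
  | Circ k q => maxn k.+1 (stamp q)
  | Prime q => stamp q
  end.

Definition fresh_stamp (W : seq atom) : nat := \max_(p <- W) stamp p.

Lemma circ_fresh (W : seq atom) (p : atom) : Circ (fresh_stamp W) p \notin W.
Proof.
apply/negP => pW; have := @leq_bigmax_seq _ W xpredT stamp _ pW isT.
by rewrite -/(fresh_stamp W) /= geq_max ltnn.
Qed.

Inductive bform :=
  | BTop | BBot | BAtom (p : atom) | BNeg (b : bform) | BAnd (b c : bform).

Lemma bform_eq_dec (b c : bform) : decidable (b = c).
Proof. by rewrite /decidable; decide equality; exact: (decP eqP). Defined.

HB.instance Definition _ := hasDecEq.Build bform (compareP bform_eq_dec).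

Definition bor b c := BNeg (BAnd (BNeg b) (BNeg c)).
Definition bimp b c := bor (BNeg b) c.
Definition biff b c := BAnd (bimp b c) (bimp c b).
Definition bands (bs : seq bform) : bform := foldr BAnd BTop bs.

(* Valuations are subsets of the vocabulary, listed; only membership matters. *)
Fixpoint bsat (s : seq atom) (b : bform) : bool :=
  match b with
  | BTop => true
  | BBot => false
  | BAtom p => p \in s
  | BNeg c => ~~ bsat s c
  | BAnd c d => bsat s c && bsat s d
  end.

Fixpoint bover (W : seq atom) (b : bform) : bool :=
  match b with
  | BTop | BBot => true
  | BAtom p => p \in W
  | BNeg c => bover W c
  | BAnd c d => bover W c && bover W d
  end.

Fixpoint blen (b : bform) : nat :=
  match b with
  | BTop | BBot | BAtom _ => 1
  | BNeg c => (blen c).+1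
  | BAnd c d => (blen c + blen d).+1
  end.

Fixpoint bsubst (f : atom -> bform) (b : bform) : bform :=
  match b with
  | BTop => BTop
  | BBot => BBot
  | BAtom p => f p
  | BNeg c => BNeg (bsubst f c)
  | BAnd c d => BAnd (bsubst f c) (bsubst f d)
  end.

(* [W |-> g W] for an injection g into fresh atoms *)
Definition bcopy (W : seq atom) (g : atom -> atom) : bform -> bform :=
  bsubst (fun p => BAtom (if p \in W then g p else p)).

(* The inverse substitution [g W |-> W] *)
Definition buncopy (W : seq atom) (g : atom -> atom) : bform -> bform :=
  bsubst (fun q => BAtom (nth q W (index q (map g W)))).

(* [x ⊑ W] *)
Definition bset (x W : seq atom) : bform -> bform :=
  bsubst (fun p => if p \in W then (if p \in x then BTop else BBot) else BAtom p).

Definition ball1 (p : atom) (b : bform) : bform :=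
  BAnd (bset [:: p] [:: p] b) (bset [::] [:: p] b).
Definition ball (W : seq atom) (b : bform) : bform := foldr ball1 b W.

(* [t_post] lists the pairs (p, theta_-(p)) for p in V_-. *)
Record transformer_of (A : finType) (form : Type) := Transformer {
  t_voc : seq atom;
  t_pre : form;
  t_post : seq (atom * bform);
  t_obs : {ffun A -> seq atom}
}.

Inductive dform (A : finType) :=
  | DTop | DBot
  | DAtom (p : atom)
  | DNeg (phi : dform A)
  | DAnd (phi psi : dform A)
  | DK (i : A) (phi : dform A)
  | DUpd (X : transformer_of A (dform A)) (x : seq atom) (phi : dform A).

Arguments DTop {A}.
Arguments DBot {A}.
Arguments DAtom {A} p.

Notation transformer A := (transformer_of A (dform A)).

Definition t_changed (A : finType) form (X : transformer_of A form) : seq atom :=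
  unzip1 (t_post X).

(* theta_-(p) for p in V_-, and p for other p *)
Definition t_change (A : finType) form (X : transformer_of A form) (p : atom) : bform :=
  nth (BAtom p) (unzip2 (t_post X)) (index p (t_changed X)).

Fixpoint dlen (A : finType) (phi : dform A) : nat :=
  match phi with
  | DTop | DBot | DAtom _ => 1
  | DNeg psi => (dlen psi).+1
  | DK _ psi => (dlen psi).+1
  | DAnd psi chi => (dlen psi + dlen chi).+1
  | DUpd X _ psi =>
      (size (t_voc X) + dlen (t_pre X) + size (t_changed X)
       + \sum_(q <- t_post X) blen q.2 + \sum_(i : A) size (t_obs X i)
       + dlen psi).+1
  end.

(* [x ⊑ W] on dynamic formulas *)
Fixpoint dset (A : finType) (x W : seq atom) (phi : dform A) : dform A :=
  match phi with
  | DTop => DTop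
  | DBot => DBot
  | DAtom p => if p \in W then (if p \in x then DTop else DBot) else DAtom p
  | DNeg psi => DNeg (dset x W psi)
  | DAnd psi chi => DAnd (dset x W psi) (dset x W chi)
  | DK i psi => DK i (dset x W psi)
  | DUpd X y psi =>
      DUpd (Transformer (t_voc X) (dset x W (t_pre X))
             [seq (q.1, bset x W q.2) | q <- t_post X] (t_obs X))
        y (dset x W psi)
  end.

Record bstruct (A : finType) := BStruct {
  b_voc : seq atom; b_law : bform; b_obs : A -> bform }.

Record kstruct (A : finType) := KStruct {
  k_voc : seq atom; k_law : bform; k_obs : {ffun A -> seq atom} }.

Definition obs_form (O : seq atom) : bform :=
  bands [seq biff (BAtom p) (BAtom (Prime p)) | p <- O].

Definition belief_of (A : finType) (F : kstruct A) : bstruct A :=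
  BStruct (k_voc F) (k_law F) (fun i => obs_form (k_obs F i)).

Coercion belief_of : kstruct >-> bstruct.

Definition is_state (A : finType) (F : bstruct A) (s : seq atom) : Prop :=
  {subset s <= b_voc F} /\ bsat s (b_law F).

(* The copy p |-> p° made when F is updated with X *)
Definition circ (A : finType) form (F : bstruct A) (X : transformer_of A form) :
    atom -> atom :=
  Circ (fresh_stamp (b_voc F ++ t_voc X)).

Definition upd_voc (A : finType) form (V : seq atom) (X : transformer_of A form) :
    seq atom :=
  V ++ t_voc X ++ map (Circ (fresh_stamp (V ++ t_voc X))) (t_changed X).

(* F x X, where [pre] is the local translation of theta^+ on F *)
Definition update_with (A : finType) form (F : bstruct A)
    (X : transformer_of A form) (pre : bform) : bstruct A :=
  let Vm := t_changed X in
  let c := circ F X in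
  BStruct (upd_voc (b_voc F) X)
    (BAnd (bcopy Vm c (BAnd (b_law F) pre))
          (bands [seq biff (BAtom q) (bcopy Vm c (t_change X q)) | q <- Vm]))
    (fun i =>
       BAnd (bcopy Vm c
               (bcopy (map Prime Vm)
                  (fun q => if q is Prime p then Prime (c p) else q)
                  (b_obs F i)))
            (obs_form (t_obs X i))).

(* s^x *)
Definition upd_state (A : finType) form (F : bstruct A)
    (X : transformer_of A form) (s x : seq atom) : seq atom :=
  let Vm := t_changed X in
  [seq p <- s | p \notin Vm] ++ map (circ F X) [seq p <- s | p \in Vm]
  ++ x ++ [seq p <- Vm | bsat (s ++ x) (t_change X p)].

(* The local translation and the semantics recur on [dset x V^+ theta^+], which
   is no subterm but has the length of theta^+; hence the fuel, initially the
   length.  The defining equations are [trans_upd], [sat_upd], etc. below. *)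
Fixpoint trans_rec (A : finType) (n : nat) (F : bstruct A) (phi : dform A) : bform :=
  if n is m.+1 then
    match phi with
    | DTop => BTop
    | DBot => BBot
    | DAtom p => BAtom p
    | DNeg psi => BNeg (trans_rec m F psi)
    | DAnd psi chi => BAnd (trans_rec m F psi) (trans_rec m F chi)
    | DK i psi =>
        let V := b_voc F in
        ball (map Prime V)
          (bimp (bcopy V Prime (b_law F))
             (bimp (b_obs F i) (bcopy V Prime (trans_rec m F psi))))
    | DUpd X x psi =>
        bimp (trans_rec m F (dset x (t_voc X) (t_pre X)))
          (buncopy (t_changed X) (circ F X)
            (bset x (t_voc X)
              (bsubst (t_change X)
                (trans_rec m (update_with F X (trans_rec m F (t_pre X))) psi))))
    end
  else BBot.

Definition trans (A : finType) (F : bstruct A) (phi : dform A) : bform :=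
  trans_rec (dlen phi) F phi.

Definition update (A : finType) (F : bstruct A) (X : transformer A) : bstruct A :=
  update_with F X (trans F (t_pre X)).

Fixpoint sat_rec (A : finType) (n : nat) (F : bstruct A) (s : seq atom)
    (phi : dform A) : Prop :=
  if n is m.+1 then
    match phi with
    | DTop => True
    | DBot => False
    | DAtom p => p \in s
    | DNeg psi => ~ sat_rec m F s psi
    | DAnd psi chi => sat_rec m F s psi /\ sat_rec m F s chi
    | DK i psi =>
        forall t, is_state F t -> bsat (s ++ map Prime t) (b_obs F i) ->
                  sat_rec m F t psi
    | DUpd X x psi =>
        sat_rec m F s (dset x (t_voc X) (t_pre X)) ->
        sat_rec m (update F X) (upd_state F X s x) psi
    end
  else False.

Definition sat (A : finType) (F : bstruct A) (s : seq atom) (phi : dform A) : Prop :=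
  sat_rec (dlen phi) F s phi.

Lemma blen_bset x W b : blen (bset x W b) = blen b.
Proof.
elim: b => //= [p|b IHb|b IHb c IHc]; rewrite /bset /= -/(bset x W _) ?IHb ?IHc //.
by case: ifP => // _; case: ifP.
Qed.

Lemma dform_nested_ind (A : finType) (P : dform A -> Prop) :
  P DTop -> P DBot -> (forall p, P (DAtom p)) ->
  (forall phi, P phi -> P (DNeg phi)) ->
  (forall phi psi, P phi -> P psi -> P (DAnd phi psi)) ->
  (forall i phi, P phi -> P (DK i phi)) ->
  (forall X x phi, P (t_pre X) -> P phi -> P (DUpd X x phi)) ->
  forall phi, P phi.
Proof.
move=> PT PB Pp PN PA PK PU; fix IH 1.
case=> [||p|phi|phi psi|i phi|[Vp pre post O] x phi].
- exact: PT.
- exact: PB.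
- exact: Pp.
- by apply: PN; apply: IH.
- by apply: PA; apply: IH.
- by apply: PK; apply: IH.
- by apply: PU; apply: IH.
Qed.

Lemma dlen_dset (A : finType) x W (phi : dform A) : dlen (dset x W phi) = dlen phi.
Proof.
elim/dform_nested_ind: phi => //= [p|phi ->|phi psi -> ->|i phi ->|X y phi -> ->] //.
  by case: ifP => // _; case: ifP.
rewrite /t_changed /= /unzip1 !size_map big_map /=.
by under eq_bigr do rewrite blen_bset.
Qed.

Lemma dlen_gt0 (A : finType) (phi : dform A) : 0 < dlen phi.
Proof. by case: phi. Qed.

Lemma trans_recE (A : finType) n m (F : bstruct A) (phi : dform A) :
  dlen phi <= n -> dlen phi <= m -> trans_rec n F phi = trans_rec m F phi.
Proof.
elim: n m F phi => [|n IH] [|m] F phi /=; try by case: phi.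
case: phi => //= [phi|phi psi|i phi|X x phi] hn hm.
- by rewrite (IH m).
- by rewrite (IH m) 1?(IH m _ psi) //; lia.
- by rewrite (IH m).
- by rewrite (IH m _ (dset _ _ _)) ?dlen_dset 1?(IH m _ (t_pre X)) 1?(IH m _ phi) //; lia.
Qed.

Lemma trans_neg (A : finType) (F : bstruct A) (phi : dform A) :
  trans F (DNeg phi) = BNeg (trans F phi).
Proof. by []. Qed.

Lemma trans_and (A : finType) (F : bstruct A) (phi psi : dform A) :
  trans F (DAnd phi psi) = BAnd (trans F phi) (trans F psi).
Proof. by rewrite /trans /=; congr BAnd; apply: trans_recE; lia. Qed.

Lemma trans_K (A : finType) (F : bstruct A) i (phi : dform A) :
  trans F (DK i phi) =
  ball (map Prime (b_voc F))
    (bimp (bcopy (b_voc F) Prime (b_law F))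
       (bimp (b_obs F i) (bcopy (b_voc F) Prime (trans F phi)))).
Proof. by []. Qed.

Lemma trans_upd (A : finType) (F : bstruct A) X x (phi : dform A) :
  trans F (DUpd X x phi) =
  bimp (trans F (dset x (t_voc X) (t_pre X)))
    (buncopy (t_changed X) (circ F X)
      (bset x (t_voc X) (bsubst (t_change X) (trans (update F X) phi)))).
Proof.
rewrite /update /trans /=.
set n := (_ + _ + dlen phi).
have hX : dlen (t_pre X) <= n by rewrite /n; lia.
have hp : dlen phi <= n by rewrite /n; lia.
by congr (bimp _ (buncopy _ _ (bset _ _ (bsubst _ _))));
   rewrite ?(trans_recE F hX (leqnn _)); apply: trans_recE; rewrite ?dlen_dset.
Qed.

Lemma sat_recE (A : finType) n m (F : bstruct A) s (phi : dform A) :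
  dlen phi <= n -> dlen phi <= m -> sat_rec n F s phi <-> sat_rec m F s phi.
Proof.
elim: n m F s phi => [|n IH] [|m] F s phi /=; try by case: phi.
case: phi => //= [phi|phi psi|i phi|X x phi] hn hm.
- by have := IH m F s phi hn hm; tauto.
- have := IH m F s phi; have := IH m F s psi.
  have [h1 h2 h3 h4] : [/\ dlen phi <= n, dlen phi <= m, dlen psi <= n & dlen psi <= m]
    by split; lia.
  by move=> /(_ h3 h4) ? /(_ h1 h2); tauto.
- by split=> H t tF /(H t tF) /(IH m F t phi); apply.
- have := IH m F s (dset x (t_voc X) (t_pre X)).
  have := IH m (update F X) (upd_state F X s x) phi.
  rewrite dlen_dset.
  have [h1 h2 h3 h4] : [/\ dlen (t_pre X) <= n, dlen (t_pre X) <= m, dlen phi <= n & dlen phi <= m]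
    by split; lia.
  by move=> /(_ h3 h4) ? /(_ h1 h2); tauto.
Qed.

Lemma sat_neg (A : finType) (F : bstruct A) s (phi : dform A) :
  sat F s (DNeg phi) <-> ~ sat F s phi.
Proof. by []. Qed.

Lemma sat_and (A : finType) (F : bstruct A) s (phi psi : dform A) :
  sat F s (DAnd phi psi) <-> sat F s phi /\ sat F s psi.
Proof.
rewrite /sat /=.
rewrite (@sat_recE _ _ (dlen phi) _ _ phi) ?(@sat_recE _ _ (dlen psi) _ _ psi) //; lia.
Qed.

Lemma sat_K (A : finType) (F : bstruct A) s i (phi : dform A) :
  sat F s (DK i phi) <->
  forall t, is_state F t -> bsat (s ++ map Prime t) (b_obs F i) -> sat F t phi.
Proof. by []. Qed.

Lemma sat_upd (A : finType) (F : bstruct A) s X x (phi : dform A) :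
  sat F s (DUpd X x phi) <->
  (sat F s (dset x (t_voc X) (t_pre X)) ->
   sat (update F X) (upd_state F X s x) phi).
Proof.
rewrite /sat /=; set n := (_ + _ + dlen phi).
rewrite (@sat_recE _ n (dlen phi) _ _ phi) //; last by rewrite /n; lia.
rewrite (@sat_recE _ n (dlen (dset x (t_voc X) (t_pre X)))) //.
by rewrite dlen_dset /n; lia.
Qed.

(* [dwf V P phi]: phi may be evaluated on structures over V, with the atoms of P
   as parameters.  In the precondition of X, evaluated on the structure that X
   updates after substituting truth values for V^+, the atoms of V^+ are
   parameters.  The formula after an event is evaluated on the updated structure,
   so it may use all of V, V^+ and V_-°. *)
Fixpoint dwf (A : finType) (V P : seq atom) (phi : dform A) : bool :=
  match phi with
  | DTop | DBot => true
  | DAtom p => p \in V ++ P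
  | DNeg psi => dwf V P psi
  | DAnd psi chi => dwf V P psi && dwf V P chi
  | DK _ psi => dwf V P psi
  | DUpd X x psi =>
      let Vp := t_voc X in
      [&& uniq Vp, all is_name Vp, ~~ has (mem (V ++ P)) Vp,
          dwf V (P ++ Vp) (t_pre X),
          uniq (t_changed X), all (mem V) (t_changed X),
          all (fun q => bover (V ++ Vp ++ P) q.2) (t_post X),
          [forall i, uniq (t_obs X i) && all (mem Vp) (t_obs X i)],
          uniq x, all (mem Vp) x
        & dwf (upd_voc V X) P psi]
  end.

(* The nodes of a diagram are listed with children before parents and the root
   last; the children of a node are given by their positions in the list. *)
Inductive bnode := BLeaf (b : bool) | BNode (p : atom) (lo hi : nat).

Lemma bnode_eq_dec (u v : bnode) : decidable (u = v).
Proof. by rewrite /decidable; decide equality; exact: (decP eqP). Defined.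

HB.instance Definition _ := hasDecEq.Build bnode (compareP bnode_eq_dec).

Definition bdd := seq bnode.

Definition is_child (j : nat) (u : bnode) : bool :=
  if u is BNode _ lo hi then (j == lo) || (j == hi) else false.

(* The position of the label of u in V; leaves come after all atoms. *)
Definition blevel (V : seq atom) (u : bnode) : nat :=
  if u is BNode p _ _ then index p V else size V.

Definition bnode_ok (V : seq atom) (d : bdd) (i : nat) : bool :=
  if nth (BLeaf false) d i is BNode p lo hi then
    [&& p \in V, lo < i, hi < i, lo != hi,
        index p V < blevel V (nth (BLeaf false) d lo)
      & index p V < blevel V (nth (BLeaf false) d hi)]
  else true.

Definition is_robdd (V : seq atom) (d : bdd) : bool :=
  [&& 0 < size d, uniq d, all (bnode_ok V d) (iota 0 (size d))
    & all (fun j => has (is_child j) d) (iota 0 (size d).-1)].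

Definition bdd_forms (d : bdd) : seq bform :=
  foldl (fun fs u => rcons fs
    match u with
    | BLeaf b => if b then BTop else BBot
    | BNode p lo hi => bor (BAnd (BAtom p) (nth BBot fs hi))
                           (BAnd (BNeg (BAtom p)) (nth BBot fs lo))
    end) [::] d.

Definition bdd_form (d : bdd) : bform := last BBot (bdd_forms d).

Record instance := Instance {
  i_agents : nat;
  i_voc : seq atom;
  i_law : bdd;
  i_obs : {ffun 'I_i_agents -> seq atom};
  i_state : seq atom;
  i_goal : dform 'I_i_agents
}.

Definition i_struct (I : instance) : kstruct 'I_(i_agents I) :=
  KStruct (i_voc I) (bdd_form (i_law I)) (i_obs I).

Definition instance_ok (I : instance) : Prop :=
  [/\ uniq (i_voc I) /\ all is_name (i_voc I),
      is_robdd (i_voc I) (i_law I),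
      forall i, uniq (i_obs I i) /\ {subset i_obs I i <= i_voc I},
      uniq (i_state I) /\ is_state (i_struct I) (i_state I)
    & dwf (i_voc I) [::] (i_goal I)].

Definition input_size (I : instance) : nat :=
  size (i_voc I) + size (i_law I) + \sum_i size (i_obs I i) + dlen (i_goal I).

Definition enc_nat (n : nat) : seq bool := rcons (nseq n true) false.

Fixpoint enc_seq T (e : T -> seq bool) (s : seq T) : seq bool :=
  if s is a :: s' then true :: e a ++ enc_seq e s' else [:: false].

Fixpoint enc_atom (p : atom) : seq bool :=
  match p with
  | Atom n => enc_nat 0 ++ enc_seq (fun b => [:: b]) n
  | Circ k q => enc_nat 1 ++ enc_nat k ++ enc_atom q
  | Prime q => enc_nat 2 ++ enc_atom q
  end.

Fixpoint enc_bform (b : bform) : seq bool :=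
  match b with
  | BTop => enc_nat 0
  | BBot => enc_nat 1
  | BAtom p => enc_nat 2 ++ enc_atom p
  | BNeg c => enc_nat 3 ++ enc_bform c
  | BAnd c d => enc_nat 4 ++ enc_bform c ++ enc_bform d
  end.

Definition enc_obs (A : finType) (O : {ffun A -> seq atom}) : seq bool :=
  flatten [seq enc_seq enc_atom (O i) | i <- enum A].

Fixpoint enc_dform (A : finType) (phi : dform A) : seq bool :=
  match phi with
  | DTop => enc_nat 0
  | DBot => enc_nat 1
  | DAtom p => enc_nat 2 ++ enc_atom p
  | DNeg psi => enc_nat 3 ++ enc_dform psi
  | DAnd psi chi => enc_nat 4 ++ enc_dform psi ++ enc_dform chi
  | DK i psi => enc_nat 5 ++ enc_nat (enum_rank i) ++ enc_dform psi
  | DUpd X x psi =>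
      enc_nat 6 ++ enc_seq enc_atom (t_voc X) ++ enc_dform (t_pre X)
      ++ enc_seq (fun q => enc_atom q.1 ++ enc_bform q.2) (t_post X)
      ++ enc_obs (t_obs X) ++ enc_seq enc_atom x ++ enc_dform psi
  end.

Definition enc_bnode (u : bnode) : seq bool :=
  match u with
  | BLeaf b => enc_nat b
  | BNode p lo hi => enc_nat 2 ++ enc_atom p ++ enc_nat lo ++ enc_nat hi
  end.

Definition enc_instance (I : instance) : seq bool :=
  enc_nat (i_agents I) ++ enc_seq enc_atom (i_voc I)
  ++ enc_seq enc_bnode (i_law I) ++ enc_obs (i_obs I)
  ++ enc_seq enc_atom (i_state I) ++ enc_dform (i_goal I).

Definition DEL_model_checking : language := fun w =>
  exists I : instance, [/\ instance_ok I, enc_instance I = w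
    & sat (i_struct I) (i_state I) (i_goal I)].

Definition prefix_code T (e : T -> seq bool) : Prop :=
  forall a b r r', e a ++ r = e b ++ r' -> a = b /\ r = r'.

Lemma enc_nat_prefix : prefix_code enc_nat.
Proof.
rewrite /enc_nat; elim=> [|n IH] [|m] r r' //= [].
  by move=> ->.
by move=> /IH [-> ->].
Qed.

Lemma enc_seq_prefix T (e : T -> seq bool) : prefix_code e -> prefix_code (enc_seq e).
Proof.
move=> he; elim=> [|a s IH] [|b t] r r' //= [].
  by move=> ->.
by rewrite -!catA => /he [-> /IH [-> ->]].
Qed.

Lemma enc_atom_prefix : prefix_code enc_atom.
Proof.
have hb : prefix_code (fun b : bool => [:: b]) by move=> a b r r' [-> ->].
elim=> [n|k p IH|p IH] [m|l q|q] r r' //=.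
- by move=> [] /(enc_seq_prefix hb) [-> ->].
- by move=> []; rewrite -!catA => /enc_nat_prefix [-> /IH [-> ->]].
- by move=> [] /IH [-> ->].
Qed.

Lemma enc_bform_prefix : prefix_code enc_bform.
Proof.
elim=> [||p|b IHb|b IHb c IHc] [||q|d|d f] r r' //=; try by move=> [->].
- by move=> [] /enc_atom_prefix [-> ->].
- by move=> [] /IHb [-> ->].
- by move=> []; rewrite -!catA => /IHb [-> /IHc [-> ->]].
Qed.

Lemma enc_obs_prefix (A : finType) : prefix_code (@enc_obs A).
Proof.
move=> O O' r r' H; rewrite /enc_obs in H.
suff [HO ->] : {in enum A, O =1 O'} /\ r = r'.
  by split=> //; apply/ffunP => i; apply: HO; rewrite mem_enum.
elim: (enum A) H => [|i s IH] /= H; first by split.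
move: H; rewrite -!catA => /(enc_seq_prefix enc_atom_prefix) [Oi /IH [Os ->]].
by split=> // j; rewrite inE => /orP[/eqP -> //|/Os].
Qed.

Lemma enc_dform_prefix (A : finType) : prefix_code (@enc_dform A).
Proof.
have hp : prefix_code (fun q : atom * bform => enc_atom q.1 ++ enc_bform q.2).
  by case=> p b [q c] r r' /=; rewrite -!catA => /enc_atom_prefix [-> /enc_bform_prefix [-> ->]].
elim/dform_nested_ind=> [||p|phi IH|phi psi IH IH'|i phi IH|[Vp pre post O] x phi IH IH']
  [||q|phi1|phi1 psi1|j phi1|[Vp1 pre1 post1 O1] x1 phi1] r r' //=; try by move=> [->].
- by move=> [] /enc_atom_prefix [-> ->].
- by move=> [] /IH [-> ->].
- by move=> []; rewrite -!catA => /IH [-> /IH' [-> ->]].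
- by move=> []; rewrite -!catA => /enc_nat_prefix [/val_inj /enum_rank_inj -> /IH [-> ->]].
- move=> []; rewrite -!catA => /(enc_seq_prefix enc_atom_prefix) [-> /IH [/= ->]].
  move=> /(enc_seq_prefix hp) [-> /enc_obs_prefix [->]].
  by move=> /(enc_seq_prefix enc_atom_prefix) [-> /IH' [-> ->]].
Qed.

Lemma enc_bnode_prefix : prefix_code enc_bnode.
Proof.
case=> [[]|p lo hi] [[]|q lo' hi'] r r' //=; try by move=> [->].
by move=> []; rewrite -!catA => /enc_atom_prefix [-> /enc_nat_prefix [-> /enc_nat_prefix [-> ->]]].
Qed.

Lemma enc_instance_inj : injective enc_instance.
Proof.
case=> m V d O s phi [m' V' d' O' s' phi']; rewrite /enc_instance /=.
move/enc_nat_prefix => [mm]; case: m' / mm O' phi' => O' phi'.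
move=> /(enc_seq_prefix enc_atom_prefix) [-> /(enc_seq_prefix enc_bnode_prefix) [->]].
move=> /enc_obs_prefix [-> /(enc_seq_prefix enc_atom_prefix) [->]].
by rewrite -[enc_dform phi]cats0 -[enc_dform phi']cats0 => /enc_dform_prefix [->].
Qed.

Lemma size_enc_nat n : size (enc_nat n) = n.+1.
Proof. by rewrite size_rcons size_nseq. Qed.

Lemma size_enc_seq T (e : T -> seq bool) s :
  size (enc_seq e s) = (\sum_(a <- s) (size (e a)).+1).+1.
Proof. by elim: s => [|a s IH]; rewrite ?big_nil //= big_cons size_cat IH /=; lia. Qed.

Lemma size_enc_obs (A : finType) (O : {ffun A -> seq atom}) :
  size (enc_obs O) = \sum_i (\sum_(p <- O i) (size (enc_atom p)).+1).+1.
Proof.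
rewrite size_flatten /shape -map_comp sumnE big_map enumT.
by apply: eq_bigr => i _; rewrite /= size_enc_seq.
Qed.

Lemma size_enc_bform_ge b : blen b <= size (enc_bform b).
Proof. by elim: b => //= [b IH|b IHb c IHc]; rewrite ?size_cat /=; lia. Qed.

Lemma leq_size_sum T (s : seq T) (f : T -> nat) : size s <= \sum_(a <- s) (f a).+1.
Proof. by elim: s => //= a s IH; rewrite big_cons; lia. Qed.

Lemma size_obs_ge (A : finType) (O : {ffun A -> seq atom}) :
  \sum_i size (O i) <= size (enc_obs O).
Proof.
rewrite size_enc_obs; apply: leq_sum => i _.
by apply: leq_trans (leqnSn _); apply: leq_size_sum.
Qed.

Lemma size_enc_dform_ge (A : finType) (phi : dform A) : dlen phi <= size (enc_dform phi).
Proof.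
elim/dform_nested_ind: phi => //= [phi IH|phi psi IH IH'|i phi IH|X x phi IH IH'];
  rewrite ?size_cat /=; try lia.
have := size_obs_ge (t_obs X).
have := leq_size_sum (t_voc X) (fun p => size (enc_atom p)).
rewrite !size_enc_seq /t_changed size_map.
have : size (t_post X) + \sum_(q <- t_post X) blen q.2 <=
       \sum_(q <- t_post X) (size (enc_atom q.1 ++ enc_bform q.2)).+1.
  elim: (t_post X) => [|q s IHs]; first by rewrite !big_nil.
  by rewrite !big_cons /= size_cat; have := size_enc_bform_ge q.2; lia.
by lia.
Qed.

Lemma input_size_leq (I : instance) : input_size I <= size (enc_instance I).
Proof.
rewrite /input_size /enc_instance !size_cat !size_enc_seq.
have := size_obs_ge (i_obs I); have := size_enc_dform_ge (i_goal I).
have := leq_size_sum (i_voc I) (fun p => size (enc_atom p)).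
have := leq_size_sum (i_law I) (fun p => size (enc_bnode p)).
move: (\sum_(a <- i_law I) _) (\sum_(a <- i_voc I) _) (\sum_i _) => a b c.
move: (size (enc_obs _)) (size (enc_dform _)) (dlen _).
by lia.
Qed.

Fixpoint dnew (A : finType) (phi : dform A) : seq atom :=
  match phi with
  | DTop | DBot | DAtom _ => [::]
  | DNeg psi | DK _ psi => dnew psi
  | DAnd psi chi => dnew psi ++ dnew chi
  | DUpd X _ psi => t_voc X ++ dnew (t_pre X) ++ dnew psi
  end.

Definition short_code (b : nat) (p : atom) : bool := size (enc_atom p) <= b.

Lemma sum_short b W : all (short_code b) W ->
  \sum_(p <- W) (size (enc_atom p)).+1 <= size W * b.+1.
Proof.
elim: W => [|p W IH] /=; first by rewrite big_nil.
by rewrite big_cons /short_code => /andP[pb /IH]; rewrite mulSn; lia.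
Qed.

Lemma all_subseq_mem (W : seq atom) (a : pred atom) (s : seq atom) :
  all (mem W) s -> all a W -> all a s.
Proof. by move=> /allP sW /allP aW; apply/allP => p /sW /aW. Qed.

Lemma size_enc_bform_leq b W c : all (short_code b) W -> bover W c ->
  size (enc_bform c) <= blen c * (b + 5).
Proof.
move=> /allP bW; elim: c => [||p|c IH|c IHc d IHd] //=; rewrite ?size_cat; try lia.
- by move=> /bW /=; rewrite /short_code; lia.
Qed.

Lemma size_obs_leq (A : finType) (O : {ffun A -> seq atom}) b W :
  all (short_code b) W -> (forall i, {subset O i <= W}) ->
  size (enc_obs O) <= #|A| + (\sum_i size (O i)) * b.+1.
Proof.
move=> /allP bW OW; rewrite size_enc_obs.
apply: (@leq_trans (\sum_(i : A) (1 + size (O i) * b.+1))).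
  apply: leq_sum => i _; rewrite add1n ltnS; apply: sum_short.
  by apply/allP => p /OW /bW.
by rewrite big_split /= sum1_card -big_distrl.
Qed.

Lemma fresh_stamp_leq W k : (fresh_stamp W <= k) = all (fun p => stamp p <= k) W.
Proof.
rewrite /fresh_stamp; elim: W => [|p W IH]; first by rewrite big_nil.
by rewrite big_cons geq_max IH.
Qed.

Lemma bound_step c e n B a : c <= 10 * (B + a + 1) ->
  e <= 10 * n * (B + a + 1) -> c + e <= 10 * n.+1 * (B + a + 1).
Proof. by move=> hc he; rewrite mulnS mulnDl leq_add // -mulnA. Qed.

Lemma code_bound_mono n m k b B : n <= m ->
  b + m * (k + m + 3) <= B -> b + n * (k + n + 3) <= B.
Proof. by move=> nm; apply: leq_trans; rewrite leq_add2l leq_mul // leq_add2r leq_add2l. Qed.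

Lemma code_bound_step n m k b B : n < m ->
  b + m * (k + m + 3) <= B -> b + k + 3 + n * (k.+1 + n + 3) <= B.
Proof.
move=> nm /(code_bound_mono nm); apply: leq_trans; rewrite mulSn.
have -> : k + n.+1 + 3 = k.+1 + n + 3 by lia.
by move: (n * _) => e; lia.
Qed.

Lemma bound_upd e1 e2 sx eo exs eX eP n0 n1 n2 n3 n4 n5 a b B :
  e1 <= 10 * n1 * (B + a + 1) -> e2 <= 10 * n5 * (B + a + 1) -> sx <= n0 ->
  eo <= a + n4 * b.+1 -> exs <= sx * b.+1 -> eX <= n0 * b.+1 ->
  eP <= n2 * b.+1 + n3 * (b + 5) -> b <= B ->
  (eX.+1 + (e1 + (eP.+1 + (eo + (exs.+1 + e2))))).+2.+4 <
  10 * (n0 + n1 + n2 + n3 + n4 + n5).+1 * (B + a + 1).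
Proof.
move=> H1 H2 Hx Ho Hxs HX HP bB.
have Hxs' : exs <= n0 * b.+1 by apply: leq_trans Hxs _; rewrite leq_mul2r Hx orbT.
have [C hC] : exists C, C = B + a + 1 by exists (B + a + 1).
have b1 : b.+1 <= C by rewrite hC; clear -bB; lia.
have b5 : b + 5 <= 5 * C by rewrite hC; clear -bB; lia.
have aC : a < C by rewrite hC; clear; lia.
rewrite -hC in H1 H2 *; clear hC.
have l1 : n0 * b.+1 <= n0 * C by rewrite leq_mul2l b1 orbT.
have l2 : n2 * b.+1 <= n2 * C by rewrite leq_mul2l b1 orbT.
have l3 : n3 * (b + 5) <= 5 * (n3 * C) by rewrite mulnCA leq_mul2l b5 orbT.
have l4 : n4 * b.+1 <= n4 * C by rewrite leq_mul2l b1 orbT.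
rewrite -mulnA in H1; rewrite -mulnA in H2.
have eS : (n0 + n1 + n2 + n3 + n4 + n5).+1 * C =
  C + (n0 * C + n1 * C + n2 * C + n3 * C + n4 * C + n5 * C) by rewrite mulSn !mulnDl.
rewrite -mulnA eS; clear eS.
move: H1 H2 Ho HX HP Hxs' l1 l2 l3 l4 aC {b1 b5 Hxs Hx bB}.
move: (n0 * b.+1) (n2 * b.+1) (n3 * (b + 5)) (n4 * b.+1).
move: (n0 * C) (n1 * C) (n2 * C) (n3 * C) (n4 * C) (n5 * C) => *.
lia.
Qed.

Lemma size_enc_dform_leq (A : finType) V P (phi : dform A) k b B :
  dwf V P phi -> all (short_code b) (V ++ P ++ dnew phi) -> fresh_stamp V <= k ->
  b + dlen phi * (k + dlen phi + 3) <= B ->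
  size (enc_dform phi) <= 10 * dlen phi * (B + #|A| + 1).
Proof.
elim/dform_nested_ind: phi V P k b B => [||p|phi IH|phi psi IH IH'|i phi IH|X x phi IH IH'] V P k b B /=.
- by lia.
- by lia.
- move=> pVP; rewrite cats0 => /allP /(_ _ pVP); rewrite /short_code; lia.
- move=> w s h hB; have := IH V P k b B w s h (code_bound_mono (leqnSn _) hB).
  by apply: (@bound_step 4); lia.
- case/andP=> w1 w2; rewrite !all_cat => /and4P[s1 s2 s3 s4] h hB.
  have := IH V P k b B w1; have := IH' V P k b B w2.
  rewrite !all_cat s1 s2 s3 s4 => /(_ isT h) H1 /(_ isT h) H2.
  have hm : dlen phi <= (dlen phi + dlen psi).+1 by lia.
  have hm' : dlen psi <= (dlen phi + dlen psi).+1 by lia.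
  have := leq_add (H2 (code_bound_mono hm hB)) (H1 (code_bound_mono hm' hB)).
  rewrite -mulnDl -mulnDr -size_cat.
  by apply: (@bound_step 5); lia.
- move=> w s h hB; have := IH V P k b B w s h (code_bound_mono (leqnSn _) hB).
  have hi := ltn_ord (enum_rank i).
  rewrite size_cat size_enc_nat -add1n -!addSn => H.
  apply: bound_step H; move: hi; set j := nat_of_ord _; set a := #|A|; lia.
- case/and5P=> uV nV _ w1 /and5P[uC CV /allP post /forallP obs /and3P[ux xV w2]].
  rewrite !all_cat => /and5P[sV sP sX s1 s2] hk hB.
  have hF : fresh_stamp (V ++ t_voc X) <= k.
    rewrite fresh_stamp_leq all_cat -fresh_stamp_leq hk /=.
    by apply/allP => p /(allP nV); case: p.
  set n0 := size (t_voc X) in hB *.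
  set n1 := dlen (t_pre X) in hB *.
  set n2 := size (t_changed X) in hB *.
  set n3 := \sum_(q <- _) _ in hB *.
  set n4 := \sum_i _ in hB *.
  set n5 := dlen phi in hB *.
  set K := B + #|A| + 1.
  have bB : b <= B by apply: leq_trans (leq_addr _ _) hB.
  have H1 : size (enc_dform (t_pre X)) <= 10 * n1 * K.
    by apply: (IH V (P ++ t_voc X) k b) => //; rewrite ?all_cat ?sV ?sP ?sX ?s1 //; apply: code_bound_mono hB; clear; lia.
  have H2 : size (enc_dform phi) <= 10 * n5 * K.
    have up c : short_code b c -> short_code (b + k + 3) c by move=> h; apply: leq_trans h _; rewrite -addnA leq_addr.
    have a1 : all (short_code (b + k + 3)) (upd_voc V X ++ P ++ dnew phi).
      rewrite /upd_voc !all_cat (sub_all up sV) (sub_all up sP) (sub_all up sX) (sub_all up s2).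
      rewrite !andbT /=; apply/allP => _ /mapP[p /(allP CV) /= pV ->].
      rewrite /short_code /= size_cat size_enc_nat.
      by move: (allP sV _ pV); rewrite /short_code; move: hF; clear; lia.
    have a2 : fresh_stamp (upd_voc V X) <= k.+1.
      rewrite fresh_stamp_leq /upd_voc !all_cat; apply/and3P; split.
      - by apply/allP => p; move: hk; rewrite fresh_stamp_leq => /allP H /H /leqW.
      - by apply/allP => p /(allP nV); case: p.
      - apply/allP => _ /mapP[p /(allP CV) /= pV ->] /=; rewrite geq_max ltnS hF /=.
        by move: hk; rewrite fresh_stamp_leq => /allP /(_ _ pV) /leqW.
    apply: (IH' (upd_voc V X) P k.+1 (b + k + 3) B w2 a1 a2).
    by apply: code_bound_step hB; rewrite ltnS leq_addl.
  clear IH IH' hB.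
  have Hx : size x <= n0 by apply: uniq_leq_size => // p /(allP xV).
  have Ho : size (enc_obs (t_obs X)) <= #|A| + n4 * b.+1.
    by apply: size_obs_leq sX _ => i p; case/andP: (obs i) => _ /allP H /H.
  have Hxs := sum_short (all_subseq_mem xV sX).
  have HX := sum_short sX.
  have HP : \sum_(q <- t_post X) (size (enc_atom q.1 ++ enc_bform q.2)).+1 <= n2 * b.+1 + n3 * (b + 5).
    have hq q : q \in t_post X -> size (enc_bform q.2) <= blen q.2 * (b + 5).
      by move=> /post; apply: size_enc_bform_leq; rewrite !all_cat sV sX sP.
    have hc q : q \in t_post X -> size (enc_atom q.1) <= b.
      move=> qX; have /(allP CV) qV : q.1 \in t_changed X by apply: map_f.
      exact: (allP sV _ qV).
    rewrite /n2 /n3 /t_changed size_map.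
    elim: (t_post X) hq hc => [|q s IHs] hq hc; first by rewrite !big_nil.
    rewrite !big_cons /= size_cat.
    move: (hq q (mem_head _ _)) (hc q (mem_head _ _)).
    move: (IHs (fun a (h : a \in s) => hq a (mem_behead (s := q :: s) h))
                (fun a (h : a \in s) => hc a (mem_behead (s := q :: s) h))).
    rewrite mulSn mulnDl; move: (blen _ * _) (_ * (b + 5)) (_ * b.+1).
    move: (\sum_(j <- s) (size _).+1) (size (enc_atom _)) (size (enc_bform _)); clear;
    by move=> x1 x2 x3 x4 x5 x6 h1 h2 h3; lia.
  rewrite !size_cat !size_enc_seq.
  exact: bound_upd H1 H2 Hx Ho Hxs HX HP bB.
Qed.

Lemma dnew_name (A : finType) V P (phi : dform A) p :
  dwf V P phi -> p \in dnew phi -> is_name p.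
Proof.
elim/dform_nested_ind: phi V P => //= [phi psi IH IH'|X x phi IH IH'] V P.
  by case/andP=> /IH w /IH' w'; rewrite mem_cat => /orP[].
case/and5P=> _ nV _ /IH w1 /and5P[_ _ _ _ /and3P[_ _ /IH' w2]].
by rewrite !mem_cat => /or3P[/(allP nV)||].
Qed.

Lemma bound_instance d n e1 l e3 v e2 e5 m e4 e6 :
  0 < d -> 0 < n -> e1 <= d * (2 * l + 2 * d + 10) ->
  e3 <= v * (2 * l + 3) -> e2 <= v * (2 * l + 2).+1 ->
  e5 <= m + e4 * (2 * l + 2).+1 ->
  e6 <= 10 * n * (2 * l + 2 + n * (0 + n + 3) + m + 1) ->
  m.+1 + (e2.+1 + (e1.+1 + (e5 + (e3.+1 + e6)))) <= 100 * (v + d + e4 + n + m + l) ^ 3.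
Proof.
move=> d0 n0 h1 h2 h3 h4 h5.
set N := v + d + e4 + n + m + l.
have [hv hd he hn hm] : [/\ v <= N, d <= N, e4 <= N, n <= N & m <= N] by rewrite /N; split; lia.
have hN : l <= N by rewrite /N; lia.
have N1 : 1 < N by rewrite /N; lia.
have f1 : e1 <= N * (14 * N) by apply: leq_trans h1 _; apply: leq_mul => //; lia.
have f2 : e3 <= N * (5 * N) by apply: leq_trans h2 _; apply: leq_mul => //; lia.
have f3 : e2 <= N * (5 * N) by apply: leq_trans h3 _; apply: leq_mul => //; lia.
have f4 : e5 <= N + N * (5 * N) by apply: leq_trans h4 _; apply: leq_add => //; apply: leq_mul => //; lia.
have fn : n * (0 + n + 3) <= N * (3 * N) by apply: leq_mul => //; lia.
have q1 : 2 * N <= N * N by rewrite leq_mul2r N1 orbT.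
have q2 : 2 * (N * N) <= N * (N * N) by rewrite leq_mul2r N1 orbT.
have f6 : e6 <= 70 * (N * (N * N)).
  apply: (@leq_trans (10 * N * (7 * (N * N)))); last by rewrite mulnACA.
  apply: leq_trans h5 _; apply: leq_mul; first by rewrite leq_mul2l hn.
  move: fn q1; rewrite mulnCA; move: (n * _) (N * N) => x y fn q1.
  clear -fn q1 hN hm N1; lia.
rewrite (expnS _ 2) -mulnn.
rewrite !(mulnCA N _ N) in f1 f2 f3 f4.
move: q1 q2 f1 f2 f3 f4 f6; move: (N * (N * N)) (N * N) => x y q1 q2 f1 f2 f3 f4 f6.
clear -q1 q2 f1 f2 f3 f4 f6 N1 hm; clearbody N; lia.
Qed.

(* Together with [input_size_leq]: up to the number of agents and the length of
   the atom names, the code length is polynomially related to [input_size]. *)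
Lemma enc_size_leq (I : instance) (l : nat) :
  instance_ok I -> (forall n, Atom n \in i_voc I ++ dnew (i_goal I) -> size n <= l) ->
  size (enc_instance I) <= 100 * (input_size I + i_agents I + l) ^ 3.
Proof.
case=> [[uV nV] /and4P[d0 _ /allP ok _] obs [us [sV _]] wf] hl.
rewrite /enc_instance !size_cat !size_enc_seq size_enc_nat /input_size.
have hs : all (short_code (2 * l + 2)) (i_voc I ++ dnew (i_goal I)).
  apply/allP => p pI; have : is_name p.
    by move: pI; rewrite mem_cat => /orP[/(allP nV) //|]; move/(dnew_name wf).
  case: p pI => // n /hl nl _; rewrite /short_code /= size_enc_seq.
  rewrite (eq_bigr (fun=> 2)) // big_const_seq count_predT iter_addn_0.
  by move: nl; clear; lia.
have hv : all (short_code (2 * l + 2)) (i_voc I) by move: hs; rewrite all_cat => /andP[].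
have := @size_enc_dform_leq _ (i_voc I) [::] (i_goal I) 0 (2 * l + 2)
   (2 * l + 2 + dlen (i_goal I) * (0 + dlen (i_goal I) + 3)) wf hs.
have -> : fresh_stamp (i_voc I) <= 0.
  by rewrite fresh_stamp_leq; apply/allP => p /(allP nV); case: p.
move=> /(_ isT (leqnn _)); rewrite card_ord.
have := size_obs_leq hv (fun i => (obs i).2); rewrite card_ord.
have := sum_short hv.
have : \sum_(a <- i_state I) (size (enc_atom a)).+1 <= size (i_voc I) * (2 * l + 3).
  apply: leq_trans (sum_short (b := 2 * l + 2) _) _.
    by apply/allP => p /sV /(allP hv).
  by rewrite -addnS leq_mul2r (uniq_leq_size us sV) orbT.
have : \sum_(a <- i_law I) (size (enc_bnode a)).+1 <= size (i_law I) * (2 * l + 2 * size (i_law I) + 10).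
  apply: (@leq_trans (\sum_(a <- i_law I) (2 * l + 2 * size (i_law I) + 10)));
    last by rewrite big_const_seq count_predT iter_addn_0 mulnC.
  rewrite big_seq [X in _ <= X]big_seq; apply: leq_sum => u uI.
  have := ok (index u (i_law I)); rewrite mem_iota add0n /bnode_ok nth_index // index_mem => /(_ uI).
  have := uI; rewrite -index_mem.
  case: u uI => [[]|p lo hi] _ hu /=; rewrite ?size_cat ?size_enc_nat; [lia|lia|].
  case/and4P=> /(allP hv); rewrite /short_code /= => hp hlo hhi _; move: hp hlo hhi hu; move: (index _ _) (size (i_law I)) (size (enc_atom p)); clear; lia.
have := dlen_gt0 (i_goal I); move: d0.
exact: bound_instance.
Qed.

(* Main.v *)
From HB Require Import structures.
From mathcomp Require Import all_boot zify.
Require Import Defs.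

Set Implicit Arguments.
Unset Strict Implicit.
Unset Printing Implicit Defensive.

(* Membership.  The state reached from a state of the initial structure by a
   sequence of updates is determined by the values of the initial atoms and of
   the atoms added by the updates: a changed atom is computed from its
   postcondition, and a copied atom has the value which the original had before
   the update.  So a formula can be evaluated recursively, with the list of
   updates in place of the updated structure and a list of truth values in place
   of its state; a knowledge operator runs through all such lists.  The recursion
   depth and the size of the data are polynomial.  The evaluator is a program of
   mutually recursive Boolean procedures over binary trees, which is run by a
   loop of a machine with stacks, and this by a Turing machine.

   Hardness.  Knowledge of an agent who does not observe a block of atoms is a
   universal quantifier over the values of the block, hence repeated squaring
   expresses by a formula of polynomial size that a configuration V is reached
   from a configuration U in 2^m steps:
     Phi_(m+1)(U, V) = exists Z, forall U2 V2,
       (U2, V2) = (U, Z) or (U2, V2) = (Z, V) implies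
       forall U V, (U, V) = (U2, V2) implies Phi_m(U, V).
   No update is needed, and the law is true. *)

(** * Structured programs over five stacks *)

(** The updated structures must not be written down: the law of $\mathcal{F}\times\mathcal{X}$
    contains the translated precondition, which quantifiers and nested updates can make
    exponentially long. The history suffices for three reasons. The stamp of a copy is the number of
    earlier updates that change an atom, so copies can be recognized. Substituting truth values for
    $V^+$ in a precondition commutes with the translation, so these atoms can be parameters valued
    in the valuation. And the new law forces each changed atom to its postcondition, so knowledge
    ranges over values of the original names only. In the evaluator, the joint size of history and
    formula drops from call to call and pays for depth and for the growth of the valuation. Parsing
    and all well-formedness checks belong to the decision procedure, since an input is a mere bit
    string.

    For hardness, halting configurations are fixed points and there are at most [2 ^ (K * N.+2)]
    encodings of configurations, so exactly that many steps suffice. Instances are printed by nested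
    loops over unary words; polynomial time is shown once, for the whole loop language. *)

Definition sym := (bool + unit)%type.
Definition store := seq (seq sym).
Definition get (s : store) (j : nat) : seq sym := nth [::] s j.
Definition put (s : store) (j : nat) (l : seq sym) : store := set_nth [::] s j l.
Definition top (s : store) (j : nat) : option sym := ohead (get s j).

Inductive cmd :=
  | Push (j : 'I_5) (a : sym)
  | Pop (j : 'I_5)
  | Seq (c1 c2 : cmd)
  | If (j : 'I_5) (p : pred (option sym)) (c1 c2 : cmd)
  | While (j : 'I_5) (p : pred (option sym)) (c : cmd).

(* [exec P c s T s']: from [s], [c] ends in [s'] after [T] steps, and every push
   on the way leads to a stack height satisfying [P]. *)
Inductive exec (P : pred nat) : cmd -> store -> nat -> store -> Prop :=
  | XPush s (j : 'I_5) a : P (size (get s j)).+1 ->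
      exec P (Push j a) s 1 (put s j (a :: get s j))
  | XPop s (j : 'I_5) : exec P (Pop j) s 1 (put s j (behead (get s j)))
  | XSeq c1 c2 s T1 s1 T2 s2 : exec P c1 s T1 s1 -> exec P c2 s1 T2 s2 ->
      exec P (Seq c1 c2) s (T1 + T2) s2
  | XIf s (j : 'I_5) (p : pred (option sym)) c1 c2 T s' : exec P (if p (top s j) then c1 else c2) s T s' ->
      exec P (If j p c1 c2) s T.+1 s'
  | XDone s (j : 'I_5) (p : pred (option sym)) c : ~~ p (top s j) -> exec P (While j p c) s 1 s
  | XLoop s (j : 'I_5) (p : pred (option sym)) c T1 s1 T2 s2 : p (top s j) -> exec P c s T1 s1 ->
      exec P (While j p c) s1 T2 s2 -> exec P (While j p c) s (T1 + T2).+1 s2.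

Lemma get_put s i j l : get (put s j l) i = if i == j then l else get s i.
Proof. by rewrite /get /put nth_set_nth /=. Qed.

Lemma exec_size P c s T s' : exec P c s T s' ->
  forall j, size (get s' j) <= size (get s j) + T.
Proof.
elim=> {c s T s'} [s j a _|s j|c1 c2 s T1 s1 T2 s2 _ IH1 _ IH2|s j p c1 c2 T s' _ IH|s j p c _|s j p c T1 s1 T2 s2 _ _ IH1 _ IH2] i.
- by rewrite get_put; case: eqP => [->|_] /=; lia.
- by rewrite get_put; case: eqP => [->|_] /=; rewrite ?size_behead; lia.
- by have := IH1 i; have := IH2 i; lia.
- by have := IH i; lia.
- by lia.
- by have := IH1 i; have := IH2 i; lia.
Qed.

(** A step pushes at most one symbol, so time bounds height. Hence only running times are proved for
    the basic operations; heights are treated separately just for the one loop whose number of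
    rounds is not polynomial. *)
Lemma exec_heights P c s T s' H : exec P c s T s' ->
  (forall j, size (get s j) + T <= H) -> exec (fun h => h <= H) c s T s'.
Proof.
move=> e; elim: e H => {c s T s'} [s j a _|s j|c1 c2 s T1 s1 T2 s2 e1 IH1 _ IH2|s j p c1 c2 T s' _ IH|s j p c np|s j p c T1 s1 T2 s2 pt e1 IH1 _ IH2] H hH.
- by apply: XPush; have := hH j; lia.
- exact: XPop.
- apply: (XSeq (s1 := s1)); first by apply: IH1 => i; have := hH i; lia.
  by apply: IH2 => i; have := hH i; have := exec_size e1 i; lia.
- by apply: XIf; apply: IH => i; have := hH i; lia.
- exact: XDone.
- apply: (XLoop (s1 := s1)) => //; first by apply: IH1 => i; have := hH i; lia.
  by apply: IH2 => i; have := hH i; have := exec_size e1 i; lia.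
Qed.

(** * Compilation to Turing machines *)

Inductive instr :=
  | IPush (j : 'I_5) (a : sym) (n : nat)
  | IPop (j : 'I_5) (n : nat)
  | IIf (j : 'I_5) (p : pred (option sym)) (n1 n2 : nat).

Fixpoint clen (c : cmd) : nat :=
  match c with
  | Push _ _ | Pop _ => 1
  | Seq c1 c2 => clen c1 + clen c2
  | If _ _ c1 c2 => (clen c1 + clen c2).+1
  | While _ _ c => (clen c).+1
  end.

(** The code starts at address [pc] and continues at [nx]. With the continuation known in advance,
    sequencing and leaving a branch cost no instruction, so the step counts of [exec] and of the
    code coincide. *)
Fixpoint compile (c : cmd) (pc nx : nat) : seq instr :=
  match c with
  | Push j a => [:: IPush j a nx]
  | Pop j => [:: IPop j nx]
  | Seq c1 c2 => compile c1 pc (pc + clen c1) ++ compile c2 (pc + clen c1) nx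
  | If j p c1 c2 =>
      IIf j p pc.+1 (pc.+1 + clen c1)
        :: compile c1 pc.+1 nx ++ compile c2 (pc.+1 + clen c1) nx
  | While j p c => IIf j p pc.+1 nx :: compile c pc.+1 pc
  end.

Lemma size_compile c pc nx : size (compile c pc nx) = clen c.
Proof.
by elim: c pc nx => //= [c1 IH1 c2 IH2|j p c1 IH1 c2 IH2|j p c IH] pc nx;
  rewrite ?size_cat ?IH1 ?IH2 ?IH.
Qed.

Definition instr0 : instr := IPop ord0 0.

Definition mstep (code : seq instr) (x : nat * store) : nat * store :=
  let: (pc, s) := x in
  match nth instr0 code pc with
  | IPush j a n => (n, put s j (a :: get s j))
  | IPop j n => (n, put s j (behead (get s j)))
  | IIf j p n1 n2 => (if p (top s j) then n1 else n2, s)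
  end.

Definition hok (H : nat) (s : store) := forall j, size (get s j) <= H.

Inductive mruns (code : seq instr) (H : nat) : nat -> nat * store -> nat * store -> Prop :=
  | MR0 x : mruns code H 0 x x
  | MRS n x y : x.1 < size code -> hok H (mstep code x).2 ->
      mruns code H n (mstep code x) y -> mruns code H n.+1 x y.

Lemma mruns_trans code H n m x y z :
  mruns code H n x y -> mruns code H m y z -> mruns code H (n + m) x z.
Proof. by elim=> {n x y} [x|n x y lt ok _ IH /IH]; last exact: MRS. Qed.

Definition code_at (code : seq instr) (pc : nat) (code1 : seq instr) :=
  exists pre post, code = pre ++ code1 ++ post /\ size pre = pc.

Lemma code_at_cat code pc c1 c2 : code_at code pc (c1 ++ c2) ->
  code_at code pc c1 /\ code_at code (pc + size c1) c2.
Proof.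
case=> [pre [post [-> <-]]]; split.
  by exists pre, (c2 ++ post); rewrite -!catA.
by exists (pre ++ c1), post; rewrite size_cat -!catA.
Qed.

Lemma code_at_head code pc i c : code_at code pc (i :: c) ->
  [/\ pc < size code, nth instr0 code pc = i & code_at code pc.+1 c].
Proof.
move=> h; have [] := code_at_cat (c1 := [:: i]) h; rewrite addn1 => _.
case: h => [pre [post [-> <-]]] ?; split=> //.
  by rewrite !size_cat /=; lia.
by rewrite nth_cat ltnn subnn.
Qed.

Lemma exec_mruns H c s T s' : exec (fun h => h <= H) c s T s' -> hok H s ->
  forall code pc nx, code_at code pc (compile c pc nx) ->
  mruns code H T (pc, s) (nx, s') /\ hok H s'.
Proof.
elim=> {c s T s'} [s j a lt|s j|c1 c2 s T1 s1 T2 s2 _ IH1 _ IH2|s j p c1 c2 T s' _ IH|s j p c /negbTE np|s j p c T1 s1 T2 s2 pt _ IH1 _ IH2] hs code pc nx /=.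
- case/code_at_head=> ltc e _.
  have hk : hok H (put s j (a :: get s j)).
    by move=> i; rewrite get_put; case: eqP => // _.
  split=> //; have E : mstep code (pc, s) = (nx, put s j (a :: get s j)) by rewrite /= e.
  by apply: MRS => //; rewrite E //; apply: MR0.
- case/code_at_head=> ltc e _.
  have hk : hok H (put s j (behead (get s j))).
    by move=> i; rewrite get_put; case: eqP => // _; rewrite size_behead; have := hs j; lia.
  split=> //; have E : mstep code (pc, s) = (nx, put s j (behead (get s j))) by rewrite /= e.
  by apply: MRS => //; rewrite E //; apply: MR0.
- case/code_at_cat; rewrite size_compile => /(IH1 hs) [r1 h1] /(IH2 h1) [r2 h2].
  by split=> //; apply: mruns_trans r1 r2.
- case/code_at_head=> ltc e /code_at_cat [a1 a2]; rewrite size_compile in a2.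
  have E : mstep code (pc, s) = (if p (top s j) then pc.+1 else pc.+1 + clen c1, s) by rewrite /= e.
  have [r h] : mruns code H T (mstep code (pc, s)) (nx, s') /\ hok H s'.
    by rewrite E; case: (p (top s j)) IH => IH; apply: IH.
  by split=> //; apply: MRS => //; rewrite E.
- case/code_at_head=> ltc e _; split=> //.
  have E : mstep code (pc, s) = (nx, s) by rewrite /= e np.
  by apply: MRS; rewrite ?E //; apply: MR0.
- move=> ca; case/code_at_head: (ca) => ltc e a1.
  have E : mstep code (pc, s) = (pc.+1, s) by rewrite /= e pt.
  have [r1 h1] := IH1 hs _ _ _ a1; have [r2 h2] := IH2 h1 _ _ _ ca.
  split=> //; apply: MRS; rewrite ?E //; exact: mruns_trans r1 r2.
Qed.

(** * Simulation of stack code by a Turing machine *)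

Section Machine.
Variable code : seq instr.
Let N := size code.

(** The three kinds of states are passed in this order. The ['I_3] phases turn the input into a
    stack: a step to the left and back creates the bottom blank, then the head runs to the right
    end. The addresses simulate the code. The last kind walks back to the first output symbol, the
    first bit telling that it has arrived and the second one being the answer. *)
Definition mstate : finType :=
  ('I_3 + 'I_N.+1 * option ('I_5 * sym) + bool * bool)%type.

Definition keep (g : {ffun 'I_5 -> option sym}) : {ffun 'I_5 -> option sym * move} :=
  [ffun j => (g j, MStay)].
Definition act1 (g : {ffun 'I_5 -> option sym}) (j : 'I_5) a m :
  {ffun 'I_5 -> option sym * move} :=
  [ffun i => if i == j then (a, m) else (g i, MStay)].

Definition at_phase (i : 'I_3) : mstate := inl (inl i).
(* The second component is a pending write: a push first moves right. *)
Definition at_pc (n : nat) (w : option ('I_5 * sym)) : mstate := inl (inr (inord n, w)).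
Definition at_end (h b : bool) : mstate := inr (h, b).

Definition mdelta (q : mstate) (g : {ffun 'I_5 -> option sym}) :
    mstate * {ffun 'I_5 -> option sym * move} :=
  match q with
  | inl (inl i) =>
      if val i == 0 then (at_phase (inord 1), act1 g ord0 (g ord0) MLeft)
      else if val i == 1 then (at_phase (inord 2), act1 g ord0 (g ord0) MRight)
      else if g ord0 is Some _ then (q, act1 g ord0 (g ord0) MRight)
      else (at_pc 0 None, act1 g ord0 None MLeft)
  | inl (inr (pc, Some (j, a))) => (inl (inr (pc, None)), act1 g j (Some a) MStay)
  | inl (inr (pc, None)) =>
      if pc < N then
        match nth instr0 code pc with
        | IPush j a n => (at_pc n (Some (j, a)), act1 g j (g j) MRight)
        | IPop j n => (at_pc n None, if g j is Some _ then act1 g j None MLeft else keep g)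
        | IIf j p n1 n2 => (at_pc (if p (g j) then n1 else n2) None, keep g)
        end
      else (at_end false (g ord0 == Some (inl true)), keep g)
  | inr (h, b) =>
      if h then (q, keep g)
      else if g ord0 is Some _ then (q, act1 g ord0 (g ord0) MLeft)
      else (at_end true b, act1 g ord0 None MRight)
  end.

Definition mverdict (q : mstate) : option bool :=
  if q is inr (true, b) then Some b else None.

Definition stack_tm : tm :=
  @TM 4 mstate unit (at_phase ord0) mverdict mdelta.

Notation tapes := {ffun 'I_5 -> tape sym}.
Definition cfg (q : mstate) (t : tapes) : config stack_tm := @Config stack_tm q t.

Definition tset (t : tapes) (j : 'I_5) (u : tape sym) : tapes :=
  [ffun i => if i == j then u else t i].

Lemma tstep_act (q : mstate) (t : tapes) q' j a m : mverdict q = None ->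
  mdelta q [ffun j => t_cur (t j)] = (q', act1 [ffun j => t_cur (t j)] j a m) ->
  tm_step (cfg q t) = cfg q' (tset t j (write_move (t j) a m)).
Proof.
move=> v e; rewrite /tm_step /= v e; congr Config; apply/ffunP => i.
by rewrite !ffunE; case: eqP => [->|_] //=; case: (t i).
Qed.

Lemma tstep_keep (q : mstate) (t : tapes) q' : mverdict q = None ->
  mdelta q [ffun j => t_cur (t j)] = (q', keep [ffun j => t_cur (t j)]) ->
  tm_step (cfg q t) = cfg q' t.
Proof.
move=> v e; rewrite /tm_step /= v e; congr Config; apply/ffunP => i.
by rewrite !ffunE /=; case: (t i).
Qed.

Definition fits (K : nat) (t : tapes) := forall j, tape_size (t j) <= K.

Lemma fits_space K q t : fits K t -> config_space (cfg q t) <= 5 * K.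
Proof.
move=> f; rewrite /config_space /=.
apply: (@leq_trans (\sum_(j < 5) K)); first by apply: leq_sum => j _; apply: f.
by rewrite sum_nat_const card_ord.
Qed.

Definition reach (K n : nat) (c c' : config stack_tm) :=
  iter n (@tm_step stack_tm) c = c' /\
  forall i, i <= n -> config_space (iter i (@tm_step stack_tm) c) <= K.

Lemma reach0 K q t : fits K t -> reach (5 * K) 0 (cfg q t) (cfg q t).
Proof. by move=> f; split=> // i; rewrite leqn0 => /eqP ->; apply: fits_space. Qed.

Lemma reach_trans K n m a b c : reach K n a b -> reach K m b c -> reach K (n + m) a c.
Proof.
case=> e1 h1 [e2 h2]; split; first by rewrite addnC iterD e1.
move=> i le; case: (leqP i n) => [/h1 //|lt].
have -> : i = (i - n) + n by lia.
by rewrite iterD e1; apply: h2; lia.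
Qed.

Lemma reach1 K q t q' t' : tm_step (cfg q t) = cfg q' t' -> fits K t -> fits K t' ->
  reach (5 * K) 1 (cfg q t) (cfg q' t').
Proof.
move=> e f f'; split=> // [[|[|i]]] //= _; first exact: fits_space.
by rewrite e; apply: fits_space.
Qed.

(* The head stands on the top of the stack; the bottom is marked by a blank. *)
Definition rep (K : nat) (l : seq sym) (t : tape sym) :=
  [/\ t_cur t :: t_left t = rcons (map Some l) None,
      all (pred1 None) (t_right t) & tape_size t <= K].

Lemma rep_cur K l t : rep K l t -> t_cur t = ohead l.
Proof. by case=> + _ _; case: l => [|a l] [->]. Qed.

Lemma rep_left K l t : rep K l t -> size (t_left t) = size l.
Proof. by case=> /(congr1 size) /=; rewrite size_rcons size_map => -[]. Qed.

(** A pop leaves a visited blank cell to the right of the head. A push reuses such a cell, and the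
    tape keeps its size, or it extends the tape, whose size is then the new height plus the bottom
    blank. *)
Lemma rep_push K l t a : rep K l t -> size l + 2 <= K ->
  let t1 := write_move t (t_cur t) MRight in
  tape_size t1 <= K /\ rep K (a :: l) (write_move t1 (Some a) MStay).
Proof.
move=> r lK; have sl := rep_left r; case: r => e b s /=.
case E: (t_right t) => [|u v] /=; rewrite /rep /tape_size /=.
  by rewrite e sl; repeat split=> //; lia.
move: b s; rewrite E /= /tape_size E /= => /andP [_ b] s.
by rewrite e; repeat split=> //; rewrite -?e /= ?sl; lia.
Qed.

Lemma rep_pop K a l t : rep K (a :: l) t -> rep K l (write_move t None MLeft).
Proof.
case=> /= -[ec el] b s; case E: (t_left t) el => [|u v] /= e.
  by move/(congr1 size): e; rewrite size_rcons.
rewrite /rep /tape_size /= b; split=> //; move: s; rewrite /tape_size E /=; lia.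
Qed.

Definition repc (K : nat) (s : store) (t : tapes) := forall j : 'I_5, rep K (get s j) (t j).

Lemma repc_fits K s t : repc K s t -> fits K t.
Proof. by move=> r j; case: (r j). Qed.

Lemma fits_tset K t j u : fits K t -> tape_size u <= K -> fits K (tset t j u).
Proof. by move=> f h i; rewrite ffunE; case: ifP. Qed.

Lemma repc_tset K s t (j : 'I_5) u l : repc K s t -> rep K l u ->
  repc K (put s j l) (tset t j u).
Proof.
move=> r ru i; rewrite ffunE get_put -val_eqE.
by case: ifP => // _; apply: r.
Qed.

(** A push takes two steps, a move and a write. A pop of the empty stack must not move, or the head
    would leave the bottom blank. *)
Lemma mstep_reach H x t : x.1 < N -> repc (H + 2) x.2 t -> hok H (mstep code x).2 ->
  exists n t', [/\ n <= 2, reach (5 * (H + 2)) n (cfg (at_pc x.1 None) t)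
    (cfg (at_pc (mstep code x).1 None) t') & repc (H + 2) (mstep code x).2 t'].
Proof.
case: x => pc s /= lt r hk; have f := repc_fits r.
have lt' : inord pc = Ordinal (leqW lt : pc < N.+1) by apply: val_inj; rewrite /= inordK // ltnW.
have hd j : t_cur (t j) = top s j by rewrite (rep_cur (r j)).
case E: (nth instr0 code pc) hk => [j a n|j n|j p n1 n2] /= hk.
- have rj := r j.
  have sj : size (get s j) + 2 <= H + 2.
    by have := hk j; rewrite get_put eqxx /=; lia.
  have [s1 r1] := rep_push a rj sj.
  set t1 := write_move (t j) (t_cur (t j)) MRight in s1 r1.
  set t2 := tset t j t1.
  exists 2, (tset t2 j (write_move t1 (Some a) MStay)).
  have -> : tset t2 j (write_move t1 (Some a) MStay) = tset t j (write_move t1 (Some a) MStay).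
    by apply/ffunP => i; rewrite !ffunE; case: eqP.
  have f2 : fits (H + 2) t2 by apply: fits_tset.
  have f3 : repc (H + 2) (put s j (a :: get s j)) (tset t j (write_move t1 (Some a) MStay)).
    exact: repc_tset.
  split=> //; apply: (@reach_trans _ 1 1 _ (cfg (at_pc n (Some (j, a))) t2)).
    apply: reach1 => //; apply: tstep_act => //.
    by rewrite /= lt' /= lt E ffunE.
  apply: reach1 => //; last exact: repc_fits f3.
  have -> : tset t j (write_move t1 (Some a) MStay) = tset t2 j (write_move (t2 j) (Some a) MStay).
    by apply/ffunP => i; rewrite !ffunE eqxx; case: eqP.
  exact: tstep_act.
- case e: (get s j) => [|a l].
    exists 1, t; split=> //; last first.
      move=> i; rewrite get_put; case: eqP => // /eqP; rewrite val_eqE => /eqP ->.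
      by have := r j; rewrite e.
    apply: reach1 => //; apply: tstep_keep => //.
    by rewrite /= lt' /= lt E ffunE hd /top e.
  have rj := r j; rewrite e in rj.
  have f3 := repc_tset j r (rep_pop rj).
  exists 1, (tset t j (write_move (t j) None MLeft)); split=> //.
  apply: reach1 => //; last exact: repc_fits f3.
  apply: tstep_act => //; by rewrite /= lt' /= lt E ffunE hd /top e.
- exists 1, t; split=> //; apply: reach1 => //; apply: tstep_keep => //.
  by rewrite /= lt' /= lt E ffunE hd.
Qed.

Lemma mruns_reach H n x y : mruns code H n x y -> forall t, repc (H + 2) x.2 t ->
  exists k t', [/\ k <= 2 * n, reach (5 * (H + 2)) k (cfg (at_pc x.1 None) t)
    (cfg (at_pc y.1 None) t') & repc (H + 2) y.2 t'].
Proof.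
elim=> {n x y} [x t r|n x y lt hk _ IH t r].
  by exists 0, t; split=> //; apply: reach0; apply: repc_fits r.
have [k1 [t1 [h1 r1 p1]]] := mstep_reach lt r hk.
have [k2 [t2 [h2 r2 p2]]] := IH _ p1.
exists (k1 + k2), t2; split=> //; first by lia.
exact: reach_trans r1 r2.
Qed.

Lemma scan_right K (u : seq sym) : forall (t : tapes) (l : seq (option sym)),
  t ord0 = (if u is a :: v then Tape l (Some a) (map Some v) else Tape l None [::]) ->
  fits K t -> size l + size u + 2 <= K ->
  exists t', [/\ reach (5 * K) (size u) (cfg (at_phase (inord 2)) t)
     (cfg (at_phase (inord 2)) t'),
     t' ord0 = Tape (catrev (map Some u) l) None [::], fits K t' &
     forall j, j != ord0 -> t' j = t j].
Proof.
elim: u => [|a v IH] t l e f hK; first by exists t; split=> //; apply: reach0.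
pose t1 := tset t ord0 (write_move (t ord0) (Some a) MRight).
have e1 : t1 ord0 = (if v is b :: w then Tape (Some a :: l) (Some b) (map Some w)
                     else Tape (Some a :: l) None [::]).
  by rewrite /t1 ffunE eqxx e; case: v {IH e hK}.
have f1 : fits K t1.
  apply: fits_tset => //; move: e1; rewrite /t1 ffunE eqxx => ->.
  by case: v hK {IH e} => [|b w] /=; rewrite /tape_size /= ?size_map; lia.
have [|t' [r' e' f' o']] := IH t1 (Some a :: l) e1 f1; first by move: hK => /=; lia.
exists t'; split=> //; last first.
  by move=> j j0; rewrite o' // ffunE (negbTE j0).
apply: (@reach_trans _ 1 _ _ _ _ _ r'); apply: reach1 => //.
apply: tstep_act => //; by rewrite /= inordK //= ffunE e.
Qed.

Lemma start_reach (w : seq sym) K : size w + 3 <= K ->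
  forall t : tapes, t = [ffun j => if j == ord0 then tape_of w else tape_of [::]] ->
  exists t', reach (5 * K) (size w + 3) (cfg (at_phase ord0) t) (cfg (at_pc 0 None) t')
   /\ repc K [:: rev w; [::]; [::]; [::]; [::]] t'.
Proof.
move=> hK t et.
have t0 : t ord0 = tape_of w by rewrite et ffunE.
have tj j : j != ord0 -> t j = tape_of [::] by rewrite et ffunE => /negbTE ->.
have fw : tape_size (tape_of w) <= K.
  by case: (w) hK => [|a v] /=; rewrite /tape_size /= ?size_map; lia.
have f : fits K t.
  move=> j; case: (eqVneq j ord0) => [->|/tj ->]; rewrite ?t0 //.
  by rewrite /tape_size /=; lia.
pose t1 := tset t ord0 (write_move (t ord0) (t_cur (t ord0)) MLeft).
pose t2 := tset t1 ord0 (write_move (t1 ord0) (t_cur (t1 ord0)) MRight).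
have f1 : fits K t1.
  apply: fits_tset => //; rewrite t0; case: (w) hK => [|a v] /=.
    by rewrite /tape_size /=; lia.
  by rewrite /tape_size /= size_map; lia.
have e2 : t2 ord0 = (if w is a :: v then Tape [:: None] (Some a) (map Some v)
                     else Tape [:: None] None [::]).
  by rewrite !ffunE !eqxx t0; case: (w).
have f2 : fits K t2.
  apply: fits_tset => //; move: e2; rewrite ffunE eqxx => ->.
  by case: (w) hK => [|a v]; rewrite /tape_size /= ?size_map; lia.
have [|t3 [r3 e3 f3 o3]] := scan_right e2 f2; first by move=> /=; lia.
pose t4 := tset t3 ord0 (write_move (t3 ord0) None MLeft).
have e4 : t4 ord0 = write_move (Tape (catrev (map Some w) [:: None]) None [::]) None MLeft.
  by rewrite ffunE eqxx e3.
have r4 : rep K (rev w) (t4 ord0).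
  rewrite e4 catrevE -map_rev cats1; case E: (rcons _ _) => [|a v].
    by move/(congr1 size): E; rewrite size_rcons.
  split=> //; rewrite /tape_size /=.
  by move/(congr1 size): E; rewrite size_rcons size_map size_rev /=; lia.
have rp : repc K [:: rev w; [::]; [::]; [::]; [::]] t4.
  move=> j; case: (eqVneq j ord0) => [->//|j0].
  have -> : t4 j = tape_of [::].
    by rewrite ffunE (negbTE j0) o3 // ffunE (negbTE j0) ffunE (negbTE j0) tj.
  have -> : get [:: rev w; [::]; [::]; [::]; [::]] j = [::].
    by case: j j0 => [[|[|[|[|[|j]]]]]] //= ? ?; rewrite /get /= nth_nil.
  by split=> //; rewrite /tape_size /=; lia.
exists t4; split=> //.
have -> : size w + 3 = 1 + (1 + (size w + 1)) by lia.
apply: (@reach_trans _ 1 _ _ (cfg (at_phase (inord 1)) t1)).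
  by apply: reach1 => //; apply: tstep_act => //; rewrite /= ffunE.
apply: (@reach_trans _ 1 _ _ (cfg (at_phase (inord 2)) t2)).
  apply: reach1 => //; apply: tstep_act => //; by rewrite /= inordK //= ffunE.
apply: (reach_trans r3).
apply: reach1 => //; last exact: repc_fits rp.
apply: tstep_act => //; by rewrite /= inordK //= ffunE e3.
Qed.

Lemma scan_left K b (l : seq sym) : forall (t : tapes) (v : seq (option sym)),
  t_cur (t ord0) :: t_left (t ord0) = rcons (map Some l) None ->
  t_right (t ord0) = v -> fits K t ->
  exists t', [/\ reach (5 * K) (size l) (cfg (at_end false b) t) (cfg (at_end false b) t'),
     t' ord0 = Tape [::] None (catrev (map Some l) v) & fits K t'].
Proof.
elim: l => [|a l IH] t v e ev f.
  exists t; split=> //; first exact: reach0.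
  by case: (t ord0) e ev => [x y z] /= [-> ->] ->.
pose t1 := tset t ord0 (write_move (t ord0) (Some a) MLeft).
have ec : t_cur (t ord0) = Some a by case: e.
have el : t_left (t ord0) = rcons (map Some l) None by case: e.
have [c [y ey]] : exists c y, t_left (t ord0) = c :: y.
  rewrite el; case E: (rcons _ _) => [|c y]; last by exists c, y.
  by move/(congr1 size): E; rewrite size_rcons.
have e1 : t1 ord0 = Tape y c (Some a :: v) by rewrite ffunE eqxx /= ey ev.
have f1 : fits K t1.
  apply: fits_tset => //; move: e1; rewrite ffunE eqxx => ->.
  by have := f ord0; rewrite /tape_size ey ev /=; lia.
have [|||t' [r' e' f']] := IH t1 (Some a :: v) => //; try by rewrite e1 //= -ey el.
exists t'; split=> //; apply: (@reach_trans _ 1 _ _ _ _ _ r'); apply: reach1 => //.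
by apply: tstep_act => //=; rewrite ffunE ec.
Qed.

Lemma tape_word_cons S (l : seq (option S)) (a : option S) r :
  tape_word (Tape l a r) = if a is Some x then
    x :: (if r is c :: r' then tape_word (Tape l c r') else [::]) else [::].
Proof. by case: a r => [x|] [|c r]. Qed.

Lemma tape_word_blank S (y : seq (option S)) (u : seq S) x l z :
  all (fun o => ~~ isSome o) y -> x :: l = map Some u ++ y -> tape_word (Tape z x l) = u.
Proof.
move=> ay; elim: u x l => [|a u IH] x l /= e; rewrite tape_word_cons.
  by move: ay; rewrite -e => /= /andP [+ _]; case: x {e}.
case: e => -> ->; congr cons; case E: (map Some u ++ y) => [|c r].
  by case: u IH E.
by apply: IH => //.
Qed.

(** The same machine decides and computes: a verdict is the top of stack 0, and an output is stack 0
    read from the bottom, which explains the reversal. The input arrives reversed as well, its last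
    bit on top. *)
Theorem stack_tm_run (w : seq bool) H T s' :
  mruns code H T (0, [:: rev (map inl w); [::]; [::]; [::]; [::]]) (N, s') ->
  size w < H -> hok H s' ->
  exists n t', [/\ n <= 2 * T + 2 * H + 10,
    reach (5 * (H + 2)) n (tm_init stack_tm w)
     (cfg (at_end true (top s' 0 == Some (inl true))) t') &
    forall u : seq bool, get s' 0 = rev (map inl u) -> tape_word (t' ord0) = map inl u].
Proof.
move=> mr hw hs.
have [|t1 [r1 p1]] := @start_reach (map inl w) (H + 2) _ _ (erefl _).
  by rewrite size_map; lia.
have [k [t2 [hk r2 p2]]] := mruns_reach mr p1.
rewrite /= in p2 r2.
have f2 := repc_fits p2.
set b := top s' 0 == _.
have c2 : t_cur (t2 ord0) = top s' 0 by rewrite (rep_cur (p2 ord0)).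
have [e2 a2 _] := p2 ord0.
have [t3 [r3 e3 f3]] := scan_left b e2 (erefl _) f2.
pose t4 := tset t3 ord0 (write_move (t3 ord0) None MRight).
have e4 : t4 ord0 = write_move (Tape [::] None (catrev (map Some (get s' 0)) (t_right (t2 ord0)))) None MRight.
  by rewrite ffunE eqxx e3.
have f4 : fits (H + 2) t4.
  apply: fits_tset => //; have := f3 ord0; rewrite e3 /tape_size /=.
  by case: (catrev _ _) => [|x y] /=; lia.
exists (size (map inl w : seq sym) + 3 + (k + (1 + (size (get s' 0) + 1)))), t4; split.
- by have := hs 0; rewrite size_map; lia.
- apply: (reach_trans r1); apply: (reach_trans r2).
  apply: (@reach_trans _ 1 _ _ (cfg (at_end false b) t2)).
    apply: reach1 => //; apply: tstep_keep => //.
    by rewrite /= inordK // ltnn ffunE c2.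
  apply: (reach_trans r3); apply: reach1 => //.
  by apply: tstep_act => //=; rewrite ffunE e3.
- move=> u eu; rewrite e4 [get _ _]eu catrevE -map_rev revK /=.
  move: a2; set y := t_right _ => ay.
  have ay' : all (fun o : option sym => ~~ isSome o) y by apply: sub_all ay => -[].
  case E: (map Some _ ++ y) => [|x l]; last by apply: (tape_word_blank _ ay').
  by case: u {eu} E.
Qed.

(** A halted configuration is repeated forever, so the space bound up to the halting time is a bound
    for all times. *)
Lemma reach_space K n (w : seq bool) q t : mverdict q <> None ->
  reach K n (tm_init stack_tm w) (cfg q t) ->
  forall i, config_space (tm_run stack_tm w i) <= K.
Proof.
move=> hv [e h] i; case: (leqP i n) => [/h //|lt].
have -> : i = (i - n) + n by lia.
rewrite /tm_run iterD e; have -> : iter (i - n) (@tm_step stack_tm) (cfg q t) = cfg q t.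
  by elim: (i - n) => //= m ->; rewrite /tm_step /=; case: (mverdict q) hv.
by rewrite -e; apply: h.
Qed.

End Machine.

(** * Polynomial bounds *)

(** Pure powers of [n + 2] absorb constants and coefficients because the base is at least 2; closure
    under sum, product and composition then needs only exponents. *)
Definition pb (f : nat -> nat) := exists k, forall n, f n <= (n + 2) ^ k.

Lemma leq_pow2 n k l : k <= l -> (n + 2) ^ k <= (n + 2) ^ l.
Proof. by move=> h; rewrite leq_exp2l // addn2. Qed.

Lemma pow2_dbl n k : 2 * (n + 2) ^ k <= (n + 2) ^ k.+1.
Proof. by rewrite expnS leq_mul2r; apply/orP; right; lia. Qed.

Lemma leq_pow_base m n k : m <= n -> m ^ k <= n ^ k.
Proof. by move=> h; elim: k => // k IH; rewrite !expnS leq_mul. Qed.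

Lemma pb_le f g : (forall n, f n <= g n) -> pb g -> pb f.
Proof. by move=> h [k hk]; exists k => n; apply: leq_trans (h n) (hk n). Qed.

Lemma pb_add f g : pb f -> pb g -> pb (fun n => f n + g n).
Proof.
move=> [k hk] [l hl]; exists (k + l).+1 => n; apply: leq_trans (pow2_dbl n _).
rewrite mul2n -addnn; apply: leq_add.
  by apply: leq_trans (hk n) _; apply: leq_pow2; lia.
by apply: leq_trans (hl n) _; apply: leq_pow2; lia.
Qed.

Lemma pb_mul f g : pb f -> pb g -> pb (fun n => f n * g n).
Proof.
move=> [k hk] [l hl]; exists (k + l) => n; rewrite expnD; exact: leq_mul.
Qed.

Lemma pb_const c : pb (fun=> c).
Proof.
exists c => n; apply: (@leq_trans (2 ^ c)); first by rewrite ltnW // ltn_expl.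
by apply: leq_pow_base; lia.
Qed.

Lemma pb_id : pb (fun n => n).
Proof. by exists 1 => n; rewrite expn1; lia. Qed.

Lemma pb_comp f g : pb f -> pb g -> {homo f : m n / m <= n} -> pb (fun n => f (g n)).
Proof.
(* The exponent [l.+2] comes from bounding [(n + 2) ^ l + 2] by [(n + 2) ^ l.+2]. *)
move=> [k hk] [l hl] mf; exists (l.+2 * k) => n.
apply: leq_trans (mf _ _ (hl n)) _; apply: leq_trans (hk _) _.
rewrite expnM; apply: leq_pow_base; apply: leq_trans (pow2_dbl n _).
rewrite mul2n -addnn; apply: leq_add; first exact: leq_pow2.
by apply: leq_trans (leq_pow2 n (isT : 0 < l.+1)); rewrite expn1; lia.
Qed.

(** For positive n one has [n + 2 <= 3 * n]; the additive constant covers n = 0. *)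
Lemma pb_pow_le k : exists c, forall n, (n + 2) ^ k <= c * n ^ k + c.
Proof.
exists (3 ^ k) => -[|n]; first by rewrite add0n; apply: leq_trans (leq_addl _ _); apply: leq_pow_base.
by rewrite -expnMn; apply: leq_trans (leq_addr _ _); apply: leq_pow_base; lia.
Qed.

(** * Trees on a stack *)

Inductive tree := Lf | Nd (l r : tree).

Fixpoint tsz (t : tree) : nat := if t is Nd l r then (tsz l + tsz r).+1 else 1.
(** Preorder with one bit per node. The code delimits itself, so trees lie on a stack without
    separators, and its length is [tsz]. *)
Fixpoint ser (t : tree) : seq sym :=
  if t is Nd l r then inl true :: ser l ++ ser r else [:: inl false].
Definition hd t := if t is Nd l _ then l else Lf.
Definition tl t := if t is Nd _ r then r else Lf.
Definition isLf t := if t is Lf then true else false.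

Lemma size_ser t : size (ser t) = tsz t.
Proof. by elim: t => //= l IHl r IHr; rewrite size_cat IHl IHr. Qed.

Lemma tsz_gt0 t : 0 < tsz t. Proof. by case: t. Qed.

Definition runs (c : cmd) (s s' : store) (B : nat) := exists2 T, T <= B & exec predT c s T s'.

Lemma runs_le c s s' B B' : runs c s s' B -> B <= B' -> runs c s s' B'.
Proof. by case=> T h e h'; exists T => //; apply: leq_trans h h'. Qed.

Lemma runs_seq c1 c2 s s1 s2 B1 B2 : runs c1 s s1 B1 -> runs c2 s1 s2 B2 ->
  runs (Seq c1 c2) s s2 (B1 + B2).
Proof.
by case=> T1 h1 e1 [T2 h2 e2]; exists (T1 + T2); [exact: leq_add|exact: XSeq e1 e2].
Qed.

Lemma runs_push (j : 'I_5) a s s' : s' = put s j (a :: get s j) -> runs (Push j a) s s' 1.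
Proof. by move=> ->; exists 1 => //; apply: XPush. Qed.

Lemma runs_pop (j : 'I_5) s s' : s' = put s j (behead (get s j)) -> runs (Pop j) s s' 1.
Proof. by move=> ->; exists 1 => //; apply: XPop. Qed.

Lemma runs_if (j : 'I_5) (p : pred (option sym)) c1 c2 s s' B :
  runs (if p (top s j) then c1 else c2) s s' B -> runs (If j p c1 c2) s s' B.+1.
Proof. by case=> T h e; exists T.+1 => //; apply: XIf. Qed.

Lemma runs_done (j : 'I_5) (p : pred (option sym)) c s : ~~ p (top s j) -> runs (While j p c) s s 1.
Proof. by move=> h; exists 1 => //; apply: XDone. Qed.

Lemma runs_loop (j : 'I_5) (p : pred (option sym)) c s s1 s2 B1 B2 : p (top s j) ->
  runs c s s1 B1 -> runs (While j p c) s1 s2 B2 -> runs (While j p c) s s2 (B1 + B2).+1.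
Proof.
move=> h [T1 h1 e1] [T2 h2 e2]; exists (T1 + T2).+1; last exact: XLoop h e1 e2.
by rewrite ltnS leq_add.
Qed.

(** [jM] holds the trees and [jIO] the input and output; [jA], [jB] are scratch space and [jC] the
    counter of [move_tree]. The last three are empty between operations. *)
Definition jIO : 'I_5 := @Ordinal 5 0 isT.
Definition jM : 'I_5 := @Ordinal 5 1 isT.
Definition jA : 'I_5 := @Ordinal 5 2 isT.
Definition jB : 'I_5 := @Ordinal 5 3 isT.
Definition jC : 'I_5 := @Ordinal 5 4 isT.
Definition mark : sym := inr tt.
Definition isN : pred (option sym) := fun o => o == Some (inl true).
Definition nomark : pred (option sym) := fun o => o != Some mark.

(* Stack C counts the trees still to be moved. *)
Definition move_tree (e : bool -> cmd) : cmd :=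
  Seq (Push jC mark) (While jC isSome (If jM isN
    (Seq (Pop jM) (Seq (e true) (Push jC mark)))
    (Seq (Pop jM) (Seq (e false) (Pop jC))))).

Section MoveTree.
Variables (st : seq sym -> seq sym -> seq sym -> store) (e : bool -> cmd).
Hypothesis gM : forall m d c, get (st m d c) jM = m.
Hypothesis gC : forall m d c, get (st m d c) jC = c.
Hypothesis pM : forall m d c m', put (st m d c) jM m' = st m' d c.
Hypothesis pC : forall m d c c', put (st m d c) jC c' = st m d c'.
Hypothesis he : forall b m d c, runs (e b) (st m d c) (st m (inl b :: d) c) 1.

(** Generalized from one tree to the forest still to be moved: an inner node replaces a pending tree
    by its two children, a leaf removes one. The induction is on the total size. The view [st] of
    the store makes the run usable for any destination and any other contents. *)
Lemma move_forest_runs n : forall ts m d, sumn (map tsz ts) <= n ->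
  runs (While jC isSome (If jM isN
    (Seq (Pop jM) (Seq (e true) (Push jC mark)))
    (Seq (Pop jM) (Seq (e false) (Pop jC)))))
   (st (flatten (map ser ts) ++ m) d (nseq (size ts) mark))
   (st m (rev (flatten (map ser ts)) ++ d) [::]) (5 * sumn (map tsz ts) + 1).
Proof.
elim: n => [|n IH] [|t ts] m d /= hn; try by apply: runs_done; rewrite /top gC.
- by have := tsz_gt0 t; lia.
case: t hn => [|l r] /= hn.
- have step : runs (If jM isN (Seq (Pop jM) (Seq (e true) (Push jC mark)))
     (Seq (Pop jM) (Seq (e false) (Pop jC))))
     (st (inl false :: flatten (map ser ts) ++ m) d (mark :: nseq (size ts) mark))
     (st (flatten (map ser ts) ++ m) (inl false :: d) (nseq (size ts) mark)) 4.
    apply: runs_if; rewrite /top gM /=.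
    apply: (@runs_seq _ _ _ (st (flatten (map ser ts) ++ m) d (mark :: nseq (size ts) mark)) _ 1 2).
      by apply: runs_pop; rewrite gM pM.
    apply: (@runs_seq _ _ _ _ _ 1 1); first exact: he.
    by apply: runs_pop; rewrite gC pC.
  have lt : sumn (map tsz ts) <= n by lia.
  have := runs_loop _ step (IH ts m (inl false :: d) lt).
  rewrite /top gC /= => /(_ isT) r.
  by rewrite rev_cons cat_rcons; apply: runs_le r _; lia.
- have step : runs (If jM isN (Seq (Pop jM) (Seq (e true) (Push jC mark)))
     (Seq (Pop jM) (Seq (e false) (Pop jC))))
     (st (inl true :: flatten (map ser [:: l, r & ts]) ++ m) d (mark :: nseq (size ts) mark))
     (st (flatten (map ser [:: l, r & ts]) ++ m) (inl true :: d) (nseq (size [:: l, r & ts]) mark)) 4.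
    apply: runs_if; rewrite /top gM /=.
    apply: (@runs_seq _ _ _ (st (flatten (map ser [:: l, r & ts]) ++ m) d (mark :: nseq (size ts) mark)) _ 1 2).
      by apply: runs_pop; rewrite gM pM.
    apply: (@runs_seq _ _ _ _ _ 1 1); first exact: he.
    by apply: runs_push; rewrite gC pC.
  have lt : sumn (map tsz [:: l, r & ts]) <= n by move=> /=; lia.
  have := runs_loop _ step (IH [:: l, r & ts] m (inl true :: d) lt).
  rewrite /top gC /= => /(_ isT) r'.
  rewrite rev_cons cat_rcons -!catA; rewrite -!catA in r'.
  by apply: runs_le r' _; lia.
Qed.

Lemma move_tree_runs t m d :
  runs (move_tree e) (st (ser t ++ m) d [::]) (st m (rev (ser t) ++ d) [::]) (5 * tsz t + 2).
Proof.
have := @move_forest_runs _ [:: t] m d (leqnn _); rewrite /= cats0 addn0 => r.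
apply: runs_le (runs_seq (runs_push _) r) _; last by lia.
by rewrite gC pC.
Qed.
End MoveTree.

Definition transfer (src : 'I_5) (e : bool -> cmd) : cmd :=
  While src nomark (If src isN (Seq (Pop src) (e true)) (Seq (Pop src) (e false))).

Section Transfer.
Variables (st : seq sym -> seq sym -> store) (src : 'I_5) (e : bool -> cmd).
Hypothesis gS : forall s d, get (st s d) src = s.
Hypothesis pS : forall s d s', put (st s d) src s' = st s' d.
Hypothesis he : forall b s d, runs (e b) (st s d) (st s (inl b :: d)) 2.

Lemma transfer_runs (l : seq bool) a d :
  runs (transfer src e) (st (map inl l ++ mark :: a) d)
    (st (mark :: a) (map inl (rev l) ++ d)) (5 * size l + 1).
Proof.
elim: l d => [|b l IH] d /=; first by apply: runs_done; rewrite /top gS.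
have step : runs (If src isN (Seq (Pop src) (e true)) (Seq (Pop src) (e false)))
   (st (inl b :: map inl l ++ mark :: a) d) (st (map inl l ++ mark :: a) (inl b :: d)) 4.
  apply: runs_if; rewrite /top gS /=; case: b => /=;
    by apply: (@runs_seq _ _ _ _ _ 1 2) (he _ _ _); apply: runs_pop; rewrite gS pS.
have := runs_loop _ step (IH (inl b :: d)).
rewrite /top gS /= => /(_ isT) r.
by rewrite rev_cons map_rcons cat_rcons; apply: runs_le r _; lia.
Qed.
End Transfer.

Definition serb (t : tree) : seq bool := [seq (if a is inl b then b else false) | a <- ser t].
Lemma ser_serb t : ser t = map inl (serb t).
Proof.
rewrite /serb -map_comp; elim: t => //= l IHl r IHr.
by rewrite map_cat -IHl -IHr.
Qed.
Lemma size_serb t : size (serb t) = tsz t.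
Proof. by rewrite size_map size_ser. Qed.

Definition std (io m : seq sym) : store := [:: io; m; [::]; [::]; [::]].

Definition c_drop : cmd :=
  Seq (Push jA mark) (Seq (move_tree (fun b => Push jA (inl b)))
    (Seq (While jA nomark (Pop jA)) (Pop jA))).

Lemma drain_runs io m (l : seq bool) a :
  runs (While jA nomark (Pop jA)) [:: io; m; map inl l ++ mark :: a; [::]; [::]]
    [:: io; m; mark :: a; [::]; [::]] (2 * size l + 1).
Proof.
elim: l => [|b l IH] /=; first exact: runs_done.
apply: (@runs_le _ _ _ (1 + (2 * size l + 1)).+1); last by lia.
by apply: runs_loop IH => //; apply: runs_pop.
Qed.

Lemma rev_ser t : rev (ser t) = map inl (rev (serb t)).
Proof. by rewrite ser_serb map_rev. Qed.

(** Stack A is allowed to be nonempty, since [c_hd] drops the right subtree while the left one is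
    parked there. *)
Lemma c_drop_runs io a t m :
  runs c_drop [:: io; ser t ++ m; a; [::]; [::]] [:: io; m; a; [::]; [::]] (10 * tsz t + 10).
Proof.
apply: (@runs_le _ _ _ (1 + (5 * tsz t + 2 + (2 * size (rev (serb t)) + 1 + 1)))); last first.
  by rewrite size_rev size_serb; lia.
apply: runs_seq; first exact: runs_push.
apply: runs_seq.
  by apply: (@move_tree_runs (fun m d c => [:: io; m; d; [::]; c])) => // *; apply: runs_push.
by rewrite rev_ser; apply: runs_seq; [exact: drain_runs | exact: runs_pop].
Qed.

(** A leaf is its own tail; the push followed by a pop stands for doing nothing. *)
Definition c_tl : cmd := If jM isN (Seq (Pop jM) c_drop) (Seq (Push jA mark) (Pop jA)).

Lemma c_tl_runs io t m :
  runs c_tl (std io (ser t ++ m)) (std io (ser (tl t) ++ m)) (10 * tsz t + 20).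
Proof.
case: t => [|l r] /=.
  apply: (@runs_le _ _ _ 3) => //; apply: runs_if => /=.
  by apply: (@runs_seq _ _ _ _ _ 1 1); [exact: runs_push|exact: runs_pop].
apply: (@runs_le _ _ _ (1 + (10 * tsz l + 10)).+1); last by lia.
apply: runs_if => /=; apply: runs_seq; first exact: runs_pop.
by rewrite /= -catA; apply: c_drop_runs.
Qed.

Definition c_hd : cmd := If jM isN
  (Seq (Pop jM) (Seq (Push jA mark) (Seq (move_tree (fun b => Push jA (inl b)))
    (Seq c_drop (Seq (transfer jA (fun b => Push jM (inl b))) (Pop jA))))))
  (Seq (Push jA mark) (Pop jA)).

Lemma c_hd_runs io t m :
  runs c_hd (std io (ser t ++ m)) (std io (ser (hd t) ++ m)) (20 * tsz t + 20).
Proof.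
case: t => [|l r] /=.
  apply: (@runs_le _ _ _ 3) => //; apply: runs_if => /=.
  by apply: (@runs_seq _ _ _ _ _ 1 1); [exact: runs_push|exact: runs_pop].
apply: (@runs_le _ _ _ (1 + (1 + (5 * tsz l + 2 + (10 * tsz r + 10 +
   (5 * size (rev (serb l)) + 1 + 1))))).+1); last by rewrite size_rev size_serb; lia.
apply: runs_if => /=; apply: runs_seq; first exact: runs_pop.
apply: runs_seq; first exact: runs_push.
apply: runs_seq => /=.
  rewrite -catA; apply: (@move_tree_runs (fun m d c => [:: io; m; d; [::]; c])) => // *.
  exact: runs_push.
apply: runs_seq; first exact: c_drop_runs.
rewrite rev_ser; apply: runs_seq.
  apply: (@transfer_runs (fun s d => [:: io; d; s; [::]; [::]])) => // *.
  by apply: (@runs_le _ _ _ 1) => //; apply: runs_push.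
by rewrite revK -ser_serb; apply: runs_pop.
Qed.

(** Every transfer reverses. One copy returns from A to the main stack directly; the other one, sent
    to B at the same time, needs two further transfers by way of A. *)
Definition c_dup : cmd :=
  Seq (Push jA mark) (Seq (move_tree (fun b => Push jA (inl b)))
   (Seq (Push jB mark) (Seq (transfer jA (fun b => Seq (Push jM (inl b)) (Push jB (inl b))))
    (Seq (transfer jB (fun b => Push jA (inl b)))
     (Seq (transfer jA (fun b => Push jM (inl b))) (Seq (Pop jA) (Pop jB))))))).

Lemma c_dup_runs io t m :
  runs c_dup (std io (ser t ++ m)) (std io (ser t ++ ser t ++ m)) (20 * tsz t + 20).
Proof.
apply: (@runs_le _ _ _ (1 + (5 * tsz t + 2 + (1 + (5 * size (rev (serb t)) + 1 +
   (5 * size (serb t) + 1 + (5 * size (rev (serb t)) + 1 + (1 + 1)))))))); last first.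
  by rewrite size_rev size_serb; lia.
apply: runs_seq; first exact: runs_push.
apply: runs_seq => /=.
  by apply: (@move_tree_runs (fun m d c => [:: io; m; d; [::]; c])) => // *; apply: runs_push.
apply: runs_seq; first exact: runs_push.
rewrite rev_ser /=; apply: runs_seq.
  apply: (@transfer_runs (fun s d => [:: io; d ++ m; s; d ++ [:: mark]; [::]]) jA _ _ _ _ _ [::] [::]) => // *.
  by apply: (@runs_seq _ _ _ _ _ 1 1); exact: runs_push.
rewrite revK cats0; apply: runs_seq.
  apply: (@transfer_runs (fun s d => [:: io; _; d; s; [::]])) => // *.
  by apply: (@runs_le _ _ _ 1) => //; apply: runs_push.
apply: runs_seq.
  apply: (@transfer_runs (fun s d => [:: io; d; s; _; [::]])) => // *.
  by apply: (@runs_le _ _ _ 1) => //; apply: runs_push.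
rewrite revK -ser_serb; apply: (@runs_seq _ _ _ _ _ 1 1); first exact: runs_pop.
exact: runs_pop.
Qed.

Definition c_swap : cmd :=
  Seq (Push jA mark) (Seq (move_tree (fun b => Push jA (inl b)))
   (Seq (Push jB mark) (Seq (move_tree (fun b => Push jB (inl b)))
    (Seq (transfer jA (fun b => Push jM (inl b)))
     (Seq (transfer jB (fun b => Push jM (inl b))) (Seq (Pop jA) (Pop jB))))))).

Lemma c_swap_runs io t u m :
  runs c_swap (std io (ser t ++ ser u ++ m)) (std io (ser u ++ ser t ++ m))
    (20 * (tsz t + tsz u) + 20).
Proof.
apply: (@runs_le _ _ _ (1 + (5 * tsz t + 2 + (1 + (5 * tsz u + 2 +
   (5 * size (rev (serb t)) + 1 + (5 * size (rev (serb u)) + 1 + (1 + 1)))))))); last first.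
  by rewrite !size_rev !size_serb; lia.
apply: runs_seq; first exact: runs_push.
apply: runs_seq => /=.
  by apply: (@move_tree_runs (fun m d c => [:: io; m; d; [::]; c])) => // *; apply: runs_push.
apply: runs_seq; first exact: runs_push.
apply: runs_seq => /=.
  by apply: (@move_tree_runs (fun m d c => [:: io; m; rev (ser t) ++ [:: mark]; d; c])) => // *; apply: runs_push.
rewrite !rev_ser; apply: runs_seq.
  apply: (@transfer_runs (fun s d => [:: io; d; s; _; [::]])) => // *.
  by apply: (@runs_le _ _ _ 1) => //; apply: runs_push.
apply: runs_seq.
  apply: (@transfer_runs (fun s d => [:: io; d; _; s; [::]])) => // *.
  by apply: (@runs_le _ _ _ 1) => //; apply: runs_push.
rewrite !revK -!ser_serb; apply: (@runs_seq _ _ _ _ _ 1 1); first exact: runs_pop.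
exact: runs_pop.
Qed.

(** * Polynomial-time functions on trees *)

Definition computes (c : cmd) (f : tree -> tree) (B : nat -> nat) :=
  forall x io m, runs c (std io (ser x ++ m)) (std io (ser (f x) ++ m)) (B (tsz x)).

Definition polyf (f : tree -> tree) :=
  exists c B, [/\ pb B, {homo B : m n / m <= n} & computes c f B].

(** The result cannot be larger than the argument plus the number of pushes. This is what makes time
    bounds compose. *)
Lemma computes_size c f B x : computes c f B -> tsz (f x) <= tsz x + B (tsz x).
Proof.
move=> h; have [T hT e] := h x [::] [::]; have := exec_size e 1.
by rewrite /get /= !size_cat /= !size_ser !addn0 => /leq_trans; apply; rewrite leq_add2l.
Qed.

Lemma homo_lin a b : {homo (fun n => a * n + b) : m n / m <= n}.
Proof. by move=> m n h; rewrite leq_add2r leq_mul2l h orbT. Qed.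

Lemma pb_lin a b : pb (fun n => a * n + b).
Proof.
by apply: pb_add (pb_const b); apply: pb_mul (pb_const a) pb_id.
Qed.

Lemma polyf_lin c f a b : computes c f (fun n => a * n + b) -> polyf f.
Proof.
by move=> h; exists c, (fun n => a * n + b); split=> //; [exact: pb_lin|exact: homo_lin].
Qed.

Lemma polyf_hd : polyf hd.
Proof. by apply: (@polyf_lin c_hd _ 20 20) => x io m; apply: c_hd_runs. Qed.

Lemma polyf_tl : polyf tl.
Proof. by apply: (@polyf_lin c_tl _ 10 20) => x io m; apply: c_tl_runs. Qed.

Lemma polyf_id : polyf id.
Proof.
apply: (@polyf_lin (Seq (Push jA mark) (Pop jA)) _ 0 2) => x io m.
by apply: (@runs_seq _ _ _ _ _ 1 1); [exact: runs_push|exact: runs_pop].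
Qed.

Lemma polyf_Lf : polyf (fun=> Lf).
Proof.
apply: (@polyf_lin (Seq c_drop (Push jM (inl false))) _ 10 11) => x io m.
apply: (@runs_le _ _ _ (10 * tsz x + 10 + 1)); last by lia.
by apply: runs_seq; [exact: c_drop_runs|exact: runs_push].
Qed.

Lemma homo_add (f g : nat -> nat) : {homo f : m n / m <= n} -> {homo g : m n / m <= n} ->
  {homo (fun n => f n + g n) : m n / m <= n}.
Proof. by move=> hf hg m n h; apply: leq_add; auto. Qed.

Lemma homo_comp (f g : nat -> nat) : {homo f : m n / m <= n} -> {homo g : m n / m <= n} ->
  {homo (fun n => f (g n)) : m n / m <= n}.
Proof. by move=> hf hg m n h; apply: hf; apply: hg. Qed.

Lemma polyf_comp f g : polyf f -> polyf g -> polyf (fun x => f (g x)).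
Proof.
move=> [cf [Bf [pf mf hf]]] [cg [Bg [pg mg hg]]].
exists (Seq cg cf), (fun n => Bg n + Bf (n + Bg n)); split.
- apply: pb_add => //; apply: (pb_comp (g := fun n => n + Bg n)) => //.
  exact: pb_add pb_id pg.
- by apply: homo_add => //; apply: (homo_comp (g := fun n => n + Bg n)) => //; apply: homo_add.
move=> x io m; apply: runs_seq (hg _ _ _) _; apply: runs_le (hf _ _ _) _.
by apply: mf; apply: computes_size hg.
Qed.

Lemma polyf_pair f g : polyf f -> polyf g -> polyf (fun x => Nd (f x) (g x)).
Proof.
move=> [cf [Bf [pf mf hf]]] [cg [Bg [pg mg hg]]].
exists (Seq c_dup (Seq cg (Seq c_swap (Seq cf (Push jM (inl true)))))).
exists (fun n => 20 * n + 20 + (Bg n + (20 * (n + Bg n + n) + 20 + (Bf n + 1)))); split.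
- have p1 := pb_add (pb_lin 20 20) pg.
  apply: pb_le (pb_add (pb_lin 20 20) (pb_add pg (pb_add (pb_add (pb_lin 40 20) (pb_mul (pb_const 20) pg))
    (pb_add pf (pb_const 1))))) => n; lia.
- by move=> m n h; have := mf _ _ h; have := mg _ _ h; lia.
move=> x io m; apply: runs_seq (c_dup_runs _ _ _) _; apply: runs_seq (hg _ _ _) _.
apply: runs_seq; first apply: runs_le (c_swap_runs _ _ _ _) _.
  by have := computes_size x hg; lia.
apply: runs_seq (hf _ _ _) _; apply: runs_push => /=; by rewrite -catA.
Qed.

Lemma polyf_if f g h : polyf f -> polyf g -> polyf h ->
  polyf (fun x => if isLf (f x) then g x else h x).
Proof.
move=> [cf [Bf [pf mf hf]]] [cg [Bg [pg mg hg]]] [ch [Bh [ph mh hh]]].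
exists (Seq c_dup (Seq cf (If jM isN (Seq c_drop ch) (Seq c_drop cg)))).
exists (fun n => 20 * n + 20 + (Bf n + (10 * (n + Bf n) + 10 + (Bg n + Bh n)).+1)); split.
- apply: pb_le (pb_add (pb_lin 20 20) (pb_add pf (pb_add (pb_add (pb_lin 10 11) (pb_mul (pb_const 10) pf))
    (pb_add pg ph)))) => n; lia.
- by move=> m n l; have := mf _ _ l; have := mg _ _ l; have := mh _ _ l; lia.
move=> x io m; apply: runs_seq (c_dup_runs _ _ _) _; apply: runs_seq (hf _ _ _) _.
apply: runs_if; have sz := computes_size x hf.
case E: (f x) sz => [|l r] sz /=.
  apply: (@runs_le _ _ _ (10 * 1 + 10 + Bg (tsz x))); last by have := tsz_gt0 x; lia.
  by apply: runs_seq (hg _ _ _); apply: (@c_drop_runs _ _ Lf).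
apply: (@runs_le _ _ _ (10 * tsz (Nd l r) + 10 + Bh (tsz x))); last by lia.
by apply: runs_seq (hh _ _ _); apply: (@c_drop_runs _ _ (Nd l r)).
Qed.

(** Iterates of a polynomial-time step may grow exponentially, so a bound on all intermediate sizes
    has to be assumed together with the bound on the number of rounds. The loop stops when the first
    component is a leaf. *)
Lemma polyf_loop F g p : polyf F -> pb p -> {homo p : m n / m <= n} ->
  (forall x, exists n, [/\ n <= p (tsz x), g x = iter n F x, isLf (hd (g x)),
     forall i, i < n -> ~~ isLf (hd (iter i F x)) &
     forall i, i <= n -> tsz (iter i F x) <= p (tsz x)]) ->
  polyf g.
Proof.
move=> [cF [BF [pF mF hF]]] pp mp H.
pose body := Seq c_drop (Seq cF (Seq c_dup c_hd)).
exists (Seq c_dup (Seq c_hd (Seq (While jM isN body) c_drop))).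
pose Q n := 10 * n + 10 + (BF n + (20 * n + 20 + (20 * n + 20))).
exists (fun n => 20 * n + 20 + (20 * n + 20 + (p n * (Q (p n)).+1 + 1 + (10 * p n + 10)))).
have mQ : {homo Q : m n / m <= n} by move=> m n h; rewrite /Q; have := mF _ _ h; lia.
have pQ : pb Q.
  apply: pb_le (pb_add (pb_lin 50 50) pF) => n; rewrite /Q; lia.
split.
- have pQ1 : pb (fun n => (Q n).+1) by apply: pb_le (pb_add pQ (pb_const 1)) => n; lia.
  have pQp : pb (fun n => (Q (p n)).+1).
    by apply: (pb_comp (f := fun n => (Q n).+1)) => // m n h; rewrite ltnS mQ.
  apply: pb_le (pb_add (pb_lin 40 40) (pb_add (pb_mul pp pQp) (pb_add (pb_const 11) (pb_mul (pb_const 10) pp)))) => n.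
  by lia.
- move=> m n h; have pl := mp _ _ h; have ql := mQ _ _ pl.
  have := leq_mul pl (ql : (Q (p m)).+1 <= (Q (p n)).+1); lia.
move=> x io m; have [n [np -> gl nl sz]] := H x.
apply: runs_seq (c_dup_runs _ _ _) _; apply: runs_seq (c_hd_runs _ _ _) _.
have loop : forall k y, k <= n -> y = iter (n - k) F x ->
   runs (While jM isN body) (std io (ser (hd y) ++ ser y ++ m))
     (std io (ser (hd (iter n F x)) ++ ser (iter n F x) ++ m)) (k * (Q (p (tsz x))).+1 + 1).
  elim=> [|k IH] y kn ey.
    rewrite ey subn0; apply: runs_done.
    by case: (hd _) gl.
  have kn' : n - k.+1 < n by lia.
  have ny := nl _ kn'; rewrite -ey in ny.
  have eF : F y = iter (n - k) F x.
    by rewrite ey; have -> : n - k = (n - k.+1).+1 by lia.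
  have := IH (F y) (ltnW kn) eF.
  have szy : tsz y <= p (tsz x) by rewrite ey; apply: sz; lia.
  have szF : tsz (F y) <= p (tsz x) by rewrite eF; apply: sz; lia.
  have szh : tsz (hd y) <= tsz y by case: (y) => //= l r; lia.
  have b1 : runs body (std io (ser (hd y) ++ ser y ++ m))
      (std io (ser (hd (F y)) ++ ser (F y) ++ m)) (Q (p (tsz x))).
    apply: (@runs_le _ _ _ (10 * tsz (hd y) + 10 + (BF (tsz y) + (20 * tsz (F y) + 20 + (20 * tsz (F y) + 20))))); last first.
      by rewrite /Q; have := mF _ _ szy; lia.
    apply: runs_seq; first exact: c_drop_runs.
    apply: runs_seq (hF _ _ _) _.
    by apply: runs_seq (c_dup_runs _ _ _) (c_hd_runs _ _ _).
  move=> r; have := runs_loop _ b1 r; rewrite /top /get /=.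
  case: (hd y) ny => //= l r' _ /(_ isT) /runs_le; apply; rewrite mulSn; lia.
have := loop n x (leqnn _); rewrite subnn => /(_ erefl) r0.
apply: runs_seq; first by apply: runs_le r0 _; rewrite leq_add2r leq_mul.
have szg : tsz (hd (iter n F x)) <= p (tsz x).
  by apply: leq_trans (sz _ (leqnn n)); case: (iter n F x) => //= l r; lia.
apply: runs_le; first exact: c_drop_runs.
by lia.
Qed.

(** * Bit strings as trees, and the passage from tree functions to machines *)

Definition cb (b : bool) : tree := if b then Nd Lf Lf else Lf.
Definition clist (l : seq tree) : tree := foldr Nd Lf l.
Definition cbits (w : seq bool) : tree := clist (map cb w).

Lemma tsz_cbits w : tsz (cbits w) <= 4 * size w + 1.
Proof. by elim: w => //= b w IH; case: b => /=; rewrite /cbits in IH *; lia. Qed.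

(** The top of the input stack is the last bit, and codes are pushed back to front, so prepending
    the bits in the order of their arrival rebuilds the word. *)
Definition c_read : cmd :=
  Seq (Push jM (inl false)) (While jIO isSome
    (Seq (If jIO isN (Seq (Push jM (inl false)) (Seq (Push jM (inl false)) (Push jM (inl true))))
            (Push jM (inl false)))
       (Seq (Push jM (inl true)) (Pop jIO)))).

Lemma read_loop_runs u v m :
  runs (While jIO isSome
    (Seq (If jIO isN (Seq (Push jM (inl false)) (Seq (Push jM (inl false)) (Push jM (inl true))))
            (Push jM (inl false)))
       (Seq (Push jM (inl true)) (Pop jIO))))
    (std (rev (map inl u)) (ser (cbits v) ++ m)) (std [::] (ser (cbits (u ++ v)) ++ m))
    (7 * size u + 1).
Proof.
elim/last_ind: u v => [|u b IH] v; first exact: runs_done.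
rewrite map_rcons rev_rcons size_rcons cat_rcons.
apply: (@runs_le _ _ _ (4 + (1 + 1) + (7 * size u + 1)).+1); last by lia.
apply: runs_loop (IH (b :: v)) => //.
apply: (@runs_seq _ _ _ (std (inl b :: rev (map inl u)) (ser (cb b) ++ ser (cbits v) ++ m)) _ 4 2).
  apply: runs_if; case: b => /=; last by apply: (@runs_le _ _ _ 1) => //; apply: runs_push.
  do 2 (apply: (@runs_seq _ _ _ _ _ 1 _); first exact: runs_push).
  exact: runs_push.
apply: (@runs_seq _ _ _ _ _ 1 1); first exact: runs_push.
by apply: runs_pop; rewrite /= catA.
Qed.

Lemma c_read_runs w m :
  runs c_read (std (rev (map inl w)) m) (std [::] (ser (cbits w) ++ m)) (7 * size w + 2).
Proof.
have := read_loop_runs w [::] m; rewrite cats0 => r.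
by apply: runs_le (runs_seq (runs_push _) r) _; last lia.
Qed.

Definition c_write : cmd :=
  While jM isN (Seq (Pop jM) (If jM isN
    (Seq (Pop jM) (Seq (Pop jM) (Seq (Pop jM) (Push jIO (inl true)))))
    (Seq (Pop jM) (Push jIO (inl false))))).

Lemma c_write_runs u io m :
  runs c_write (std io (ser (cbits u) ++ m)) (std (rev (map inl u) ++ io) (inl false :: m))
    (7 * size u + 1).
Proof.
elim: u io => [|b u IH] io; first exact: runs_done.
rewrite map_cons rev_cons cat_rcons.
apply: (@runs_le _ _ _ (1 + 5 + (7 * size u + 1)).+1); last by rewrite /=; lia.
apply: runs_loop (IH (inl b :: io)) => //.
apply: runs_seq; first exact: runs_pop.
apply: runs_if; case: b => /=.
  do 3 (apply: (@runs_seq _ _ _ _ _ 1 _); first exact: runs_pop).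
  exact: runs_push.
apply: (@runs_le _ _ _ 2) => //; apply: (@runs_seq _ _ _ _ _ 1 1); first exact: runs_pop.
exact: runs_push.
Qed.

Lemma program_run (c : cmd) (w : seq bool) H T s' :
  exec (fun h => h <= H) c (std (rev (map inl w)) [::]) T s' -> size w < H ->
  exists n t', [/\ n <= 2 * T + 2 * H + 10,
    reach (5 * (H + 2)) n (tm_init (stack_tm (compile c 0 (clen c))) w)
     (cfg (at_end _ true (top s' 0 == Some (inl true))) t') &
    forall u : seq bool, get s' 0 = rev (map inl u) -> tape_word (t' ord0) = map inl u].
Proof.
move=> e hw; set code := compile c 0 (clen c).
have hs : hok H (std (rev (map inl w)) [::]).
  by case=> [|[|[|[|[|j]]]]]; rewrite /get /= ?size_rev ?size_map ?nth_nil //=; lia.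
have [|mr hs'] := exec_mruns e hs (code := code) (pc := 0) (nx := clen c).
  by exists [::], [::]; rewrite cats0.
rewrite -(size_compile c 0 (clen c)) -/code in mr.
exact: stack_tm_run mr hw hs'.
Qed.

Lemma pb_poly B : pb B -> exists c k, forall n, B n <= c * n ^ k + c.
Proof.
case=> k hk; have [c hc] := pb_pow_le k; exists c, k => n.
exact: leq_trans (hk n) (hc n).
Qed.

Theorem polytime_of_polyf f g : polyf f -> (forall w, f (cbits w) = cbits (g w)) -> polytime g.
Proof.
move=> [cf [B [pB mB hB]]] hf.
pose c := Seq c_read (Seq cf c_write).
pose B1 n := B (4 * n + 1).
pose T n := 7 * n + 2 + (B1 n + (7 * (4 * n + 1 + B1 n) + 1)).
have pB1 : pb B1 by apply: pb_comp => //; apply: pb_lin.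
have pT : pb (fun n => 4 * T n + 2 * n + 20).
  apply: pb_le (pb_add (pb_lin 142 64) (pb_mul (pb_const 32) pB1)) => n; rewrite /T; lia.
have [a [k hk]] := pb_poly pT.
exists (stack_tm (compile c 0 (clen c))), a, k => w.
have szf : size (g w) <= 4 * size w + 1 + B1 (size w).
  have sg : size (g w) <= tsz (cbits (g w)).
    by elim: (g w) => //= b v; rewrite /cbits /=; lia.
  apply: leq_trans sg _; rewrite -hf.
  have le := tsz_cbits w.
  by apply: leq_trans (computes_size _ hB) _; apply: leq_add => //; apply: mB.
have r : runs c (std (rev (map inl w)) [::]) (std (rev (map inl (g w))) [:: inl false]) (T (size w)).
  apply: runs_seq (c_read_runs _ _) _.
  apply: runs_seq; first by apply: runs_le (hB _ _ _) _; apply: mB; apply: tsz_cbits.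
  rewrite hf; have := c_write_runs (g w) [::] [::]; rewrite !cats0 => /runs_le; apply.
  lia.
case: r => t ht e.
have {}e : exec (fun h => h <= size w + 1 + t) c (std (rev (map inl w)) [::]) t (std (rev (map inl (g w))) [:: inl false]).
  by apply: exec_heights e _ => -[|[|[|[|[|j]]]]]; rewrite /get /= ?size_rev ?size_map ?nth_nil //=; lia.
have [|n [t' [hn [rn _] hw]]] := program_run e; first by lia.
exists n; split.
- by apply: leq_trans (hk _); lia.
- by rewrite /tm_run rn.
- by rewrite /tm_run rn; apply: hw.
Qed.

Lemma runs_exec c s s' B H : runs c s s' B -> (forall j, size (get s j) + B <= H) ->
  exists T, exec (fun h => h <= H) c s T s'.
Proof.
case=> T hT e h; exists T; apply: exec_heights e _ => j.
by apply: leq_trans (h j); rewrite leq_add2l.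
Qed.

Lemma std_height m B H : size m + B <= H -> forall j, size (get (std [::] m) j) + B <= H.
Proof. by move=> h [|[|[|[|[|j]]]]]; rewrite /get /= ?nth_nil //=; lia. Qed.

(** The number of rounds is unrestricted, only the sizes of the iterates are bounded. Each round
    gets its own height bound, from its initial height and its running time, and the loop adds
    nothing to it. *)
Theorem PSPACE_of_step (L : language) init step p : polyf init -> polyf step -> pb p ->
  (forall w, exists n b, let x i := iter i step (init (cbits w)) in
    [/\ (forall i, i < n -> ~~ isLf (hd (x i))), x n = Nd Lf (cb b),
        (forall i, i <= n -> tsz (x i) <= p (size w)) & b <-> L w]) ->
  PSPACE L.
Proof.
move=> [ci [Bi [pi mi hi]]] [cs [Bs [ps ms hs]]] pp HL.
pose body := Seq c_drop (Seq cs (Seq c_dup c_hd)).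
pose fin := Seq c_drop (Seq c_tl (If jM isN (Push jIO (inl true)) (Push jIO (inl false)))).
pose c := Seq c_read (Seq ci (Seq c_dup (Seq c_hd (Seq (While jM isN body) fin)))).
(* Room for the initial height plus the running time of each piece: reading, [init], one round of
   the loop, and the final test. *)
pose H n := 100 * p n + 100 + Bs (p n) + (100 * n + 100) + Bi (4 * n + 1).
have pH : pb (fun n => 5 * (H n + 2)).
  have p1 : pb (fun n => Bs (p n)) by apply: pb_comp.
  have p2 : pb (fun n => Bi (4 * n + 1)) by apply: pb_comp => //; apply: pb_lin.
  apply: pb_le (pb_add (pb_lin 500 1200) (pb_mul (pb_const 500) (pb_add pp (pb_add p1 p2)))) => n.
  by rewrite /H; lia.
have [a [k hk]] := pb_poly pH.
exists (stack_tm (compile c 0 (clen c))), a, k => w.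
have [n [b [nl xn sz hb]]] := HL w.
pose x i := iter i step (init (cbits w)).
have {}xn : x n = Nd Lf (cb b) := xn.
have {}nl i : i < n -> ~~ isLf (hd (x i)) := nl i.
have {}sz i : i <= n -> tsz (x i) <= p (size w) := sz i.
set K := H (size w).
have szi : tsz (cbits w) <= 4 * size w + 1 by apply: tsz_cbits.
have loop i y : i <= n -> y = x (n - i) ->
  exists T, exec (fun h => h <= K) (While jM isN body) (std [::] (ser (hd y) ++ ser y))
     T (std [::] (ser (hd (x n)) ++ ser (x n))).
  elim: i y => [|i IH] y le ->.
    by rewrite subn0 xn; exists 1; apply: XDone.
  set y0 := x _.
  have lt : n - i.+1 < n by lia.
  have ny := nl _ lt; rewrite -/y0 in ny.
  have [|T2 e2] := IH (step y0) (ltnW le).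
    by rewrite /y0 /x; have -> : n - i = (n - i.+1).+1 by lia.
  have s0 : tsz y0 <= p (size w) by apply: sz; lia.
  have s1 : tsz (step y0) <= p (size w).
    by have := sz (n - i.+1).+1; rewrite /x /= -/y0; apply; lia.
  have sh : tsz (hd y0) <= tsz y0 by case: (y0) => //= l r; lia.
  have [T1 e1] : exists T, exec (fun h => h <= K) body (std [::] (ser (hd y0) ++ ser y0)) T
      (std [::] (ser (hd (step y0)) ++ ser (step y0))).
    apply: (@runs_exec _ _ _ (10 * tsz (hd y0) + 10 + (Bs (tsz y0) + (20 * tsz (step y0) + 20 + (20 * tsz (step y0) + 20))))).
      apply: runs_seq; first exact: c_drop_runs.
      have := hs y0 [::] [::]; rewrite !cats0 => r; apply: runs_seq r _.
      have := c_dup_runs [::] (step y0) [::]; rewrite !cats0 => r; apply: runs_seq r _.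
      exact: c_hd_runs.
    apply: std_height; rewrite size_cat !size_ser.
    by have := ms _ _ s0; rewrite /K /H; lia.
  exists (T1 + T2).+1; apply: XLoop e1 e2.
  by rewrite /top /get /=; case: (hd y0) ny.
have [T e] : exists T, exec (fun h => h <= K) c (std (rev (map inl w)) [::]) T
    (std [:: inl b] (ser (cb b))).
  have sz0 : tsz (x 0) <= p (size w) by apply: sz.
  have [|T1 e1] := runs_exec (H := K) (c_read_runs w [::]).
    by case=> [|[|[|[|[|j]]]]]; rewrite /get /= ?size_rev ?size_map ?nth_nil //= /K /H; lia.
  have r2 := hi (cbits w) [::] [::]; rewrite !cats0 in e1 r2.
  have [|T2 e2] := runs_exec (H := K) r2.
    by apply: std_height; rewrite size_ser; have := mi _ _ szi; rewrite /K /H; lia.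
  have r3 := c_dup_runs [::] (x 0) [::]; rewrite !cats0 in r3.
  have [|T3 e3] := runs_exec (H := K) r3.
    by apply: std_height; rewrite size_ser /K /H; lia.
  have [|T4 e4] := runs_exec (H := K) (c_hd_runs [::] (x 0) (ser (x 0))).
    by apply: std_height; rewrite size_cat !size_ser /K /H; lia.
  have [|T5 e5] := loop n (x 0) (leqnn _); first by rewrite subnn.
  have szn := sz n (leqnn _).
  rewrite xn /= in e5 szn.
  have r6 : runs fin (std [::] (ser Lf ++ ser (Nd Lf (cb b)) ++ [::])) (std [:: inl b] (ser (cb b))) 200.
    apply: (@runs_le _ _ _ (10 * 1 + 10 + (10 * tsz (Nd Lf (cb b)) + 20 + 2))); last by case: (b).
    apply: runs_seq; first exact: c_drop_runs.
    apply: runs_seq; first exact: c_tl_runs.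
    by apply: runs_if; case: (b) => /=; apply: runs_push.
  have [T6 e6] : exists T, exec (fun h => h <= K) fin (std [::] (inl false :: inl true :: inl false :: ser (cb b))) T (std [:: inl b] (ser (cb b))).
    rewrite /= cats0 in r6; apply: (runs_exec r6); apply: std_height.
    by rewrite /= size_ser; case: (b); rewrite /= /K /H; lia.
  exists (T1 + (T2 + (T3 + (T4 + (T5 + T6))))).
  by apply: XSeq e1 _; apply: XSeq e2 _; apply: XSeq e3 _; apply: XSeq e4 _; apply: XSeq e5 e6.
have [|m [t' [_ rm _]]] := program_run e; first by rewrite /K /H; lia.
have eb : (top (std [:: inl b] (ser (cb b))) 0 == Some (inl true)) = b by case: (b).
rewrite eb in rm.
split.
  exists m; eexists; split; last exact: hb.
  by rewrite /tm_run; case: rm => -> _.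
move=> i; apply: leq_trans (hk _); apply: reach_space rm i; by [].
Qed.

(** * A recursive machine with if-then-else calls *)

Fixpoint cnat (n : nat) : tree := if n is m.+1 then Nd Lf (cnat m) else Lf.

(** The first component is a unary tag: 0 for true, 1 for false, 2 for a conditional, and f + 3 for
    a call of procedure f. *)
Definition eT : tree := Nd Lf Lf.
Definition eF : tree := Nd (Nd Lf Lf) Lf.
Definition eIte (a b c : tree) : tree := Nd (Nd Lf (Nd Lf Lf)) (Nd a (Nd b c)).
Definition eCall (f : nat) (a : tree) : tree := Nd (Nd Lf (Nd Lf (Nd Lf (cnat f)))) a.

Lemma polyf_hdc f : polyf f -> polyf (fun x => hd (f x)).
Proof. exact: polyf_comp polyf_hd. Qed.

Lemma polyf_tlc f : polyf f -> polyf (fun x => tl (f x)).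
Proof. exact: polyf_comp polyf_tl. Qed.

Ltac polyf_auto := repeat lazymatch goal with
  | |- polyf (fun x => x) => exact polyf_id
  | |- polyf hd => exact polyf_hd
  | |- polyf tl => exact polyf_tl
  | |- polyf (fun x => Lf) => exact polyf_Lf
  | |- polyf (fun x => Nd _ _) => apply polyf_pair
  | |- polyf (fun x => hd _) => apply polyf_hdc
  | |- polyf (fun x => tl _) => apply polyf_tlc
  | |- polyf (fun x => if isLf _ then _ else _) => apply polyf_if
  end.

Section Calls.
Variable bodies : seq (tree -> tree).

Fixpoint dispatch (bs : seq (tree -> tree)) (t a : tree) : tree :=
  if bs is b :: bs' then if isLf t then b a else dispatch bs' (tl t) a else eF.

(* A running state is a current expression with a list of pending branch pairs. *)
Definition rst (e fr : tree) : tree := Nd (Nd e fr) Lf.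

(** Only a conditional leaves something pending, its two branches; a call is replaced by the body
    and leaves no return frame. Thus the space depends on the nesting of tests and not on the number
    of calls. A leaf as first component stops the outer loop, with the answer behind it. *)
Definition rstep (x : tree) : tree :=
  if isLf (hd (hd (hd x))) then
    if isLf (tl (hd x)) then Nd Lf (Nd Lf Lf)
    else Nd (Nd (hd (hd (tl (hd x)))) (tl (tl (hd x)))) Lf
  else if isLf (tl (hd (hd (hd x)))) then
    if isLf (tl (hd x)) then Nd Lf Lf
    else Nd (Nd (tl (hd (tl (hd x)))) (tl (tl (hd x)))) Lf
  else if isLf (tl (tl (hd (hd (hd x))))) then
    Nd (Nd (hd (tl (hd (hd x)))) (Nd (tl (tl (hd (hd x)))) (tl (hd x)))) Lf
  else Nd (Nd (dispatch bodies (tl (tl (tl (hd (hd (hd x)))))) (tl (hd (hd x)))) (tl (hd x))) Lf.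

Inductive all_polyf : seq (tree -> tree) -> Prop :=
  | APnil : all_polyf [::]
  | APcons f fs : polyf f -> all_polyf fs -> all_polyf (f :: fs).

Lemma polyf_dispatch bs f g : all_polyf bs -> polyf f -> polyf g ->
  polyf (fun x => dispatch bs (f x) (g x)).
Proof.
move=> h; elim: h f => [|b bs' pb' _ IH] f pf pg /=; first by rewrite /eF; polyf_auto.
apply: polyf_if => //; first exact: (polyf_comp (f := b)).
exact: IH (polyf_tlc pf) pg.
Qed.

Lemma polyf_rstep : all_polyf bodies -> polyf rstep.
Proof.
move=> h; rewrite /rstep; polyf_auto.
by apply: polyf_dispatch => //; polyf_auto.
Qed.

Definition body (f : nat) : tree -> tree := nth (fun=> eF) bodies f.

Lemma dispatch_body f a : dispatch bodies (cnat f) a = body f a.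
Proof. by rewrite /body; elim: bodies f => [|b bs IH] [|f] //=. Qed.

(* [ev S d e b]: [e] has value [b], all expressions met have size at most [S],
   and at most [d] branch pairs are pending at any time; the branches
   themselves are tail calls. *)
Inductive ev (S : nat) : nat -> tree -> bool -> Prop :=
  | EvT d : ev S d eT true
  | EvF d : ev S d eF false
  | EvIte d e0 e1 e2 b0 b : tsz (eIte e0 e1 e2) <= S -> ev S d e0 b0 ->
      ev S d.+1 (if b0 then e1 else e2) b -> ev S d.+1 (eIte e0 e1 e2) b
  | EvCall d f a b : tsz (eCall f a) <= S -> ev S d (body f a) b -> ev S d (eCall f a) b.

Definition returned (b : bool) (fr : tree) : tree :=
  if isLf fr then Nd Lf (cb b) else rst ((if b then hd else tl) (hd fr)) (tl fr).

(** Each of the at most [d] pending pairs is part of an expression of size at most [S], and one more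
    [S] is for the current expression. *)
Lemma ev_run S d e b : ev S d e b -> 5 <= S -> forall fr, exists n,
  [/\ iter n rstep (rst e fr) = returned b fr,
   forall i, i < n -> ~~ isLf (hd (iter i rstep (rst e fr))) &
   forall i, i < n -> tsz (iter i rstep (rst e fr)) <= tsz fr + d.+1 * S + 5].
Proof.
move=> h S5; elim: h => {d e b} [d|d|d e0 e1 e2 b0 b sz _ IH0 _ IH|d f a b sz _ IH] fr.
- by exists 1; split=> [||[|i] //= _]; [case: fr|case|lia].
- by exists 1; split=> [||[|i] //= _]; [case: fr|case|lia].
- have [n0 [r0 l0 s0]] := IH0 (Nd (Nd e1 e2) fr).
  have [n1 [r1 l1 s1]] := IH fr.
  have e1' : rstep (rst (eIte e0 e1 e2) fr) = rst e0 (Nd (Nd e1 e2) fr) by [].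
  have e2' : returned b0 (Nd (Nd e1 e2) fr) = rst (if b0 then e1 else e2) fr by case: (b0).
  have it i : i >= n0.+1 -> iter i rstep (rst (eIte e0 e1 e2) fr) =
      iter (i - n0.+1) rstep (rst (if b0 then e1 else e2) fr).
    by move=> le; rewrite -{1}(subnK le) iterD iterSr e1' r0 e2'.
  exists (n1 + n0.+1); split.
  + by rewrite it ?addnK // leq_addl.
  + move=> i lt; case: (leqP n0.+1 i) => le; first by rewrite it //; apply: l1; lia.
    by case: i le {lt} => // i le; rewrite iterSr e1'; apply: l0.
  + move=> i lt; case: (leqP n0.+1 i) => le; first by rewrite it //; apply: s1; lia.
    case: i le {lt} => [_|i le]; first by move: sz => /=; lia.
    rewrite iterSr e1'; apply: leq_trans (s0 _ le) _; move: sz => /=; lia.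
- have [n1 [r1 l1 s1]] := IH fr.
  have e1' : rstep (rst (eCall f a) fr) = rst (body f a) fr.
    by rewrite /rstep /= dispatch_body.
  exists n1.+1; split=> [|[|i] lt|[|i] lt] //; rewrite ?iterSr ?e1' //.
  + exact: l1.
  + by move: sz => /=; lia.
  + exact: s1.
Qed.

Theorem PSPACE_of_ev (L : language) init pS pd : all_polyf bodies -> polyf init ->
  pb pS -> pb pd ->
  (forall w, exists2 b, ev (pS (size w)) (pd (size w)) (init (cbits w)) b & b <-> L w) ->
  PSPACE L.
Proof.
move=> hb hi hS hd' H.
pose p n := (pd n).+1 * (pS n + 5) + 10.
apply: (@PSPACE_of_step _ (fun x => rst (init x) Lf) rstep p).
- by apply: polyf_pair polyf_Lf; apply: polyf_pair polyf_Lf.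
- exact: polyf_rstep.
- apply: pb_le (pb_add (pb_mul (pb_add hd' (pb_const 1)) (pb_add hS (pb_const 5))) (pb_const 10)) => n.
  by rewrite /p; lia.
move=> w; have [b hev hL] := H w.
(* The values [eT] and [eF] are themselves current expressions; 5 is the size of [eF]. *)
have hev' : ev (pS (size w) + 5) (pd (size w)) (init (cbits w)) b.
  elim: hev => {b hL} [d|d|d e0 e1 e2 b0 b sz _ IH0 _ IH|d f a b sz _ IH].
  - exact: EvT.
  - exact: EvF.
  - by apply: EvIte IH0 IH; lia.
  - by apply: EvCall IH; lia.
have [|n [r l s]] := ev_run hev' _ Lf; first by lia.
exists n, b; split=> // i; rewrite leq_eqVlt => /orP[/eqP ->|/s le].
  by rewrite r /p; case: (b) => /=; lia.
by apply: leq_trans le _; rewrite /p /=; lia.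
Qed.
End Calls.

(** * Valuations and substitutions *)

Notation valu := (atom -> bool).

Fixpoint bsatp (v : valu) (b : bform) : bool :=
  match b with
  | BTop => true
  | BBot => false
  | BAtom p => v p
  | BNeg c => ~~ bsatp v c
  | BAnd c d => bsatp v c && bsatp v d
  end.

Lemma bsatE s b : bsat s b = bsatp (fun p => p \in s) b.
Proof. by elim: b => //= [b ->|b -> c ->]. Qed.

Lemma bsatp_subst v f b : bsatp v (bsubst f b) = bsatp (fun p => bsatp v (f p)) b.
Proof. by elim: b => //= [b ->|b -> c ->]. Qed.

Lemma bsatp_over W (v v' : valu) b : bover W b -> {in W, v =1 v'} -> bsatp v b = bsatp v' b.
Proof.
move=> h e; elim: b h => //= [b IH|b IHb c IHc].
  by move=> /IH ->.
by case/andP=> /IHb -> /IHc ->.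
Qed.

Lemma bsatp_ext (v v' : valu) b : v =1 v' -> bsatp v b = bsatp v' b.
Proof. by move=> e; elim: b => //= [b ->|b -> c ->]. Qed.

Lemma bsatp_imp v b c : bsatp v (bimp b c) = (bsatp v b ==> bsatp v c).
Proof. by rewrite /= negbK; case: (bsatp v b); case: (bsatp v c). Qed.

Lemma bsatp_bands_iff v (I : Type) (f g : I -> bform) s :
  bsatp v (bands [seq biff (f q) (g q) | q <- s]) = all (fun q => bsatp v (f q) == bsatp v (g q)) s.
Proof. by elim: s => // q s /= ->; rewrite !negbK; case: (bsatp v (f q)); case: (bsatp v (g q)). Qed.

Lemma bover_subst (W W' : seq atom) (f : atom -> bform) b : bover W b -> (forall p, p \in W -> bover W' (f p)) ->
  bover W' (bsubst f b).
Proof.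
by move=> + h; elim: b => //= [b IHb c IHc /andP[/IHb -> /IHc ->]].
Qed.

Lemma bover_bands W bs : bover W (bands bs) = all (bover W) bs.
Proof. by elim: bs => //= b bs ->. Qed.

Lemma bover_sub (W W' : seq atom) b : bover W b -> {subset W <= W'} -> bover W' b.
Proof. by move=> + h; elim: b => //= [b IHb c IHc /andP[/IHb -> /IHc ->]]. Qed.

Lemma bover_and W b c : bover W (BAnd b c) = bover W b && bover W c.
Proof. by []. Qed.

Lemma bover_imp W b c : bover W (bimp b c) = bover W b && bover W c.
Proof. by []. Qed.

Definition ovr (W : seq atom) (t v : valu) : valu := fun p => if p \in W then t p else v p.

Lemma bsatp_bset v x W b : bsatp v (bset x W b) = bsatp (ovr W (fun p => p \in x) v) b.
Proof.
rewrite bsatp_subst; apply: bsatp_ext => p; rewrite /ovr.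
by case: ifP => // _; case: ifP.
Qed.

Lemma bsatp_ball v W b :
  bsatp v (ball W b) <-> forall t : valu, bsatp (ovr W t v) b.
Proof.
elim: W v => [|p W IH] v /=; first by split=> [h t|]; [|by apply].
rewrite !bsatp_bset; split.
- case/andP=> h1 h2 t.
  have {h1 h2} : bsatp (ovr [:: p] (fun=> t p) v) (ball W b).
    case: (t p).
      by rewrite -(bsatp_ext (v := ovr [:: p] (fun q => q \in [:: p]) v)) // => q; rewrite /ovr; case: ifP.
    by rewrite -(bsatp_ext (v := ovr [:: p] (fun q => q \in [::]) v)) // => q; rewrite /ovr; case: ifP.
  move/IH/(_ t); rewrite (bsatp_ext (v' := ovr (p :: W) t v)) // => q.
  by rewrite /ovr !inE; case: (q \in W); rewrite ?orbT ?orbF //; case: eqP => [->|].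
- move=> h; apply/andP; split; apply/IH => t.
    have := h (ovr W t (fun=> true)); rewrite (bsatp_ext (v' := ovr W t (ovr [:: p] (fun q => q \in [:: p]) v))) // => q.
    by rewrite /ovr !inE; case: (q \in W); rewrite ?orbT ?orbF //; case: eqP.
  have := h (ovr W t (fun=> false)); rewrite (bsatp_ext (v' := ovr W t (ovr [:: p] (fun q => q \in [::]) v))) // => q.
  by rewrite /ovr !inE; case: (q \in W); rewrite ?orbT ?orbF //; case: eqP.
Qed.

Lemma bover_ball W U b : bover (W ++ U) b -> bover U (ball W b).
Proof.
elim: W U => [//|q W IH] U hb.
have {}hb : bover (q :: U) (ball W b).
  by apply: IH; apply: bover_sub hb _ => p; rewrite !(inE, mem_cat) => /or3P[->|->|->]; rewrite ?orbT.
apply/andP; split; apply: bover_subst hb _ => p; rewrite !inE;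
  by case: eqP.
Qed.

Lemma bsatp_bcopy v W g b :
  bsatp v (bcopy W g b) = bsatp (fun p => v (if p \in W then g p else p)) b.
Proof. by rewrite bsatp_subst. Qed.

Lemma t_change_notin (A : finType) form (X : transformer_of A form) p :
  p \notin t_changed X -> t_change X p = BAtom p.
Proof.
move=> h; rewrite /t_change nth_default //.
by rewrite /unzip2 size_map; move: h; rewrite -index_mem -leqNgt /t_changed size_map.
Qed.

Lemma t_change_mem (A : finType) form (X : transformer_of A form) p :
  p \in t_changed X -> exists2 q, q \in t_post X & t_change X p = q.2.
Proof.
move=> h; have lt : index p (t_changed X) < size (t_post X).
  by rewrite -(size_map fst) index_mem.
exists (nth (p, BTop) (t_post X) (index p (t_changed X))); first exact: mem_nth.
by rewrite /t_change (nth_map (p, BTop)).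
Qed.

Lemma uncopy_notin (W : seq atom) (g : atom -> atom) q : q \notin map g W -> nth q W (index q (map g W)) = q.
Proof.
move=> h; rewrite nth_default //; move: h; rewrite -index_mem -leqNgt size_map //.
Qed.

Lemma uncopy_mem (W : seq atom) k q : q \in W -> nth (Circ k q) W (index (Circ k q) (map (Circ k) W)) = q.
Proof.
move=> h; rewrite index_map; first by apply: nth_index.
by move=> a b [].
Qed.

(** * Well-formed structures and transformers *)

Section Wf.
Variable A : finType.
Implicit Types (X : transformer A) (F : bstruct A) (phi : dform A).

Definition is_prime (p : atom) := if p is Prime _ then true else false.

Definition pok (V P : seq atom) := all is_name P && all (fun p => p \notin V) P.

(** Parameters may enter the law, through the translated preconditions of updates, but never the
    observation formulas. *)
Definition fok (V P : seq atom) F :=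
  [/\ b_voc F = V, bover (V ++ P) (b_law F) &
      forall i, bover (V ++ map Prime V) (b_obs F i)].

Definition nonprime (V : seq atom) := {in V, forall p, ~~ is_prime p}.

Definition xok (V P : seq atom) X :=
  [/\ uniq (t_voc X) /\ all is_name (t_voc X), ~~ has (mem (V ++ P)) (t_voc X),
      dwf V (P ++ t_voc X) (t_pre X),
      uniq (t_changed X) /\ {subset t_changed X <= V} &
      (forall q, q \in t_post X -> bover (V ++ t_voc X ++ P) q.2) /\
      forall i, {subset t_obs X i <= t_voc X}].

Lemma dwf_updP V P X x phi : reflect
  ([/\ xok V P X, forall i, uniq (t_obs X i), uniq x, {subset x <= t_voc X} & dwf (upd_voc V X) P phi])
  (dwf V P (DUpd X x phi)).
Proof.
apply: (iffP idP) => /=.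
  case/and5P=> a1 a2 a3 a4 /and5P[a5 /allP a6 /allP a7 /forallP a8 /and3P[a9 /allP a10 a11]].
  split=> //; first split=> //.
  - by split=> // i; have /andP[_ /allP] := a8 i.
  - by move=> i; have /andP[] := a8 i.
case=> [[[a1 a2] a3 a4 [a5 a6] [a7 a8]] u9 a9 a10 a11].
apply/and5P; split=> //; apply/and5P; split=> //.
- exact/allP.
- exact/allP.
- by apply/forallP => i; rewrite u9 /=; apply/allP/a8.
- by apply/and3P; split=> //; apply/allP.
Qed.

Lemma name_nonprime (p : atom) : is_name p -> ~~ is_prime p. Proof. by case: p. Qed.

Lemma pok_name V P p : pok V P -> p \in P -> is_name p.
Proof. by case/andP=> /allP h _ /h. Qed.

Lemma pok_notin V P p : pok V P -> p \in P -> p \notin V.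
Proof. by case/andP=> _ /allP h /h. Qed.

Section Xok.
Variables (V P : seq atom) (X : transformer A).
Hypothesis hx : xok V P X.

Lemma xok_notin p : p \in t_voc X -> (p \notin V) * (p \notin P) * is_name p.
Proof.
case: hx => [[_ /allP n] /hasPn d _ _ _] h; rewrite n //.
by have := d _ h; rewrite /= mem_cat negb_or => /andP[-> ->].
Qed.

Lemma xok_changed p : p \in t_changed X -> p \in V.
Proof. by case: hx => _ _ _ [_ h] _ /h. Qed.

Lemma xok_change p : p \in t_changed X -> bover (V ++ t_voc X ++ P) (t_change X p).
Proof. by case/t_change_mem=> q qX ->; case: hx => _ _ _ _ [h _]; apply: h. Qed.

Lemma fresh_notin p : Circ (fresh_stamp (V ++ t_voc X)) p \notin V.
Proof. by have := circ_fresh (V ++ t_voc X) p; rewrite mem_cat negb_or => /andP[]. Qed.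
End Xok.

Lemma mem_upd_voc V X p : (p \in upd_voc V X) =
  [|| p \in V, p \in t_voc X | p \in map (Circ (fresh_stamp (V ++ t_voc X))) (t_changed X)].
Proof. by rewrite !mem_cat. Qed.

Lemma upd_nonprime V P X : xok V P X -> nonprime V -> nonprime (upd_voc V X).
Proof.
move=> hx n p; rewrite mem_upd_voc => /or3P[/n //|/(xok_notin hx)[_]|/mapP[q _ ->]] //.
by apply: name_nonprime.
Qed.

Lemma upd_pok V P X : xok V P X -> pok V P -> pok (upd_voc V X) P.
Proof.
move=> hx hp; apply/andP; split; first by case/andP: hp.
apply/allP => p pP; rewrite mem_upd_voc !negb_or (pok_notin hp pP) /=.
apply/andP; split; first by apply/negP => /(xok_notin hx)[[_ /negP]].
by apply/mapP => -[q _ e]; have := pok_name hp pP; rewrite e.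
Qed.

Lemma pok_cat V P X : xok V P X -> pok V P -> pok V (P ++ t_voc X).
Proof.
move=> hx /andP[h1 h2]; rewrite /pok !all_cat h1 h2 /=; apply/andP.
by split; apply/allP => p /(xok_notin hx)[[]].
Qed.

Lemma dwf_dset V P P' phi x W : dwf V P phi -> {subset P' <= P} ->
  (forall p, p \in P -> p \in P' \/ p \in W) -> dwf V P' (dset x W phi).
Proof.
elim/dform_nested_ind: phi V P P' => [||p|phi IH|phi psi IH IH'|i phi IH|X y phi IH IH'] V P P'.
- by [].
- by [].
- move=> /= + s h; case: ifP => [_|n]; first by case: ifP.
  by rewrite /= !mem_cat => /orP[->//|/h]; rewrite n => -[->|//]; rewrite orbT.
- exact: IH.
- by move=> /= /andP[a b] s h; rewrite (IH _ P) // (IH' _ P).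
- exact: IH.
case/dwf_updP=> [[[a1 a2] a3 a4 [a5 a6] [a7 a8]] u9 a9 a10 a11] s h.
have ec : t_changed (Transformer (t_voc X) (dset x W (t_pre X))
             [seq (q.1, bset x W q.2) | q <- t_post X] (t_obs X)) = t_changed X.
  by rewrite /t_changed /unzip1 /= -map_comp; apply: eq_map.
apply/dwf_updP; split=> //.
  split=> //=.
  - by apply: contra a3 => /hasP[p pX]; rewrite /= mem_cat => pV; apply/hasP; exists p => //=;
      rewrite mem_cat; case/orP: pV => [->//|/s ->]; rewrite orbT.
  - apply: IH a4 _ _ => p; rewrite !mem_cat; first by case/orP=> [/s ->|->]; rewrite ?orbT.
    by case/orP=> [/h[->|->]|->]; rewrite ?orbT; [left|right|left].
  - by rewrite ec.
  - split=> // q /mapP[r rX ->] /=; apply: bover_subst (a7 _ rX) _ => p.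
    rewrite !mem_cat; case: ifP => [_|n] pV; first by case: ifP.
    by rewrite /= !mem_cat; case/or3P: pV => [->|->|/h[->|]]; rewrite ?orbT ?n.
by rewrite /upd_voc ec; apply: IH' a11 s h.
Qed.

Lemma mem_prime V q : (Prime q \in map Prime V) = (q \in V).
Proof. by apply: mem_map => a b []. Qed.

Lemma nonprime_notin V p : ~~ is_prime p -> p \notin map Prime V.
Proof. by move=> h; apply/mapP => -[q _ e]; rewrite e in h. Qed.

Lemma fok_cat V P W F : fok V P F -> fok V (P ++ W) F.
Proof.
by case=> e h o; split=> //; apply: bover_sub h _ => p; rewrite !mem_cat => /orP[->|->]; rewrite ?orbT.
Qed.

Lemma fok_update V P F X : fok V P F -> xok V P X ->
  bover (V ++ P ++ t_voc X) (trans F (t_pre X)) -> fok (upd_voc V X) P (update F X).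
Proof.
case=> eV hl ho hx hpre; rewrite /update /update_with; split; rewrite /b_voc /b_law /b_obs.
- by rewrite -eV.
- have hc : forall b, bover (V ++ t_voc X ++ P) b ->
     bover (upd_voc V X ++ P) (bcopy (t_changed X) (circ F X) b).
    move=> b hb; apply: bover_subst hb _ => p pV.
    rewrite /= mem_cat mem_upd_voc /circ eV; case: ifP => pc; first by rewrite map_f ?orbT.
    by move: pV; rewrite !mem_cat => /or3P[->|->|->]; rewrite ?orbT.
  rewrite bover_and; apply/andP; split; first (apply: hc; rewrite bover_and; apply/andP; split).
  + by apply: bover_sub hl _ => p; rewrite !mem_cat => /orP[->|->]; rewrite ?orbT.
  + by apply: bover_sub hpre _ => p; rewrite !mem_cat => /or3P[->|->|->]; rewrite ?orbT.
  + rewrite bover_bands; apply/allP => _ /mapP[q qX ->].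
    have h1 := hc _ (xok_change hx qX).
    by rewrite /= h1 !mem_cat (xok_changed hx qX).
- move=> i; rewrite bover_and; apply/andP; split.
    apply: (@bover_subst (upd_voc V X ++ map Prime (upd_voc V X))).
      apply: bover_subst (ho i) _ => p; rewrite /= !mem_cat !map_cat !mem_cat.
      case: ifP => [/mapP[q qX ->] _|_].
        by rewrite /circ eV !mem_prime (map_f _ qX) !orbT.
      by case/orP=> ->; rewrite ?orbT.
    move=> p /=; case: ifP => // pc _; rewrite !mem_cat /circ eV map_f ?orbT //.
  rewrite bover_bands; apply/allP => _ /mapP[q qO ->].
  have qX : q \in t_voc X by case: hx => _ _ _ _ [_ h]; apply: h qO.
  have qU : q \in upd_voc V X by rewrite mem_upd_voc qX orbT.
  set U := upd_voc V X in qU *.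
  have h2 : q \in U ++ map Prime U by rewrite mem_cat qU.
  have h3 : Prime q \in U ++ map Prime U by rewrite mem_cat mem_prime qU orbT.
  by rewrite /= h2 h3.
Qed.

Definition ocopy (W : seq atom) (c : atom -> atom) (p : atom) : atom :=
  if p is Prime q then if q \in W then Prime (c q) else p
  else if p \in W then c p else p.

(** No atom of [W] is primed, so the renaming of primed atoms and that of unprimed atoms do not
    interfere and amount to a single renaming. *)
Lemma bsatp_ocopy v W c b : nonprime W ->
  bsatp v (bcopy W c (bcopy (map Prime W) (fun q => if q is Prime p then Prime (c p) else q) b)) =
  bsatp (fun p => v (ocopy W c p)) b.
Proof.
move=> np; rewrite !bsatp_bcopy; apply: bsatp_ext => -[k|k q|q] /=.
- by rewrite (negbTE (nonprime_notin W (isT : ~~ is_prime (Atom k)))).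
- by rewrite (negbTE (nonprime_notin W (isT : ~~ is_prime (Circ k q)))).
- have nW r : (Prime r \in W) = false by apply/negP => /np.
  by rewrite mem_prime; case: (q \in W); rewrite nW.
Qed.

(** The induction is on the length, because the translation of an event recurses on a precondition
    with substituted truth values, which is no subformula but is as long as the precondition. The
    same scheme is used below for the semantics. *)
Lemma trans_over_rec n V P F phi : dlen phi <= n -> nonprime V -> pok V P ->
  fok V P F -> dwf V P phi -> bover (V ++ P) (trans F phi).
Proof.
elim: n V P F phi => [|n IH] V P F phi; first by case: phi.
case: phi => [||p|phi|phi psi|i phi|X x phi] hn np hp hF; rewrite /= in hn.
- by [].
- by [].
- by [].
- by move=> w; rewrite trans_neg; apply: IH.
- by case/andP=> w1 w2; rewrite trans_and; apply/andP; split; apply: IH => //; lia.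
- move=> w; rewrite trans_K; case: (hF) => eV hl ho; rewrite eV.
  have h : forall b, bover (V ++ P) b -> bover (map Prime V ++ V ++ P) (bcopy V Prime b).
    move=> b hb; apply: bover_subst hb _ => p /=; case: ifP => pV; last by rewrite !mem_cat => ->; rewrite orbT.
    by move=> _; rewrite mem_cat mem_prime pV.
  apply: bover_ball; rewrite /= h // h; last exact: IH.
  rewrite !andbT; apply: bover_sub (ho i) _ => p; rewrite !mem_cat.
  by case/orP=> ->; rewrite ?orbT.
- move=> w; have /dwf_updP[hx uo ux sx wp] := w; rewrite trans_upd.
  have hpre : bover (V ++ P) (trans F (dset x (t_voc X) (t_pre X))).
    apply: IH => //; first by rewrite dlen_dset; lia.
    case: hx => _ _ h _ _; apply: dwf_dset h _ _ => p; rewrite mem_cat; first by move=> ->.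
    by case/orP; [left|right].
  rewrite bover_imp hpre /=.
  have hpre' : bover (V ++ P ++ t_voc X) (trans F (t_pre X)).
    apply: (IH) => //; [lia|exact: pok_cat|exact: fok_cat|by case: hx].
  have hU : bover (upd_voc V X ++ P) (trans (update F X) phi).
    apply: IH => //; first by lia.
    - exact: upd_nonprime hx np.
    - exact: upd_pok hx hp.
    exact: fok_update.
  apply: (@bover_subst (map (circ F X) (t_changed X) ++ V ++ P)).
    apply: (@bover_subst (map (circ F X) (t_changed X) ++ V ++ t_voc X ++ P)).
      apply: bover_subst hU _ => p; rewrite mem_cat mem_upd_voc => pU.
      case: (boolP (p \in t_changed X)) => pc.
        by apply: bover_sub (xok_change hx pc) _ => q; rewrite !mem_cat => ->; rewrite orbT.
      rewrite t_change_notin //= !mem_cat; case: (hF) => eV _ _; rewrite /circ eV.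
      by case/orP: pU => [/or3P[->|->|->]|->]; rewrite ?orbT.
    move=> p; rewrite /= !mem_cat; case: ifP => [_|pX] pU; first by case: ifP.
    by rewrite /= !mem_cat; case/or4P: pU => [->|->|//|->]; rewrite ?orbT.
  move=> p; rewrite /= mem_cat => pU; case: (boolP (p \in map (circ F X) (t_changed X))) => pc.
    case/mapP: pc => q qc ->; rewrite /circ uncopy_mem // mem_cat (xok_changed hx qc) //.
  by rewrite uncopy_notin //; move: pU; rewrite (negbTE pc).
Qed.

Lemma trans_over V P F phi : nonprime V -> pok V P -> fok V P F -> dwf V P phi ->
  bover (V ++ P) (trans F phi).
Proof. exact: trans_over_rec (leqnn _). Qed.

Definition pairv (v t : valu) : valu := fun p => if p is Prime q then t q else v p.

(** The Boolean quantifier over primed atoms becomes a quantifier over valuations [t] of the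
    vocabulary. Parameters are not in the vocabulary and keep their values in the other state,
    whence [ovr V t v]. *)
Lemma trans_K_sem V P F i phi v : nonprime V -> pok V P -> fok V P F -> dwf V P phi ->
  bsatp v (trans F (DK i phi)) <->
  forall t : valu, bsatp (ovr V t v) (b_law F) -> bsatp (pairv v t) (b_obs F i) ->
    bsatp (ovr V t v) (trans F phi).
Proof.
move=> np hp hF w; have ht := trans_over np hp hF w.
case: hF => eV hl ho; rewrite trans_K eV.
have hc u b : bover (V ++ P) b -> bsatp (ovr (map Prime V) u v) (bcopy V Prime b) =
    bsatp (ovr V (fun q => u (Prime q)) v) b.
  move=> hb; rewrite bsatp_bcopy; apply: bsatp_over hb _ => p; rewrite mem_cat /ovr.
  case: (boolP (p \in V)) => [pV _|_ /= pP]; first by rewrite mem_prime pV.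
  by rewrite (negbTE (nonprime_notin _ (name_nonprime (pok_name hp pP)))).
have hq u : bsatp (ovr (map Prime V) u v) (b_obs F i) =
    bsatp (pairv v (fun q => u (Prime q))) (b_obs F i).
  apply: bsatp_over (ho i) _ => p; rewrite mem_cat /ovr.
  case/orP=> [pV|pV]; last by rewrite pV; case/mapP: pV => q _ ->.
  have := np _ pV; case: p pV => // [n|k q] pV _.
    by rewrite (negbTE (nonprime_notin _ (isT : ~~ is_prime (Atom n)))).
  by rewrite (negbTE (nonprime_notin _ (isT : ~~ is_prime (Circ k q)))).
split=> [/bsatp_ball h t|h].
  have := h (fun p => if p is Prime q then t q else true).
  by rewrite !bsatp_imp !hc // hq => /implyP a b c; apply: (implyP (a b)).
apply/bsatp_ball => t; rewrite !bsatp_imp !hc // hq.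
by apply/implyP => a; apply/implyP => b; apply: h.
Qed.

Lemma bsatp_upd F X x v b : bsatp v (buncopy (t_changed X) (circ F X)
      (bset x (t_voc X) (bsubst (t_change X) b))) =
  bsatp (fun p => bsatp (fun r => if r \in t_voc X then r \in x else
      v (nth r (t_changed X) (index r (map (circ F X) (t_changed X))))) (t_change X p)) b.
Proof.
rewrite bsatp_subst bsatp_bset bsatp_subst; apply: bsatp_ext => p; exact: bsatp_ext.
Qed.

(** Correctness of the local translation, which turns the semantics into Boolean evaluation. The two
    sides represent states differently, by lists and by valuations. *)
Lemma sat_trans_rec n V F phi (s : seq atom) : dlen phi <= n -> nonprime V -> fok V [::] F ->
  dwf V [::] phi -> {subset s <= V} -> sat F s phi <-> bsat s (trans F phi).
Proof.
elim: n V F phi s => [|n IH] V F phi s; first by case: phi.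
case: phi => [||p|phi|phi psi|i phi|X x phi] hn np hF w sV; rewrite /= in hn; rewrite bsatE.
- by [].
- by [].
- by [].
- have e := IH V F phi s hn np hF w sV; rewrite bsatE in e.
  by rewrite sat_neg trans_neg; split=> [h|/negP h /e //]; apply/negP => /e.
- case/andP: w => w1 w2.
  have [h1 h2] : dlen phi <= n /\ dlen psi <= n by lia.
  have e1 := IH V F phi s h1 np hF w1 sV; have e2 := IH V F psi s h2 np hF w2 sV.
  rewrite !bsatE in e1 e2; rewrite sat_and trans_and.
  by split=> [[/e1 a /e2 b]|/andP[/e1 a /e2 b]] //; apply/andP.
- have {}w : dwf V [::] phi := w.
  rewrite sat_K (trans_K_sem _ _ np (isT : pok V [::]) hF w).
  have [eV hl ho] := hF; rewrite cats0 in hl.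
  have ht := trans_over np (isT : pok V [::]) hF w; rewrite cats0 in ht.
  split=> h t.
    (* A valuation becomes a state by listing the atoms of the vocabulary that it makes true;
       nothing else of it matters, as all formulas involved are over the vocabulary and its copy. *)
    move=> a b; pose t' := [seq p <- V | t p].
    have et : {in V, (fun p => p \in t') =1 t} by move=> p pV; rewrite mem_filter pV andbT.
    have st : {subset t' <= V} by move=> p; rewrite mem_filter => /andP[].
    have eo : {in V, ovr V t (fun p => p \in s) =1 (fun p => p \in t')}.
      by move=> p pV; rewrite /ovr pV et.
    rewrite (bsatp_over ht eo) -bsatE -(IH V) //; apply: h.
      by split; rewrite ?eV // bsatE -(bsatp_over hl eo).
    rewrite bsatE -(bsatp_over (v := pairv (fun p => p \in s) t) (ho i)) // => p.
    rewrite !mem_cat => /orP[pV|/mapP[q qV ->]].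
      have := np _ pV; case: p pV => //= [k|k q] pV _;
        by rewrite /pairv (negbTE (nonprime_notin _ _)) ?orbF.
    rewrite /pairv /= mem_prime et //; case: (boolP (Prime q \in s)) => // /sV /np //.
  case=> sub lw ob; rewrite (IH V) //; last by rewrite -eV.
  have eo : {in V, ovr V (fun p => p \in t) (fun p => p \in s) =1 (fun p => p \in t)}.
    by move=> p pV; rewrite /ovr pV.
  rewrite bsatE -(bsatp_over ht eo); apply: h.
    by rewrite (bsatp_over hl eo) -bsatE.
  move: ob; rewrite bsatE -(bsatp_over (v := pairv (fun p => p \in s) (fun p => p \in t)) (ho i)) // => p.
  rewrite !mem_cat => /orP[pV|/mapP[q qV ->]].
    have := np _ pV; case: p pV => //= [k|k q] pV _;
      by rewrite /pairv (negbTE (nonprime_notin _ _)) ?orbF.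
  rewrite /pairv /= mem_prime; case: (boolP (Prime q \in s)) => // /sV /np //.
- have /dwf_updP[hx uo ux sx wp] := w; rewrite sat_upd trans_upd bsatp_imp.
  have wpre : dwf V [::] (dset x (t_voc X) (t_pre X)).
    by case: hx => _ _ h _ _; apply: dwf_dset h _ _ => // p; right.
  rewrite (IH V) //; last by rewrite dlen_dset; lia.
  have hpre : bover (V ++ [::] ++ t_voc X) (trans F (t_pre X)).
    apply: trans_over => //; [exact: (pok_cat hx)|exact: (fok_cat _ hF)|by case: hx].
  have hF' := fok_update hF hx hpre.
  have np' := upd_nonprime hx np.
  have [eV _ _] := hF.
  have sub : {subset upd_state F X s x <= upd_voc V X}.
    move=> p; rewrite mem_upd_voc !mem_cat !mem_filter => /or4P[/andP[_ /sV ->] //|/mapP[q]||/andP[_ /(xok_changed hx) -> //]].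
      by rewrite mem_filter => /andP[qc _] ->; rewrite /circ eV map_f ?orbT.
    by move=> /sx ->; rewrite orbT.
  rewrite (IH (upd_voc V X)) //; last by lia.
  (* It remains to compare $s^x$ with the substitution atom by atom: changed atoms take the value of
     the postcondition, copies that of the original, and atoms of $V^+$ their value in [x]. *)
  have -> : bsat (upd_state F X s x) (trans (update F X) phi) =
     bsatp (fun p => p \in s) (buncopy (t_changed X) (circ F X)
        (bset x (t_voc X) (bsubst (t_change X) (trans (update F X) phi)))).
    rewrite bsatE bsatp_upd.
    have := trans_over np' (isT : pok _ [::]) hF' wp; rewrite cats0 => ht.
    apply: bsatp_over ht _ => p; rewrite mem_upd_voc => pU.
    have cN q : (circ F X q \in V = false) by rewrite /circ eV (negbTE (fresh_notin _ _ _)).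
    have vm q : q \in V -> q \notin map (circ F X) (t_changed X).
      by move=> qV; apply/mapP => -[r _ e]; move: qV; rewrite e cN.
    have nm q : q \in t_voc X -> q \notin map (circ F X) (t_changed X).
      by move=> /(xok_notin hx)[_ qn]; apply/mapP => -[r _ e]; move: qn; rewrite e.
    have sN q : q \notin V -> (q \in s) = false by move=> h; apply/negP => /sV; apply/negP.
    have xN q : q \notin t_voc X -> (q \in x) = false by move=> h; apply/negP => /sx; apply/negP.
    have VX q : q \in V -> q \notin t_voc X.
      by move=> qV; apply/negP => /(xok_notin hx)[[/negP]].
    rewrite !mem_cat !mem_filter; case: (boolP (p \in t_changed X)) => pc /=.
      have pV := xok_changed hx pc.
      rewrite (xN _ (VX _ pV)) /=.
      have -> : (p \in map (circ F X) [seq p0 <- s | p0 \in t_changed X]) = false.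
        apply/negP => /mapP[q]; rewrite mem_filter => /andP[qc _] e.
        by have := vm _ pV; rewrite e map_f.
      rewrite /= andbT bsatE; apply: bsatp_over (xok_change hx pc) _ => r.
      rewrite cats0 !mem_cat; case: ifP => [rX _|/negbT rX].
        by rewrite sN //; case: (xok_notin hx rX) => -[].
      rewrite orbF => rV; rewrite (xN _ rX) orbF uncopy_notin //; exact: vm.
    rewrite t_change_notin //= andbF orbF.
    case: (boolP (p \in V)) pU => [pV _|pV] /=.
      rewrite (xN _ (VX _ pV)) (negbTE (VX _ pV)) orbF uncopy_notin; last exact: vm.
      rewrite orbC; case: mapP => // -[q]; rewrite mem_filter => /andP[qc _] e.
      by have := vm _ pV; rewrite e map_f.
    rewrite (sN _ pV) /=; case/orP=> [pX|/mapP[q qc e]].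
      rewrite pX; case: mapP => // -[q]; rewrite mem_filter => /andP[qc _] e.
      by have := nm _ pX; rewrite e map_f.
    have pX : p \notin t_voc X by rewrite e; apply/negP => /(xok_notin hx)[].
    rewrite (negbTE pX) (xN _ pX) orbF e.
    have ec : Circ (fresh_stamp (V ++ t_voc X)) = circ F X by rewrite /circ eV.
    rewrite ec {2}/circ uncopy_mem // mem_map; last by rewrite /circ => a b [].
    by rewrite mem_filter qc.
  by rewrite bsatE; split=> [h|/implyP //]; apply/implyP.
Qed.

Lemma sat_trans V F phi (s : seq atom) : nonprime V -> fok V [::] F ->
  dwf V [::] phi -> {subset s <= V} -> sat F s phi <-> bsat s (trans F phi).
Proof. exact: sat_trans_rec (leqnn _). Qed.

(** * Parameters as partially evaluated atoms *)

Lemma ovr_ovr W x W' y v p : (p \in W -> p \in W' -> false) ->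
  ovr W x (ovr W' y v) p = ovr W' y (ovr W x v) p.
Proof. by rewrite /ovr; case: (p \in W); case: (p \in W') => // /(_ isT isT). Qed.

Definition dset_t (x W : seq atom) X : transformer A :=
  Transformer (t_voc X) (dset x W (t_pre X)) [seq (q.1, bset x W q.2) | q <- t_post X] (t_obs X).

Lemma dset_t_changed x W X : t_changed (dset_t x W X) = t_changed X.
Proof. by rewrite /t_changed /unzip1 /= -map_comp; apply: eq_map. Qed.

Lemma dset_t_change x W X p : p \in t_changed X ->
  t_change (dset_t x W X) p = bset x W (t_change X p).
Proof.
move=> h; rewrite /t_change dset_t_changed /= /unzip2 -map_comp.
have lt : index p (t_changed X) < size (t_post X) by rewrite -(size_map fst) index_mem.
by rewrite !(nth_map (p, BTop)).
Qed.

(** Updating with [X] and with the substituted [X] gives different structures, since the translated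
    precondition enters the law. The induction for substitutions therefore has to compare two
    structures, and it does so by the truth values of their formulas. *)
Definition fdset (x W : seq atom) F' F :=
  (forall v, bsatp v (b_law F') = bsatp (ovr W (fun p => p \in x) v) (b_law F)) /\
  forall v i, bsatp v (b_obs F' i) = bsatp (ovr W (fun p => p \in x) v) (b_obs F i).

Lemma fdset_refl V P F x W : fok V P F -> nonprime V -> all is_name W ->
  {in W, forall p, p \notin V ++ P} -> fdset x W F F.
Proof.
case=> eV hl ho np nW dW; split=> v.
  apply: bsatp_over hl _ => p pV; rewrite /ovr; case: ifP => // /dW; by rewrite pV.
move=> i; apply: bsatp_over (ho i) _ => p pV; rewrite /ovr; case: ifP => // pW.
have := dW _ pW; rewrite !mem_cat negb_or => /andP[/negbTE pV' _].
move: pV; rewrite mem_cat pV' => /mapP[q _ e]; by have := allP nW _ pW; rewrite e.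
Qed.

(** Substituting truth values for parameters can be deferred to the valuation. Thanks to this the
    evaluator never rewrites a precondition: it assigns values to $V^+$ and evaluates the formula as
    given. *)
Lemma trans_dset_rec n V P F F' phi x W v : dlen phi <= n -> nonprime V -> pok V P ->
  fok V P F -> fok V P F' -> dwf V P phi -> all is_name W -> {in W, forall p, p \notin V} ->
  {in W, forall p, p \in P} -> fdset x W F' F ->
  bsatp v (trans F' (dset x W phi)) = bsatp (ovr W (fun p => p \in x) v) (trans F phi).
Proof.
elim: n V P F F' phi x W v => [|n IH] V P F F' phi x W v; first by case: phi.
case: phi => [||p|phi|phi psi|i phi|X y phi] hn np hp hF hF' w nW dV dP hd; rewrite /= in hn.
- by [].
- by [].
- by rewrite /= /ovr; case: ifP => // _; case: ifP.
- by rewrite [dset _ _ _]/= !trans_neg; congr (~~ _); apply: IH (hn) _ _ _ _ w _ _ _ _.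
- case/andP: w => w1 w2; rewrite [dset _ _ _]/= !trans_and.
  by congr (_ && _); apply: (IH V P) => //; lia.
- have w' : dwf V P phi := w.
  have wd : dwf V P (dset x W phi) by apply: dwf_dset w' _ _ => // p; left.
  have WP p : p \in W -> p \notin V by move/dV.
  have WQ q : (Prime q \in W) = false by apply/negP => /(allP nW).
  have eo t u : ovr W (fun p => p \in x) (ovr V t u) =1 ovr V t (ovr W (fun p => p \in x) u).
    by move=> p; apply: ovr_ovr => /WP/negbTE ->.
  rewrite [dset _ _ _]/=; apply/idP/idP.
    move/(trans_K_sem _ _ np hp hF' wd) => h; apply/(trans_K_sem _ _ np hp hF w') => t a b.
    rewrite -(bsatp_ext _ (eo t v)) -(IH V P F F' phi) //; apply: h.
      by case: hd => -> _; rewrite (bsatp_ext _ (eo t v)).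
    case: hd => _ ->; rewrite (bsatp_ext (v' := pairv (ovr W (fun p => p \in x) v) t)) // => p.
    by case: p => [k|k q|q]; rewrite /ovr /pairv ?WQ.
  move/(trans_K_sem _ _ np hp hF w') => h; apply/(trans_K_sem _ _ np hp hF' wd) => t a b.
  rewrite (IH V P F F' phi) // (bsatp_ext _ (eo t v)); apply: h.
    by rewrite -(bsatp_ext _ (eo t v)); case: hd => <- _.
  rewrite (bsatp_ext (v' := ovr W (fun p => p \in x) (pairv v t))); first by case: hd => _ <-.
  by case=> [k|k q|q]; rewrite /ovr /pairv ?WQ.
- have /dwf_updP[hx uo uy sy wp] := w.
  have wX : dwf V P (DUpd (dset_t x W X) y (dset x W phi)).
    by apply: (@dwf_dset V P P (DUpd X y phi)) => // p; left.
  have /dwf_updP[hx' _ _ _ wp'] := wX.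
  have [eV hl ho] := hF; have [eV' hl' ho'] := hF'.
  have nX : all is_name (t_voc X) by case: hx => -[].
  have dVX : {in t_voc X, forall p, p \notin V} by move=> p /(xok_notin hx)[[]].
  have hpX : pok V (P ++ t_voc X) := pok_cat hx hp.
  have hFX : fok V (P ++ t_voc X) F := fok_cat _ hF.
  have hFX' : fok V (P ++ t_voc X) F' := fok_cat _ hF'.
  have dXP (p : atom) : p \in t_voc X -> p \notin V ++ P.
    by move=> /(xok_notin hx)[[a b] _]; rewrite mem_cat negb_or a b.
  have wpre : dwf V (P ++ t_voc X) (t_pre X) by case: hx.
  have wpre' : dwf V (P ++ t_voc X) (dset x W (t_pre X)) by case: hx'.
  have WX p : p \in W -> p \in t_voc X -> false.
    by move=> /dP pP /(xok_notin hx)[[_ /negP]].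
  have dP' : {in W, forall p, p \in P ++ t_voc X} by move=> p /dP; rewrite mem_cat => ->.
  have sX : {in t_voc X, forall p, p \in P ++ t_voc X} by move=> p; rewrite mem_cat => ->; rewrite orbT.
  have lpre : dlen (t_pre X) <= n by clear -hn; lia.
  have IHpre u : bsatp u (trans F' (dset x W (t_pre X))) = bsatp (ovr W (fun p => p \in x) u) (trans F (t_pre X)).
    exact: (IH V (P ++ t_voc X)).
  (* Two substitutions meet here, for [W] and for the atoms of $V^+$. The induction hypothesis
     treats them one at a time, and the two assignments commute because the sets are disjoint. *)
  have e1 : bsatp v (trans F' (dset y (t_voc X) (dset x W (t_pre X)))) =
       bsatp (ovr W (fun p => p \in x) v) (trans F (dset y (t_voc X) (t_pre X))).
    rewrite (IH V (P ++ t_voc X) F' F') ?dlen_dset //; last exact: fdset_refl hF' np nX dXP.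
    rewrite IHpre (IH V (P ++ t_voc X) F F (t_pre X)) //; last exact: fdset_refl hF np nX dXP.
    by apply: bsatp_ext => p; apply: ovr_ovr; apply: WX.
  have ec : circ F' (dset_t x W X) = circ F X by rewrite /circ /= eV eV'.
  have WV p : p \in W -> p \in V = false by move=> /dV/negbTE.
  have Wc p : (circ F X p \in W) = false by apply/negP => /(allP nW).
  have ecp u p : ovr W (fun p => p \in x) (fun p => u (if p \in t_changed X then circ F X p else p)) p
      = ovr W (fun p => p \in x) u (if p \in t_changed X then circ F X p else p).
    rewrite /ovr; case: (boolP (p \in t_changed X)) => // pc; rewrite Wc.
    by case: ifP => // /WV; rewrite (xok_changed hx pc).
  have hU : bover (V ++ P ++ t_voc X) (trans F (t_pre X)) by apply: trans_over.
  have hU' : bover (V ++ P ++ t_voc X) (trans F' (dset x W (t_pre X))) by apply: trans_over.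
  have hF1 : fok (upd_voc V X) P (update F X) by apply: fok_update.
  have hF1' : fok (upd_voc V X) P (update F' (dset_t x W X)).
    by have := fok_update hF' hx' hU'; rewrite /upd_voc dset_t_changed.
  have np1 := upd_nonprime hx np; have hp1 := upd_pok hx hp.
  have dV1 : {in W, forall p, p \notin upd_voc V X}.
    move=> p pW; rewrite mem_upd_voc !negb_or dV //=; apply/andP; split; first by apply/negP => /(WX _ pW).
    by apply/mapP => -[q _ e]; have := allP nW _ pW; rewrite e.
  have hd1 : fdset x W (update F' (dset_t x W X)) (update F X).
    split=> u; rewrite /update /update_with /b_law /b_obs /= ?dset_t_changed ec.
      congr (_ && _).
        have := hd.1; rewrite /b_law => hdl.
        rewrite -!/(bcopy _ _ _) !bsatp_bcopy hdl IHpre.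
        by congr (_ && _); apply: bsatp_ext => p; rewrite ecp.
      rewrite /obs_form !bsatp_bands_iff; apply: eq_in_all => q qc.
      congr (_ == _); last first.
        rewrite dset_t_change // !bsatp_bcopy bsatp_bset.
        by apply: bsatp_ext => p; rewrite ecp.
      by rewrite /= /ovr; case: ifP => // /WV; rewrite (xok_changed hx qc).
    move=> i; congr (_ && _).
      have := hd.2; rewrite /b_obs => hdo.
      have npc : nonprime (t_changed X) by move=> p /(xok_changed hx)/np.
      rewrite !bsatp_ocopy // hdo; apply: bsatp_ext => -[k|k q|q].
      - exact: (ecp u (Atom k)).
      - exact: (ecp u (Circ k q)).
      have WQ r : (Prime r \in W) = false by apply/negP => /(allP nW).
      by rewrite /ovr /ocopy WQ; case: (q \in t_changed X); rewrite WQ.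
    rewrite /obs_form !bsatp_bands_iff; apply: eq_in_all => q qc.
    have qX : q \in t_voc X by case: hx => _ _ _ _ [_ h]; apply: h qc.
    congr (_ == _); rewrite /= /ovr; case: ifP => // h; last by have := allP nW _ h.
    by have := WX _ h qX.
  have wp1' : dwf (upd_voc V X) P (dset x W phi) by move: wp'; rewrite /upd_voc dset_t_changed.
  have ht1 := trans_over np1 hp1 hF1 wp.
  have -> : dset x W (DUpd X y phi) = DUpd (dset_t x W X) y (dset x W phi) by [].
  rewrite !trans_upd !bsatp_imp e1; congr (_ ==> _).
  rewrite !bsatp_upd [t_voc _]/= dset_t_changed ec.
  rewrite (IH (upd_voc V X) P (update F X)) //; last by clear -hn; lia.
  apply: bsatp_over ht1 _ => p pU; rewrite {1}/ovr.
  have un r : r \in V ++ P -> r \notin map (circ F X) (t_changed X).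
    move=> rV; apply/mapP => -[q _ e]; move: rV; rewrite e mem_cat /circ eV.
    rewrite (negbTE (fresh_notin _ _ _)) /=; move/(pok_name hp); by [].
  case: ifP => pW.
    have pP := dP _ pW.
    have pc : p \notin t_changed X by apply/negP => /(xok_changed hx) h; have := WV _ pW; rewrite h.
    rewrite t_change_notin //=.
    have -> : (p \in t_voc X) = false by apply/negP => /(WX _ pW).
    by rewrite uncopy_notin ?un ?mem_cat ?pP ?orbT // /ovr pW.
  case: (boolP (p \in t_changed X)) => pc; last first.
    rewrite !t_change_notin ?dset_t_changed //=; case: ifP => // _.
    case: (boolP (p \in map (circ F X) (t_changed X))) => pm.
      case/mapP: pm => q qc ->; rewrite /circ uncopy_mem // /ovr.
      by case: ifP => // /WV; rewrite (xok_changed hx qc).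
    by rewrite uncopy_notin // /ovr pW.
  rewrite dset_t_change // bsatp_bset; apply: bsatp_over (xok_change hx pc) _ => r.
  rewrite !mem_cat => rU; rewrite {1}/ovr; case: (boolP (r \in t_voc X)) rU => [rX _|rX].
    by case: ifP => // /WX /(_ rX).
  rewrite /= => rV; have rV' : r \in V ++ P by rewrite mem_cat.
  by rewrite uncopy_notin ?un // /ovr; case: ifP.
Qed.

Lemma trans_dset V P F phi x W v : nonprime V -> pok V (P ++ W) ->
  fok V P F -> dwf V (P ++ W) phi -> {in W, forall p, p \notin P} ->
  bsatp v (trans F (dset x W phi)) = bsatp (ovr W (fun p => p \in x) v) (trans F phi).
Proof.
move=> np hp hF w d; case/andP: (hp); rewrite !all_cat => /andP[_ nW] /andP[_ /allP dW].
apply: (@trans_dset_rec _ V (P ++ W)) => //; try exact: fok_cat.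
- by move=> p pW; rewrite mem_cat pW orbT.
- apply: fdset_refl hF np nW _ => p pW.
  by rewrite mem_cat negb_or dW // d.
Qed.
End Wf.

(** * Histories of updates *)

Section Hist.
Variables (A : finType) (K0 : kstruct A).
Hypothesis base_names : all is_name (k_voc K0).
Hypothesis base_law : bover (k_voc K0) (k_law K0).
Hypothesis base_obs : forall i, {subset k_obs K0 i <= k_voc K0}.
Implicit Types (X : transformer A) (h : seq (transformer A)) (phi : dform A).

Definition hstr h : bstruct A := foldr (fun X F => update F X) (belief_of K0) h.
Definition hvoc h : seq atom := b_voc (hstr h).
Lemma bsatp_and v b c : bsatp v (BAnd b c) = bsatp v b && bsatp v c.
Proof. by []. Qed.

Lemma hstr_law X h : b_law (hstr (X :: h)) =
  BAnd (bcopy (t_changed X) (circ (hstr h) X) (BAnd (b_law (hstr h)) (trans (hstr h) (t_pre X))))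
    (bands [seq biff (BAtom q) (bcopy (t_changed X) (circ (hstr h) X) (t_change X q)) | q <- t_changed X]).
Proof. by []. Qed.

Lemma hstr_obs X h i : b_obs (hstr (X :: h)) i =
  BAnd (bcopy (t_changed X) (circ (hstr h) X) (bcopy (map Prime (t_changed X))
         (fun q => if q is Prime p then Prime (circ (hstr h) X p) else q) (b_obs (hstr h) i)))
    (obs_form (t_obs X i)).
Proof. by []. Qed.

(** An update without postconditions makes no copies and leaves the largest stamp as it is. Hence
    the copies made after [h] carry the stamp [kc h], computable from the history alone. *)
Definition kc h : nat := count (fun X => ~~ nilp (t_post X)) h.
Definition nms h : seq atom := foldr (fun X l => t_voc X ++ l) (k_voc K0) h.

(* The state reached after the updates [h] is determined by a valuation of the
   names; the other atoms are computed from it. *)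
Fixpoint look h (v : valu) (p : atom) : bool :=
  if h is X :: h' then
    if p \in t_changed X then bsatp (look h' v) (t_change X p)
    else if p is Circ k q then
      if (k == kc h') && (q \in t_changed X) then look h' v q else look h' v p
    else look h' v p
  else v p.

(** An update was checked with the parameters [P'] of its time. Since then the set may have grown,
    by the atoms $V^+$ of preconditions that are being evaluated on the same history. *)
Fixpoint hwf (P : seq atom) h : Prop :=
  if h is X :: h' then
    exists P' : seq atom, {subset P' <= P} /\ (hwf P' h' /\ xok (hvoc h') P' X)
  else True.

Lemma hwf_sub P P' h : hwf P h -> {subset P <= P'} -> hwf P' h.
Proof.
case: h => //= X h [Q [QP w]] s; exists Q; split=> // p /QP; exact: s.
Qed.

Lemma fresh_stamp_cat V W : fresh_stamp (V ++ W) = maxn (fresh_stamp V) (fresh_stamp W).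
Proof. by rewrite /fresh_stamp big_cat. Qed.

Lemma fresh_stamp_names W : all is_name W -> fresh_stamp W = 0.
Proof.
by move=> /allP h; apply/eqP; rewrite -leqn0 fresh_stamp_leq; apply/allP => p /h; case: p.
Qed.

(** Names have stamp 0, and a changed atom has a stamp of at most [kc h], so its copy has exactly
    the stamp [(kc h).+1]. *)
Lemma hvoc_fresh P h : hwf P h -> fresh_stamp (hvoc h) = kc h.
Proof.
elim: h P => [|X h IH] P /=; first by rewrite fresh_stamp_names.
move=> [Q [_ [w hx]]]; rewrite /hvoc /= /upd_voc -/(hvoc h).
have fX : fresh_stamp (t_voc X) = 0 by apply: fresh_stamp_names; case: hx => -[].
have e := IH _ w.
rewrite !fresh_stamp_cat e fX max0n !maxn0.
have st : all (fun p => stamp p <= kc h) (t_changed X).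
  apply/allP => p /(xok_changed hx) pV; have : fresh_stamp (hvoc h) <= kc h by rewrite e.
  by rewrite fresh_stamp_leq => /allP; apply.
have ec : nilp (t_post X) = nilp (t_changed X) by rewrite /nilp /t_changed size_map.
rewrite ec; case: (t_changed X) st => [|p s] /= st; first by rewrite /fresh_stamp big_nil maxn0.
case/andP: st => sp ss.
suff -> : fresh_stamp (Circ (kc h) p :: map (Circ (kc h)) s) = (kc h).+1 by rewrite add1n; apply/maxn_idPr.
apply/eqP; rewrite eqn_leq fresh_stamp_leq /= geq_max leqnn (leqW sp) /=; apply/andP; split.
  by apply/allP => _ /mapP[q qs ->] /=; rewrite geq_max leqnn leqW // (allP ss).
by rewrite /fresh_stamp big_cons /= leq_max leq_max leqnn.
Qed.

Lemma hist_fresh P h X : hwf P h -> all is_name (t_voc X) ->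
  fresh_stamp (hvoc h ++ t_voc X) = kc h.
Proof. by move=> w n; rewrite fresh_stamp_cat (hvoc_fresh w) fresh_stamp_names // maxn0. Qed.

Lemma hist_circ P h X : hwf P h -> all is_name (t_voc X) -> circ (hstr h) X = Circ (kc h).
Proof. by move=> w n; rewrite /circ (hist_fresh w). Qed.

Lemma mem_hvoc P h X p : hwf P (X :: h) -> (p \in hvoc (X :: h)) =
  [|| p \in hvoc h, p \in t_voc X | p \in map (Circ (kc h)) (t_changed X)].
Proof.
move=> /= [Q [_ [w hx]]]; rewrite /hvoc /= mem_upd_voc -/(hvoc h) (hist_fresh w) //.
by case: hx => -[].
Qed.

Lemma hvoc_nonprime P h : hwf P h -> nonprime (hvoc h).
Proof.
elim: h P => [|X h IH] P /=; first by move=> _ p /(allP base_names) /name_nonprime.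
by move=> [Q [_ [w hx]]]; apply: upd_nonprime hx (IH _ w).
Qed.

Lemma hvoc_circ P h k q : hwf P h -> Circ k q \in hvoc h -> k < kc h.
Proof.
move=> w pV; have := leqnn (fresh_stamp (hvoc h)); rewrite fresh_stamp_leq => /allP /(_ _ pV) /=.
by rewrite geq_max (hvoc_fresh w) => /andP[].
Qed.

Lemma nms_sub h : {subset nms h <= hvoc h}.
Proof.
elim: h => [|X h IH] p //=; rewrite mem_cat mem_upd_voc => /orP[->|/IH]; rewrite ?orbT //.
by rewrite /hvoc => ->.
Qed.

Lemma hvoc_pok P P' h X : {subset P' <= P} -> pok (hvoc (X :: h)) P -> pok (hvoc h) P'.
Proof.
move=> s /andP[/allP n /allP d]; apply/andP; split; apply/allP => p /s pP; first exact: n.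
by apply: contra (d _ pP) => pV; rewrite /hvoc /= mem_upd_voc -/(hvoc h) pV.
Qed.

Lemma hist_fok P h : hwf P h -> pok (hvoc h) P -> fok (hvoc h) P (hstr h).
Proof.
elim: h P => [|X h IH] P.
  move=> _ _; split=> //=.
    by apply: bover_sub base_law _ => p; rewrite mem_cat => ->.
  move=> i; rewrite bover_bands; apply/allP => _ /mapP[q /base_obs qV ->].
  have qV' : q \in k_voc K0 ++ map Prime (k_voc K0) by rewrite mem_cat qV.
  have qP : Prime q \in k_voc K0 ++ map Prime (k_voc K0) by rewrite mem_cat mem_prime qV orbT.
  by rewrite /hvoc /= qV' qP.
move=> /= [Q [QP [w hx]]] hp.
have hq := hvoc_pok QP hp; have hF := IH _ w hq.
have np := hvoc_nonprime w.
have [eV hl ho] : fok (upd_voc (hvoc h) X) Q (update (hstr h) X).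
  apply: fok_update (hF) (hx) _; apply: trans_over => //.
  - exact: pok_cat.
  - exact: fok_cat.
  - by case: hx.
split=> //; apply: bover_sub hl _ => p; rewrite !mem_cat => /orP[->//|/QP ->].
by rewrite orbT.
Qed.

Lemma look_ext h v v' : v =1 v' -> look h v =1 look h v'.
Proof.
move=> e; elim: h => [|X h IH] p //=; case: ifP => _; first exact: bsatp_ext.
by case: p => // k q; case: ifP.
Qed.

Lemma look_notin P h v p : hwf P h -> p \notin hvoc h -> look h v p = v p.
Proof.
elim: h P p => [|X h IH] P p //= w; rewrite (mem_hvoc _ w) !negb_or => /and3P[pV pX pc].
move: w => [Q [_ [w hx]]].
have -> : (p \in t_changed X) = false by apply/negP => /(xok_changed hx); apply/negP.
case: p pV pX pc => [n|k q|q] pV pX pc; try exact: (IH _ _ w pV).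
case: ifP => [/andP[/eqP e qc]|_]; last exact: (IH _ _ w pV).
by move: pc; rewrite e map_f.
Qed.

Lemma look_param P h v p : hwf P h -> pok (hvoc h) P -> p \in P -> look h v p = v p.
Proof. by move=> w hp pP; apply: look_notin w (pok_notin hp pP). Qed.

Lemma look_dep P h v v' : hwf P h -> pok (hvoc h) P -> {in nms h ++ P, v =1 v'} ->
  {in hvoc h ++ P, look h v =1 look h v'}.
Proof.
elim: h P => [|X h IH] P //= w hp e p.
have [Q [QP [w' hx]]] := w; have hq := hvoc_pok QP hp.
have eQ : {in nms h ++ Q, v =1 v'}.
  by move=> q; rewrite mem_cat => qn; apply: e; rewrite !mem_cat; case/orP: qn => [->|/QP ->]; rewrite ?orbT.
have IHe := IH _ w' hq eQ.
rewrite mem_cat (mem_hvoc _ w) => pV.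
have eX q : q \in t_voc X -> look h v q = look h v' q.
  move=> qX; have [[qV _] _] := xok_notin hx qX.
  by rewrite !(look_notin _ w') //; apply: e; rewrite !mem_cat qX.
case: (boolP (p \in t_changed X)) => pc.
  apply: bsatp_over (xok_change hx pc) _ => r; rewrite !mem_cat => /or3P[rV|/eX //|rP].
    by apply: IHe; rewrite mem_cat rV.
  by apply: IHe; rewrite mem_cat rP orbT.
have low : p \notin map (Circ (kc h)) (t_changed X) -> look h v p = look h v' p.
  move=> pm; case/orP: pV => [/or3P[pV|/eX //|pV]|pP].
  - by apply: IHe; rewrite mem_cat pV.
  - by rewrite pV in pm.
  have pV : p \notin hvoc h.
    apply: contra (pok_notin hp pP) => pV; by rewrite (mem_hvoc _ w) pV.
  by rewrite !(look_notin _ w') //; apply: e; rewrite !mem_cat pP !orbT.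
case: p pV pc low => [n|k q|q] pV pc low.
- by apply: low; apply/mapP => -[].
- case: ifP => [/andP[_ qc]|n]; first by apply: IHe; rewrite mem_cat (xok_changed hx qc).
  by apply: low; apply/mapP => -[r rc [ek er]]; rewrite ek er eqxx rc in n.
- by apply: low; apply/mapP => -[].
Qed.

(** A copy is the memory of the state before the update: reading the renamed atom afterwards is
    reading the atom before. An older copy cannot be mistaken for a new one, as its stamp is
    smaller. *)
Lemma look_pull P h X v p : hwf P (X :: h) -> pok (hvoc (X :: h)) P ->
  p \in hvoc h ++ P ++ t_voc X ->
  look (X :: h) v (if p \in t_changed X then Circ (kc h) p else p) = look h v p.
Proof.
move=> w hp pV; have [Q [QP [w' hx]]] := w; have hq := hvoc_pok QP hp.
case: ifP => pc /=.
  have -> : (Circ (kc h) p \in t_changed X) = false.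
    by apply/negP => /(xok_changed hx)/(hvoc_circ w'); rewrite ltnn.
  by rewrite eqxx pc.
rewrite pc; case: p pV pc => // k q pV pc; case: eqP => //= e; case: ifP => // qc.
move: pV; rewrite !mem_cat => /or3P[/(hvoc_circ w')|/(pok_name hp)|/(xok_notin hx)[]] //.
by rewrite e ltnn.
Qed.

Definition tr h v phi : bool := bsatp (look h v) (trans (hstr h) phi).
Definition lawv h v : bool := bsatp (look h v) (b_law (hstr h)).

Lemma tr_ext h v v' phi : v =1 v' -> tr h v phi = tr h v' phi.
Proof. by move=> e; apply: bsatp_ext; apply: look_ext. Qed.

Lemma lawv_ext h v v' : v =1 v' -> lawv h v = lawv h v'.
Proof. by move=> e; apply: bsatp_ext; apply: look_ext. Qed.

(** The evaluation rule for events. The substitutions in the precondition and behind the event both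
    turn into one assignment of [x] to $V^+$, after which the formula is evaluated with the history
    extended by [X]. *)
Lemma tr_upd P h v X x phi : hwf P h -> pok (hvoc h) P -> dwf (hvoc h) P (DUpd X x phi) ->
  tr h v (DUpd X x phi) =
  (tr h (ovr (t_voc X) (fun p => p \in x) v) (t_pre X) ==>
   tr (X :: h) (ovr (t_voc X) (fun p => p \in x) v) phi).
Proof.
move=> w hp wX; have /dwf_updP[hx uo ux sx wp] := wX.
set v' := ovr _ _ v.
have hF := hist_fok w hp; have np := hvoc_nonprime w.
have nX : all is_name (t_voc X) by case: hx => -[].
have wh : hwf P (X :: h) by exists P; split.
have hpX := pok_cat hx hp.
have wpre : dwf (hvoc h) (P ++ t_voc X) (t_pre X) by case: hx.
have hp1 : pok (hvoc (X :: h)) P := upd_pok hx hp.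
have eX q : q \in t_voc X -> look h v' q = (q \in x).
  move=> qX; have [[qV _] _] := xok_notin hx qX.
  by rewrite (look_notin _ w) // /v' /ovr qX.
have eV : {in hvoc h ++ P, look h v' =1 look h v}.
  apply: look_dep => // q qn; rewrite /v' /ovr; case: ifP => // /(xok_notin hx)[[qV qP] _].
  by move: qn; rewrite mem_cat (negbTE qP) orbF => /nms_sub; rewrite (negbTE qV).
rewrite /tr trans_upd bsatp_imp; congr (_ ==> _).
  rewrite (trans_dset (P := P) (V := hvoc h)) //; last by move=> q /(xok_notin hx)[[]].
  have ht := trans_over np hpX (fok_cat _ hF) wpre.
  apply: bsatp_over ht _ => q; rewrite catA mem_cat /ovr.
  case: (boolP (q \in t_voc X)) => qX; first by rewrite eX.
  by rewrite orbF => qV; rewrite eV.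
rewrite bsatp_upd (hist_circ w nX).
have ht : bover (hvoc (X :: h) ++ P) (trans (update (hstr h) X) phi).
  apply: trans_over => //; first exact: upd_nonprime hx np.
  exact: (hist_fok wh hp1).
have un r : r \in hvoc h ++ P -> r \notin map (Circ (kc h)) (t_changed X).
  move=> rV; apply/mapP => -[q _ e]; move: rV; rewrite e mem_cat.
  by case/orP=> [/(hvoc_circ w)|/(pok_name hp) //]; rewrite ltnn.
have VX r : r \in hvoc h ++ P -> (r \in t_voc X) = false.
  move=> rV; apply/negP => /(xok_notin hx)[[a b] _].
  by move: rV; rewrite mem_cat (negbTE a) (negbTE b).
apply: bsatp_over ht _ => p; rewrite mem_cat (mem_hvoc _ wh) => pU.
case: (boolP (p \in t_changed X)) => pc.
  rewrite [look _ _ _]/= pc; apply: bsatp_over (xok_change hx pc) _ => r.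
  rewrite !mem_cat => rU; case: ifP => rX; first by rewrite eX.
  rewrite rX /= in rU; have rV : r \in hvoc h ++ P by rewrite mem_cat.
  by rewrite uncopy_notin ?un // eV.
rewrite t_change_notin // /= (negbTE pc).
case: (boolP (p \in t_voc X)) pU => pX pU.
  have [_] := xok_notin hx pX; rewrite -(eX _ pX).
  by case: p {pc pX pU}.
case: (boolP (p \in map (Circ (kc h)) (t_changed X))) pU => pm pU.
  case/mapP: pm => q qc ->; rewrite uncopy_mem // eqxx qc /= eV //.
  by rewrite mem_cat (xok_changed hx qc).
have pV : p \in hvoc h ++ P by rewrite mem_cat; move: pU; rewrite orbF orbF.
rewrite uncopy_notin //; case: p pV pc pX pm {pU} => [n|k q|q] pV pc pX pm; try by rewrite eV.
case: ifP => [/andP[/eqP ek qc]|_]; last by rewrite eV.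
by rewrite ek map_f in pm.
Qed.

Lemma lawv_nil v : lawv [::] v = bsatp v (k_law K0).
Proof. by []. Qed.

(** The law of an updated structure is checked by going back through the history, one precondition
    at a time. *)
Lemma lawv_cons P h X v : hwf P (X :: h) -> pok (hvoc (X :: h)) P ->
  lawv (X :: h) v = lawv h v && tr h v (t_pre X).
Proof.
move=> wh hp; have [Q [QP [w hx]]] := wh; have hq := hvoc_pok QP hp.
have hF := hist_fok w hq; have np := hvoc_nonprime w.
have nX : all is_name (t_voc X) by case: hx => -[].
have ec := hist_circ w nX.
have hpX := pok_cat hx hq.
have ht : bover (hvoc h ++ Q ++ t_voc X) (trans (hstr h) (t_pre X)).
  by apply: trans_over hpX (fok_cat _ hF) _ => //; case: hx.
have wQ : hwf Q (X :: h) by exists Q; split.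
have hQ : pok (hvoc (X :: h)) Q := upd_pok hx hq.
have pull b : bover (hvoc h ++ Q ++ t_voc X) b ->
   bsatp (look (X :: h) v) (bcopy (t_changed X) (Circ (kc h)) b) = bsatp (look h v) b.
  by move=> hb; rewrite bsatp_bcopy; apply: bsatp_over hb _ => p pV; apply: look_pull wQ hQ pV.
have [_ hl _] := hF.
have hl' : bover (hvoc h ++ Q ++ t_voc X) (BAnd (b_law (hstr h)) (trans (hstr h) (t_pre X))).
  by rewrite bover_and ht andbT; apply: bover_sub hl _ => p; rewrite !mem_cat => /orP[->|->]; rewrite ?orbT.
rewrite /lawv /tr hstr_law ec bsatp_and (pull _ hl') bsatp_and.
(* The equivalences that define the changed atoms hold automatically, because [look] computes these
   atoms from their postconditions. *)
suff -> : bsatp (look (X :: h) v) (bands [seq biff (BAtom q) (bcopy (t_changed X) (Circ (kc h)) (t_change X q)) | q <- t_changed X]).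
  by rewrite andbT.
rewrite bsatp_bands_iff; apply/allP => q qc.
rewrite pull; last first.
  apply: bover_sub (xok_change hx qc) _ => p; rewrite !mem_cat.
  by case/or3P=> ->; rewrite ?orbT.
by rewrite /= qc.
Qed.

Definition obsok (i : A) h (v v' : valu) : bool :=
  all (fun p => v p == v' p) (k_obs K0 i) &&
  all (fun X : transformer A => all (fun p => v p == v' p) (t_obs X i)) h.

(** Observation formulas are renamed along with the atoms, so they always compare the values that
    the observed atoms had when they were introduced. These are the values given to the names by the
    two valuations. *)
Lemma obs_look P i h v v' : hwf P h -> pok (hvoc h) P ->
  bsatp (pairv (look h v) (look h v')) (b_obs (hstr h) i) = obsok i h v v'.
Proof.
elim: h P => [|X h IH] P.
  move=> _ _; rewrite /obsok andbT [b_obs _]/= /obs_form bsatp_bands_iff.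
  by apply: eq_in_all => p /base_obs/(allP base_names); case: p.
move=> wh hp; have [Q [QP [w hx]]] := wh; have hq := hvoc_pok QP hp.
have hF := hist_fok w hq; have np := hvoc_nonprime w.
have nX : all is_name (t_voc X) by case: hx => -[].
have ec := hist_circ w nX.
have npc : nonprime (t_changed X) by move=> p /(xok_changed hx)/np.
have -> : obsok i (X :: h) v v' = all (fun p => v p == v' p) (t_obs X i) && obsok i h v v'.
  by rewrite /obsok /= andbCA.
rewrite hstr_obs ec bsatp_and bsatp_ocopy // andbC.
congr (_ && _).
  rewrite /obs_form bsatp_bands_iff; apply: eq_in_all => p pO.
  have pX : p \in t_voc X by case: hx => _ _ _ _ [_ o]; apply: o pO.
  have [[pV _] pn] := xok_notin hx pX.
  have pc : p \notin t_changed X by apply: contra pV => /(xok_changed hx).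
  have e u : look (X :: h) u p = u p.
    rewrite /= (negbTE pc) -(look_notin u w pV).
    by case: p pn {pO pX pV pc}.
  have -> : bsatp (pairv (look (X :: h) v) (look (X :: h) v')) (BAtom (Prime p)) = look (X :: h) v' p by [].
  have -> : bsatp (pairv (look (X :: h) v) (look (X :: h) v')) (BAtom p) = look (X :: h) v p.
    by case: p pn {pO pX pV pc e}.
  by rewrite !e.
rewrite -(IH _ w hq); have [_ _ ho] := hF; apply: bsatp_over (ho i) _ => p.
rewrite mem_cat => /orP[pV|/mapP[q qV ->]].
  have lk := look_pull v wh hp (p := p); rewrite mem_cat pV in lk.
  move: (lk isT) (np _ pV); rewrite /ocopy.
  by case: p pV {lk} => // [n|k q] pV; case: ifP => _ e _; exact: e.
have lk := look_pull v' wh hp (p := q); rewrite mem_cat qV in lk.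
by move: (lk isT); rewrite /ocopy; case: ifP => _ e; exact: e.
Qed.

(** The way back from a state to the names: the value before the newest update is found at the copy
    for a changed atom, and at the atom itself otherwise. *)
Fixpoint down h (v : valu) : valu :=
  if h is X :: h' then
    down h' (fun p => v (if p \in t_changed X then Circ (kc h') p else p))
  else v.

Lemma down_notin P h v p : hwf P h -> p \notin hvoc h -> down h v p = v p.
Proof.
elim: h P v => [|X h IH] P v //= w; rewrite (mem_hvoc _ w) !negb_or => /and3P[pV pX pc].
move: w => [Q [_ [w hx]]]; rewrite (IH _ _ w pV).
by case: ifP => // /(xok_changed hx); rewrite (negbTE pV).
Qed.

(** Every state of the updated structure comes from a valuation of the names: the values of the
    names are recovered by [down], and the law forces the changed atoms to be what [look]
    computes. *)
Lemma look_down P h v u : hwf P h -> pok (hvoc h) P -> {in P, u =1 v} ->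
  bsatp u (b_law (hstr h)) ->
  {in hvoc h, look h (ovr (nms h) (down h u) v) =1 u}.
Proof.
elim: h P v u => [|X h IH] P v u.
  by move=> _ _ _ _ p pV; rewrite /= /ovr pV.
move=> wh hp eP; have [Q [QP [w hx]]] := wh; have hq := hvoc_pok QP hp.
have hF := hist_fok w hq; have np := hvoc_nonprime w.
have nX : all is_name (t_voc X) by case: hx => -[].
have ec := hist_circ w nX.
(* [u0] is the state before the newest update, read off from the copies; the first part of the law
   says that it satisfies the older law. *)
rewrite hstr_law ec bsatp_and bsatp_bcopy bsatp_and; set u0 := fun p : atom => _; case/andP=> /andP[l0 _].
rewrite bsatp_bands_iff => /allP lc.
set v1 := ovr _ _ v => p.
have PV q : q \in Q -> q \notin hvoc h by move/(pok_notin hq).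
have eQ0 : {in Q, u0 =1 v}.
  move=> q qQ; rewrite /u0; have := PV _ qQ; case: ifP => [/(xok_changed hx) ->//|_ _].
  exact: eP (QP _ qQ).
have IH0 := IH _ _ _ w hq eQ0 l0.
have XV q : q \in t_voc X -> q \notin hvoc h by move/(xok_notin hx)=> [[]].
have v1X q : q \in t_voc X -> v1 q = u0 q.
  by move=> qX; rewrite /v1 /ovr /= mem_cat qX /= -/u0 (down_notin _ w (XV _ qX)).
have v1Q q : q \in Q -> v1 q = v q.
  move=> qQ; rewrite /v1 /ovr /= mem_cat; have qP := QP _ qQ.
  have -> : (q \in t_voc X) = false by apply/negP => /(xok_notin hx)[[_ /negP]].
  by case: ifP => // /nms_sub; rewrite (negbTE (PV _ qQ)).
have lkV : {in hvoc h, look h v1 =1 u0}.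
  move=> q qV; rewrite -IH0 //; apply: (look_dep w hq); last by rewrite mem_cat qV.
  move=> r; rewrite mem_cat /v1 /ovr /= !mem_cat => /orP[rn|rQ]; first by rewrite rn orbT.
  have -> : (r \in t_voc X) = false by apply/negP => /(xok_notin hx)[[_ /negP]].
  by [].
have lk : {in hvoc h ++ t_voc X ++ Q, look h v1 =1 u0}.
  move=> q; rewrite !mem_cat => /or3P[/lkV //|qX|qQ].
    by rewrite (look_notin _ w (XV _ qX)) v1X.
  by rewrite (look_notin _ w (PV _ qQ)) v1Q // eQ0.
rewrite (mem_hvoc _ wh) => pU /=; case: (boolP (p \in t_changed X)) => pc.
  have := lc _ pc; rewrite [bsatp _ (BAtom p)]/= => /eqP ->; rewrite bsatp_bcopy.
  exact: bsatp_over (xok_change hx pc) lk.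
have u0p : u0 p = u p by rewrite /u0 (negbTE pc).
case: (boolP (p \in map (Circ (kc h)) (t_changed X))) pU => [/mapP[q qc ->] _|pm].
  by rewrite eqxx qc /= lkV ?(xok_changed hx) // /u0 qc.
rewrite orbF => pV; have lp : look h v1 p = u p.
  by rewrite lk ?u0p // !mem_cat; case/orP: pV => ->; rewrite ?orbT.
case: p {pV pc u0p} pm lp => // k q pm lp; case: ifP => // /andP[/eqP ek qc].
by rewrite ek map_f in pm.
Qed.

(** The quantifier over states of the updated structure becomes one over valuations of the names:
    [look] maps a valuation that satisfies the law to a state, and [look_down] shows that all states
    are reached. *)
Lemma tr_K P h v i phi : hwf P h -> pok (hvoc h) P -> dwf (hvoc h) P phi ->
  tr h v (DK i phi) <->
  forall v' : valu, (forall p, p \notin nms h -> v' p = v p) ->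
    obsok i h v v' -> lawv h v' -> tr h v' phi.
Proof.
move=> w hp wp; have hF := hist_fok w hp; have np := hvoc_nonprime w.
rewrite /tr (trans_K_sem _ _ np hp hF wp).
have ht := trans_over np hp hF wp; have [_ hl ho] := hF.
have ob v1 t : {in hvoc h, t =1 look h v1} ->
   bsatp (pairv (look h v) t) (b_obs (hstr h) i) = obsok i h v v1.
  move=> e; rewrite -(obs_look i _ _ w hp); apply: bsatp_over (ho i) _ => p.
  rewrite mem_cat => /orP[pV|/mapP[q qV ->]]; last by rewrite /pairv e.
  by have := np _ pV; case: p pV.
have nP p : p \in P -> p \notin nms h.
  by move=> pP; apply: contra (pok_notin hp pP) => /nms_sub.
split=> H.
  move=> v' e o l.
  have ev : {in hvoc h ++ P, ovr (hvoc h) (look h v') (look h v) =1 look h v'}.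
    move=> p; rewrite mem_cat /ovr; case: ifP => //= _ pP.
    by rewrite !(look_param _ w hp) // e // nP.
  rewrite -(bsatp_over ht ev); apply: H; first by rewrite (bsatp_over hl ev).
  by rewrite (ob v').
move=> t l o; set u := ovr _ t _ in l *.
pose v' := ovr (nms h) (down h u) v.
have eP : {in P, u =1 v}.
  by move=> p pP; rewrite /u /ovr (negbTE (pok_notin hp pP)) (look_param _ w hp).
have lk := look_down w hp eP l; rewrite -/v' in lk.
have ev : {in hvoc h ++ P, look h v' =1 u}.
  move=> p; rewrite mem_cat => /orP[/lk //|pP].
  by rewrite (look_param _ w hp) // eP // /v' /ovr (negbTE (nP _ pP)).
rewrite -(bsatp_over ht ev); apply: H.
- by move=> p pn; rewrite /v' /ovr (negbTE pn).
- by rewrite -(ob _ t) // => p pV; rewrite lk // /u /ovr pV.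
- by rewrite /lawv (bsatp_over hl ev).
Qed.

End Hist.

(** * The model checking program *)

Lemma tree_eq_dec (x y : tree) : decidable (x = y).
Proof. by rewrite /decidable; decide equality. Defined.

HB.instance Definition _ := hasDecEq.Build tree (compareP tree_eq_dec).

Lemma polyf_call k g : polyf g -> polyf (fun x => eCall k (g x)).
Proof.
move=> h; apply: polyf_pair h; do 3 apply: (polyf_pair polyf_Lf).
elim: k => [|k IH] /=; first exact: polyf_Lf.
exact: polyf_pair polyf_Lf IH.
Qed.

Lemma polyf_ite f g h : polyf f -> polyf g -> polyf h -> polyf (fun x => eIte (f x) (g x) (h x)).
Proof.
by move=> pf pg ph; apply: polyf_pair (polyf_pair pf (polyf_pair pg ph)); polyf_auto.
Qed.

Lemma polyf_const t : polyf (fun=> t).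
Proof. by elim: t => [|l IHl r IHr]; [exact: polyf_Lf|exact: polyf_pair IHl IHr]. Qed.

Lemma tsz_cnat n : tsz (cnat n) = 2 * n + 1.
Proof. by elim: n => //= n ->; lia. Qed.

Lemma tsz_call k a : tsz (eCall k a) = tsz a + 2 * k + 8.
Proof. by rewrite /= tsz_cnat; lia. Qed.

Lemma tsz_ite a b c : tsz (eIte a b c) = tsz a + tsz b + tsz c + 8.
Proof. by rewrite /=; lia. Qed.

Notation eAnd a b := (eIte a b eF).
Notation eOr a b := (eIte a eT b).
Notation eNot a := (eIte a eF eT).
(** Arguments are right-nested tuples: [f1], [f2], ... are components that are followed by others,
    and [g2], [g3], ... are the last component of a pair, a triple, and so on. *)
Notation f1 a := (hd a).
Notation f2 a := (hd (tl a)).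
Notation f3 a := (hd (tl (tl a))).
Notation f4 a := (hd (tl (tl (tl a)))).
Notation f5 a := (hd (tl (tl (tl (tl a))))).
Notation g2 a := (tl a).
Notation g3 a := (tl (tl a)).
Notation g4 a := (tl (tl (tl a))).
Notation g5 a := (tl (tl (tl (tl a)))).

(** The numbers are positions in [bodies]. A body does not run other procedures but returns an
    expression that calls them. *)
Notation cEQ := (eCall 0).
Notation cMEM := (eCall 1).
Notation cMEMK := (eCall 2).
Notation cUNIQ := (eCall 3).
Notation cUNIQK := (eCall 4).
Notation cSUB := (eCall 5).
Notation cNAMES := (eCall 6).
Notation cLT := (eCall 7).
Notation cBEF := (eCall 8).
Notation cLEV := (eCall 9).
Notation cNOK := (eCall 10).
Notation cNOKS := (eCall 11).
Notation cHASC := (eCall 12).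
Notation cCHS := (eCall 13).
Notation cOBSC := (eCall 14).
Notation cCNT := (eCall 15).
Notation cINV := (eCall 16).
Notation cINP := (eCall 17).
Notation cDISJ := (eCall 18).
Notation cBO := (eCall 19).
Notation cPOST := (eCall 20).
Notation cDW := (eCall 21).
Notation cSUBK := (eCall 22).
Notation cASSOC := (eCall 23).
Notation cLOOK := (eCall 24).
Notation cLOOKK := (eCall 25).
Notation cBS := (eCall 26).
Notation cE := (eCall 27).
Notation cSETX := (eCall 28).
Notation cKQ := (eCall 29).
Notation cOBSH := (eCall 30).
Notation cOBSI := (eCall 31).
Notation cOBSL := (eCall 32).
Notation cLAW := (eCall 33).
Notation cBDDR := (eCall 34).
Notation cBDDN := (eCall 35).
Notation cBDDA := (eCall 36).
Notation cMAIN := (eCall 37).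
Notation cSTART := (eCall 38).
Notation cPR := (eCall 39).

Definition bEQ a := if isLf (f1 a) then (if isLf (g2 a) then eT else eF) else
  if isLf (g2 a) then eF else
  eAnd (cEQ (Nd (hd (f1 a)) (hd (g2 a)))) (cEQ (Nd (tl (f1 a)) (tl (g2 a)))).
Definition bMEM a := if isLf (g2 a) then eF else
  eOr (cEQ (Nd (f1 a) (hd (g2 a)))) (cMEM (Nd (f1 a) (tl (g2 a)))).
Definition bMEMK a := if isLf (g2 a) then eF else
  eOr (cEQ (Nd (f1 a) (hd (hd (g2 a))))) (cMEMK (Nd (f1 a) (tl (g2 a)))).
Definition bUNIQ a := if isLf a then eT else
  eAnd (eNot (cMEM (Nd (hd a) (tl a)))) (cUNIQ (tl a)).
Definition bUNIQK a := if isLf a then eT else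
  eAnd (eNot (cMEMK (Nd (hd (hd a)) (tl a)))) (cUNIQK (tl a)).
Definition bSUB a := if isLf (f1 a) then eT else
  eAnd (cMEM (Nd (hd (f1 a)) (g2 a))) (cSUB (Nd (tl (f1 a)) (g2 a))).
Definition bNAMES a := if isLf a then eT else
  if isLf (hd (hd a)) then cNAMES (tl a) else eF.
Definition bLT a := if isLf (g2 a) then eF else if isLf (f1 a) then eT else
  cLT (Nd (tl (f1 a)) (tl (g2 a))).
Definition bBEF a := if isLf (f1 a) then eF else
  eIte (cEQ (Nd (hd (f1 a)) (g3 a))) eF
   (eIte (cEQ (Nd (hd (f1 a)) (f2 a))) eT (cBEF (Nd (tl (f1 a)) (Nd (f2 a) (g3 a))))).
(* The label of a diagram node is 0 or 1 for a leaf and 2 otherwise. *)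
Definition bLEV a := if isLf (f3 a) then eT else
  if isLf (g4 a) then
    if isLf (tl (hd (hd (f3 a)))) then eT else cBEF (Nd (f1 a) (Nd (f2 a) (hd (tl (hd (f3 a))))))
  else cLEV (Nd (f1 a) (Nd (f2 a) (Nd (tl (f3 a)) (tl (g4 a))))).
Definition bNOK a := if isLf (tl (hd (g4 a))) then eT else
  eAnd (cMEM (Nd (hd (tl (g4 a))) (f1 a)))
   (eAnd (cLT (Nd (hd (tl (tl (g4 a)))) (f3 a)))
    (eAnd (cLT (Nd (tl (tl (tl (g4 a)))) (f3 a)))
     (eAnd (eNot (cEQ (Nd (hd (tl (tl (g4 a)))) (tl (tl (tl (g4 a)))))))
      (eAnd (cLEV (Nd (f1 a) (Nd (hd (tl (g4 a))) (Nd (f2 a) (hd (tl (tl (g4 a))))))))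
        (cLEV (Nd (f1 a) (Nd (hd (tl (g4 a))) (Nd (f2 a) (tl (tl (tl (g4 a)))))))))))).
Definition bNOKS a := if isLf (g4 a) then eT else
  eAnd (cNOK (Nd (f1 a) (Nd (f2 a) (Nd (f3 a) (hd (g4 a))))))
   (cNOKS (Nd (f1 a) (Nd (f2 a) (Nd (Nd Lf (f3 a)) (tl (g4 a)))))).
Definition bHASC a := if isLf (g2 a) then eF else
  if isLf (tl (hd (hd (g2 a)))) then cHASC (Nd (f1 a) (tl (g2 a))) else
  eOr (cEQ (Nd (f1 a) (hd (tl (tl (hd (g2 a)))))))
   (eOr (cEQ (Nd (f1 a) (tl (tl (tl (hd (g2 a))))))) (cHASC (Nd (f1 a) (tl (g2 a))))).
Definition bCHS a := if isLf (tl (g3 a)) then eT else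
  eAnd (cHASC (Nd (f2 a) (f1 a))) (cCHS (Nd (f1 a) (Nd (Nd Lf (f2 a)) (tl (g3 a))))).
Definition bOBSC a := if isLf (f1 a) then eT else
  eAnd (cUNIQ (hd (f1 a))) (eAnd (cSUB (Nd (hd (f1 a)) (g2 a))) (cOBSC (Nd (tl (f1 a)) (g2 a)))).
(** A history lists the updates, newest first. It ends in a leaf paired with the vocabulary, the
    diagram and the observations of the initial structure; a transformer is never a leaf, so the
    leaf marks the end. *)
Definition bCNT a := if isLf (hd (g2 a)) then (if isLf (f1 a) then eT else eF) else
  if isLf (f3 (hd (g2 a))) then cCNT (Nd (f1 a) (tl (g2 a))) else
  if isLf (f1 a) then eF else cCNT (Nd (tl (f1 a)) (tl (g2 a))).
(* For p = Circ k q: q is changed by the newest update and k is its stamp. *)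
Definition eCIRC p h := if isLf (hd p) then eF else if isLf (tl (hd p)) then
  eAnd (cMEMK (Nd (tl (tl p)) (f3 (hd h)))) (cCNT (Nd (hd (tl p)) (tl h))) else eF.
Definition bINV a := if isLf (hd (g2 a)) then cMEM (Nd (f1 a) (hd (tl (g2 a)))) else
  eOr (cMEM (Nd (f1 a) (hd (hd (g2 a)))))
   (eOr (eCIRC (f1 a) (g2 a)) (cINV (Nd (f1 a) (tl (g2 a))))).
Definition bINP a := if isLf (g2 a) then eF else
  eOr (cMEM (Nd (f1 a) (hd (g2 a)))) (cINP (Nd (f1 a) (tl (g2 a)))).
Definition bDISJ a := if isLf (f1 a) then eT else
  eIte (cINV (Nd (hd (f1 a)) (f2 a))) eF
   (eIte (cINP (Nd (hd (f1 a)) (g3 a))) eF (cDISJ (Nd (tl (f1 a)) (Nd (f2 a) (g3 a))))).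
Definition tag_case (t a0 a1 a2 a3 a4 a5 a6 : tree) :=
  if isLf t then a0 else if isLf (tl t) then a1 else if isLf (tl (tl t)) then a2 else
  if isLf (tl (tl (tl t))) then a3 else if isLf (tl (tl (tl (tl t)))) then a4 else
  if isLf (tl (tl (tl (tl (tl t))))) then a5 else
  if isLf (tl (tl (tl (tl (tl (tl t)))))) then a6 else eF.
Definition bBO a := tag_case (hd (f1 a)) eT eT
  (eOr (cINV (Nd (tl (f1 a)) (f2 a))) (cINP (Nd (tl (f1 a)) (g3 a))))
  (cBO (Nd (tl (f1 a)) (g2 a)))
  (eAnd (cBO (Nd (hd (tl (f1 a))) (g2 a))) (cBO (Nd (tl (tl (f1 a))) (g2 a)))) eF eF.
Definition bPOST a := if isLf (f1 a) then eT else
  eAnd (cBO (Nd (tl (hd (f1 a))) (g2 a))) (cPOST (Nd (tl (f1 a)) (g2 a))).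
(* X = (V+, (pre, (post, obs))) *)
Definition eUPD X x psi h P :=
  eAnd (cUNIQ (f1 X)) (eAnd (cNAMES (f1 X)) (eAnd (cDISJ (Nd (f1 X) (Nd h P)))
   (eAnd (cDW (Nd (f2 X) (Nd h (Nd (f1 X) P)))) (eAnd (cUNIQK (f3 X)) (eAnd (cSUBK (Nd (f3 X) h))
    (eAnd (cPOST (Nd (f3 X) (Nd h (Nd (f1 X) P)))) (eAnd (cOBSC (Nd (g4 X) (f1 X)))
     (eAnd (cUNIQ x) (eAnd (cSUB (Nd x (f1 X))) (cDW (Nd psi (Nd (Nd X h) P)))))))))))).
Definition bDW a := tag_case (hd (f1 a)) eT eT
  (eOr (cINV (Nd (tl (f1 a)) (f2 a))) (cINP (Nd (tl (f1 a)) (g3 a))))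
  (cDW (Nd (tl (f1 a)) (g2 a)))
  (eAnd (cDW (Nd (hd (tl (f1 a))) (g2 a))) (cDW (Nd (tl (tl (f1 a))) (g2 a))))
  (cDW (Nd (tl (tl (f1 a))) (g2 a)))
  (eUPD (hd (tl (f1 a))) (hd (tl (tl (f1 a)))) (tl (tl (tl (f1 a)))) (f2 a) (g3 a)).
Definition bSUBK a := if isLf (f1 a) then eT else
  eAnd (cINV (Nd (hd (hd (f1 a))) (g2 a))) (cSUBK (Nd (tl (f1 a)) (g2 a))).
Definition bASSOC a := if isLf (g2 a) then eF else
  eIte (cEQ (Nd (f1 a) (hd (hd (g2 a))))) (if isLf (tl (hd (g2 a))) then eF else eT)
    (cASSOC (Nd (f1 a) (tl (g2 a)))).
Definition bLOOK a := if isLf (hd (f2 a)) then cASSOC (Nd (f1 a) (g3 a)) else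
  cLOOKK (Nd (f1 a) (Nd (f3 (hd (f2 a))) (g2 a))).
Definition bLOOKK a := if isLf (f2 a) then
    eIte (eCIRC (f1 a) (f3 a)) (cLOOK (Nd (tl (tl (f1 a))) (Nd (tl (f3 a)) (g4 a))))
      (cLOOK (Nd (f1 a) (Nd (tl (f3 a)) (g4 a))))
  else eIte (cEQ (Nd (f1 a) (hd (hd (f2 a))))) (cBS (Nd (tl (hd (f2 a))) (Nd (tl (f3 a)) (g4 a))))
    (cLOOKK (Nd (f1 a) (Nd (tl (f2 a)) (g3 a)))).
Definition bBS a := tag_case (hd (f1 a)) eT eF (cLOOK (Nd (tl (f1 a)) (g2 a)))
  (eNot (cBS (Nd (tl (f1 a)) (g2 a))))
  (eAnd (cBS (Nd (hd (tl (f1 a))) (g2 a))) (cBS (Nd (tl (tl (f1 a))) (g2 a)))) eF eF.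
Definition bE a := tag_case (hd (f1 a)) eT eF (cLOOK (Nd (tl (f1 a)) (g2 a)))
  (eNot (cE (Nd (tl (f1 a)) (g2 a))))
  (eAnd (cE (Nd (hd (tl (f1 a))) (g2 a))) (cE (Nd (tl (tl (f1 a))) (g2 a))))
  (cKQ (Nd Lf (Nd (f2 a) (Nd (g3 a) (Nd (hd (tl (f1 a))) (Nd (tl (tl (f1 a))) (g2 a)))))))
  (cSETX (Nd (hd (hd (tl (f1 a)))) (Nd (hd (tl (tl (f1 a)))) (Nd (hd (tl (f1 a)))
    (Nd (tl (tl (tl (f1 a)))) (g2 a)))))).
(** The atoms of $V^+$ receive their values in front of the valuation, one per call; then the
    implication from the precondition to the formula after the event is evaluated. *)
Definition bSETX a := if isLf (f1 a) then
    eIte (cE (Nd (f2 (f3 a)) (g5 a))) (cE (Nd (f4 a) (Nd (Nd (f3 a) (hd (g5 a))) (tl (g5 a))))) eT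
  else eIte (cMEM (Nd (hd (f1 a)) (f2 a)))
    (cSETX (Nd (tl (f1 a)) (Nd (f2 a) (Nd (f3 a) (Nd (f4 a) (Nd (f5 a)
       (Nd (Nd (hd (f1 a)) (Nd Lf Lf)) (tl (g5 a)))))))))
    (cSETX (Nd (tl (f1 a)) (Nd (f2 a) (Nd (f3 a) (Nd (f4 a) (Nd (f5 a)
       (Nd (Nd (hd (f1 a)) Lf) (tl (g5 a))))))))).
(* Arguments: the names still to be assigned, the part of the history whose
   names remain, the new valuation, the agent, the formula, and the current
   history and valuation. *)
Definition bKQ a := if isLf (f1 a) then
    if isLf (f2 a) then
      eIte (cOBSH (Nd (f4 a) (Nd (hd (tl (g5 a))) (Nd (tl (tl (g5 a))) (f3 a)))))
       (eIte (cLAW (Nd (hd (tl (g5 a))) (f3 a)))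
         (cE (Nd (f5 a) (Nd (hd (tl (g5 a))) (f3 a)))) eT) eT
    else if isLf (hd (f2 a)) then cKQ (Nd (hd (tl (f2 a))) (Nd Lf (g3 a)))
    else cKQ (Nd (hd (hd (f2 a))) (Nd (tl (f2 a)) (g3 a)))
  else eAnd (cKQ (Nd (tl (f1 a)) (Nd (f2 a) (Nd (Nd (Nd (hd (f1 a)) (Nd Lf Lf)) (f3 a)) (g4 a)))))
            (cKQ (Nd (tl (f1 a)) (Nd (f2 a) (Nd (Nd (Nd (hd (f1 a)) Lf) (f3 a)) (g4 a))))).
Definition bOBSH a := if isLf (hd (f2 a)) then cOBSI (Nd (f1 a) (Nd (tl (tl (tl (f2 a)))) (g3 a)))
  else eAnd (cOBSI (Nd (f1 a) (Nd (g4 (hd (f2 a))) (g3 a)))) (cOBSH (Nd (f1 a) (Nd (tl (f2 a)) (g3 a)))).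
Definition bOBSI a := if isLf (f1 a) then cOBSL (Nd (hd (f2 a)) (g3 a)) else
  cOBSI (Nd (tl (f1 a)) (Nd (tl (f2 a)) (g3 a))).
Definition bOBSL a := if isLf (f1 a) then eT else
  eAnd (eIte (cASSOC (Nd (hd (f1 a)) (f2 a))) (cASSOC (Nd (hd (f1 a)) (g3 a)))
          (eNot (cASSOC (Nd (hd (f1 a)) (g3 a)))))
    (cOBSL (Nd (tl (f1 a)) (g2 a))).
Definition bLAW a := if isLf (hd (f1 a)) then
    cBDDR (Nd (hd (tl (tl (f1 a)))) (Nd (hd (tl (tl (f1 a)))) (g2 a)))
  else eAnd (cLAW (Nd (tl (f1 a)) (g2 a))) (cE (Nd (f2 (hd (f1 a))) (Nd (tl (f1 a)) (g2 a)))).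
(** The root is the last node of the list. A child is fetched by counting its unary position down
    from the start of the whole diagram, which is kept as a further argument. *)
Definition bBDDR a := if isLf (tl (f2 a)) then cBDDN (Nd (hd (f2 a)) (Nd (f1 a) (g3 a)))
  else cBDDR (Nd (f1 a) (Nd (tl (f2 a)) (g3 a))).
Definition bBDDN a := if isLf (hd (f1 a)) then eF else if isLf (tl (hd (f1 a))) then eT else
  eIte (cASSOC (Nd (hd (tl (f1 a))) (g3 a)))
    (cBDDA (Nd (f2 a) (Nd (tl (tl (tl (f1 a)))) (g2 a))))
    (cBDDA (Nd (f2 a) (Nd (hd (tl (tl (f1 a)))) (g2 a)))).
Definition bBDDA a := if isLf (f2 a) then cBDDN (Nd (hd (f1 a)) (g3 a)) else
  cBDDA (Nd (tl (f1 a)) (Nd (tl (f2 a)) (g3 a))).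
Definition eBASE a := Nd Lf (Nd (f1 a) (Nd (f2 a) (f3 a))).
Definition bMAIN a := if isLf (f2 a) then eF else
  eAnd (cUNIQ (f1 a)) (eAnd (cNAMES (f1 a)) (eAnd (cUNIQ (f2 a))
   (eAnd (cNOKS (Nd (f1 a) (Nd (f2 a) (Nd Lf (f2 a))))) (eAnd (cCHS (Nd (f2 a) (Nd Lf (f2 a))))
    (eAnd (cOBSC (Nd (f3 a) (f1 a))) (eAnd (cUNIQ (f4 a)) (eAnd (cSUB (Nd (f4 a) (f1 a)))
     (eAnd (cDW (Nd (g5 a) (Nd (eBASE a) Lf)))
       (cSTART (Nd (f1 a) (Nd (f4 a) (Nd (g5 a) (Nd (eBASE a) Lf)))))))))))))  .
Definition bSTART a := if isLf (f1 a) then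
    eAnd (cLAW (g4 a)) (cE (Nd (f3 a) (g4 a)))
  else eIte (cMEM (Nd (hd (f1 a)) (f2 a)))
    (cSTART (Nd (tl (f1 a)) (Nd (f2 a) (Nd (f3 a) (Nd (hd (g4 a))
       (Nd (Nd (hd (f1 a)) (Nd Lf Lf)) (tl (g4 a))))))))
    (cSTART (Nd (tl (f1 a)) (Nd (f2 a) (Nd (f3 a) (Nd (hd (g4 a))
       (Nd (Nd (hd (f1 a)) Lf) (tl (g4 a)))))))).

(* Parser actions; a list of them is run against a stack of values. *)
Definition act (n : nat) (t : tree) := Nd (cnat n) t.
Notation aPAIR := (act 0 Lf).
Notation aNAT := (act 1 Lf).
Notation aNATL := (act 2 Lf).
Notation aBIT := (act 3 Lf).
Notation aSEQ X := (act 4 X).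
Notation aATOM := (act 5 Lf).
Notation aATOMD := (act 6 Lf).
Notation aBF := (act 7 Lf).
Notation aBFD := (act 8 Lf).
Notation aPOST := (act 9 Lf).
Notation aOBS n := (act 10 n).
Notation aDF := (act 11 Lf).
Notation aDFD := (act 12 Lf).
Notation aCHK := (act 13 Lf).
Notation aBN := (act 14 Lf).
Notation aBND := (act 15 Lf).
Notation aSETM := (act 16 Lf).
Notation aFIN := (act 17 Lf).

Fixpoint pushes (l : seq tree) (t : tree) := if l is a :: l' then Nd a (pushes l' t) else t.

Definition pr t v m b := cPR (Nd t (Nd v (Nd m b))).

(* The clauses are indexed by the tag of the first action; their arguments are
   its parameter, the other actions, the values, the number of agents and the
   remaining bits. *)
Definition prs : seq (tree -> tree -> tree -> tree -> tree -> tree) := [::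
  fun _ t v m b => pr t (Nd (Nd (hd (tl v)) (hd v)) (tl (tl v))) m b;
  fun _ t v m b => pr (Nd aNATL t) (Nd Lf v) m b;
  fun _ t v m b => if isLf b then eF else if isLf (hd b) then pr t v m (tl b)
    else pr (Nd aNATL t) (Nd (Nd Lf (hd v)) (tl v)) m (tl b);
  fun _ t v m b => if isLf b then eF else pr t (Nd (hd b) v) m (tl b);
  fun x t v m b => if isLf b then eF else if isLf (hd b) then pr t (Nd Lf v) m (tl b)
    else pr (Nd x (Nd (Nd (Nd Lf (Nd Lf (Nd Lf (Nd Lf Lf)))) x) (Nd aPAIR t))) v m (tl b);
  fun _ t v m b => pr (pushes [:: aNAT; aATOMD] t) v m b;
  fun _ t v m b => tag_case (hd v) (pr (pushes [:: aSEQ aBIT; aPAIR] t) v m b)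
    (pr (pushes [:: aNAT; aATOM; aPAIR; aPAIR] t) v m b)
    (pr (pushes [:: aATOM; aPAIR] t) v m b) eF eF eF eF;
  fun _ t v m b => pr (pushes [:: aNAT; aBFD] t) v m b;
  fun _ t v m b => tag_case (hd v) (pr (Nd aPAIR t) (Nd Lf v) m b) (pr (Nd aPAIR t) (Nd Lf v) m b)
    (pr (pushes [:: aATOM; aPAIR] t) v m b)
    (pr (pushes [:: aBF; aPAIR] t) v m b)
    (pr (pushes [:: aBF; aBF; aPAIR; aPAIR] t) v m b) eF eF;
  fun _ t v m b => pr (pushes [:: aATOM; aBF; aPAIR] t) v m b;
  fun x t v m b => if isLf x then pr t (Nd Lf v) m b else
    pr (Nd (aSEQ aATOM) (Nd (Nd (cnat 10) (tl x)) (Nd aPAIR t))) v m b;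
  fun _ t v m b => pr (pushes [:: aNAT; aDFD] t) v m b;
  fun _ t v m b => tag_case (hd v) (pr (Nd aPAIR t) (Nd Lf v) m b) (pr (Nd aPAIR t) (Nd Lf v) m b)
    (pr (pushes [:: aATOM; aPAIR] t) v m b)
    (pr (pushes [:: aDF; aPAIR] t) v m b)
    (pr (pushes [:: aDF; aDF; aPAIR; aPAIR] t) v m b)
    (pr (pushes [:: aNAT; aCHK; aDF; aPAIR; aPAIR] t) v m b)
    (pr (Nd (aSEQ aATOM) (Nd aDF (Nd (aSEQ aPOST) (Nd (Nd (cnat 10) m)
      (pushes [:: aPAIR; aPAIR; aPAIR; aSEQ aATOM; aDF; aPAIR; aPAIR; aPAIR] t))))) v m b);
  fun _ t v m b => eIte (cLT (Nd (hd v) m)) (pr t v m b) eF;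
  fun _ t v m b => pr (pushes [:: aNAT; aBND] t) v m b;
  fun _ t v m b => tag_case (hd v) (pr (Nd aPAIR t) (Nd Lf v) m b) (pr (Nd aPAIR t) (Nd Lf v) m b)
    (pr (pushes [:: aATOM; aNAT; aNAT; aPAIR; aPAIR; aPAIR] t) v m b) eF eF eF eF;
  fun _ t v m b => pr (Nd (aSEQ aATOM) (Nd (aSEQ aBN) (Nd (Nd (cnat 10) (hd v))
     (pushes [:: aSEQ aATOM; aDF; aFIN] t)))) (tl v) (hd v) b;
  fun _ t v m b => if isLf b then
     cMAIN (Nd (hd (tl (tl (tl (tl v))))) (Nd (hd (tl (tl (tl v)))) (Nd (hd (tl (tl v)))
       (Nd (hd (tl v)) (hd v))))) else eF].

Fixpoint pr_dispatch (l : seq (tree -> tree -> tree -> tree -> tree -> tree)) (t a : tree) : tree :=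
  if l is c :: l' then
    if isLf t then c (tl (hd (f1 a))) (tl (f1 a)) (f2 a) (f3 a) (g4 a) else pr_dispatch l' (tl t) a
  else eF.
Definition bPR a := pr_dispatch prs (hd (hd (f1 a))) a.

Definition bodies : seq (tree -> tree) := [:: bEQ; bMEM; bMEMK; bUNIQ; bUNIQK; bSUB; bNAMES; bLT;
  bBEF; bLEV; bNOK; bNOKS; bHASC; bCHS; bOBSC; bCNT; bINV; bINP; bDISJ; bBO; bPOST; bDW; bSUBK;
  bASSOC; bLOOK; bLOOKK; bBS; bE; bSETX; bKQ; bOBSH; bOBSI; bOBSL; bLAW; bBDDR; bBDDN; bBDDA;
  bMAIN; bSTART; bPR].

Definition pinit (w : tree) : tree := pr (pushes [:: aNAT; aSETM] Lf) Lf Lf w.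

Ltac polyf_prog := repeat lazymatch goal with
  | |- polyf (fun x => x) => exact polyf_id
  | |- polyf hd => exact polyf_hd
  | |- polyf tl => exact polyf_tl
  | |- polyf (fun x => hd _) => apply polyf_hdc
  | |- polyf (fun x => tl _) => apply polyf_tlc
  | |- polyf (fun x => eIte _ _ _) => apply polyf_ite
  | |- polyf (fun x => eCall _ _) => apply polyf_call
  | |- polyf (eCall _) => apply (polyf_call _ polyf_id)
  | |- polyf (fun x => if isLf _ then _ else _) => apply polyf_if
  | |- polyf (fun _ => ?t) => exact (polyf_const t)
  | |- polyf (Nd ?t) => exact (polyf_pair (polyf_const t) polyf_id)
  | |- polyf (fun x => Nd _ _) => apply polyf_pair
  end.

Lemma polyf_bodies : all_polyf bodies.
Proof.
rewrite /bodies; repeat (apply: APcons || apply: APnil);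
  rewrite /bEQ /bMEM /bMEMK /bUNIQ /bUNIQK /bSUB /bNAMES /bLT /bBEF /bLEV /bNOK /bNOKS /bHASC /bCHS
    /bOBSC /bCNT /bINV /bINP /bDISJ /bBO /bPOST /bDW /bSUBK /bASSOC /bLOOK /bLOOKK /bBS /bE /bSETX
    /bKQ /bOBSH /bOBSI /bOBSL /bLAW /bBDDR /bBDDN /bBDDA /bMAIN /bSTART /eUPD /eCIRC /eBASE
    /tag_case; try by polyf_prog.
rewrite /bPR /prs /pr_dispatch /pr /pushes /act /tag_case; polyf_prog.
Qed.

Lemma polyf_pinit : polyf pinit.
Proof. by rewrite /pinit /pr /pushes; polyf_prog. Qed.

(** * Codes *)

Fixpoint catom (p : atom) : tree :=
  match p with
  | Atom n => Nd (cnat 0) (cbits n)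
  | Circ k q => Nd (cnat 1) (Nd (cnat k) (catom q))
  | Prime q => Nd (cnat 2) (catom q)
  end.

Definition catoms (W : seq atom) : tree := clist (map catom W).

Fixpoint cbform (b : bform) : tree :=
  match b with
  | BTop => Nd (cnat 0) Lf
  | BBot => Nd (cnat 1) Lf
  | BAtom p => Nd (cnat 2) (catom p)
  | BNeg c => Nd (cnat 3) (cbform c)
  | BAnd c d => Nd (cnat 4) (Nd (cbform c) (cbform d))
  end.

Definition cpairs (l : seq (tree * tree)) : tree := clist [seq Nd q.1 q.2 | q <- l].
Definition cpost (l : seq (atom * bform)) : tree := cpairs [seq (catom q.1, cbform q.2) | q <- l].
Definition cobs m (O : {ffun 'I_m -> seq atom}) : tree := clist [seq catoms (O i) | i <- enum 'I_m].

Definition cbnode (u : bnode) : tree :=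
  match u with
  | BLeaf b => Nd (cnat b) Lf
  | BNode p lo hi => Nd (cnat 2) (Nd (catom p) (Nd (cnat lo) (cnat hi)))
  end.
Definition cbdd (d : bdd) : tree := clist (map cbnode d).

Fixpoint cdform m (phi : dform 'I_m) : tree :=
  match phi with
  | DTop => Nd (cnat 0) Lf
  | DBot => Nd (cnat 1) Lf
  | DAtom p => Nd (cnat 2) (catom p)
  | DNeg psi => Nd (cnat 3) (cdform psi)
  | DAnd psi chi => Nd (cnat 4) (Nd (cdform psi) (cdform chi))
  | DK i psi => Nd (cnat 5) (Nd (cnat i) (cdform psi))
  | DUpd X x psi =>
      Nd (cnat 6) (Nd (Nd (catoms (t_voc X)) (Nd (cdform (t_pre X)) (Nd (cpost (t_post X)) (cobs (t_obs X)))))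
        (Nd (catoms x) (cdform psi)))
  end.

Lemma cnat_inj : injective cnat.
Proof. by elim=> [|n IH] [|m] //= [/IH ->]. Qed.

Lemma cbits_inj : injective cbits.
Proof. by elim=> [|b s IH] [|c t] //= [e /IH ->]; case: b c e => -[]. Qed.

Lemma catom_inj : injective catom.
Proof.
elim=> [n|k p IH|p IH] [m|l q|q] //= [].
- by move=> /cbits_inj ->.
- by move=> /cnat_inj -> /IH ->.
- by move=> /IH ->.
Qed.

Lemma cbnode_inj : injective cbnode.
Proof.
case=> [b|p lo hi] [c|q lo' hi'] /=.
- by case: b c => -[].
- by case: b => -[].
- by case: c => -[].
- by case=> /catom_inj -> /cnat_inj -> /cnat_inj ->.
Qed.

Lemma mem_catoms p W : (catom p \in map catom W) = (p \in W).
Proof. by rewrite mem_map //; apply: catom_inj. Qed.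

Lemma Nd_eq l r l' r' : (Nd l r == Nd l' r') = (l == l') && (r == r').
Proof. by apply/eqP/andP => [[-> ->]|[/eqP -> /eqP ->]]. Qed.

Lemma cnat_eq n m : (cnat n == cnat m) = (n == m).
Proof. by apply/eqP/eqP => [/cnat_inj|->]. Qed.

Lemma tsz_mem x l : x \in l -> tsz x < tsz (clist l).
Proof.
elim: l => //= y l IH; rewrite inE => /orP[/eqP ->|/IH]; lia.
Qed.

Lemma cpairs_cons y z l : cpairs ((y, z) :: l) = Nd (Nd y z) (cpairs l). Proof. by []. Qed.
Lemma catoms_cons p W : catoms (p :: W) = Nd (catom p) (catoms W). Proof. by []. Qed.
Lemma cbdd_cons u d : cbdd (u :: d) = Nd (cbnode u) (cbdd d). Proof. by []. Qed.

Lemma size_cbdd d : 2 * size d + 1 <= tsz (cbdd d).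
Proof. by elim: d => // u d; rewrite cbdd_cons /=; have := tsz_gt0 (cbnode u); lia. Qed.

Ltac keep_arith := repeat match goal with
  | H : ?P |- _ => lazymatch type of P with Prop =>
      lazymatch P with is_true (leq _ _) => fail | _ => clear H end end
  end.
Ltac klia := keep_arith; lia.
Ltac szt := rewrite ?(tsz_ite, tsz_call); keep_arith; simpl in *; lia.
Ltac evcall := apply: EvCall; [szt|rewrite /body [nth _ _ _]/=].

(** * Elementary procedures on lists, numbers and diagrams *)

Section Connectives.
Variable S : nat.
Notation ev := (@ev bodies S).

(** Only the test pays one unit of depth; the second conjunct replaces the conjunction and keeps the
    full depth. The constant 13 is the overhead 8 of a conditional plus the size 5 of [eF]. *)
Lemma ev_and d a b x y : tsz a + tsz b + 13 <= S -> ev d a x -> (x -> ev d.+1 b y) ->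
  ev d.+1 (eAnd a b) (x && y).
Proof.
move=> s ha hb; apply: EvIte ha _; first by szt.
by case: x hb => hb; [apply: hb|apply: EvF].
Qed.

Lemma ev_or d a b x y : tsz a + tsz b + 13 <= S -> ev d a x -> (~~ x -> ev d.+1 b y) ->
  ev d.+1 (eOr a b) (x || y).
Proof.
move=> s ha hb; apply: EvIte ha _; first by szt.
by case: x hb => hb; [apply: EvT|apply: hb].
Qed.

Lemma ev_not d a x : tsz a + 16 <= S -> ev d a x -> ev d.+1 (eNot a) (~~ x).
Proof.
move=> s ha; apply: EvIte ha _; first by szt.
by case: x; [apply: EvF|apply: EvT].
Qed.

End Connectives.

Section Ev.
Variables (S B : nat).
(** Every expression of the program combines a fixed number of data, each of size at most [B], with
    fixed tags; the constants leave ample room for this. *)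
Hypothesis hS : 1000 * B + 4000 <= S.
Notation ev := (@ev bodies S).

Lemma ev_EQ x y d : tsz x <= B -> tsz y <= B -> tsz x <= d -> ev d (cEQ (Nd x y)) (x == y).
Proof.
elim: x y d => [|l IHl r IHr] y d hx hy hd; evcall; rewrite /bEQ /=.
  by case: y hy => *; [exact: EvT|exact: EvF].
case: y hy => [|l' r'] hy; first exact: EvF.
rewrite Nd_eq /= in hx hy hd *; case: d hd => // d hd; apply: ev_and; first by szt.
  by apply: IHl; lia.
by move=> _; apply: IHr; lia.
Qed.

Lemma ev_MEM x l d : tsz x <= B -> tsz (clist l) <= B -> tsz x < d ->
  ev d (cMEM (Nd x (clist l))) (x \in l).
Proof.
move=> hx; elim: l d => [|y l IH] d hl hd; evcall; rewrite /bMEM /=; first exact: EvF.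
rewrite inE /= in hl *; case: d hd => // d hd; apply: ev_or; first by szt.
  by apply: ev_EQ; lia.
by move=> _; apply: IH; lia.
Qed.

Lemma ev_MEMK x l d : tsz x <= B -> tsz (cpairs l) <= B -> tsz x < d ->
  ev d (cMEMK (Nd x (cpairs l))) (x \in unzip1 l).
Proof.
move=> hx; elim: l d => [|[y z] l IH] d hl hd; rewrite ?cpairs_cons /= in hl *; evcall; rewrite /bMEMK /=; first exact: EvF.
rewrite inE; case: d hd => // d hd; apply: ev_or; first by szt.
  by apply: ev_EQ; lia.
by move=> _; apply: IH; lia.
Qed.

Lemma ev_UNIQ l d : tsz (clist l) <= B -> B + 2 < d -> ev d (cUNIQ (clist l)) (uniq l).
Proof.
elim: l d => [|y l IH] d hl hd; evcall; rewrite /bUNIQ /=; first exact: EvT.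
rewrite /= in hl; case: d hd => [|[|d]] hd; try by exfalso; lia.
apply: ev_and; first by szt.
  by apply: ev_not; [szt|apply: ev_MEM; lia].
by move=> _; apply: IH; lia.
Qed.

Lemma ev_UNIQK l d : tsz (cpairs l) <= B -> B + 2 < d -> ev d (cUNIQK (cpairs l)) (uniq (unzip1 l)).
Proof.
elim: l d => [|[y z] l IH] d hl hd; rewrite ?cpairs_cons /= in hl *; evcall; rewrite /bUNIQK /=; first exact: EvT.
case: d hd => [|[|d]] hd; try by exfalso; lia.
apply: ev_and; first by szt.
  by apply: ev_not; [szt|apply: ev_MEMK; lia].
by move=> _; apply: IH; lia.
Qed.

Lemma ev_SUB l m d : tsz (clist l) <= B -> tsz (clist m) <= B -> B + 2 < d ->
  ev d (cSUB (Nd (clist l) (clist m))) (all (mem m) l).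
Proof.
move=> + hm; elim: l d => [|y l IH] d hl hd; evcall; rewrite /bSUB /=; first exact: EvT.
rewrite /= in hl; case: d hd => // d hd; apply: ev_and; first by szt.
  by apply: ev_MEM; lia.
by move=> _; apply: IH; lia.
Qed.

Lemma ev_NAMES W d : tsz (catoms W) <= B -> ev d (cNAMES (catoms W)) (all is_name W).
Proof.
elim: W d => [|y l IH] d hl; evcall; rewrite /bNAMES /=; first exact: EvT.
by rewrite /catoms /= in hl *; case: y hl => [n|k q|q] /= hl; try exact: EvF; apply: IH; rewrite /catoms; lia.
Qed.

Lemma ev_LT n m d : tsz (cnat n) <= B -> tsz (cnat m) <= B -> ev d (cLT (Nd (cnat n) (cnat m))) (n < m).
Proof.
elim: n m d => [|n IH] [|m] d hn hm; evcall; rewrite /bLT /=; try exact: EvF; try exact: EvT.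
by rewrite /= in hn hm; apply: IH; lia.
Qed.

Lemma ev_BEF l p q d : tsz (clist l) <= B -> tsz p <= B -> tsz q <= B -> B + 2 < d ->
  ev d (cBEF (Nd (clist l) (Nd p q))) (index p l < index q l).
Proof.
move=> + hp hq; elim: l d => [|y l IH] d hl hd; evcall; rewrite /bBEF /=; first exact: EvF.
rewrite /= in hl; case: d hd => // d hd; apply: (EvIte (b0 := y == q)); first by szt.
  by apply: ev_EQ; lia.
case: ifP => _; first exact: EvF.
apply: (EvIte (b0 := y == p)); first by szt.
  by apply: ev_EQ; lia.
case: ifP => _; first exact: EvT.
by rewrite ltnS; apply: IH; lia.
Qed.

Lemma ev_LEV V p d n e : p \in V -> tsz (catoms V) <= B -> tsz (cbdd d) <= B -> tsz (cnat n) <= B ->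
  B + 2 < e -> ev e (cLEV (Nd (catoms V) (Nd (catom p) (Nd (cbdd d) (cnat n)))))
    (index p V < blevel V (nth (BLeaf false) d n)).
Proof.
move=> pV hV; have hp : tsz (catom p) <= B.
  by apply: leq_trans hV; apply: ltnW; apply: tsz_mem; rewrite mem_catoms.
have pl : index p V < size V by rewrite index_mem.
elim: d n e => [|u d IH] n e hd hn he; evcall; rewrite /bLEV /=.
  by rewrite nth_nil /= pl; apply: EvT.
rewrite /cbdd /= in hd *; case: n hn => [|n] hn /=; last first.
  by rewrite /= in hn; apply: IH; rewrite /cbdd; lia.
case: u hd => [[]|q lo hi] hd /=; rewrite ?pl; try exact: EvT.
rewrite -(index_map catom_inj V p) -(index_map catom_inj V q); apply: ev_BEF => //.
by rewrite /= in hd; lia.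
Qed.

Lemma ev_NOK V d i u e : tsz (catoms V) <= B -> tsz (cbdd d) <= B -> tsz (cnat i) <= B ->
  tsz (cbnode u) <= B -> B + 10 < e ->
  ev e (cNOK (Nd (catoms V) (Nd (cbdd d) (Nd (cnat i) (cbnode u)))))
    (if u is BNode p lo hi then
      [&& p \in V, lo < i, hi < i, lo != hi,
        index p V < blevel V (nth (BLeaf false) d lo)
      & index p V < blevel V (nth (BLeaf false) d hi)] else true).
Proof.
move=> hV hd hi hu he; evcall; rewrite /bNOK /=.
case: u hu => [[]|p lo hi'] hu /=; try exact: EvT.
rewrite /= in hu; case: e he => // e he; apply: ev_and; first by szt.
  by rewrite -mem_catoms; apply: ev_MEM; [lia|exact: hV|lia].
move=> pV.
apply: ev_and; first by szt.
  by apply: ev_LT; lia.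
move=> _; apply: ev_and; first by szt.
  by apply: ev_LT; lia.
move=> _; apply: ev_and; first by szt.
  case: e he => [|e] he; first by exfalso; lia.
  by rewrite -cnat_eq; apply: ev_not; [szt|apply: ev_EQ; lia].
move=> _; apply: ev_and; first by szt.
  by apply: ev_LEV => //; lia.
by move=> _; apply: ev_LEV => //; lia.
Qed.

Lemma ev_NOKS V d e i r : tsz (catoms V) <= B -> tsz (cbdd d) <= B -> d = take i d ++ r ->
  i <= size d -> B + 11 < e ->
  ev e (cNOKS (Nd (catoms V) (Nd (cbdd d) (Nd (cnat i) (cbdd r)))))
    (all (bnode_ok V d) (iota i (size r))).
Proof.
move=> hV hd; have hd2 := size_cbdd d; elim: r i e => [|u r IH] i e hr hi he.
  have hn : tsz (cnat i) <= B by rewrite tsz_cnat; lia.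
  by evcall; rewrite /bNOKS /=; apply: EvT.
have szi : size d = i + (size r).+1 by rewrite {1}hr size_cat size_takel.
have hdr : tsz (cbdd (u :: r)) <= tsz (cbdd d).
  by rewrite [X in _ <= tsz (cbdd X)]hr; elim: (take i d) => // v s; rewrite cat_cons [cbdd (v :: _)]cbdd_cons /=; lia.
have nu : nth (BLeaf false) d i = u by rewrite hr nth_cat size_takel // ltnn subnn.
have hn : tsz (cnat i) <= B by rewrite tsz_cnat; lia.
rewrite cbdd_cons /= in hdr *; evcall; rewrite /bNOKS /=.
case: e he => // e he; apply: ev_and; first by szt.
  by rewrite /bnode_ok nu; apply: ev_NOK => //; lia.
move=> _; apply: (IH i.+1) => //; try lia.
by rewrite {1}hr -[u :: r]cat1s catA; congr (_ ++ _); rewrite (take_nth (BLeaf false)) ?nu ?cats1 //; lia.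
Qed.

Lemma ev_HASC j d e : tsz (cnat j) <= B -> tsz (cbdd d) <= B -> B + 2 < e ->
  ev e (cHASC (Nd (cnat j) (cbdd d))) (has (is_child j) d).
Proof.
move=> hj; elim: d e => [|u d IH] e hd he; evcall; rewrite /bHASC /=; first exact: EvF.
rewrite /cbdd /= -/(cbdd d) in hd *; case: u hd => [[]|p lo hi] hd /=; try by apply: IH; lia.
rewrite /= in hd; case: e he => // e he; rewrite -orbA; apply: ev_or; first by szt.
  by rewrite -cnat_eq; apply: ev_EQ; lia.
move=> _; apply: ev_or; first by szt.
  by rewrite -cnat_eq; apply: ev_EQ; lia.
by move=> _; apply: IH; lia.
Qed.

Lemma ev_CHS d e j r : tsz (cbdd d) <= B -> j + size r <= size d -> B + 4 < e ->
  ev e (cCHS (Nd (cbdd d) (Nd (cnat j) (cbdd r))))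
    (all (fun j => has (is_child j) d) (iota j (size r).-1)) \/ B < tsz (cbdd r).
Proof.
move=> hd; have hd2 := size_cbdd d.
elim: r j e => [|u r IH] j e hj he; have hn : tsz (cnat j) <= B by rewrite tsz_cnat; lia.
  by left; evcall; rewrite /bCHS /=; apply: EvT.
case: (leqP (tsz (cbdd (u :: r))) B) => hr; last by right.
left; rewrite /cbdd /= -/(cbdd d) -/(cbdd r) in hr hj *.
evcall; rewrite /bCHS /=.
case: r IH hj hr => [|v r] IH hj hr; first exact: EvT.
have {}IH := IH j.+1 e; rewrite [isLf _]/=.
case: e he IH => // e he IH; apply: ev_and; first by szt.
  by apply: ev_HASC; [rewrite tsz_cnat; move: hj; rewrite /=; lia|exact: hd|lia].
by move=> _; case: IH => //; [move: hj; rewrite /=; lia|move: hr; rewrite /=; lia].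
Qed.

Lemma ev_OBSC m (O : {ffun 'I_m -> seq atom}) V e : tsz (cobs O) <= B -> tsz (catoms V) <= B ->
  B + 5 < e -> ev e (cOBSC (Nd (cobs O) (catoms V))) [forall i, uniq (O i) && all (mem V) (O i)].
Proof.
move=> hO hV he.
have -> : [forall i, uniq (O i) && all (mem V) (O i)] =
          all (fun i => uniq (O i) && all (mem V) (O i)) (enum 'I_m).
  by apply/forallP/allP => [h i _|h i]; apply: h => //; rewrite mem_enum.
rewrite /cobs in hO *; elim: (enum 'I_m) e he hO => [|i l IH] e he hO; evcall; rewrite /bOBSC /=.
  exact: EvT.
rewrite /= in hO; case: e he => // e he; rewrite -andbA; apply: ev_and; first by szt.
  by rewrite -(map_inj_uniq catom_inj); apply: ev_UNIQ; [move: hO; rewrite /catoms; lia|lia].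
move=> _; apply: ev_and; first by szt.
  have -> : all (mem V) (O i) = all (mem (map catom V)) (map catom (O i)).
    by rewrite all_map; apply: eq_all => p; rewrite /= mem_catoms.
  by apply: ev_SUB; [move: hO; rewrite /catoms; lia|exact: hV|lia].
move=> _; apply: IH; first by lia.
by apply: leq_trans (ltnW hO); exact: leq_addl.
Qed.
End Ev.

(** * Well-formedness checks *)

(** The program keeps the parameters as a list of blocks with the newest in front, whereas [dwf]
    appends new ones at the end. *)
Lemma dwf_eqi (A : finType) V P P' (phi : dform A) : P =i P' -> dwf V P phi = dwf V P' phi.
Proof.
elim/dform_nested_ind: phi V P P' => [||p|phi IH|phi psi IH IH'|i phi IH|X x phi IH IH'] V P P' e //=.
- by rewrite !mem_cat e.
- exact: IH.
- by rewrite (IH _ _ P') // (IH' _ _ P').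
- exact: IH.
have eV U : U ++ P =i U ++ P' by move=> p; rewrite !mem_cat e.
have bo b U : bover (U ++ P) b = bover (U ++ P') b.
  by apply/idP/idP => h; apply: bover_sub h _ => p; rewrite eV.
rewrite (IH _ _ (P' ++ t_voc X)); last by move=> p; rewrite !mem_cat e.
rewrite (IH' _ _ P') // (eq_has (a2 := mem (V ++ P'))); last by move=> p /=; rewrite eV.
by congr [&& _, _, _, _, _, _, _ & _]; apply: eq_all => q; rewrite !catA bo.
Qed.

Section Check.
Variables (m : nat) (V0 : seq atom) (dg : bdd) (O : {ffun 'I_m -> seq atom}).
Let K0 : kstruct 'I_m := KStruct V0 (bdd_form dg) O.
Hypothesis base_names : all is_name V0.

Definition cX (X : transformer 'I_m) : tree :=
  Nd (catoms (t_voc X)) (Nd (cdform (t_pre X)) (Nd (cpost (t_post X)) (cobs (t_obs X)))).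
Definition chist (h : seq (transformer 'I_m)) : tree :=
  foldr (fun X t => Nd (cX X) t) (Nd Lf (Nd (catoms V0) (Nd (cbdd dg) (cobs O)))) h.

Lemma chist_cons X h : chist (X :: h) = Nd (cX X) (chist h). Proof. by []. Qed.

Variables (S B : nat).
Hypothesis hS : 1000 * B + 4000 <= S.
Notation ev := (@ev bodies S).
Implicit Types (h : seq (transformer 'I_m)) (Ps : seq (seq atom)).

Lemma isLf_cpost l : isLf (cpost l) = nilp l.
Proof. by case: l. Qed.

Lemma ev_memA p W d : tsz (catom p) <= B -> tsz (catoms W) <= B -> tsz (catom p) < d ->
  ev d (cMEM (Nd (catom p) (catoms W))) (p \in W).
Proof. by move=> *; rewrite -mem_catoms; apply: (ev_MEM hS). Qed.

Lemma unzip1_post l : unzip1 [seq (catom q.1, cbform q.2) | q <- l] = map catom (unzip1 l).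
Proof. by rewrite /unzip1 -!map_comp. Qed.

Lemma ev_memKA p l d : tsz (catom p) <= B -> tsz (cpost l) <= B -> tsz (catom p) < d ->
  ev d (cMEMK (Nd (catom p) (cpost l))) (p \in unzip1 l).
Proof. by move=> *; rewrite -mem_catoms -unzip1_post; apply: (ev_MEMK hS). Qed.

Lemma ev_CNT k h d : tsz (cnat k) <= B -> tsz (chist h) <= B ->
  ev d (cCNT (Nd (cnat k) (chist h))) (k == kc h).
Proof.
elim: h k => [|X h IH] k hk hh.
  by evcall; rewrite /bCNT /=; case: k {hk} => [|k]; [exact: EvT|exact: EvF].
rewrite chist_cons in hh *; evcall; rewrite /bCNT /= isLf_cpost.
have hh' : tsz (chist h) <= B by move: hh => /=; klia.
case: (nilp _) => /=; first exact: IH.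
case: k hk => [|k] hk /=; first exact: EvF.
by rewrite add1n eqSS; apply: IH => //; move: hk => /=; klia.
Qed.

Lemma ev_CIRC p X h d : tsz (catom p) <= B -> tsz (chist (X :: h)) <= B -> tsz (catom p) + 2 < d ->
  ev d (eCIRC (catom p) (chist (X :: h)))
    (if p is Circ k q then (q \in t_changed X) && (k == kc h) else false).
Proof.
rewrite chist_cons => hp hh hd; case: p hp hd => [n|k q|q] /= hp hd; rewrite /eCIRC /=;
  try exact: EvF.
case: d hd => // d hd; apply: ev_and; first by szt.
  by apply: ev_memKA; move: hh => /=; klia.
by move=> _; apply: ev_CNT; move: hh => /=; klia.
Qed.

(** The updated vocabulary is not computed. Going back through the history, an atom is recognized as
    new by membership in $V^+$, or as a copy by its stamp [kc h] and its original among the changed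
    atoms. *)
Lemma ev_INV P p h d : hwf K0 P h -> tsz (catom p) <= B -> tsz (chist h) <= B ->
  tsz (catom p) + 4 < d -> ev d (cINV (Nd (catom p) (chist h))) (p \in hvoc K0 h).
Proof.
elim: h P => [|X h IH] P w hp hh hd.
  by evcall; rewrite /bINV /=; apply: ev_memA; move: hh => /=; klia.
have [Q [QP [w' _]]] := w; rewrite (mem_hvoc (K0 := K0) base_names _ w).
have -> : [|| p \in hvoc K0 h, p \in t_voc X | p \in map (Circ (kc h)) (t_changed X)] =
  [|| p \in t_voc X, (if p is Circ k q then (q \in t_changed X) && (k == kc h) else false) | p \in hvoc K0 h].
  rewrite orbCA; congr (_ || _); rewrite orbC; congr (_ || _).
  case: p {IH hp hd} => [n|k q|q]; try by apply/mapP => -[].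
  apply/mapP/andP => [[r rX [-> ->]]|[qX /eqP ->]]; [by rewrite rX eqxx|by exists q].
have ec : chist (X :: h) = Nd (cX X) (chist h) by [].
evcall; rewrite /bINV /=.
rewrite ec /= in hh; case: d hd IH => // d hd IH; apply: ev_or; first by rewrite /eCIRC; case: (p) hp => [n|k q|q] /= hp; szt.
  by apply: ev_memA; klia.
move=> _; apply: ev_or; first by rewrite /eCIRC; case: (p) hp => [n|k q|q] /= hp; szt.
  by apply: ev_CIRC; rewrite ?ec /=; klia.
by move=> _; apply: (IH Q) => //; klia.
Qed.

Definition cPs Ps : tree := clist (map catoms Ps).
Lemma cPs_cons W Ps : cPs (W :: Ps) = Nd (catoms W) (cPs Ps). Proof. by []. Qed.

Lemma ev_INP p Ps d : tsz (catom p) <= B -> tsz (cPs Ps) <= B -> tsz (catom p) + 1 < d ->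
  ev d (cINP (Nd (catom p) (cPs Ps))) (p \in flatten Ps).
Proof.
move=> hp; elim: Ps d => [|W Ps IH] d hP hd; rewrite ?cPs_cons in hP *; evcall; rewrite /bINP /=.
  exact: EvF.
rewrite /= in hP; rewrite mem_cat; case: d hd => // d hd; apply: ev_or; first by szt.
  by apply: ev_memA; klia.
by move=> _; apply: IH; klia.
Qed.

Lemma ev_VP P p h Ps d : hwf K0 P h -> tsz (catom p) <= B -> tsz (chist h) <= B ->
  tsz (cPs Ps) <= B -> tsz (catom p) + 6 < d ->
  ev d (eOr (cINV (Nd (catom p) (chist h))) (cINP (Nd (catom p) (cPs Ps))))
    (p \in hvoc K0 h ++ flatten Ps).
Proof.
move=> w hp hh hP hd; rewrite mem_cat; case: d hd => // d hd; apply: ev_or; first by szt.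
  by apply: (ev_INV w); klia.
by move=> _; apply: ev_INP; klia.
Qed.

Lemma ev_DISJ P W h Ps d : hwf K0 P h -> tsz (catoms W) <= B -> tsz (chist h) <= B ->
  tsz (cPs Ps) <= B -> B + 6 < d ->
  ev d (cDISJ (Nd (catoms W) (Nd (chist h) (cPs Ps)))) (~~ has (mem (hvoc K0 h ++ flatten Ps)) W).
Proof.
move=> w + hh hP hd; elim: W => [|p W IH] hW; rewrite ?catoms_cons in hW *; evcall; rewrite /bDISJ /=.
  exact: EvT.
rewrite /= in hW; rewrite mem_cat negb_or negb_or -andbA; case: d hd IH => // d hd IH.
apply: (EvIte (b0 := p \in hvoc K0 h)); first by szt.
  by apply: (ev_INV w); klia.
case: ifP => _ /=; first exact: EvF.
apply: (EvIte (b0 := p \in flatten Ps)); first by szt.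
  by apply: ev_INP; klia.
case: ifP => _ /=; first exact: EvF.
by apply: IH; klia.
Qed.

Lemma ev_BO P b h Ps d : hwf K0 P h -> tsz (cbform b) <= B -> tsz (chist h) <= B ->
  tsz (cPs Ps) <= B -> B + 7 + tsz (cbform b) < d ->
  ev d (cBO (Nd (cbform b) (Nd (chist h) (cPs Ps)))) (bover (hvoc K0 h ++ flatten Ps) b).
Proof.
move=> w + hh hP; elim: b d => [||p|b IH|b IHb c IHc] d /= hb hd; evcall; rewrite /bBO /tag_case /=.
- exact: EvT.
- exact: EvT.
- by apply: (ev_VP w); klia.
- by apply: IH; klia.
- case: d hd => // d hd; apply: ev_and; first by szt.
    by apply: IHb; klia.
  by move=> _; apply: IHc; klia.
Qed.

Lemma cpost_cons q l : cpost (q :: l) = Nd (Nd (catom q.1) (cbform q.2)) (cpost l).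
Proof. by []. Qed.

Lemma ev_POST P l h Ps d : hwf K0 P h -> tsz (cpost l) <= B -> tsz (chist h) <= B ->
  tsz (cPs Ps) <= B -> 2 * B + 8 < d ->
  ev d (cPOST (Nd (cpost l) (Nd (chist h) (cPs Ps))))
    (all (fun q => bover (hvoc K0 h ++ flatten Ps) q.2) l).
Proof.
move=> w + hh hP hd; elim: l => [|q l IH] hl; rewrite ?cpost_cons in hl *; evcall; rewrite /bPOST /=.
  exact: EvT.
rewrite /= in hl; case: d hd IH => // d hd IH; apply: ev_and; first by szt.
  by apply: (ev_BO w); klia.
by move=> _; apply: IH; klia.
Qed.

Lemma ev_SUBK P l h d : hwf K0 P h -> tsz (cpost l) <= B -> tsz (chist h) <= B -> B + 6 < d ->
  ev d (cSUBK (Nd (cpost l) (chist h))) (all (mem (hvoc K0 h)) (unzip1 l)).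
Proof.
move=> w + hh hd; elim: l => [|q l IH] hl; rewrite ?cpost_cons in hl *; evcall; rewrite /bSUBK /=.
  exact: EvT.
rewrite /= in hl; case: d hd IH => // d hd IH; apply: ev_and; first by szt.
  by apply: (ev_INV w); klia.
by move=> _; apply: IH; klia.
Qed.

Lemma ev_uniqA W d : tsz (catoms W) <= B -> B + 2 < d -> ev d (cUNIQ (catoms W)) (uniq W).
Proof. by move=> *; rewrite -(map_inj_uniq catom_inj); apply: (ev_UNIQ hS). Qed.

Lemma ev_subA W V d : tsz (catoms W) <= B -> tsz (catoms V) <= B -> B + 2 < d ->
  ev d (cSUB (Nd (catoms W) (catoms V))) (all (mem V) W).
Proof.
move=> *; have -> : all (mem V) W = all (mem (map catom V)) (map catom W).
  by rewrite all_map; apply: eq_all => p; rewrite /= mem_catoms.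
exact: (ev_SUB hS).
Qed.

Lemma cdform_upd X x (phi : dform 'I_m) :
  cdform (DUpd X x phi) = Nd (cnat 6) (Nd (cX X) (Nd (catoms x) (cdform phi))).
Proof. by []. Qed.

(** Behind an event the transformer moves from the formula to the history, and in a precondition
    $V^+$ moves to the parameters. So the sums with the size of the formula do not grow, and one
    bound [B] serves throughout. *)
Lemma ev_DW (phi : dform 'I_m) h Ps d : hwf K0 (flatten Ps) h ->
  tsz (chist h) + tsz (cdform phi) <= B -> tsz (cPs Ps) + tsz (cdform phi) <= B ->
  2 * B + 10 + tsz (cdform phi) < d ->
  ev d (cDW (Nd (cdform phi) (Nd (chist h) (cPs Ps)))) (dwf (hvoc K0 h) (flatten Ps) phi).
Proof.
elim/dform_nested_ind: phi h Ps d => [||p|phi IH|phi psi IH IH'|i phi IH|X x phi IH IH'] h Ps d w hh hP hd.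
- by evcall; apply: EvT.
- by evcall; apply: EvT.
- rewrite [cdform _]/= /= in hh hP hd *; evcall; rewrite /bDW /tag_case /=.
  by apply: (ev_VP w); klia.
- rewrite [cdform _]/= /= in hh hP hd *; evcall; rewrite /bDW /tag_case /=.
  by apply: IH => //; klia.
- rewrite [cdform _]/= /= in hh hP hd *; evcall; rewrite /bDW /tag_case /=.
  case: d hd => // d hd; apply: ev_and; first by szt.
    by apply: IH => //; klia.
  by move=> _; apply: IH' => //; klia.
- rewrite [cdform _]/= /= in hh hP hd *; evcall; rewrite /bDW /tag_case /=.
  by apply: IH => //; klia.
rewrite cdform_upd /= in hh hP hd *; evcall; rewrite /bDW /tag_case /= /eUPD /=.
case: d hd => // d hd.
apply: ev_and; [by szt|by apply: ev_uniqA; klia|move=> uV].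
apply: ev_and; [by szt|by apply: (ev_NAMES hS); klia|move=> nV].
apply: ev_and; [by szt|by apply: (ev_DISJ w); klia|move=> dV].
have ePs : flatten Ps ++ t_voc X =i flatten (t_voc X :: Ps) by move=> p; rewrite /= !mem_cat orbC.
have wV : hwf K0 (flatten (t_voc X :: Ps)) h.
  by apply: hwf_sub w _ => p pP; rewrite /= mem_cat pP orbT.
rewrite (dwf_eqi _ _ ePs).
apply: ev_and; first by szt.
  by apply: (IH h (t_voc X :: Ps)) => //; rewrite ?cPs_cons /=; klia.
move=> wpre.
apply: ev_and; first by szt.
  rewrite -(map_inj_uniq catom_inj) -unzip1_post; apply: (ev_UNIQK hS); last by klia.
  by rewrite -/(cpost _); klia.
move=> uc; apply: ev_and; [by szt|by apply: (ev_SUBK w); klia|move=> sc].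
apply: ev_and; first by szt.
  by apply: (@ev_POST _ _ _ (t_voc X :: Ps) _ w); rewrite ?cPs_cons /=; klia.
move=> hpost; apply: ev_and; [by szt|by apply: (ev_OBSC hS); klia|move=> hobs].
apply: ev_and; [by szt|by apply: ev_uniqA; klia|move=> ux].
apply: ev_and; [by szt|by apply: ev_subA; klia|move=> sx].
apply: (IH' (X :: h)); rewrite ?chist_cons /=; try klia.
exists (flatten Ps); split=> //; split=> //; split=> //.
- by rewrite (dwf_eqi _ _ ePs).
- by split=> //; apply/allP.
- split; first by apply/allP.
  by move=> i; have /forallP/(_ i)/andP[_ /allP] := hobs.
Qed.
End Check.

(** * Evaluation *)

Lemma bdd_forms_rcons d u : bdd_forms (rcons d u) = rcons (bdd_forms d)
    match u with
    | BLeaf b => if b then BTop else BBot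
    | BNode p lo hi => bor (BAnd (BAtom p) (nth BBot (bdd_forms d) hi))
                           (BAnd (BNeg (BAtom p)) (nth BBot (bdd_forms d) lo))
    end.
Proof. by rewrite /bdd_forms foldl_rcons. Qed.

Lemma size_bdd_forms d : size (bdd_forms d) = size d.
Proof. by elim/last_ind: d => // d u IH; rewrite bdd_forms_rcons !size_rcons IH. Qed.

Lemma bdd_form_nth d v i : i < size d ->
  (forall j, j < size d -> if nth (BLeaf false) d j is BNode _ lo hi then (lo < j) && (hi < j) else true) ->
  bsatp v (nth BBot (bdd_forms d) i) =
  match nth (BLeaf false) d i with
  | BLeaf b => b
  | BNode p lo hi => bsatp v (nth BBot (bdd_forms d) (if v p then hi else lo))
  end.
Proof.
elim/last_ind: d => // d u IH lt ok; rewrite bdd_forms_rcons.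
rewrite size_rcons ltnS leq_eqVlt in lt.
have okd j : j < size d -> if nth (BLeaf false) d j is BNode _ lo hi then (lo < j) && (hi < j) else true.
  by move=> lj; have := ok j; rewrite size_rcons nth_rcons lj; apply; apply: ltnW.
have oki := ok i; rewrite size_rcons ltnS in oki.
case/orP: lt => [/eqP ei|lt].
  rewrite ei !nth_rcons size_bdd_forms ltnn eqxx.
  move: oki; rewrite ei leqnn nth_rcons ltnn eqxx => /(_ isT).
  case: u {ok} => [[]|p lo hi] // /andP[h1 h2] /=.
  by case: (v p); rewrite nth_rcons size_bdd_forms ?h1 ?h2 /= ?andbF ?andbT ?negbK.
rewrite !nth_rcons size_bdd_forms lt IH //.
have := okd _ lt; case: (nth _ d i) => // p lo hi /andP[h1 h2].
by case: (v p); rewrite nth_rcons size_bdd_forms ?(ltn_trans h1 lt) ?(ltn_trans h2 lt).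
Qed.

(** The first entry for an atom counts, so a name is reassigned by prepending a new entry. *)
Fixpoint av (l : seq (atom * bool)) (p : atom) : bool :=
  if l is (q, b) :: l' then if p == q then b else av l' p else false.

Definition crho (l : seq (atom * bool)) : tree := cpairs [seq (catom q.1, cb q.2) | q <- l].
Lemma crho_cons p b l : crho ((p, b) :: l) = Nd (Nd (catom p) (cb b)) (crho l).
Proof. by []. Qed.

Section Eval.
Variables (m : nat) (V0 : seq atom) (dg : bdd) (O : {ffun 'I_m -> seq atom}).
Let K0 : kstruct 'I_m := KStruct V0 (bdd_form dg) O.
Hypothesis base_names : all is_name V0.
Hypothesis base_law : bover V0 (bdd_form dg).
Hypothesis base_obs : forall i, {subset O i <= V0}.
Hypothesis dg_gt0 : 0 < size dg.
Hypothesis dg_ok : forall j, j < size dg ->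
  if nth (BLeaf false) dg j is BNode _ lo hi then (lo < j) && (hi < j) else true.
Notation chist := (chist V0 dg O).

Variables (S B : nat).
Hypothesis hS : 1000 * B + 4000 <= S.
Notation ev := (@ev bodies S).
Implicit Types (h : seq (transformer 'I_m)) (l : seq (atom * bool)).

Lemma ev_ASSOC p l d : tsz (catom p) <= B -> tsz (crho l) <= B -> tsz (catom p) < d ->
  ev d (cASSOC (Nd (catom p) (crho l))) (av l p).
Proof.
move=> hp; elim: l d => [|[q b] l IH] d hl hd; rewrite ?crho_cons in hl *; evcall; rewrite /bASSOC /=.
  exact: EvF.
rewrite /= in hl; case: d hd => // d hd; apply: (EvIte (b0 := p == q)); first by case: (b); szt.
  rewrite -(inj_eq catom_inj); apply: (ev_EQ hS); klia.
by case: ifP => _; [case: b {hl}; [exact: EvT|exact: EvF]|apply: IH; klia].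
Qed.

(** Lookup and evaluation of postconditions are mutually recursive. The knot is cut here by assuming
    lookup for [h]; the lookup for a longer history then evaluates its postconditions on [h]. *)
Lemma ev_BS_of h l : (forall p d, tsz (catom p) <= B -> B + 5 + tsz (chist h) < d ->
    ev d (cLOOK (Nd (catom p) (Nd (chist h) (crho l)))) (look h (av l) p)) ->
  tsz (chist h) <= B -> tsz (crho l) <= B ->
  forall b d, tsz (cbform b) <= B -> B + 5 + tsz (chist h) + tsz (cbform b) < d ->
  ev d (cBS (Nd (cbform b) (Nd (chist h) (crho l)))) (bsatp (look h (av l)) b).
Proof.
move=> hL hh hl; elim=> [||p|b IH|b IHb c IHc] d /= hb hd; evcall; rewrite /bBS /tag_case /=.
- exact: EvT.
- exact: EvF.
- by apply: hL; klia.
- by case: d hd => // d hd; apply: ev_not; [szt|apply: IH; klia].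
- case: d hd => // d hd; apply: ev_and; first by szt.
    by apply: IHb; klia.
  by move=> _; apply: IHc; klia.
Qed.

Lemma ev_LOOK h p l d : tsz (catom p) <= B -> tsz (chist h) <= B -> tsz (crho l) <= B ->
  B + 5 + tsz (chist h) < d -> ev d (cLOOK (Nd (catom p) (Nd (chist h) (crho l)))) (look h (av l) p).
Proof.
move=> + + hl; elim: h p d => [|X h IH] p d hp hh hd.
  by evcall; rewrite /bLOOK /=; apply: ev_ASSOC => //; klia.
have ec := chist_cons V0 dg O X h.
have hh' : tsz (chist h) <= B by move: hh; rewrite ec /=; klia.
have hX : tsz (cX X) + tsz (chist h) < tsz (chist (X :: h)) by rewrite ec /=; klia.
have hpost : tsz (cpost (t_post X)) < tsz (cX X) by rewrite /cX /=; klia.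
have hL q e : tsz (catom q) <= B -> B + 5 + tsz (chist h) < e ->
    ev e (cLOOK (Nd (catom q) (Nd (chist h) (crho l)))) (look h (av l) q) by move=> *; apply: IH.
have hBS := ev_BS_of hL hh' hl.
evcall; rewrite /bLOOK /=.
have gen r : tsz (cpost r) <= tsz (cpost (t_post X)) ->
  ev d (cLOOKK (Nd (catom p) (Nd (cpost r) (Nd (chist (X :: h)) (crho l)))))
   (if p \in unzip1 r then bsatp (look h (av l)) (nth (BAtom p) (unzip2 r) (index p (unzip1 r)))
    else if p is Circ k q then
      if (k == kc h) && (q \in t_changed X) then look h (av l) q else look h (av l) p
    else look h (av l) p).
  elim: r => [|[q th] r IHr] hr; rewrite ?cpost_cons in hr *; evcall; rewrite /bLOOKK /=.
    case: d hd => // d hd.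
    apply: (EvIte (b0 := if p is Circ k q then (q \in t_changed X) && (k == kc h) else false)).
    - have ht t : tsz (tl t) <= tsz t by case: t => // x y; rewrite /=; klia.
      have := ht (catom p); have := ht (tl (catom p)); move: (tl (tl (catom p))) => g h1 h2.
      by rewrite /eCIRC; case: (p) hp h1 h2 => [n|k q|q] /= hp h1 h2; szt.
    - by apply: (ev_CIRC hS); klia.
    case: p hp => [n|k q|q] hp; try by apply: hL; klia.
    rewrite andbC; case: ifP => _; last by apply: hL; klia.
    by rewrite /=; apply: hL; [move: hp => /=; klia|klia].
  rewrite /= in hr; rewrite inE; case: d hd IHr => // d hd IHr.
  apply: (EvIte (b0 := p == q)); first by szt.
    by rewrite -(inj_eq catom_inj); apply: (ev_EQ hS); klia.
  rewrite [q == p]eq_sym; case: ifP => _ /=; first by apply: hBS; klia.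
  by apply: IHr; klia.
exact: gen (leqnn _).
Qed.

Lemma ev_BDDN i l d : i < size dg -> tsz (cbdd dg) <= B -> tsz (crho l) <= B -> B + 2 < d ->
  ev d (cBDDN (Nd (cbnode (nth (BLeaf false) dg i)) (Nd (cbdd dg) (crho l))))
    (bsatp (av l) (nth BBot (bdd_forms dg) i)).
Proof.
move=> + hd hl hd'; have szd := size_cbdd dg.
have hnode j : j < size dg -> tsz (cbnode (nth (BLeaf false) dg j)) <= tsz (cbdd dg).
  by move=> lj; apply: ltnW; apply: tsz_mem; apply: map_f; apply: mem_nth.
elim/ltn_ind: i => i IH lt; rewrite bdd_form_nth //.
have hn := hnode _ lt; have := dg_ok lt.
case: (nth _ dg i) hn => [[]|p lo hi] hn ok; evcall; rewrite /bBDDN /=.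
- exact: EvT.
- exact: EvF.
rewrite /= in hn; case/andP: ok => llo lhi.
(* [n] is what remains to be counted down to node [j], and [r] the part of the diagram from position
   [j - n] on. *)
have walk j n (r : bdd) : j < i -> n <= j -> r = drop (j - n) dg ->
  ev d (cBDDA (Nd (cbdd r) (Nd (cnat n) (Nd (cbdd dg) (crho l)))))
    (bsatp (av l) (nth BBot (bdd_forms dg) j)).
  move=> ji; elim: n r => [|n IHn] r nj er.
    have lj : j < size dg by klia.
    rewrite subn0 (drop_nth (BLeaf false)) // in er.
    have hr : tsz (cbdd r) <= tsz (cbdd dg).
      rewrite er -(drop_nth _ lj); elim: (dg) (j) => [|u e IHe] [|k] //.
      by rewrite [cbdd (u :: e)]cbdd_cons /=; apply: leq_trans (IHe k) _; klia.
    by evcall; rewrite /bBDDA /= er /=; apply: IH.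
  have lj : j - n.+1 < size dg by klia.
  rewrite (drop_nth (BLeaf false)) // in er.
  have hr : tsz (cbdd r) <= tsz (cbdd dg).
    rewrite er -(drop_nth _ lj); elim: (dg) (j - n.+1) => [|u e IHe] [|k] //.
    by rewrite [cbdd (u :: e)]cbdd_cons /=; apply: leq_trans (IHe k) _; klia.
  have hc : tsz (cnat n.+1) <= B by rewrite tsz_cnat; klia.
  evcall; rewrite /bBDDA /= er /=; apply: IHn; first by klia.
  by congr drop; klia.
case: d hd' walk {IH} => // d hd' walk; apply: (EvIte (b0 := av l p)); first by szt.
  by apply: ev_ASSOC; klia.
by case: (av l p); apply: walk; rewrite ?subnn ?drop0.
Qed.

Lemma ev_BDDR l d : tsz (cbdd dg) <= B -> tsz (crho l) <= B -> B + 2 < d ->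
  ev d (cBDDR (Nd (cbdd dg) (Nd (cbdd dg) (crho l)))) (bsatp (av l) (bdd_form dg)).
Proof.
move=> hd hl hd'.
have -> : bdd_form dg = nth BBot (bdd_forms dg) (size dg).-1.
  by rewrite /bdd_form -size_bdd_forms nth_last.
have gen k (r : bdd) : k < size dg -> r = drop k dg -> tsz (cbdd r) <= tsz (cbdd dg) ->
  ev d (cBDDR (Nd (cbdd dg) (Nd (cbdd r) (crho l)))) (bsatp (av l) (nth BBot (bdd_forms dg) (size dg).-1)).
  elim: r k => [|u r IH] k lk er hr.
    by move/(congr1 size): er; rewrite size_drop /=; klia.
  have er' := er; rewrite (drop_nth (BLeaf false)) // in er'; case: er' => eu er'.
  rewrite cbdd_cons /= in hr *; evcall; rewrite /bBDDR /=.
  case: r IH er' hr {er} => [|u' r] IH er' hr /=.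
    have ek : k = (size dg).-1 by move/(congr1 size): er'; rewrite size_drop /=; klia.
    by rewrite eu -ek; apply: ev_BDDN.
  apply: (IH k.+1) => //; last by klia.
  by move/(congr1 size): er'; rewrite size_drop /=; klia.
by apply: (gen 0); rewrite ?drop0.
Qed.

Lemma ev_OBSL W l l' d : tsz (catoms W) <= B -> tsz (crho l) <= B -> tsz (crho l') <= B ->
  B + 3 < d -> ev d (cOBSL (Nd (catoms W) (Nd (crho l) (crho l'))))
    (all (fun p => av l p == av l' p) W).
Proof.
move=> + hl hl' hd; elim: W => [|p W IH] hW; rewrite ?catoms_cons in hW *; evcall; rewrite /bOBSL /=.
  exact: EvT.
rewrite /= in hW; case: d hd IH => [|[|d]] hd IH; try by exfalso; klia.
apply: ev_and; first by szt.
  apply: (EvIte (b0 := av l p)); first by szt.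
    by apply: ev_ASSOC; klia.
  case: (av l p); rewrite ?eqb_id.
    have -> : (true == av l' p) = av l' p by case: (av l' p).
    by apply: ev_ASSOC; klia.
  have -> : (false == av l' p) = ~~ av l' p by case: (av l' p).
  by apply: ev_not; [szt|apply: ev_ASSOC; klia].
by move=> _; apply: IH; klia.
Qed.

Lemma ev_OBSI (i : 'I_m) (O' : {ffun 'I_m -> seq atom}) l l' d : tsz (cobs O') <= B ->
  tsz (cnat i) <= B -> tsz (crho l) <= B -> tsz (crho l') <= B -> B + 3 < d ->
  ev d (cOBSI (Nd (cnat i) (Nd (cobs O') (Nd (crho l) (crho l')))))
    (all (fun p => av l p == av l' p) (O' i)).
Proof.
move=> hO hi hl hl' hd.
have gen n (s : seq 'I_m) : tsz (clist [seq catoms (O' i) | i <- s]) <= B -> tsz (cnat n) <= B ->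
  n < size s -> ev d (cOBSI (Nd (cnat n) (Nd (clist [seq catoms (O' i) | i <- s]) (Nd (crho l) (crho l')))))
    (all (fun p => av l p == av l' p) (O' (nth i s n))).
  elim: n s => [|n IH] [|j s] //= hs hn ls; evcall; rewrite /bOBSI /=.
    by apply: ev_OBSL; klia.
  by apply: IH => //; [exact: leq_trans (leq_addl _ _) (ltnW hs)|exact: leq_trans (leq_addl _ _) (ltnW hn)].
by have := gen i (enum 'I_m) hO hi; rewrite size_enum_ord nth_ord_enum; apply.
Qed.

Lemma ev_OBSH (i : 'I_m) h l l' d : tsz (chist h) <= B ->
  tsz (cnat i) <= B -> tsz (crho l) <= B -> tsz (crho l') <= B -> B + 4 < d ->
  ev d (cOBSH (Nd (cnat i) (Nd (chist h) (Nd (crho l) (crho l'))))) (obsok K0 i h (av l) (av l')).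
Proof.
move=> + hi hl hl' hd; elim: h => [|X h IH] hh.
  evcall; rewrite /bOBSH /= /obsok /= andbT; rewrite /= in hh.
  by apply: ev_OBSI; klia.
have -> : obsok K0 i (X :: h) (av l) (av l') =
   all (fun p => av l p == av l' p) (t_obs X i) && obsok K0 i h (av l) (av l').
  by rewrite /obsok /= andbCA.
have ec := chist_cons V0 dg O X h; rewrite ec in hh *; evcall; rewrite /bOBSH /=.
rewrite /= in hh; case: d hd IH => // d hd IH; apply: ev_and; first by szt.
  by apply: ev_OBSI; klia.
by move=> _; apply: IH; klia.
Qed.

Lemma av_cons p b l : av ((p, b) :: l) =1 ovr [:: p] (fun=> b) (av l).
Proof. by move=> q; rewrite /ovr /= inE; case: eqP. Qed.

Lemma ovr_cons p W (t v : valu) b : b = t p ->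
  ovr W t (ovr [:: p] (fun=> b) v) =1 ovr (p :: W) t v.
Proof.
move=> -> q; rewrite /ovr !inE; case: (q \in W); rewrite ?orbT // orbF.
by case: eqP => // ->.
Qed.

Lemma ovr_ext W (t v v' : valu) : v =1 v' -> ovr W t v =1 ovr W t v'.
Proof. by move=> e p; rewrite /ovr; case: ifP. Qed.

Lemma tsz_cb b : tsz (cb b) <= 3. Proof. by case: b. Qed.

(* [N] bounds the sizes of histories and formulas; each connective met may
   add at most one valuation of the names to the association list. *)
Variable N : nat.
(** The constant part covers lookups. Each unit of the measure pays [2 * N + 20]: one [N] for the
    nested conjunctions of a quantifier over the names, the other for the recursion of the law check
    along the history. *)
Definition depth_of (M : nat) := 2 * B + 50 + M * (2 * N + 20).

(** The measure is the joint size of history and formula. Each unit of it also buys [10 * N] for the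
    valuation, enough for assigning all names once more: an entry takes at most six times the space
    of its atom in a list, and the names occupy at most [N]. *)
Definition E_ok (M : nat) := forall P h (phi : dform 'I_m) l d,
  tsz (chist h) + tsz (cdform phi) <= M -> M <= N ->
  tsz (crho l) + 10 * N * (tsz (chist h) + tsz (cdform phi)) <= B ->
  hwf K0 P h -> pok (hvoc K0 h) P -> dwf (hvoc K0 h) P phi ->
  depth_of (tsz (chist h) + tsz (cdform phi)) <= d ->
  ev d (cE (Nd (cdform phi) (Nd (chist h) (crho l)))) (tr K0 h (av l) phi).

Lemma leq_depth M M' : M < M' -> depth_of M + 2 * N + 20 <= depth_of M'.
Proof.
rewrite /depth_of => lt; have : M.+1 * (2 * N + 20) <= M' * (2 * N + 20) by rewrite leq_mul2r lt orbT.
by rewrite mulSn; clear; lia.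
Qed.

Lemma leq_rho c M M' R : c + 10 * N * M' <= R -> M < M' -> c + 10 * N + 10 * N * M <= R.
Proof.
move=> h lt; apply: leq_trans h; rewrite -addnA leq_add2l -mulnS leq_mul2l lt; exact: orbT.
Qed.

Lemma N_leq_B c M R : c + 10 * N * M <= R -> 0 < M -> 10 * N + c <= R.
Proof.
by case: M => // M; rewrite mulnS => h _; apply: leq_trans h; clear; lia.
Qed.

(** Checking the law evaluates preconditions of older updates on still older histories, so the
    evaluator is used only below the size of the given history. *)
Lemma ev_LAW M : E_ok M -> forall P h l d, tsz (chist h) <= M.+1 -> M < N ->
  tsz (crho l) + 10 * N * M.+1 <= B -> hwf K0 P h -> pok (hvoc K0 h) P ->
  depth_of M + 2 + tsz (chist h) <= d ->
  ev d (cLAW (Nd (chist h) (crho l))) (lawv K0 h (av l)).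
Proof.
move=> HE P h l d hM hN hl; have hB := N_leq_B hl isT.
elim: h P d hM => [|X h IH] P d hM w hp hd.
  rewrite lawv_nil; rewrite /= in hM; evcall; rewrite /bLAW /=.
  by apply: ev_BDDR; move: hd; rewrite /depth_of; klia.
rewrite (lawv_cons (K0 := K0) base_names base_law base_obs _ w hp).
have ec := chist_cons V0 dg O X h.
have [Q [QP [w' hx]]] := w.
have hq := hvoc_pok (K0 := K0) QP hp.
(* An update contains its precondition as a proper part, hence the older history together with the
   precondition is smaller than the whole history. *)
have szX : tsz (chist h) + tsz (cdform (t_pre X)) < tsz (chist (X :: h)) by rewrite ec /= /cX /=; klia.
rewrite ec in hM hd *; evcall; rewrite /bLAW /=.
rewrite /= in hM hd; case: d hd => [|d] hd; first by exfalso; move: hd; rewrite /depth_of; klia.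
apply: ev_and; first by rewrite /cX in hM; szt.
  by apply: (IH Q) => //; klia.
move=> _; apply: (HE (Q ++ t_voc X)).
- by rewrite ec /= in szX; klia.
- exact: ltnW.
- apply: leq_trans hl; rewrite leq_add2l leq_mul2l; apply/orP; right.
  by rewrite ec /= in szX; klia.
- by apply: hwf_sub w' _ => p pQ; rewrite mem_cat pQ.
- exact: pok_cat.
- by case: hx.
- apply: leq_trans (_ : depth_of M <= _); last by klia.
  rewrite /depth_of leq_add2l leq_mul2r; apply/orP; right.
  by rewrite ec /= in szX; klia.
Qed.

Lemma ev_SETX (val : valu -> bool) (X : transformer 'I_m) (phi : dform 'I_m) x h d R W l :
  (forall v v', v =1 v' -> val v = val v') ->
  (forall l', tsz (crho l') <= R ->
     ev d (eIte (cE (Nd (cdform (t_pre X)) (Nd (chist h) (crho l'))))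
            (cE (Nd (cdform phi) (Nd (Nd (cX X) (chist h)) (crho l')))) eT) (val (av l'))) ->
  R <= B -> tsz (cX X) <= B -> tsz (chist h) <= B -> tsz (catoms x) <= B -> tsz (cdform phi) <= B ->
  B + 2 < d -> tsz (catoms W) <= B -> tsz (crho l) + 6 * tsz (catoms W) <= R ->
  ev d (cSETX (Nd (catoms W) (Nd (catoms x) (Nd (cX X) (Nd (cdform phi) (Nd (chist h) (crho l)))))))
    (val (ovr W (fun p => p \in x) (av l))).
Proof.
move=> hv hE hR hX hh hx hphi hd; elim: W l => [|p W IH] l hW hl.
  evcall; rewrite /bSETX /=; rewrite (hv _ (av l)); last by move=> q; rewrite /ovr.
  by apply: hE; move: hl => /=; klia.
rewrite catoms_cons in hW hl *; evcall; rewrite /bSETX /=; rewrite /= in hW hl.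
case: d hd hE IH => // d hd hE IH; apply: (EvIte (b0 := p \in x)); first by szt.
  by apply: (ev_memA hS); klia.
have step b : b = (p \in x) -> ev d.+1 (cSETX (Nd (catoms W) (Nd (catoms x) (Nd (cX X)
     (Nd (cdform phi) (Nd (chist h) (crho ((p, b) :: l)))))))) (val (ovr (p :: W) (fun p => p \in x) (av l))).
  move=> eb; rewrite -(hv (ovr W (fun p => p \in x) (av ((p, b) :: l)))).
    by apply: IH; [klia|rewrite crho_cons /=; have := tsz_cb b; klia].
  by move=> q; rewrite -(ovr_cons _ _ (b := b)) //; apply: ovr_ext; apply: av_cons.
by case: ifP => px; [have := step true|have := step false]; rewrite px; apply.
Qed.

(* The names of the part [g] of the history not yet reached; [None] is the end. *)
Definition gnms (g : option (seq (transformer 'I_m))) : seq atom :=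
  if g is Some h then nms K0 h else [::].
Definition cg (g : option (seq (transformer 'I_m))) : tree := if g is Some h then chist h else Lf.

(** The quantifier is separated from what is quantified: [val] is any test that the final expression
    evaluates at depth [D]. Each name and each passage to an older part of the history is paid for
    by the sizes of [W] and [g], which also bound how far the valuation grows. *)
Lemma ev_KQ (val : valu -> bool) (i : 'I_m) (phi : dform 'I_m) h l d D R :
  (forall v v', v =1 v' -> val v = val v') ->
  (forall l' e, tsz (crho l') <= R -> D <= e ->
     ev e (eIte (cOBSH (Nd (cnat i) (Nd (chist h) (Nd (crho l) (crho l')))))
       (eIte (cLAW (Nd (chist h) (crho l')))
         (cE (Nd (cdform phi) (Nd (chist h) (crho l')))) eT) eT) (val (av l'))) ->
  R <= B -> tsz (cnat i) <= B -> tsz (cdform phi) <= B -> tsz (chist h) <= B -> tsz (crho l) <= B ->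
  forall g W l', tsz (cg g) <= B -> tsz (catoms W) <= B ->
  tsz (crho l') + 6 * (tsz (catoms W) + tsz (cg g)) <= R ->
  D + tsz (catoms W) + tsz (cg g) <= d ->
  exists2 b, ev d (cKQ (Nd (catoms W) (Nd (cg g) (Nd (crho l') (Nd (cnat i) (Nd (cdform phi)
      (Nd (chist h) (crho l)))))))) b &
    (b <-> forall t : valu, val (ovr (W ++ gnms g) t (av l'))).
Proof.
move=> hv hE hR hi hphi hh hl.
have main n : forall g W l' d, tsz (catoms W) + tsz (cg g) <= n -> tsz (cg g) <= B -> tsz (catoms W) <= B ->
  tsz (crho l') + 6 * (tsz (catoms W) + tsz (cg g)) <= R ->
  D + tsz (catoms W) + tsz (cg g) <= d ->
  exists2 b, ev d (cKQ (Nd (catoms W) (Nd (cg g) (Nd (crho l') (Nd (cnat i) (Nd (cdform phi)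
      (Nd (chist h) (crho l)))))))) b &
    (b <-> forall t : valu, val (ovr (W ++ gnms g) t (av l'))).
  elim: n => [|n IH] g W l' {}d hn hg hW hl' hd.
    by have := tsz_gt0 (cg g); move: hn; clear; lia.
  case: W hn hW hl' hd => [|p W] hn hW hl' hd; last first.
    rewrite catoms_cons /= in hn hW hl' hd *.
    case: d hd => [|d] hd; first by exfalso; klia.
    have step b e : d <= e -> exists2 b', ev e (cKQ (Nd (catoms W) (Nd (cg g) (Nd (crho ((p, b) :: l')) (Nd (cnat i) (Nd (cdform phi)
        (Nd (chist h) (crho l)))))))) b' &
       (b' <-> forall t : valu, val (ovr (W ++ gnms g) t (av ((p, b) :: l')))).
      move=> de; apply: IH; [klia|klia|klia| |klia].
      by rewrite crho_cons /=; have := tsz_cb b; klia.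
    have [b1 e1 v1] := step true d (leqnn _).
    have [|b2 e2 v2] := step false d.+1; first by clear; lia.
    exists (b1 && b2).
      evcall; rewrite /bKQ /=; apply: ev_and => //; by szt.
    have eo t b : t p = b -> val (ovr (W ++ gnms g) t (av ((p, b) :: l'))) = val (ovr ((p :: W) ++ gnms g) t (av l')).
      move=> eb; apply: hv => q; rewrite -(@ovr_cons p (W ++ gnms g) t (av l') b) //.
      by apply: ovr_ext; apply: av_cons.
    split.
      case/andP=> /v1 h1 /v2 h2 t.
      by case E: (t p); rewrite -(eo _ _ E).
    move=> H; apply/andP; split; [apply/v1|apply/v2] => t.
      (* Outside the remaining names [t] is replaced by a constant, which gives [p] the wanted value
         unless [p] occurs again among them and is overwritten anyway. *)
      have := H (ovr (W ++ gnms g) t (fun=> true)).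
      rewrite (hv _ (ovr (W ++ gnms g) t (av ((p, true) :: l')))) // => q.
      by rewrite /ovr /= !inE; case: (q \in W ++ _); rewrite ?orbT // orbF; case: eqP.
    have := H (ovr (W ++ gnms g) t (fun=> false)).
    rewrite (hv _ (ovr (W ++ gnms g) t (av ((p, false) :: l')))) // => q.
    by rewrite /ovr /= !inE; case: (q \in W ++ _); rewrite ?orbT // orbF; case: eqP.
  case: g hn hg hl' hd => [g|] hn hg hl' hd; last first.
    exists (val (av l')); last first.
      by split=> [H t|/(_ xpredT)]; [rewrite (hv _ (av l'))|rewrite (hv _ (av l'))].
    evcall; rewrite /bKQ /=; apply: hE; [move: hl' => /=; klia|move: hd => /=; klia].
  case: g hn hg hl' hd => [|X g] hn hg hl' hd.
    rewrite /= in hn hg hl' hd.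
    have [|||||b e v] := IH None V0 l' d; rewrite /=; try klia.
    exists b; first by evcall; rewrite /bKQ /=.
    by rewrite v /= cats0.
  have ec := chist_cons V0 dg O X g.
  have szX : tsz (catoms (t_voc X)) < tsz (cX X) by rewrite /cX /=; klia.
  rewrite /= -/(chist g) in hn hg hl' hd.
  have [|||||b e v] := IH (Some g) (t_voc X) l' d; rewrite ?[cg _]/=; try klia.
  exists b => //; evcall; rewrite /bKQ /=; exact: e.
by move=> g W l'; apply: main (leqnn _).
Qed.

(** A single induction on the joint size covers subformulas, preconditions, formulas behind an event
    and, through [ev_LAW], the law check under a quantifier. *)
Lemma ev_E M : E_ok M.
Proof.
elim: M => [|M IHM] P h phi l d.
  by have := tsz_gt0 (chist h); clear; lia.
move=> hM hN hl w hp wf hd.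
have IHE : forall P h (phi' : dform 'I_m) l d, tsz (chist h) + tsz (cdform phi') <= M ->
  tsz (crho l) + 10 * N * (tsz (chist h) + tsz (cdform phi')) <= B ->
  hwf K0 P h -> pok (hvoc K0 h) P -> dwf (hvoc K0 h) P phi' ->
  depth_of (tsz (chist h) + tsz (cdform phi')) <= d ->
  ev d (cE (Nd (cdform phi') (Nd (chist h) (crho l)))) (tr K0 h (av l) phi').
  by move=> P' h' phi' l' d' a1 a2 a3 a4 a5 a6; apply: (IHM P') => //; apply: ltnW.
have hB := N_leq_B hl (leq_trans (tsz_gt0 (chist h)) (leq_addr _ _)).
have hd0 : 2 * B + 50 <= d by apply: leq_trans hd; rewrite /depth_of; clear; lia.
case: phi hM hl wf hd => [||p|phi|phi psi|i phi|X x phi] hM hl wf hd.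
- by evcall; apply: EvT.
- by evcall; apply: EvF.
- rewrite /= in hM; evcall; rewrite /bE /tag_case /=.
  by apply: ev_LOOK; klia.
- have lt : tsz (chist h) + tsz (cdform phi) < tsz (chist h) + tsz (cdform (DNeg phi)) by rewrite /=; clear; lia.
  have d1 := leq_depth lt; have r1 := leq_rho hl lt.
  rewrite /= in hM; evcall; rewrite /bE /tag_case /=.
  case: d hd hd0 => [|d] hd hd0; first by exfalso; klia.
  apply: ev_not; first by szt.
  by apply: (IHE P) => //; klia.
- have lt : tsz (chist h) + tsz (cdform phi) < tsz (chist h) + tsz (cdform (DAnd phi psi)) by rewrite /=; clear; lia.
  have lt' : tsz (chist h) + tsz (cdform psi) < tsz (chist h) + tsz (cdform (DAnd phi psi)) by rewrite /=; clear; lia.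
  have d1 := leq_depth lt; have r1 := leq_rho hl lt.
  have d2 := leq_depth lt'; have r2 := leq_rho hl lt'.
  rewrite /= in hM; case/andP: wf => w1 w2; evcall; rewrite /bE /tag_case /=.
  rewrite /tr trans_and bsatp_and.
  case: d hd hd0 => [|d] hd hd0; first by exfalso; klia.
  apply: ev_and; first by szt.
    by apply: (IHE P) => //; klia.
  by move=> _; apply: (IHE P) => //; klia.
- have lt : tsz (chist h) + tsz (cdform phi) < tsz (chist h) + tsz (cdform (DK i phi)) by rewrite /=; clear; lia.
  have d1 := leq_depth lt; have r1 := leq_rho hl lt.
  have wf' : dwf (hvoc K0 h) P phi := wf.
  have KE := tr_K (K0 := K0) base_names base_law base_obs (av l) i w hp wf'.
  have szi : tsz (cnat i) <= B by move: hM; rewrite /=; klia.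
  have szp : tsz (chist h) + tsz (cdform phi) <= M by move: hM; rewrite /=; klia.
  have hl0 : tsz (crho l) <= B by klia.
  pose val v' := obsok K0 i h (av l) v' ==> lawv K0 h v' ==> tr K0 h v' phi.
  have hv v v' : v =1 v' -> val v = val v'.
    move=> e; rewrite /val (tr_ext _ _ _ e) (lawv_ext _ _ e); congr (_ ==> _).
    rewrite /obsok; congr (_ && _); first by apply: eq_all => p; rewrite e.
    by apply: eq_all => Y; apply: eq_all => p; rewrite e.
  pose R := tsz (crho l) + 10 * N.
  have hR : R <= B by rewrite /R; clear -r1; lia.
  pose D := depth_of (tsz (chist h) + tsz (cdform phi)) + N + 10.
  have hE l' e : tsz (crho l') <= R -> D <= e ->
     ev e (eIte (cOBSH (Nd (cnat i) (Nd (chist h) (Nd (crho l) (crho l')))))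
       (eIte (cLAW (Nd (chist h) (crho l')))
         (cE (Nd (cdform phi) (Nd (chist h) (crho l')))) eT) eT) (val (av l')).
    move=> hl' he; have hD : 2 * B + 60 <= D by rewrite /D /depth_of; clear; lia.
    have hl'B := leq_trans hl' hR.
    case: e he => [|e] he; first by exfalso; klia.
    apply: (EvIte (b0 := obsok K0 i h (av l) (av l'))); first by szt.
      by apply: ev_OBSH => //; klia.
    rewrite /val; case: (obsok _ _ _ _ _); last exact: EvT.
    rewrite implyTb; apply: (EvIte (b0 := lawv K0 h (av l'))); first by szt.
      have [M' eM] : exists M', tsz (chist h) + tsz (cdform phi) = M'.+1.
        by exists (tsz (chist h) + tsz (cdform phi)).-1; rewrite prednK // ltn_addr // tsz_gt0.
      apply: (@ev_LAW M' _ P) => //.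
      + move=> P' h' phi' l'' d' a1 a2 a3 a4 a5 a6 a7; apply: (IHE P') => //.
        by apply: leq_trans a1 _; clear -eM szp; lia.
      + by clear -eM; lia.
      + by clear -eM szp hN; lia.
      + by rewrite -eM; apply: leq_trans r1; rewrite leq_add2r.
      + have : depth_of M' <= depth_of (tsz (chist h) + tsz (cdform phi)).
          by rewrite eM /depth_of leq_add2l leq_mul2r leqnSn orbT.
        move: he; rewrite /D; clear -szp hN; lia.
    case: (lawv _ _ _); last exact: EvT.
    rewrite implyTb; apply: (IHE P) => //.
      by apply: leq_trans r1; rewrite leq_add2r.
    by move: he; rewrite /D; clear; lia.
  (* The new valuation starts as the current one: the names are overwritten one by one, while the
     parameters keep their values. *)
  have [||||||b eb vb] := ev_KQ (d := d) hv hE hR szi _ _ hl0 (g := Some h) (W := [::]) (l' := l); try klia.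
  + by rewrite [cg _]/=; klia.
  + by rewrite /=; klia.
  + by rewrite /= /R; clear -szp hN; lia.
  + by rewrite [tsz (catoms _)]/= [cg _]/= /D; clear -szp hN d1 hd; lia.
  have -> : tr K0 h (av l) (DK i phi) = b.
    apply/idP/idP => [/KE H|/vb H].
      apply/vb => t; apply/implyP => o; apply/implyP => lw; apply: H => // p pn.
      by rewrite /ovr (negbTE pn).
    apply/KE => v' e o lw; have := H v'; rewrite (hv _ v').
      by rewrite /val o lw.
    by move=> p; rewrite /ovr /=; case: ifP => // /negbT /e.
  evcall; rewrite /bE /tag_case /=; exact: eb.
- have wfX := wf; have /dwf_updP[hx uo ux sx wp] := wf.
  have sz1 : tsz (chist h) + tsz (cdform (t_pre X)) < tsz (chist h) + tsz (cdform (DUpd X x phi)).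
    by rewrite cdform_upd /= /cX /=; clear; lia.
  have ec := chist_cons V0 dg O X h.
  have sz2 : tsz (chist (X :: h)) + tsz (cdform phi) < tsz (chist h) + tsz (cdform (DUpd X x phi)).
    by rewrite ec cdform_upd /=; clear; lia.
  have d1 := leq_depth sz1; have r1 := leq_rho hl sz1.
  have d2 := leq_depth sz2; have r2 := leq_rho hl sz2.
  pose R := tsz (crho l) + 10 * N.
  have hR : R <= B by rewrite /R; clear -r1; lia.
  have szX : tsz (chist h) + (tsz (cX X) + (tsz (catoms x) + tsz (cdform phi))) <= N.
    by apply: leq_trans hN; apply: leq_trans hM; rewrite cdform_upd /=; clear; lia.
  have szV : tsz (catoms (t_voc X)) < tsz (cX X) by rewrite /cX /=; clear; lia.
  rewrite (tr_upd (K0 := K0) base_names base_law base_obs (av l) w hp wfX).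
  pose val v := tr K0 h v (t_pre X) ==> tr K0 (X :: h) v phi.
  have hv v v' : v =1 v' -> val v = val v' by move=> e; rewrite /val !(tr_ext _ _ _ e).
  have hpX := pok_cat hx hp.
  have hE l' : tsz (crho l') <= R ->
     ev d (eIte (cE (Nd (cdform (t_pre X)) (Nd (chist h) (crho l'))))
            (cE (Nd (cdform phi) (Nd (Nd (cX X) (chist h)) (crho l')))) eT) (val (av l')).
    move=> hl'; have hl'B := leq_trans hl' hR.
    have szpre : tsz (cdform (t_pre X)) < tsz (cX X) by rewrite /cX /=; clear; lia.
    case: d hd hd0 => [|d] hd hd0; first by exfalso; klia.
    apply: (EvIte (b0 := tr K0 h (av l') (t_pre X))); first by szt.
      apply: (IHE (P ++ t_voc X)) => //.
      + by clear -sz1 hM; lia.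
      + by apply: leq_trans r1; rewrite leq_add2r.
      + by apply: hwf_sub w _ => p pP; rewrite mem_cat pP.
      + by case: hx.
      + by clear -d1 hd; lia.
    rewrite /val; case: (tr _ _ _ _); last exact: EvT.
    rewrite implyTb -ec; apply: (IHE P) => //.
    + by clear -sz2 hM; lia.
    + by apply: leq_trans r2; rewrite leq_add2r.
    + by exists P; split.
    + exact: upd_pok hx hp.
    + by clear -d2 hd; lia.
  rewrite cdform_upd; evcall; rewrite /bE /tag_case /=.
  apply: (ev_SETX (val := val) hv hE hR); try klia.
Qed.
End Eval.

(** * Deciding an instance given by its tree codes *)

Definition good S d (P : Prop) (e : tree) := exists2 b, @ev bodies S d e b & (b <-> P).

Lemma good_iff S d P Q e : (P <-> Q) -> good S d P e -> good S d Q e.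
Proof. by move=> h [b eb hb]; exists b => //; rewrite hb. Qed.

Lemma good_F S d P : ~ P -> good S d P eF.
Proof. by move=> h; exists false => //; exact: EvF. Qed.

(** The remaining expression is needed only if the first test succeeds. Later procedures, whose
    correctness presupposes well-formed data, may thus rely on the earlier checks. *)
Lemma good_and S d a (x : bool) P e : tsz a + tsz e + 13 <= S -> @ev bodies S d a x ->
  (x -> good S d.+1 P e) -> good S d.+1 (x /\ P) (eAnd a e).
Proof.
move=> sz ea he; case: x ea he => ea he.
  have [//|b eb hb] := he; exists b; last by rewrite hb; split=> [|[]].
  exact: (ev_and (x := true)).
exists false; last by split=> // -[].
by apply: (ev_and (x := false) (y := false)).
Qed.

Lemma bover_bdd V (d : bdd) : (forall u, u \in d -> if u is BNode p _ _ then p \in V else true) ->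
  all (bover V) (bdd_forms d).
Proof.
elim/last_ind: d => // d u IH h; rewrite bdd_forms_rcons all_rcons.
have {}IH : all (bover V) (bdd_forms d) by apply: IH => w wd; apply: h; rewrite mem_rcons inE wd orbT.
rewrite IH andbT; have := h u; rewrite mem_rcons mem_head => /(_ isT).
have hn i : bover V (nth BBot (bdd_forms d) i).
  case: (ltnP i (size (bdd_forms d))) => lt; last by rewrite nth_default.
  exact: (allP IH) (mem_nth _ lt).
by case: u {h} => [[]|p lo hi] //= ->; rewrite !hn.
Qed.

Lemma bdd_law_over V (d : bdd) : all (bnode_ok V d) (iota 0 (size d)) -> bover V (bdd_form d).
Proof.
move=> h; have : all (bover V) (bdd_forms d).
  apply: bover_bdd => u ud; have := allP h (index u d); rewrite mem_iota /= add0n index_mem => /(_ ud).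
  by rewrite /bnode_ok nth_index //; case: (u) => // p lo hi /and5P[].
by rewrite /bdd_form; case: (bdd_forms d) => // b bs /allP H; apply: H; exact: (mem_last b bs).
Qed.

Section Main.
Variables (m : nat) (V0 : seq atom) (dg : bdd) (O : {ffun 'I_m -> seq atom}).
Let K0 : kstruct 'I_m := KStruct V0 (bdd_form dg) O.
Notation chist := (chist V0 dg O).
Variables (S B : nat).
Hypothesis hS : 1000 * B + 4000 <= S.
Notation ev := (@ev bodies S).

Lemma ev_START (val : valu -> bool) (phi : dform 'I_m) s d R W l :
  (forall v v', v =1 v' -> val v = val v') ->
  (forall l', tsz (crho l') <= R ->
     ev d (eAnd (cLAW (Nd (chist [::]) (crho l')))
            (cE (Nd (cdform phi) (Nd (chist [::]) (crho l'))))) (val (av l'))) ->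
  R <= B -> tsz (chist [::]) <= B -> tsz (catoms s) <= B -> tsz (cdform phi) <= B ->
  B + 2 < d -> tsz (catoms W) <= B -> tsz (crho l) + 6 * tsz (catoms W) <= R ->
  ev d (cSTART (Nd (catoms W) (Nd (catoms s) (Nd (cdform phi) (Nd (chist [::]) (crho l))))))
    (val (ovr W (fun p => p \in s) (av l))).
Proof.
move: (chist [::]) => ch hv hE hR hh hs hphi hd; elim: W l => [|p W IH] l hW hl.
  evcall; rewrite /bSTART /=; rewrite (hv _ (av l)); last by move=> q; rewrite /ovr.
  by apply: hE; move: hl => /=; klia.
rewrite catoms_cons in hW hl *; evcall; rewrite /bSTART /=; rewrite /= in hW hl.
case: d hd hE IH => // d hd hE IH; apply: (EvIte (b0 := p \in s)); first by szt.
  by apply: (ev_memA hS); klia.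
have step b : b = (p \in s) -> ev d.+1 (cSTART (Nd (catoms W) (Nd (catoms s)
     (Nd (cdform phi) (Nd ch (crho ((p, b) :: l))))))) (val (ovr (p :: W) (fun p => p \in s) (av l))).
  move=> eb; rewrite -(hv (ovr W (fun p => p \in s) (av ((p, b) :: l)))).
    by apply: IH; [klia|rewrite crho_cons /=; have := tsz_cb b; klia].
  by move=> q; rewrite -(ovr_cons _ _ (b := b)) //; apply: ovr_ext; apply: av_cons.
by case: ifP => px; [have := step true|have := step false]; rewrite px; apply.
Qed.

(** [N] bounds the whole input and with it the measure of the evaluator; [10 * N * N] is the
    corresponding budget for valuations, and [20 * N] leaves room for the initial valuation. *)
Lemma good_MAIN (s : seq atom) (phi : dform 'I_m) N d :
  tsz (catoms V0) + tsz (cbdd dg) + tsz (cobs O) + tsz (catoms s) + tsz (cdform phi) + 20 <= N ->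
  10 * N * N + 20 * N <= B -> 2 * B + 200 + N * (2 * N + 20) + N <= d ->
  good S d (let I := Instance V0 dg O s phi in
      instance_ok I /\ sat (i_struct I) (i_state I) (i_goal I))
    (cMAIN (Nd (catoms V0) (Nd (cbdd dg) (Nd (cobs O) (Nd (catoms s) (cdform phi)))))).
Proof.
move=> hN hB hd'.
have hNB : 20 * N <= B by apply: leq_trans hB; exact: leq_addl.
have szh : tsz (chist [::]) + tsz (cdform phi) <= N by rewrite /=; klia.
have evmain P e : good S d P e -> tsz (cbdd dg) <= B -> body bodies 37 (Nd (catoms V0) (Nd (cbdd dg) (Nd (cobs O) (Nd (catoms s) (cdform phi))))) = e ->
  good S d P (cMAIN (Nd (catoms V0) (Nd (cbdd dg) (Nd (cobs O) (Nd (catoms s) (cdform phi)))))).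
  by move=> [b eb hb] _ ee; exists b => //; apply: EvCall; [szt|rewrite ee].
apply: evmain; [|by klia|by rewrite /body [nth _ _ _]/=].
rewrite /bMAIN /=.
have eL : isLf (cbdd dg) = nilp dg by case: (dg).
rewrite eL; case: ifP => dg0.
  by apply: good_F => /= -[[_ /and4P[]]]; rewrite /= (nilP dg0).
have dg_gt0 : 0 < size dg by move: dg0; case: (dg).
case: d hd' => [|d] hd'; first by exfalso; klia.
pose b1 := uniq V0; pose b2 := all is_name V0; pose b3 := uniq dg.
pose b4 := all (bnode_ok V0 dg) (iota 0 (size dg)).
pose b5 := all (fun j => has (is_child j) dg) (iota 0 (size dg).-1).
pose b6 := [forall i, uniq (O i) && all (mem V0) (O i)].
pose b7 := uniq s; pose b8 := all (mem V0) s; pose b9 := dwf V0 [::] phi.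
pose b10 := bsat s (bdd_form dg) && bsat s (trans K0 phi).
(* The conditions in the order in which the program tests them. Satisfaction has become Boolean
   truth of the local translation, which is legitimate only once the other conditions hold. *)
apply: (@good_iff _ _ (b1 /\ b2 /\ b3 /\ b4 /\ b5 /\ b6 /\ b7 /\ b8 /\ b9 /\ b10)).
  have np : nonprime V0 -> fok V0 [::] (belief_of K0) -> b9 -> b8 ->
      sat K0 s phi <-> bsat s (trans K0 phi).
    move=> np fk h9 h8; apply: (sat_trans np fk h9) => p ps; exact: (allP h8).
  have bases : b2 -> b4 -> b6 -> nonprime V0 /\ fok V0 [::] (belief_of K0).
    move=> h2 h4 /forallP h6; split; first by move=> p /(allP h2) /name_nonprime.
    have base_obs i : {subset O i <= V0} by have /andP[_ /allP] := h6 i.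
    exact: (@hist_fok _ K0 h2 (bdd_law_over h4) base_obs [::] [::]).
  split.
    move=> [h1 [h2 [h3 [h4 [h5 [h6 [h7 [h8 [h9 /andP[hl hp]]]]]]]]]].
    have [nV fV] := bases h2 h4 h6; split; last by apply/np.
    split=> //=; first by apply/and4P.
      by move=> i; have /andP[? /allP] := forallP h6 i.
    by split=> //; split=> //=; apply/allP.
  case=> -[[h1 h2] /and4P[_ h3 h4 h5] h6 [h7 [h8 hl]] h9] hs; rewrite /= in h1 h2 h3 h4 h5 h6 h7 h8 hl h9 hs.
  have h6' : b6 by apply/forallP => i; have [-> h] := h6 i; apply/allP.
  have h8' : b8 by apply/allP.
  have [nV fV] := bases h2 h4 h6'.
  by do 9 split=> //; rewrite /b10 hl; apply/np.
have hd2 : 2 * B + 200 + N <= d.+1 by clear -hd'; move: hd'; move: (N * _) => z; lia.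
apply: good_and; [by rewrite ?(tsz_ite, tsz_call) /=; clear -hS hN hNB; lia|by apply: (ev_uniqA hS); (clear -hS hN hNB hd2; lia)|move=> h1].
apply: good_and; [by rewrite ?(tsz_ite, tsz_call) /=; clear -hS hN hNB; lia|by apply: (ev_NAMES hS); (clear -hS hN hNB hd2; lia)|move=> h2].
apply: good_and; first by rewrite ?(tsz_ite, tsz_call) /=; clear -hS hN hNB; lia.
  by rewrite /b3 -(map_inj_uniq cbnode_inj); apply: (ev_UNIQ hS); rewrite -/(cbdd dg); (clear -hS hN hNB hd2; lia).
move=> h3; apply: good_and; first by rewrite ?(tsz_ite, tsz_call) /=; clear -hS hN hNB; lia.
  by apply: (ev_NOKS hS (i := 0)); rewrite ?take0 //; (clear -hS hN hNB hd2; lia).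
move=> h4; apply: good_and; first by rewrite ?(tsz_ite, tsz_call) /=; clear -hS hN hNB; lia.
  by have [||||] := @ev_CHS S B hS dg d 0 dg; rewrite ?add0n //; clear -hS hN hNB hd2; lia.
move=> h5; apply: good_and; [by rewrite ?(tsz_ite, tsz_call) /=; clear -hS hN hNB; lia|by apply: (ev_OBSC hS); (clear -hS hN hNB hd2; lia)|move=> h6].
apply: good_and; [by rewrite ?(tsz_ite, tsz_call) /=; clear -hS hN hNB; lia|by apply: (ev_uniqA hS); (clear -hS hN hNB hd2; lia)|move=> h7].
apply: good_and; [by rewrite ?(tsz_ite, tsz_call) /=; clear -hS hN hNB; lia|by apply: (ev_subA hS); (clear -hS hN hNB hd2; lia)|move=> h8].
have hch : eBASE (Nd (catoms V0) (Nd (cbdd dg) (Nd (cobs O) (Nd (catoms s) (cdform phi))))) = chist [::] by [].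
rewrite hch /=.
have hBs : tsz (chist [::]) + tsz (cdform phi) <= B by clear -szh hNB; lia.
apply: good_and; first by rewrite ?(tsz_ite, tsz_call) /=; clear -hS hN hNB; lia.
  by apply: (@ev_DW _ V0 dg O h2 S B hS phi [::] [::]) => //; rewrite /cPs /=; (clear -hS hN hNB hd2 hBs; simpl in *; lia).
move=> h9.
have dg_ok j : j < size dg -> if nth (BLeaf false) dg j is BNode _ lo hi then (lo < j) && (hi < j) else true.
  move=> lj; have := allP h4 j; rewrite mem_iota /= => /(_ lj); rewrite /bnode_ok.
  by case: (nth _ _ _) => // p lo hi /and5P[_ -> ->].
have base_law := bdd_law_over h4.
have base_obs i : {subset O i <= V0} by have /forallP/(_ i)/andP[_ /allP] := h6.
pose val v := lawv K0 [::] v && tr K0 [::] v phi.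
have hv v v' : v =1 v' -> val v = val v' by move=> e; rewrite /val (lawv_ext _ _ e) (tr_ext _ _ _ e).
exists (val (ovr V0 (fun p => p \in s) (av [::]))).
  apply: (@ev_START val phi s d.+1 (10 * N) V0 [::] hv); [|clear -hS hNB; lia|clear -szh hNB; lia|clear -hN hNB; lia|clear -hN hNB; lia|clear -hd2; lia|clear -hN hNB; lia|by rewrite /=; clear -hN; lia].
  move=> l' hl'; unfold b2 in h2; unfold b9 in h9; clear b1 b2 b3 b4 b5 b6 b7 b8 b9 b10 h1 h3 h5 h7 h8 h4 h6.
  have hl2 : tsz (crho l') + 10 * N * (tsz (chist [::]) + tsz (cdform phi)) <= B.
    apply: leq_trans hB; rewrite addnC leq_add //; last by klia.
    by rewrite leq_mul2l szh orbT.
  have [M eM] : exists M, tsz (chist [::]) + tsz (cdform phi) = M.+1.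
    by exists (tsz (chist [::]) + tsz (cdform phi)).-1; rewrite prednK // ltn_addr // tsz_gt0.
  have hM : M.+1 * (2 * N + 20) <= N * (2 * N + 20) by rewrite leq_mul2r -eM szh orbT.
  apply: ev_and; first by szt.
    apply: (@ev_LAW _ V0 dg O h2 base_law base_obs dg_gt0 dg_ok S B hS N M (@ev_E _ V0 dg O h2 base_law base_obs dg_gt0 dg_ok S B hS N M) [::] [::] l') => //.
    - by move: eM szh; have := tsz_gt0 (cdform phi); klia.
    - by rewrite -eM.
    - by rewrite -eM.
    - by rewrite /depth_of; move: hM; rewrite mulSn; klia.
  move=> _; apply: (ev_E h2 base_law base_obs dg_gt0 dg_ok hS (N := N) (M := N) (P := [::])) => //.
  by rewrite /depth_of eM; klia.
rewrite /val /b10 lawv_nil !bsatE.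
have e : ovr V0 (fun p => p \in s) (av [::]) =1 (fun p => p \in s).
  by move=> p; rewrite /ovr; case: ifP => // /negbT pV; apply/esym/negbTE; apply: contra pV => /(allP h8).
by rewrite (bsatp_ext _ e) (tr_ext _ _ _ e).
Qed.
End Main.

(** * Parsing *)

Lemma enc_natS n r : enc_nat n.+1 ++ r = true :: enc_nat n ++ r. Proof. by []. Qed.

Lemma cpostE l : cpost l = clist [seq Nd (catom q.1) (cbform q.2) | q <- l].
Proof. by rewrite /cpost /cpairs -map_comp. Qed.

Lemma size_consE (b : bool) s : size (b :: s) = (size s).+1. Proof. by []. Qed.

Section Parse.
Variables (m S B d wt : nat).
Hypothesis hS : 1000 * B + 4000 <= S.
Hypothesis hm : tsz (cnat m) <= B.
Hypothesis hd0 : 0 < d.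
(** The weight of a bit includes the number of agents because reading an update schedules an action
    that carries this number. *)
Hypothesis hwt : 1000 + tsz (cnat m) <= wt.
Notation good := (good S d).
Notation prc t v bits := (pr t v (cnat m) (cbits bits)).

Lemma wt_ge k : 1000 * k <= wt * k.
Proof. by rewrite leq_mul2r; apply/orP; right; apply: leq_trans hwt; apply: leq_addr. Qed.

Lemma good_step e P a t v bits : good P e ->
  bPR (Nd (Nd a t) (Nd v (Nd (cnat m) (cbits bits)))) = e ->
  tsz a + tsz t + tsz v + wt * size bits <= 2 * B + 1000 -> good P (prc (Nd a t) v bits).
Proof.
move=> [b eb hb] he sz; exists b => //; apply: EvCall.
  have := tsz_cbits bits; have := wt_ge (size bits); rewrite tsz_call /=.
  move: (wt * size bits) sz; clear -hS hm => x; lia.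
by rewrite /body [nth _ _ _]/= he.
Qed.

Lemma good_PAIR P t v a b bits : good P (prc t (Nd (Nd a b) v) bits) ->
  tsz t + tsz v + tsz a + tsz b + wt * size bits <= B + 500 -> good P (prc (Nd aPAIR t) (Nd b (Nd a v)) bits).
Proof. by move=> h sz; apply: (good_step h) => //; rewrite /=; klia. Qed.

(* The action [a] reads the code of an [x] and pushes [code x]; every bit read
   pays [wt] towards the space used. *)
Definition pparse n a c T (enc : T -> seq bool) (code : T -> tree) :=
  forall t v bits (K : T -> seq bool -> Prop),
  size bits < n -> tsz t + tsz v + wt * size bits + c <= B ->
  (forall x rest, bits = enc x ++ rest -> size rest < size bits ->
     tsz (code x) + 600 + tsz (cnat m) + wt * size rest <= wt * size bits ->
     good (K x rest) (prc t (Nd (code x) v) rest)) ->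
  good (exists x rest, bits = enc x ++ rest /\ K x rest) (prc (Nd a t) v bits).

Lemma good_NATL t v bits k (K : nat -> seq bool -> Prop) :
  tsz t + tsz v + tsz (cnat k) + wt * size bits + 50 <= B ->
  (forall n rest, bits = enc_nat n ++ rest -> good (K (k + n) rest) (prc t (Nd (cnat (k + n)) v) rest)) ->
  good (exists n rest, bits = enc_nat n ++ rest /\ K (k + n) rest) (prc (Nd aNATL t) (Nd (cnat k) v) bits).
Proof.
elim: bits k => [|b bits IH] k sz H.
  apply: (good_step (e := eF)) => //; last by move: sz; rewrite /=; klia.
  by apply: good_F => -[[|n] [r []]].
rewrite [size _]/= mulnS in sz.
have hw := hwt.
case: b H => H; last first.
  apply: (good_step (e := prc t (Nd (cnat k) v) bits)) => //; last by rewrite /= mulnS; klia.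
  have := H 0 bits erefl; rewrite addn0; apply: good_iff; split=> [h|].
    by exists 0, bits; rewrite addn0.
  by case=> -[|n] [r []] //= [<-]; rewrite addn0.
apply: (good_step (e := prc (Nd aNATL t) (Nd (cnat k.+1) v) bits)) => //; last by rewrite /= mulnS; klia.
have := IH k.+1; rewrite /= => /(_ _ _)/good_iff; apply.
- split=> -[n [r []]]; first by move=> -> h; exists n.+1, r; rewrite -addSnnS.
  by case: n => [|n] //= [->]; rewrite -addSnnS; exists n, r.
- by klia.
- by move=> n r e; have := H n.+1 r; rewrite enc_natS -e addnS => /(_ erefl).
Qed.

Lemma good_NAT t v bits (K : nat -> seq bool -> Prop) : tsz t + tsz v + wt * size bits + 100 <= B ->
  (forall k rest, bits = enc_nat k ++ rest -> size rest < size bits ->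
     tsz (cnat k) + 700 + tsz (cnat m) + wt * size rest <= wt * size bits ->
     good (K k rest) (prc t (Nd (cnat k) v) rest)) ->
  good (exists k rest, bits = enc_nat k ++ rest /\ K k rest) (prc (Nd aNAT t) v bits).
Proof.
move=> sz H; apply: (good_step (e := prc (Nd aNATL t) (Nd (cnat 0) v) bits)) => //; last by rewrite /=; klia.
apply: good_NATL; first by rewrite /=; klia.
move=> k rest e; rewrite add0n; apply: H => //; rewrite e size_cat size_enc_nat; first by klia.
by rewrite mulnDr mulnS tsz_cnat; have := wt_ge k; have := hwt; move: (wt * k) (wt * size rest); klia.
Qed.

Lemma pparse_nat n : pparse n aNAT 100 enc_nat cnat.
Proof. by move=> t v bits K _ sz H; apply: good_NAT => // k r e sr h; apply: H => //; klia. Qed.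

Lemma pparse_bit n : pparse n aBIT 100 (fun b => [:: b]) cb.
Proof.
move=> t v [|b bits] K _ sz H.
  by apply: (good_step (e := eF)) => //; [apply: good_F => -[? [? []]]|rewrite /=; klia].
have hw := hwt; have hb := tsz_cb b; have := H b bits erefl (leqnn _); rewrite size_consE mulnS => h.
apply: (good_step (e := prc t (Nd (cb b) v) bits)) => //; last by rewrite /= mulnS in sz *; klia.
apply: good_iff (h _); last by klia.
by split=> [k|[x [r [[-> ->]]]] //]; exists b, bits.
Qed.

Lemma pparse_seq n X c T (enc : T -> seq bool) code : tsz X <= 200 -> c <= 500 ->
  pparse n X c enc code -> pparse n (aSEQ X) 100 (enc_seq enc) (fun s => clist (map code s)).
Proof.
move=> hX hc H; elim: n H => [|n IH] H t v bits K hn sz HK; have hw := hwt; first by [].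
case: bits hn sz HK => [|b bits] hn sz HK.
  by apply: (good_step (e := eF)) => //; [apply: good_F => -[[|? ?] [? []]]|rewrite /=; klia].
rewrite [size _]/= mulnS in sz; rewrite /= in hn.
case: b HK => HK; last first.
  apply: (good_step (e := prc t (Nd Lf v) bits)) => //; last by rewrite /= mulnS; klia.
  have := HK [::] bits erefl; rewrite /= ltnS leqnn mulnS => /(_ isT) h.
  apply: good_iff (h _); last by klia.
  split=> [h'|[[|? ?] [r [//= [<-]]]] //].
  by exists [::], bits.
apply: (good_step (e := prc (Nd X (Nd (aSEQ X) (Nd aPAIR t))) v bits)) => //; last by rewrite /= mulnS; klia.
apply: (good_iff (P := exists x r, bits = enc x ++ r /\ exists s r', r = enc_seq enc s ++ r' /\ K (x :: s) r')).
  split.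
    by move=> [x [r [-> [s [r' [-> h]]]]]]; exists (x :: s), r'; rewrite /= catA.
  case=> -[|x s] [r' []] //= [->]; rewrite -catA => h.
  by exists x, (enc_seq enc s ++ r'); split=> //; exists s, r'.
apply: (H); [by klia|by rewrite /=; klia|].
move=> x r e sr hr.
have Hk : pparse n X c enc code.
  by move=> t0 v0 bits0 K0 h0; apply: (H); apply: leq_trans h0 _.
apply: (IH Hk); [by klia|by rewrite /=; klia|].
move=> s r' e' sr' hr'; apply: good_PAIR; last by move: hr'; rewrite /=; klia.
apply: HK; [by rewrite e e' /= catA|by rewrite /=; klia|].
by rewrite /= mulnS; move: hr' => /=; klia.
Qed.

Lemma pparse_atom n : pparse n aATOM 200 enc_atom catom.
Proof.
elim: n => [|n IH] t v bits K hn sz HK; have hw := hwt; first by [].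
apply: (good_step (e := prc (pushes [:: aNAT; aATOMD] t) v bits)) => //; last by rewrite /=; klia.
(* The condition on the bits behind the tag [k]. Reading the tag first and then satisfying [K1] is
   equivalent to the original claim, constructor by constructor. *)
pose K1 k r := match k with
  | 0 => exists s r', r = enc_seq (fun b : bool => [:: b]) s ++ r' /\ K (Atom s) r'
  | 1 => exists j r1, r = enc_nat j ++ r1 /\ exists q r2, r1 = enc_atom q ++ r2 /\ K (Circ j q) r2
  | 2 => exists q r', r = enc_atom q ++ r' /\ K (Prime q) r'
  | _ => False end.
apply: (good_iff (P := exists k r, bits = enc_nat k ++ r /\ K1 k r)).
  split.
    case=> -[|[|[|k]]] [r [-> /=]] //.
    - by move=> [s [r' [-> h]]]; exists (Atom s), r'.
    - by move=> [j [r1 [-> [q [r2 [-> h]]]]]]; exists (Circ j q), r2; rewrite /= catA.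
    - by move=> [q [r' [-> h]]]; exists (Prime q), r'.
  case=> -[s|j q|q] [r [->]] h; [exists 0|exists 1|exists 2]; eexists; (split; first by rewrite /= -?catA).
  - by exists s, r.
  - by exists j, (enc_atom q ++ r); split=> //; exists q, r.
  - by exists q, r.
apply: good_NAT; first by rewrite /=; klia.
case=> [|[|[|k]]] r e sr hr.
- apply: (good_step (e := prc (pushes [:: aSEQ aBIT; aPAIR] t) (Nd (cnat 0) v) r)) => //; last by move: hr; rewrite /=; klia.
  apply: (pparse_seq (n := (size r).+1) (c := 100) _ _ (pparse_bit (n := _))) => //; first by move: hr; rewrite /=; klia.
  move=> s r' e' sr' hr'; apply: good_PAIR; last by move: hr hr'; rewrite /=; klia.
  apply: HK; [by rewrite e e'|by klia|by move: hr hr'; rewrite /= -/(cbits s); klia].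
- apply: (good_step (e := prc (pushes [:: aNAT; aATOM; aPAIR; aPAIR] t) (Nd (cnat 1) v) r)) => //; last by move: hr; rewrite /=; klia.
  apply: (pparse_nat (n := (size r).+1)) => //; first by move: hr; rewrite /=; klia.
  move=> j r1 e1 s1 h1; apply: IH; [by klia|by move: hr h1; rewrite /=; klia|].
  move=> q r2 e2 s2 h2; apply: good_PAIR; last by move: hr h1 h2; rewrite /=; klia.
  apply: good_PAIR; last by move: hr h1 h2; rewrite /=; klia.
  by apply: HK; [rewrite e e1 e2 /= -catA|klia|move: hr h1 h2; rewrite /=; klia].
- apply: (good_step (e := prc (pushes [:: aATOM; aPAIR] t) (Nd (cnat 2) v) r)) => //; last by move: hr; rewrite /=; klia.
  apply: IH; [by klia|by move: hr; rewrite /=; klia|].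
  move=> q r2 e2 s2 h2; apply: good_PAIR; last by move: hr h2; rewrite /=; klia.
  by apply: HK; [rewrite e e2|klia|move: hr h2; rewrite /=; klia].
- apply: (good_step (e := eF)); [exact: good_F| |by move: hr; rewrite /=; klia].
  by rewrite /bPR /= /tag_case; do ?case: ifP.
Qed.

Lemma pparse_bform n : pparse n aBF 200 enc_bform cbform.
Proof.
elim: n => [|n IH] t v bits K hn sz HK; have hw := hwt; first by [].
apply: (good_step (e := prc (pushes [:: aNAT; aBFD] t) v bits)) => //; last by rewrite /=; klia.
pose K1 k r := match k with
  | 0 => K BTop r
  | 1 => K BBot r
  | 2 => exists q r', r = enc_atom q ++ r' /\ K (BAtom q) r'
  | 3 => exists q r', r = enc_bform q ++ r' /\ K (BNeg q) r'
  | 4 => exists b r1, r = enc_bform b ++ r1 /\ exists c r2, r1 = enc_bform c ++ r2 /\ K (BAnd b c) r2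
  | _ => False end.
apply: (good_iff (P := exists k r, bits = enc_nat k ++ r /\ K1 k r)).
  split.
    case=> -[|[|[|[|[|k]]]]] [r [-> /=]] //.
    - by move=> h; exists BTop, r.
    - by move=> h; exists BBot, r.
    - by move=> [q [r' [-> h]]]; exists (BAtom q), r'.
    - by move=> [q [r' [-> h]]]; exists (BNeg q), r'.
    - by move=> [b [r1 [-> [c [r2 [-> h]]]]]]; exists (BAnd b c), r2; rewrite /= -catA.
  case=> -[||p|b|b c] [r [->]] h; [exists 0|exists 1|exists 2|exists 3|exists 4]; eexists; (split; first by rewrite /= -?catA); rewrite //=.
  - by exists p, r.
  - by exists b, r.
  - by exists b, (enc_bform c ++ r); split=> //; exists c, r.
apply: good_NAT; first by rewrite /=; klia.
case=> [|[|[|[|[|k]]]]] r e sr hr.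
- apply: (good_step (e := prc (Nd aPAIR t) (Nd Lf (Nd (cnat 0) v)) r)) => //; last by move: hr; rewrite /=; klia.
  apply: good_PAIR; last by move: hr; rewrite /=; klia.
  by apply: HK; [rewrite e|klia|move: hr; rewrite /=; klia].
- apply: (good_step (e := prc (Nd aPAIR t) (Nd Lf (Nd (cnat 1) v)) r)) => //; last by move: hr; rewrite /=; klia.
  apply: good_PAIR; last by move: hr; rewrite /=; klia.
  by apply: HK; [rewrite e|klia|move: hr; rewrite /=; klia].
- apply: (good_step (e := prc (pushes [:: aATOM; aPAIR] t) (Nd (cnat 2) v) r)) => //; last by move: hr; rewrite /=; klia.
  apply: (pparse_atom (n := (size r).+1)) => //; first by move: hr; rewrite /=; klia.
  move=> q r2 e2 s2 h2; apply: good_PAIR; last by move: hr h2; rewrite /=; klia.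
  by apply: HK; [rewrite e e2|klia|move: hr h2; rewrite /=; klia].
- apply: (good_step (e := prc (pushes [:: aBF; aPAIR] t) (Nd (cnat 3) v) r)) => //; last by move: hr; rewrite /=; klia.
  apply: IH; [by klia|by move: hr; rewrite /=; klia|].
  move=> q r2 e2 s2 h2; apply: good_PAIR; last by move: hr h2; rewrite /=; klia.
  by apply: HK; [rewrite e e2|klia|move: hr h2; rewrite /=; klia].
- apply: (good_step (e := prc (pushes [:: aBF; aBF; aPAIR; aPAIR] t) (Nd (cnat 4) v) r)) => //; last by move: hr; rewrite /=; klia.
  apply: (IH); [by klia|by move: hr; rewrite /=; klia|].
  move=> b r1 e1 s1 h1; apply: (IH); [by klia|by move: hr h1; rewrite /=; klia|].
  move=> c r2 e2 s2 h2; apply: good_PAIR; last by move: hr h1 h2; rewrite /=; klia.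
  apply: good_PAIR; last by move: hr h1 h2; rewrite /=; klia.
  by apply: HK; [rewrite e e1 e2 /= -catA|klia|move: hr h1 h2; rewrite /=; klia].
- apply: (good_step (e := eF)); [exact: good_F| |by move: hr; rewrite /=; klia].
  by rewrite /bPR /= /tag_case; do ?case: ifP.
Qed.

Lemma pparse_bnode n : pparse n aBN 200 enc_bnode cbnode.
Proof.
move=> t v bits K hn sz HK; have hw := hwt.
apply: (good_step (e := prc (pushes [:: aNAT; aBND] t) v bits)) => //; last by rewrite /=; klia.
pose K1 k r := match k with
  | 0 => K (BLeaf false) r
  | 1 => K (BLeaf true) r
  | 2 => exists p r1, r = enc_atom p ++ r1 /\ exists lo r2, r1 = enc_nat lo ++ r2 /\
          exists hi r3, r2 = enc_nat hi ++ r3 /\ K (BNode p lo hi) r3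
  | _ => False end.
apply: (good_iff (P := exists k r, bits = enc_nat k ++ r /\ K1 k r)).
  split.
    case=> -[|[|[|k]]] [r [-> /=]] //.
    - by move=> h; exists (BLeaf false), r.
    - by move=> h; exists (BLeaf true), r.
    - by move=> [p [r1 [-> [lo [r2 [-> [hi [r3 [-> h]]]]]]]]]; exists (BNode p lo hi), r3; rewrite /= -!catA.
  case=> -[[]|p lo hi] [r [->]] h; [exists 1|exists 0|exists 2]; eexists; (split; first by rewrite /= -?catA); rewrite //=.
  by exists p, (enc_nat lo ++ enc_nat hi ++ r); split=> //; exists lo, (enc_nat hi ++ r); split=> //; exists hi, r.
apply: good_NAT; first by rewrite /=; klia.
case=> [|[|[|k]]] r e sr hr.
- apply: (good_step (e := prc (Nd aPAIR t) (Nd Lf (Nd (cnat 0) v)) r)) => //; last by move: hr; rewrite /=; klia.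
  apply: good_PAIR; last by move: hr; rewrite /=; klia.
  by apply: (HK (BLeaf false)); [rewrite e|klia|move: hr; rewrite /=; klia].
- apply: (good_step (e := prc (Nd aPAIR t) (Nd Lf (Nd (cnat 1) v)) r)) => //; last by move: hr; rewrite /=; klia.
  apply: good_PAIR; last by move: hr; rewrite /=; klia.
  by apply: (HK (BLeaf true)); [rewrite e|klia|move: hr; rewrite /=; klia].
- apply: (good_step (e := prc (pushes [:: aATOM; aNAT; aNAT; aPAIR; aPAIR; aPAIR] t) (Nd (cnat 2) v) r)) => //; last by move: hr; rewrite /=; klia.
  apply: (pparse_atom (n := (size r).+1)) => //; first by move: hr; rewrite /=; klia.
  move=> p r1 e1 s1 h1; apply: (pparse_nat (n := (size r1).+1)) => //; first by move: hr h1; rewrite /=; klia.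
  move=> lo r2 e2 s2 h2; apply: (pparse_nat (n := (size r2).+1)) => //; first by move: hr h1 h2; rewrite /=; klia.
  move=> hi r3 e3 s3 h3; apply: good_PAIR; last by move: hr h1 h2 h3; rewrite /=; klia.
  apply: good_PAIR; last by move: hr h1 h2 h3; rewrite /=; klia.
  apply: good_PAIR; last by move: hr h1 h2 h3; rewrite /=; klia.
  by apply: (HK (BNode p lo hi)); [rewrite e e1 e2 e3 /= -!catA|klia|move: hr h1 h2 h3; rewrite /=; klia].
- apply: (good_step (e := eF)); [exact: good_F| |by move: hr; rewrite /=; klia].
  by rewrite /bPR /= /tag_case; do ?case: ifP.
Qed.

Lemma pparse_post n : pparse n aPOST 300 (fun q => enc_atom q.1 ++ enc_bform q.2)
  (fun q => Nd (catom q.1) (cbform q.2)).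
Proof.
move=> t v bits K hn sz HK; have hw := hwt.
apply: (good_step (e := prc (pushes [:: aATOM; aBF; aPAIR] t) v bits)) => //; last by rewrite /=; klia.
apply: (good_iff (P := exists p r, bits = enc_atom p ++ r /\ exists b r', r = enc_bform b ++ r' /\ K (p, b) r')).
  split; first by move=> [p [r [-> [b [r' [-> h]]]]]]; exists (p, b), r'; rewrite /= catA.
  by move=> [[p b] [r [-> h]]]; exists p, (enc_bform b ++ r); rewrite /= catA; split=> //; exists b, r.
apply: (pparse_atom (n := (size bits).+1)) => //; first by rewrite /=; klia.
move=> p r e sr hr; apply: (pparse_bform (n := (size r).+1)) => //; first by move: hr; rewrite /=; klia.
move=> b r' e' sr' hr'; apply: good_PAIR; last by move: hr hr'; rewrite /=; klia.
by apply: (HK (p, b)); [rewrite e e' /= catA|klia|move: hr hr'; rewrite /=; klia].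
Qed.

Notation enc_atoms := (enc_seq enc_atom).

Lemma pparse_atoms n : pparse n (aSEQ aATOM) 100 enc_atoms catoms.
Proof. by apply: (pparse_seq (c := 200)) => //; apply: pparse_atom. Qed.

(** This code has no end marker, the number of lists being known. For [j = 0] no bit is read
    although a leaf is pushed, hence the weak inequalities and the loss of 1. *)
Lemma good_OBS j t v bits (K : seq (seq atom) -> seq bool -> Prop) :
  tsz t + tsz v + wt * size bits + tsz (cnat j) + 300 <= B ->
  (forall L rest, size L = j -> bits = flatten (map enc_atoms L) ++ rest -> size rest <= size bits ->
     tsz (clist (map catoms L)) + wt * size rest <= wt * size bits + 1 ->
     good (K L rest) (prc t (Nd (clist (map catoms L)) v) rest)) ->
  good (exists L rest, [/\ size L = j, bits = flatten (map enc_atoms L) ++ rest & K L rest])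
    (prc (Nd (aOBS (cnat j)) t) v bits).
Proof.
have hw := hwt; elim: j t v bits K => [|j IH] t v bits K sz HK.
  apply: (good_step (e := prc t (Nd Lf v) bits)) => //; last by move: sz; rewrite /=; klia.
  have := HK [::] bits erefl erefl (leqnn _); rewrite /= addnC leqnn => /(_ isT).
  apply: good_iff; split=> [h|[[|? ?] [r [//]]]]; first by exists [::], bits.
  by move=> _ ->.
apply: (good_step (e := prc (Nd (aSEQ aATOM) (Nd (aOBS (cnat j)) (Nd aPAIR t))) v bits)) => //; last by move: sz; rewrite /=; klia.
apply: (good_iff (P := exists x r, bits = enc_atoms x ++ r /\
   exists L r', [/\ size L = j, r = flatten (map enc_atoms L) ++ r' & K (x :: L) r'])).
  split.
    by move=> [x [r [-> [L [r' [<- -> h]]]]]]; exists (x :: L), r'; rewrite /= catA.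
  move=> [[|x L] [r [//= [eL] -> h]]]; exists x, (flatten (map enc_atoms L) ++ r); rewrite catA.
  by split=> //; exists L, r.
apply: (pparse_atoms (n := (size bits).+1)) => //; first by move: sz; rewrite /=; klia.
move=> x r e sr hr; apply: IH; first by move: sz hr; rewrite /=; klia.
move=> L r' eL e' sr' hr'; apply: good_PAIR; last by move: sz hr hr'; rewrite /=; klia.
by apply: (HK (x :: L)); [rewrite /= eL|rewrite e e' /= catA|klia|move: hr hr'; rewrite /=; klia].
Qed.

Lemma obs_of_list (L : seq (seq atom)) : size L = m ->
  let O := [ffun i : 'I_m => nth [::] L i] in
  enc_obs O = flatten (map enc_atoms L) /\ cobs O = clist (map catoms L).
Proof.
move=> eL O.
have e : [seq O i | i <- enum 'I_m] = L.
  apply: (@eq_from_nth _ [::]); first by rewrite size_map size_enum_ord.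
  move=> i; rewrite size_map size_enum_ord => lt.
  by rewrite (nth_map (Ordinal lt)) ?size_enum_ord // ffunE nth_enum_ord.
by split; rewrite -[in RHS]e -map_comp.
Qed.

Lemma list_of_obs (O : {ffun 'I_m -> seq atom}) : exists2 L, size L = m & O = [ffun i : 'I_m => nth [::] L i].
Proof.
exists [seq O i | i <- enum 'I_m]; first by rewrite size_map size_enum_ord.
apply/ffunP => i; rewrite ffunE (nth_map i) ?size_enum_ord //.
by congr (O _); apply/val_inj; rewrite /= nth_enum_ord.
Qed.

Lemma good_obs t v bits (K : {ffun 'I_m -> seq atom} -> seq bool -> Prop) :
  tsz t + tsz v + wt * size bits + tsz (cnat m) + 300 <= B ->
  (forall O rest, bits = enc_obs O ++ rest -> size rest <= size bits ->
     tsz (cobs O) + wt * size rest <= wt * size bits + 1 ->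
     good (K O rest) (prc t (Nd (cobs O) v) rest)) ->
  good (exists O rest, bits = enc_obs O ++ rest /\ K O rest) (prc (Nd (aOBS (cnat m)) t) v bits).
Proof.
move=> sz HK.
apply: (good_iff (P := exists L rest, [/\ size L = m, bits = flatten (map enc_atoms L) ++ rest
  & K [ffun i : 'I_m => nth [::] L i] rest])).
  split=> [[L [r [eL -> h]]]|[O [r [-> h]]]].
    by eexists; exists r; split; last exact: h; rewrite (obs_of_list eL).1.
  have [L eL eO] := list_of_obs O; exists L, r; split=> //; last by rewrite -eO.
  by rewrite eO (obs_of_list eL).1.
apply: good_OBS => // L r eL e sr hr.
by rewrite -(obs_of_list eL).2; apply: HK => //; rewrite ?(obs_of_list eL).1 ?(obs_of_list eL).2.
Qed.

Lemma good_CHK i (P : Prop) t v bits : tsz t + tsz v + tsz (cnat i) + wt * size bits + 100 <= B ->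
  (i < m -> good P (prc t (Nd (cnat i) v) bits)) ->
  good (i < m /\ P) (prc (Nd aCHK t) (Nd (cnat i) v) bits).
Proof.
move=> sz H; have := tsz_cbits bits; have := wt_ge (size bits) => h1 h2.
apply: (good_step (e := eIte (cLT (Nd (cnat i) (cnat m))) (prc t (Nd (cnat i) v) bits) eF)) => //; last by move: sz; rewrite /=; klia.
case: d hd0 H => // e _ H; apply: good_and => //; first by rewrite !tsz_call /=; klia.
by apply: (ev_LT hS) => //; klia.
Qed.

Lemma pparse_dform n : pparse n aDF 200 (@enc_dform 'I_m) (@cdform m).
Proof.
elim: n => [|n IH] t v bits K hn sz HK; have hw := hwt; first by [].
apply: (good_step (e := prc (pushes [:: aNAT; aDFD] t) v bits)) => //; last by rewrite /=; klia.
pose K1 k r := match k with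
  | 0 => K DTop r
  | 1 => K DBot r
  | 2 => exists q r', r = enc_atom q ++ r' /\ K (DAtom q) r'
  | 3 => exists q r', r = enc_dform q ++ r' /\ K (DNeg q) r'
  | 4 => exists b r1, r = enc_dform b ++ r1 /\ exists c r2, r1 = enc_dform c ++ r2 /\ K (DAnd b c) r2
  | 5 => exists i r1, r = enc_nat i ++ r1 /\ (i < m /\ exists b r2, r1 = enc_dform b ++ r2 /\
          exists2 j : 'I_m, j = i :> nat & K (DK j b) r2)
  | 6 => exists V r1, r = enc_atoms V ++ r1 /\ exists b r2, r1 = enc_dform b ++ r2 /\
         exists post r3, r2 = enc_seq (fun q => enc_atom q.1 ++ enc_bform q.2) post ++ r3 /\
         exists O r4, r3 = enc_obs O ++ r4 /\ exists x r5, r4 = enc_atoms x ++ r5 /\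
         exists c r6, r5 = enc_dform c ++ r6 /\ K (DUpd (Transformer V b post O) x c) r6
  | _ => False end.
apply: (good_iff (P := exists k r, bits = enc_nat k ++ r /\ K1 k r)).
  split.
    case=> -[|[|[|[|[|[|[|k]]]]]]] [r [-> /=]] //.
    - by move=> h; exists DTop, r.
    - by move=> h; exists DBot, r.
    - by move=> [q [r' [-> h]]]; exists (DAtom q), r'.
    - by move=> [q [r' [-> h]]]; exists (DNeg q), r'.
    - by move=> [b [r1 [-> [c [r2 [-> h]]]]]]; exists (DAnd b c), r2; rewrite /= -catA.
    - move=> [i [r1 [-> [lt [b [r2 [-> [j ej h]]]]]]]]; exists (DK j b), r2.
      by rewrite /= enum_rank_ord /= ej -catA.
    - move=> [V [r1 [-> [b [r2 [-> [po [r3 [-> [O [r4 [-> [x [r5 [-> [c [r6 [-> h]]]]]]]]]]]]]]]]]].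
      by exists (DUpd (Transformer V b po O) x c), r6; rewrite /= -!catA.
  case=> -[||p|b|b c|i b|[V b po O] x c] [r [->]] h;
    [exists 0|exists 1|exists 2|exists 3|exists 4|exists 5|exists 6]; eexists; (split; first by rewrite /= -?catA); rewrite //=.
  - by exists p, r.
  - by exists b, r.
  - by exists b, (enc_dform c ++ r); split=> //; exists c, r.
  - exists i, (enc_dform b ++ r); rewrite enum_rank_ord; split=> //; split=> //; exists b, r; split=> //.
    by exists i.
  - eexists; eexists; split; first by []. eexists; eexists; split; first by [].
    eexists; eexists; split; first by []. eexists; eexists; split; first by [].
    eexists; eexists; split; first by []. eexists; eexists; split; first by []. by [].
apply: good_NAT; first by rewrite /=; klia.
case=> [|[|[|[|[|[|[|k]]]]]]] r e sr hr.
- apply: (good_step (e := prc (Nd aPAIR t) (Nd Lf (Nd (cnat 0) v)) r)) => //; last by move: hr; rewrite /=; klia.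
  apply: good_PAIR; last by move: hr; rewrite /=; klia.
  by apply: HK; [rewrite e|klia|move: hr; rewrite /=; klia].
- apply: (good_step (e := prc (Nd aPAIR t) (Nd Lf (Nd (cnat 1) v)) r)) => //; last by move: hr; rewrite /=; klia.
  apply: good_PAIR; last by move: hr; rewrite /=; klia.
  by apply: HK; [rewrite e|klia|move: hr; rewrite /=; klia].
- apply: (good_step (e := prc (pushes [:: aATOM; aPAIR] t) (Nd (cnat 2) v) r)) => //; last by move: hr; rewrite /=; klia.
  apply: (pparse_atom (n := (size r).+1)) => //; first by move: hr; rewrite /=; klia.
  move=> q r2 e2 s2 h2; apply: good_PAIR; last by move: hr h2; rewrite /=; klia.
  by apply: HK; [rewrite e e2|klia|move: hr h2; rewrite /=; klia].
- apply: (good_step (e := prc (pushes [:: aDF; aPAIR] t) (Nd (cnat 3) v) r)) => //; last by move: hr; rewrite /=; klia.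
  apply: IH; [by klia|by move: hr; rewrite /=; klia|].
  move=> q r2 e2 s2 h2; apply: good_PAIR; last by move: hr h2; rewrite /=; klia.
  by apply: HK; [rewrite e e2|klia|move: hr h2; rewrite /=; klia].
- apply: (good_step (e := prc (pushes [:: aDF; aDF; aPAIR; aPAIR] t) (Nd (cnat 4) v) r)) => //; last by move: hr; rewrite /=; klia.
  apply: (IH); [by klia|by move: hr; rewrite /=; klia|].
  move=> b r1 e1 s1 h1; apply: (IH); [by klia|by move: hr h1; rewrite /=; klia|].
  move=> c r2 e2 s2 h2; apply: good_PAIR; last by move: hr h1 h2; rewrite /=; klia.
  apply: good_PAIR; last by move: hr h1 h2; rewrite /=; klia.
  by apply: HK; [rewrite e e1 e2 /= -catA|klia|move: hr h1 h2; rewrite /=; klia].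
- apply: (good_step (e := prc (pushes [:: aNAT; aCHK; aDF; aPAIR; aPAIR] t) (Nd (cnat 5) v) r)) => //; last by move: hr; rewrite /=; klia.
  apply: (pparse_nat (n := (size r).+1)) => //; first by move: hr; rewrite /=; klia.
  move=> i r1 e1 s1 h1; apply: good_CHK; first by move: hr h1; rewrite /=; klia.
  move=> lt; apply: (IH); [by klia|by move: hr h1; rewrite /=; klia|].
  move=> c r2 e2 s2 h2; apply: good_PAIR; last by move: hr h1 h2; rewrite /=; klia.
  apply: good_PAIR; last by move: hr h1 h2; rewrite /=; klia.
  apply: (good_iff (P := K (DK (Ordinal lt) c) r2)).
    by split=> [h|[j ej]]; [exists (Ordinal lt)|have -> : j = Ordinal lt by apply: val_inj].
  by apply: (HK (DK (Ordinal lt) c)); [rewrite e e1 e2 /= enum_rank_ord /= -catA|klia|move: hr h1 h2; rewrite /=; klia].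
- apply: (good_step (e := prc (Nd (aSEQ aATOM) (Nd aDF (Nd (aSEQ aPOST) (Nd (aOBS (cnat m))
      (pushes [:: aPAIR; aPAIR; aPAIR; aSEQ aATOM; aDF; aPAIR; aPAIR; aPAIR] t))))) (Nd (cnat 6) v) r)) => //; last by move: hr; rewrite /=; klia.
  apply: (pparse_atoms (n := (size r).+1)) => //; first by move: hr; rewrite /=; klia.
  move=> V r1 e1 s1 h1; apply: (IH); [by klia|by move: hr h1; rewrite /=; klia|].
  move=> b r2 e2 s2 h2.
  apply: (pparse_seq (n := (size r2).+1) (c := 300) _ _ (pparse_post (n := _))) => //; first by move: hr h1 h2; rewrite /=; klia.
  move=> po r3 e3 s3; rewrite -cpostE => h3.
  apply: good_obs; first by move: hr h1 h2 h3; rewrite /=; klia.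
  move=> O r4 e4 s4 h4.
  apply: good_PAIR; last by move: hr h1 h2 h3 h4; rewrite /=; klia.
  apply: good_PAIR; last by move: hr h1 h2 h3 h4; rewrite /=; klia.
  apply: good_PAIR; last by move: hr h1 h2 h3 h4; rewrite /=; klia.
  apply: (pparse_atoms (n := (size r4).+1)) => //; first by move: hr h1 h2 h3 h4; rewrite /=; klia.
  move=> x r5 e5 s5 h5; apply: (IH); [by klia|by move: hr h1 h2 h3 h4 h5; rewrite /=; klia|].
  move=> c r6 e6 s6 h6.
  apply: good_PAIR; last by move: hr h1 h2 h3 h4 h5 h6; rewrite /=; klia.
  apply: good_PAIR; last by move: hr h1 h2 h3 h4 h5 h6; rewrite /=; klia.
  apply: good_PAIR; last by move: hr h1 h2 h3 h4 h5 h6; rewrite /=; klia.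
  apply: (HK (DUpd (Transformer V b po O) x c)); [by rewrite e e1 e2 e3 e4 e5 e6 /= -!catA|by klia|].
  by move: hr h1 h2 h3 h4 h5 h6; rewrite /=; klia.
- apply: (good_step (e := eF)); [exact: good_F| |by move: hr; rewrite /=; klia].
  by rewrite /bPR /= /tag_case; do ?case: ifP.
Qed.
End Parse.

(** * The polynomial bounds, and membership in PSPACE *)

Definition parse_bound n := (1001 + 2 * n) * n + 2 * n + 2000.
Definition size_bound n := (parse_bound n + 40).
Definition rho_bound n := 10 * size_bound n * size_bound n + 20 * size_bound n.
Definition depth_bound n :=
  2 * rho_bound n + 200 + size_bound n * (2 * size_bound n + 20) + size_bound n.

Lemma pb_size_bound : pb size_bound.
Proof.
exact (pb_add (pb_add (pb_add (pb_mul (pb_add (pb_const 1001) (pb_mul (pb_const 2) pb_id)) pb_id)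
  (pb_mul (pb_const 2) pb_id)) (pb_const 2000)) (pb_const 40)).
Qed.

Lemma pb_rho_bound : pb rho_bound.
Proof.
exact (pb_add (pb_mul (pb_mul (pb_const 10) pb_size_bound) pb_size_bound)
  (pb_mul (pb_const 20) pb_size_bound)).
Qed.

Lemma pb_depth_bound : pb depth_bound.
Proof.
exact (pb_add (pb_add (pb_add (pb_mul (pb_const 2) pb_rho_bound) (pb_const 200))
  (pb_mul pb_size_bound (pb_add (pb_mul (pb_const 2) pb_size_bound) (pb_const 20)))) pb_size_bound).
Qed.

Lemma parse_le_rho n : parse_bound n <= rho_bound n.
Proof.
rewrite /rho_bound; apply: leq_trans (leq_addl _ _); rewrite /size_bound.
by move: (parse_bound n); clear; lia.
Qed.

Lemma depth_bound_gt0 n : 0 < depth_bound n.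
Proof.
by rewrite /depth_bound; move: (rho_bound n) (size_bound n) (size_bound n * _) => a b c; lia.
Qed.

Notation enc_atoms := (enc_seq enc_atom).

Definition parsed_ok k (r : seq bool) :=
  exists V r1, r = enc_atoms V ++ r1 /\ exists dg r2, r1 = enc_seq enc_bnode dg ++ r2 /\
  exists (O : {ffun 'I_k -> seq atom}) r3, r2 = enc_obs O ++ r3 /\ exists s r4, r3 = enc_atoms s ++ r4 /\
  exists phi r5, r4 = enc_dform phi ++ r5 /\ (r5 = [::] /\ let I := Instance V dg O s phi in
    instance_ok I /\ sat (i_struct I) (i_state I) (i_goal I)).

Lemma good_instance S n k r : 1000 * rho_bound n + 4000 <= S -> k <= n -> size r <= n ->
  good S (depth_bound n) (parsed_ok k r)
    (pr (Nd (aSEQ aATOM) (Nd (aSEQ aBN) (Nd (aOBS (cnat k))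
     (pushes [:: aSEQ aATOM; aDF; aFIN] Lf)))) Lf (cnat k) (cbits r)).
Proof.
move=> hS kn rn.
have hN := parse_le_rho n.
have hS1 : 1000 * parse_bound n + 4000 <= S by klia.
have hk : tsz (cnat k) <= parse_bound n by rewrite tsz_cnat /parse_bound; klia.
have hd0 := depth_bound_gt0 n.
(* This is 1000 plus the size of the code of [k]. With at most [n] agents and [n] bits it yields the
   main term of [parse_bound]. *)
pose wt := 1001 + 2 * k.
have hwt : 1000 + tsz (cnat k) <= wt by rewrite tsz_cnat /wt; klia.
have hw : 1001 <= wt by rewrite /wt; klia.
have hB : wt * size r + 2 * k + 2000 <= parse_bound n.
  rewrite /parse_bound /wt leq_add2r; apply: leq_add; last by klia.
  by apply: leq_mul => //; klia.
have sk := tsz_cnat k.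
have hk2 : tsz (cnat k) <= 2 * k + 1 by rewrite sk.
clearbody wt; clear sk.
apply: (pparse_atoms hS1 hk hd0 hwt (n := (size r).+1)) => //; first by rewrite /=; klia.
move=> V r1 e1 s1 h1.
apply: (pparse_seq hS1 hk hd0 hwt (n := (size r1).+1) (c := 200) _ _ (pparse_bnode hS1 hk hd0 hwt (n := _))) => //.
  by rewrite /=; klia.
move=> dg r2 e2 s2; rewrite -/(cbdd dg) => h2.
apply: (good_obs hS1 hk hd0 hwt); first by rewrite /=; klia.
move=> O r3 e3 s3 h3.
apply: (pparse_atoms hS1 hk hd0 hwt (n := (size r3).+1)) => //; first by rewrite /=; klia.
move=> s r4 e4 s4 h4.
apply: (pparse_dform hS1 hk hd0 hwt (n := (size r4).+1)) => //; first by rewrite /=; klia.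
move=> phi r5 e5 s5 h5.
case: r5 e5 s5 h5 => [|b r5] e5 s5 h5; last first.
  by apply: (good_step hS1 hk hwt (e := eF)); [apply: good_F => -[]|by []|move: h5; rewrite /=; klia].
apply: (good_step hS1 hk hwt (e := cMAIN (Nd (catoms V) (Nd (cbdd dg) (Nd (cobs O) (Nd (catoms s) (cdform phi))))))) => //.
  have h0 : wt * size (@nil bool) <= 0 by rewrite muln0.
  apply: good_iff (good_MAIN hS (N := size_bound n) _ _ _) => //.
    by split=> [//|[]].
  by rewrite /size_bound; klia.
by rewrite /=; klia.
Qed.

Theorem DEL_in_PSPACE : PSPACE DEL_model_checking.
Proof.
apply: (@PSPACE_of_ev bodies _ pinit (fun n => 1000 * rho_bound n + 4000) depth_bound).
- exact: polyf_bodies.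
- exact: polyf_pinit.
- exact (pb_add (pb_mul (pb_const 1000) pb_rho_bound) (pb_const 4000)).
- exact: pb_depth_bound.
move=> w; set n := size w.
suff [b eb hb] : good (1000 * rho_bound n + 4000) (depth_bound n)
    (exists k r, w = enc_nat k ++ r /\ parsed_ok k r) (pinit (cbits w)).
  exists b => //; rewrite hb; split.
    move=> [k [r [-> [V [r1 [-> [dg [r2 [-> [O [r3 [-> [s [r4 [-> [phi [r5 [-> [-> [ok st]]]]]]]]]]]]]]]]]]]].
    by exists (Instance V dg O s phi); split=> //; rewrite /enc_instance cats0.
  move=> [[k V dg O s phi] [ok e st]]; rewrite /enc_instance /= in e.
  exists k; eexists; split; first by rewrite -e.
  exists V; eexists; split; first by [].
  exists dg; eexists; split; first by [].
  exists O; eexists; split; first by [].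
  exists s; eexists; split; first by [].
  by exists phi, [::]; rewrite cats0.
have hN := parse_le_rho n.
have hS1 : 1000 * parse_bound n + 4000 <= 1000 * rho_bound n + 4000 by klia.
have hk : tsz (cnat 0) <= parse_bound n by rewrite /parse_bound /=; klia.
have hd0 := depth_bound_gt0 n.
have hwt : 1000 + tsz (cnat 0) <= 1001 by [].
have hB : 1001 * n + 2000 <= parse_bound n.
  by rewrite /parse_bound leq_add2r mulnDl; move: (_ * n * n); klia.
(* The number of agents is itself read from the input; until then its register holds 0. *)
rewrite -[pinit _]/(pr (Nd aNAT (Nd aSETM Lf)) Lf (cnat 0) (cbits w)).
apply: (@good_NAT 0 _ _ _ 1001 hS1 hk hd0 hwt (Nd aSETM Lf) Lf w parsed_ok); first by rewrite -/n /=; klia.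
move=> k r e sr hr.
have [kn rn] : k <= n /\ size r <= n.
  by move/(congr1 size): e; rewrite size_cat size_enc_nat -/n; clear; lia.
apply: (good_step hS1 hk hwt (e := pr (Nd (aSEQ aATOM) (Nd (aSEQ aBN) (Nd (aOBS (cnat k))
     (pushes [:: aSEQ aATOM; aDF; aFIN] Lf)))) Lf (cnat k) (cbits r))) => //.
  exact: good_instance.
by move: hr; rewrite -/n /=; klia.
Qed.

(** * A language of string generators *)

(* [SFor k e0 e1] runs over the bits of the [k]-th word of the environment,
   executing [e0] or [e1] according to the bit, in the environment extended by
   the position in unary. *)
Inductive sexp := SConst (s : seq bool) | SCat (e1 e2 : sexp) | SFor (k : nat) (e0 e1 : sexp).

Fixpoint sloop (f : bool -> nat -> seq bool) (i : nat) (l : seq bool) : seq bool :=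
  if l is b :: l' then f b i ++ sloop f i.+1 l' else [::].

Fixpoint den (e : sexp) (env : seq (seq bool)) : seq bool :=
  match e with
  | SConst s => s
  | SCat e1 e2 => den e1 env ++ den e2 env
  | SFor k e0 e1 => sloop (fun b i => if b then den e1 (nseq i false :: env) else den e0 (nseq i false :: env))
      0 (nth [::] env k)
  end.

Fixpoint tlen (t : tree) : nat := if t is Nd _ r then (tlen r).+1 else 0.

(** The state of a loop consists of the unread part of the word, the position in unary, the
    environment and the output so far. *)
Definition fstep (g0 g1 : tree -> tree) (x : tree) : tree :=
  Nd (tl (hd x)) (Nd (Nd Lf (hd (tl x))) (Nd (hd (tl (tl x)))
    (if isLf (hd (hd x)) then g0 (Nd (Nd (hd (tl x)) (hd (tl (tl x)))) (tl (tl (tl x))))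
     else g1 (Nd (Nd (hd (tl x)) (hd (tl (tl x)))) (tl (tl (tl x))))))).

Definition floop g0 g1 (x : tree) : tree := iter (tlen (hd x)) (fstep g0 g1) x.

(* The generated word is pushed, reversed, on the second component. *)
Fixpoint gen (e : sexp) (x : tree) : tree :=
  match e with
  | SConst s => foldl (fun t b => Nd (cb b) t) (tl x) s
  | SCat e1 e2 => gen e2 (Nd (hd x) (gen e1 x))
  | SFor k e0 e1 =>
      tl (tl (tl (floop (gen e0) (gen e1) (Nd (hd (iter k tl (hd x))) (Nd Lf (Nd (hd x) (tl x)))))))
  end.

Lemma tlen_tsz t : 2 * tlen t < tsz t.
Proof. by elim: t => //= l _ r; have := tsz_gt0 l; lia. Qed.

Lemma tlen_tl t : tlen (tl t) = (tlen t).-1. Proof. by case: t. Qed.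
Lemma isLf_tlen t : isLf t = (tlen t == 0). Proof. by case: t. Qed.
Lemma tsz_hd t : tsz (hd t) <= tsz t. Proof. by case: t => //= *; lia. Qed.
Lemma tsz_tl t : tsz (tl t) <= tsz t. Proof. by case: t => //= *; lia. Qed.
Lemma tsz_hdtl t : tsz t <= tsz (hd t) + tsz (tl t) + 1. Proof. by case: t => //= *; lia. Qed.

(** A round adds to the output an amount bounded in terms of position and environment, neither of
    which contains the output. So the growth is additive and cannot become exponential. *)
Lemma floop_inv g0 g1 q x i : {homo q : m n / m <= n} ->
  (forall y, tsz (g0 y) <= tsz (tl y) + q (tsz (hd y))) ->
  (forall y, tsz (g1 y) <= tsz (tl y) + q (tsz (hd y))) ->
  i <= tlen (hd x) ->
  let y := iter i (fstep g0 g1) x in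
  [/\ tlen (hd y) = tlen (hd x) - i, tsz (hd y) <= tsz (hd x), tsz (hd (tl y)) <= tsz (hd (tl x)) + 2 * i,
      tsz (hd (tl (tl y))) <= tsz (hd (tl (tl x))) &
      tsz (tl (tl (tl y))) <= tsz (tl (tl (tl x))) +
        i * q (tsz (hd (tl x)) + 2 * tlen (hd x) + tsz (hd (tl (tl x))) + 1)].
Proof.
move=> mq h0 h1; elim: i => [|i IH] hi /=; first by rewrite subn0; split; lia.
have [|a1 a2 a3 a4 a5] := IH; first by lia.
set y := iter i _ x in a1 a2 a3 a4 a5 *.
have hq : q (tsz (Nd (hd (tl y)) (hd (tl (tl y))))) <=
    q (tsz (hd (tl x)) + 2 * tlen (hd x) + tsz (hd (tl (tl x))) + 1).
  by apply: mq; rewrite /=; lia.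
split=> //=.
- by rewrite tlen_tl a1; lia.
- by apply: leq_trans (tsz_tl _) a2.
- by lia.
- have g0' := h0 (Nd (Nd (hd (tl y)) (hd (tl (tl y)))) (tl (tl (tl y)))).
  have g1' := h1 (Nd (Nd (hd (tl y)) (hd (tl (tl y)))) (tl (tl (tl y)))).
  rewrite [tl (Nd _ _)]/= [hd (Nd _ _)]/= in g0' g1'; rewrite mulSn.
  by case: ifP => _; [move: g0'|move: g1']; move: hq a5; clear; lia.
Qed.

Lemma polyf_floop g0 g1 q : polyf g0 -> polyf g1 -> pb q -> {homo q : m n / m <= n} ->
  (forall y, tsz (g0 y) <= tsz (tl y) + q (tsz (hd y))) ->
  (forall y, tsz (g1 y) <= tsz (tl y) + q (tsz (hd y))) ->
  polyf (floop g0 g1).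
Proof.
move=> p0 p1 pq mq h0 h1.
pose p n := 10 * n + 20 + n * q (5 * n + 5).
have mq' : {homo (fun n => q (5 * n + 5)) : m n / m <= n} by move=> m n mn; apply: mq; lia.
apply: (@polyf_loop (fstep g0 g1) _ p).
- rewrite /fstep; polyf_auto.
  + by apply: polyf_comp p0 _; polyf_auto.
  + by apply: polyf_comp p1 _; polyf_auto.
- apply: pb_add (pb_lin 10 20) _; apply: pb_mul pb_id _.
  by apply: (pb_comp (f := q) (g := fun n => 5 * n + 5)) => //; exact: pb_lin.
- move=> m n mn; rewrite /p; apply: leq_add; first by lia.
  by apply: leq_mul => //; apply: mq'.
move=> x; exists (tlen (hd x)).
have inv i := floop_inv (x := x) (i := i) mq h0 h1.
have hx : tsz (hd x) <= tsz x := tsz_hd x.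
have hl := tlen_tsz (hd x).
split=> //.
- by rewrite /p; lia.
- by rewrite isLf_tlen /floop; have [//|-> _ _ _ _] := inv (tlen (hd x)); rewrite subnn.
- by move=> i li; rewrite isLf_tlen; have [|-> _ _ _ _] := inv i; [exact: ltnW|rewrite subn_eq0 -ltnNge].
move=> i li; have [//|_ a2 a3 a4 a5] := inv i.
set y := iter i _ x in a2 a3 a4 a5 *.
have t1 := tsz_tl x; have t2 := tsz_tl (tl x); have t3 := tsz_tl (tl (tl x)).
have t4 := tsz_hd (tl x); have t5 := tsz_hd (tl (tl x)).
have y1 := tsz_hdtl y; have y2 := tsz_hdtl (tl y); have y3 := tsz_hdtl (tl (tl y)).
have hq : i * q (tsz (hd (tl x)) + 2 * tlen (hd x) + tsz (hd (tl (tl x))) + 1) <= tsz x * q (5 * tsz x + 5).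
  by apply: leq_mul; [lia|apply: mq; lia].
rewrite /p; move: hq a5 a4 a3 a2 y1 y2 y3 t1 t2 t3 t4 t5 hx hl li.
by move: (_ * q _) (_ * q _) => u1 u2; clear; lia.
Qed.

(** Polynomial time alone would not pass through a loop. The additive bound on the output is proved
    along with it and supplies the hypothesis for the enclosing loop. *)
Lemma gen_ok e : polyf (gen e) /\ exists q, [/\ pb q, {homo q : m n / m <= n} &
  forall x, tsz (gen e x) <= tsz (tl x) + q (tsz (hd x))].
Proof.
elim: e => [s|e1 [p1 [q1 [b1 m1 h1]]] e2 [p2 [q2 [b2 m2 h2]]]|k e0 [p0 [q0 [b0 m0 h0]]] e1 [p1 [q1 [b1 m1 h1]]]].
- split.
    have : polyf (fun x => tl x) by exact: polyf_tl.
    rewrite /=; move: tl; elim: s => //= b s IH f pf.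
    apply: (IH (fun x => Nd (cb b) (f x))); apply: polyf_pair => //; exact: polyf_const.
  exists (fun=> 4 * size s); split=> [|//|x]; first exact: pb_const.
  rewrite /=; elim: s (tl x) => [|b s IH] t /=; first by lia.
  by apply: leq_trans (IH _) _; case: (b) => /=; lia.
- split=> /=.
    by apply: polyf_comp p2 _; apply: polyf_pair p1; exact: polyf_hd.
  exists (fun n => q1 n + q2 n); split.
  + exact: pb_add.
  + by move=> m n mn; apply: leq_add; [apply: m1|apply: m2].
  + by move=> x; apply: leq_trans (h2 _) _; rewrite /=; have := h1 x; lia.
pose q n := q0 n + q1 n.
have bq : pb q by exact: pb_add.
have mq : {homo q : m n / m <= n} by move=> m n mn; apply: leq_add; [apply: m0|apply: m1].
have h0' y : tsz (gen e0 y) <= tsz (tl y) + q (tsz (hd y)) by apply: leq_trans (h0 y) _; rewrite /q; lia.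
have h1' y : tsz (gen e1 y) <= tsz (tl y) + q (tsz (hd y)) by apply: leq_trans (h1 y) _; rewrite /q; lia.
have pk j : polyf (fun x => iter j tl (hd x)).
  by elim: j => [|j IH] /=; [exact: polyf_hd|apply: polyf_tlc].
split=> /=.
  do 3 apply: polyf_tlc.
  apply: polyf_comp (polyf_floop p0 p1 bq mq h0' h1') _.
  by apply: polyf_pair; [apply: polyf_hdc|polyf_auto].
exists (fun n => n * q (5 * n + 5)); split.
- apply: pb_mul pb_id _; apply: (pb_comp (f := q) (g := fun n => 5 * n + 5)) => //; exact: pb_lin.
- by move=> m n mn; apply: leq_mul => //; apply: mq; lia.
move=> x; set y := Nd _ _.
have [|_ _ _ _] := floop_inv (x := y) (i := tlen (hd y)) mq h0' h1'; first by [].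
rewrite -/(floop _ _ y) /= => h; apply: leq_trans h _; rewrite leq_add2l.
have sz j : tsz (iter j tl (hd x)) <= tsz (hd x).
  by elim: j => //= j; apply: leq_trans; apply: tsz_tl.
have l1 := tlen_tsz (hd (iter k tl (hd x))); have l2 := tsz_hd (iter k tl (hd x)); have l3 := sz k.
by apply: leq_mul; [lia|apply: mq; lia].
Qed.

Definition cenv (env : seq (seq bool)) : tree := clist (map cbits env).
Definition cpre (s : seq bool) (t : tree) : tree := foldr (fun b t => Nd (cb b) t) t s.

Lemma cpre_cat s s' t : cpre (s ++ s') t = cpre s (cpre s' t).
Proof. by rewrite /cpre foldr_cat. Qed.

Lemma cpre_nil s : cpre s Lf = cbits s.
Proof. by elim: s => //= b s ->. Qed.

Lemma tlen_cbits s : tlen (cbits s) = size s.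
Proof. by elim: s => //= b s ->. Qed.

Lemma cbits_false n : cbits (nseq n false) = cnat n.
Proof. by elim: n => //= n <-. Qed.

Lemma gen_den e env acc : gen e (Nd (cenv env) acc) = cpre (rev (den e env)) acc.
Proof.
elim: e env acc => [s|e1 IH1 e2 IH2|k e0 IH0 e1 IH1] env acc /=.
- elim: s acc => //= b s IH acc.
  by rewrite IH rev_cons -cats1 cpre_cat.
- by rewrite IH1 IH2 rev_cat cpre_cat.
have -> : hd (iter k tl (cenv env)) = cbits (nth [::] env k).
  elim: k env => [|k IHk] [|w env] //; last by rewrite iterSr; apply: IHk.
  have -> : iter k.+1 tl (cenv [::]) = Lf by elim: k.+1 => //= j ->.
  by rewrite nth_nil.
move: (nth [::] env k) => l; rewrite /floop /= tlen_cbits.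
rewrite -[Lf]/(cnat 0); elim: l 0 acc => [|b l IH] i acc //.
rewrite [size _]/= iterSr {2}/fstep [sloop _ _ _]/= [hd _]/= [tl _]/= -/(cbits l) /=.
have eE : Nd (cnat i) (cenv env) = cenv (nseq i false :: env) by rewrite /cenv /= cbits_false.
rewrite eE IH0 IH1 -[Nd Lf (cnat i)]/(cnat i.+1).
have -> : (if isLf (cb b) then cpre (rev (den e0 (nseq i false :: env))) acc
   else cpre (rev (den e1 (nseq i false :: env))) acc) =
   cpre (rev (if b then den e1 (nseq i false :: env) else den e0 (nseq i false :: env))) acc by case: b.
by rewrite IH rev_cat cpre_cat.
Qed.

Definition rstepT (x : tree) := Nd (tl (hd x)) (Nd (hd (hd x)) (tl x)).

Lemma polyf_rev : polyf (fun x => iter (tlen (hd x)) rstepT x).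
Proof.
apply: (@polyf_loop rstepT _ (fun n => 10 * n + 10)).
- by rewrite /rstepT; polyf_auto.
- exact: pb_lin.
- exact: homo_lin.
move=> x; exists (tlen (hd x)).
have inv i : i <= tlen (hd x) -> let y := iter i rstepT x in tlen (hd y) = tlen (hd x) - i /\
    tsz (hd y) + tsz (tl y) <= tsz (hd x) + tsz (tl x) + 2 * i.
  elim: i => [|i IH] hi /=; first by split; lia.
  have [|a b] := IH; first exact: ltnW.
  rewrite tlen_tl a; split; first by lia.
  by move: b; case: (hd _) => [|l r] /=; lia.
have hl := tlen_tsz (hd x); have hx := tsz_hd x; have hx' := tsz_tl x.
split=> //.
- by lia.
- by rewrite isLf_tlen; have [//|-> _] := inv (tlen (hd x)); rewrite subnn.
- by move=> i li; rewrite isLf_tlen; have [|-> _] := inv i; [exact: ltnW|rewrite subn_eq0 -ltnNge].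
by move=> i li; have [//|_ b] := inv i; have := tsz_hdtl (iter i rstepT x); lia.
Qed.

Lemma rev_cbits s t : tl (iter (tlen (cbits s)) rstepT (Nd (cbits s) t)) = cpre (rev s) t.
Proof.
rewrite tlen_cbits; elim: s t => [|b s IH] t //; rewrite [size _]/=.
by rewrite iterSr {2}/rstepT [hd _]/= [tl _]/= -/(cbits s) IH rev_cons -cats1 cpre_cat.
Qed.

(** Two passes: a word generated from the input serves as a further loop range in the second pass.
    It is reversed because [gen] leaves it so; its use below is as a unary number. *)
Lemma polytime_den eN e : polytime (fun w => den e [:: rev (den eN [:: w]); w]).
Proof.
have [pN _] := gen_ok eN; have [pe _] := gen_ok e.
pose env t := Nd (gen eN (Nd (Nd t Lf) Lf)) (Nd t Lf).
pose f t := tl (iter (tlen (gen e (Nd (env t) Lf))) rstepT (Nd (gen e (Nd (env t) Lf)) Lf)).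
apply: (@polytime_of_polyf f).
  apply: polyf_tlc; apply: (polyf_comp (g := fun t => Nd (gen e (Nd (env t) Lf)) Lf) polyf_rev).
  apply: polyf_pair polyf_Lf; apply: polyf_comp pe _; apply: polyf_pair polyf_Lf.
  by apply: polyf_pair; [apply: polyf_comp pN _; polyf_auto|polyf_auto].
move=> w; rewrite /f /env.
rewrite (gen_den eN [:: w]) cpre_nil (gen_den e [:: rev (den eN [:: w]); w]) cpre_nil.
by rewrite rev_cbits revK cpre_nil.
Qed.

(** * Repeated squaring of a transition relation *)

(** The pair of a track number and an index, both in unary, so that a loop can print an atom whose
    index is the current position. *)
Definition name (a i : nat) : atom := Atom (nseq a true ++ false :: nseq i true).

Definition dconj (A : finType) (l : seq (dform A)) : dform A := foldr (@DAnd A) DTop l.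
Definition dimp (A : finType) (p q : dform A) : dform A := DNeg (DAnd p (DNeg q)).
Definition diff (A : finType) (p q : dform A) : dform A := DAnd (dimp p q) (dimp q p).
Definition dor (A : finType) (p q : dform A) : dform A := DNeg (DAnd (DNeg p) (DNeg q)).

Definition ntrack (n : seq bool) := index false n.
Definition nindex (n : seq bool) := size n - (ntrack n).+1.

Lemma ntrack_name a i : ntrack (nseq a true ++ false :: nseq i true) = a.
Proof. by rewrite /ntrack; elim: a => //= a ->. Qed.

Lemma nindex_name a i : nindex (nseq a true ++ false :: nseq i true) = i.
Proof. by rewrite /nindex ntrack_name size_cat /= !size_nseq; lia. Qed.

Lemma name_inj a i b j : name a i = name b j -> a = b /\ i = j.
Proof.
case=> e; have := congr1 ntrack e; have := congr1 nindex e.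
by rewrite !nindex_name !ntrack_name.
Qed.

Lemma dwf_conj (A : finType) V P (l : seq (dform A)) : dwf V P (dconj l) = all (dwf V P) l.
Proof. by elim: l => //= p l ->. Qed.

Lemma all_flatten S (a : pred S) l : all a (flatten l) = all (all a) l.
Proof. by elim: l => //= x l <-; rewrite all_cat. Qed.

Lemma all_grid S (a : pred S) (f : nat -> nat -> S) m n :
  all a (flatten [seq [seq f k i | i <- iota 0 n] | k <- iota 0 m]) <->
  forall k i, k < m -> i < n -> a (f k i).
Proof.
rewrite all_flatten all_map; split=> [/allP h k i lk li|h].
  have := h k; rewrite mem_iota add0n lk /= all_map => /(_ isT)/allP/(_ i) /=.
  by rewrite mem_iota add0n li; apply.
apply/allP => k; rewrite mem_iota add0n /= all_map => lk.
by apply/allP => i; rewrite mem_iota add0n /= => li; apply: h.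
Qed.

Section Squaring.
Variables (K N : nat).
Hypothesis K_gt0 : 0 < K.

Definition cell (b k i : nat) : atom := name (b * K + k) i.

Definition tracks_atoms (l : seq nat) : seq atom := [seq name a i | a <- l, i <- iota 0 N.+2].
Definition nvoc : seq atom := tracks_atoms (iota 0 (5 * K)).

(* The blocks are U, V, Z, U2, V2 in this order. *)
Definition forgotten : seq (seq nat) := [:: [:: 2]; [:: 3; 4]; [:: 0; 1]; [:: 1]].
Definition obs_tracks (a : nat) : seq nat :=
  [seq t <- iota 0 (5 * K) | t %/ K \notin nth [::] forgotten a].
Definition nobs : {ffun 'I_4 -> seq atom} := [ffun a : 'I_4 => tracks_atoms (obs_tracks a)].
Definition nstr : kstruct 'I_4 := KStruct nvoc (bdd_form [:: BLeaf true]) nobs.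

Lemma uniq_tracks l : uniq l -> uniq (tracks_atoms l).
Proof.
move=> ul; apply: allpairs_uniq => //; first exact: iota_uniq.
by move=> [a i] [b j] _ _ /= /name_inj[-> ->].
Qed.

Lemma mem_tracks l a i : (name a i \in tracks_atoms l) = (a \in l) && (i < N.+2).
Proof.
apply/allpairsP/andP => [[[b j] [bl + /name_inj[-> ->]]]|[al il]].
  by rewrite mem_iota.
by exists (a, i); rewrite mem_iota.
Qed.

Lemma mem_tracksP l p : p \in tracks_atoms l -> exists a i, [/\ p = name a i, a \in l & i < N.+2].
Proof. by move=> /allpairsP[[a i] [al + ->]]; rewrite mem_iota => /= il; exists a, i. Qed.

Lemma nvoc_names : all is_name nvoc.
Proof. by apply/allP => p /mem_tracksP[a [i [->]]]. Qed.

Lemma nobs_sub i : {subset nobs i <= nvoc}.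
Proof.
move=> p; rewrite ffunE => /mem_tracksP[a [j [-> + lj]]].
by rewrite mem_filter mem_tracks lj andbT => /andP[].
Qed.

Lemma cell_voc b k i : b < 5 -> k < K -> i < N.+2 -> cell b k i \in nvoc.
Proof.
move=> lb lk li; rewrite mem_tracks li andbT mem_iota /= add0n.
apply: leq_trans (_ : b.+1 * K <= _); first by rewrite mulSn; lia.
by rewrite leq_mul2r lb orbT.
Qed.

Lemma cell_inj b k i b' k' i' : k < K -> k' < K -> cell b k i = cell b' k' i' ->
  [/\ b = b', k = k' & i = i'].
Proof.
move=> lk lk' /name_inj[e ->]; have := congr1 (divn^~ K) e; have := congr1 (modn^~ K) e.
by rewrite !divnMDl // !modnMDl !modn_small // !divn_small // !addn0.
Qed.

Definition T (v : valu) (phi : dform 'I_4) : bool := tr nstr [::] v phi.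

Lemma T_atom v p : T v (DAtom p) = v p. Proof. by []. Qed.
Lemma T_neg v phi : T v (DNeg phi) = ~~ T v phi. Proof. by []. Qed.
Lemma T_and v phi psi : T v (DAnd phi psi) = T v phi && T v psi.
Proof. by rewrite /T /tr trans_and bsatp_and. Qed.
Lemma T_imp v phi psi : T v (dimp phi psi) = (T v phi ==> T v psi).
Proof. by rewrite T_neg T_and T_neg; case: (T v phi); case: (T v psi). Qed.
Lemma T_or v phi psi : T v (dor phi psi) = T v phi || T v psi.
Proof. by rewrite T_neg T_and !T_neg negb_and !negbK. Qed.
Lemma T_iff v phi psi : T v (diff phi psi) = (T v phi == T v psi).
Proof. by rewrite T_and !T_imp; case: (T v phi); case: (T v psi). Qed.
Lemma T_conj v l : T v (dconj l) = all (T v) l.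
Proof. by elim: l => // p l IH; rewrite /dconj /= T_and -/(dconj l) IH. Qed.

Lemma T_K v (a : 'I_4) phi : dwf nvoc [::] phi ->
  T v (DK a phi) <-> forall v' : valu,
    (forall b k i, b < 5 -> k < K -> i < N.+2 -> b \notin nth [::] forgotten a ->
       v' (cell b k i) = v (cell b k i)) ->
    (forall p, p \notin nvoc -> v' p = v p) -> T v' phi.
Proof.
move=> w; rewrite /T (@tr_K _ nstr nvoc_names isT nobs_sub [::] [::] v a phi) //.
split=> H v' h1 h2.
  apply: H => //; rewrite /obsok andbT; apply/allP => p; rewrite [k_obs _ _]ffunE => /mem_tracksP[t [i [-> + li]]].
  rewrite mem_filter mem_iota /= add0n => /andP[nt lt].
  have := h1 (t %/ K) (t %% K) i; rewrite /cell -divn_eq ltn_divLR // ltn_mod => -> //.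
by move=> _; apply: H => // b k i lb lk li nb; apply/esym/eqP; move: h2; rewrite /obsok andbT => /allP; apply;
  rewrite [k_obs _ _]ffunE mem_tracks li andbT mem_filter divnMDl // divn_small // addn0 nb /=;
  have := cell_voc lb lk li; rewrite mem_tracks li andbT.
Qed.

Definition setb (v : valu) (b : nat) (f : nat -> nat -> bool) : valu := fun p =>
  if p is Atom n then
    if (p \in nvoc) && (ntrack n %/ K == b) then f (ntrack n %% K) (nindex n) else v p
  else v p.

Lemma setb_cell v b f b' k i : b' < 5 -> k < K -> i < N.+2 ->
  setb v b f (cell b' k i) = if b' == b then f k i else v (cell b' k i).
Proof.
move=> lb lk li; rewrite /setb /cell /name -/(name _ _) -/(cell _ _ _) cell_voc //.
by rewrite ntrack_name nindex_name divnMDl // divn_small // addn0 modnMDl modn_small.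
Qed.

Lemma setb_out v b f p : p \notin nvoc -> setb v b f p = v p.
Proof. by rewrite /setb; case: p => // n /negbTE ->. Qed.

Definition rd (v : valu) (b : nat) : nat -> nat -> bool := fun k i => v (cell b k i).
Definition eqc (f g : nat -> nat -> bool) : Prop := forall k i, k < K -> i < N.+2 -> f k i = g k i.

Lemma eqc_refl f : eqc f f. Proof. by []. Qed.
Lemma eqc_sym f g : eqc f g -> eqc g f. Proof. by move=> h k i lk li; rewrite h. Qed.
Lemma eqc_trans f g h : eqc f g -> eqc g h -> eqc f h.
Proof. by move=> h1 h2 k i lk li; rewrite h1 ?h2. Qed.

Lemma rd_setb v b f : b < 5 -> eqc (rd (setb v b f) b) f.
Proof. by move=> lb k i lk li; rewrite /rd setb_cell // eqxx. Qed.

Lemma rd_setb_neq v b b' f : b' < 5 -> b' != b -> eqc (rd (setb v b f) b') (rd v b').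
Proof. by move=> lb /negbTE n k i lk li; rewrite /rd setb_cell // n. Qed.

Definition eq_track (b b' k : nat) : seq (dform 'I_4) :=
  [seq diff (DAtom (cell b k i)) (DAtom (cell b' k i)) | i <- iota 0 N.+2].
Definition eq_blocks (b b' : nat) : dform 'I_4 := dconj (flatten [seq eq_track b b' k | k <- iota 0 K]).

Lemma T_eq_blocks v b b' : T v (eq_blocks b b') <-> eqc (rd v b) (rd v b').
Proof.
rewrite T_conj; split=> [/all_grid h k i lk li|h].
  by have := h k i lk li; rewrite T_iff !T_atom => /eqP.
by apply/all_grid => k i lk li; rewrite T_iff !T_atom; apply/eqP; apply: h.
Qed.

Lemma dwf_eq_blocks b b' : b < 5 -> b' < 5 -> dwf nvoc [::] (eq_blocks b b').
Proof.
move=> lb lb'; rewrite dwf_conj; apply/all_grid => k i lk li.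
by rewrite /= !cats0 !cell_voc.
Qed.

Definition choice : dform 'I_4 :=
  dor (DAnd (eq_blocks 3 0) (eq_blocks 4 2)) (DAnd (eq_blocks 3 2) (eq_blocks 4 1)).
Definition copy : dform 'I_4 := DAnd (eq_blocks 0 3) (eq_blocks 1 4).

Definition agent (a : nat) : 'I_4 := inord a.

(** The argument occurs once, so each squaring adds a fixed amount to the length. As it always
    speaks of the blocks 0 and 1, the chosen pair in the blocks 3 and 4 has to be copied there. *)
Definition square (phi : dform 'I_4) : dform 'I_4 :=
  DNeg (DK (agent 0) (DNeg (DK (agent 1) (dimp choice (DK (agent 2) (dimp copy phi)))))).

Lemma dwf_square phi : dwf nvoc [::] phi -> dwf nvoc [::] (square phi).
Proof. by move=> w; rewrite /= !dwf_eq_blocks. Qed.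

Lemma dwf_iter_square m phi : dwf nvoc [::] phi -> dwf nvoc [::] (iter m square phi).
Proof. by move=> w; elim: m => // m IH; apply: dwf_square. Qed.

Variables (C : Type) (step : C -> C) (enc : C -> nat -> nat -> bool) (Inv : C -> Prop).
Hypothesis Inv_step : forall c, Inv c -> Inv (step c).
Variable R0 : dform 'I_4.
Hypothesis R0_wf : dwf nvoc [::] R0.
Hypothesis R0_ok : forall v c, Inv c -> eqc (rd v 0) (enc c) ->
  T v R0 <-> eqc (rd v 1) (enc (step c)).

Lemma Inv_iter n c : Inv c -> Inv (iter n step c).
Proof. by move=> h; elim: n => //= n; apply: Inv_step. Qed.

(** The relation is meaningful only when its first block encodes a configuration that satisfies the
    invariant. For the middle block this becomes known only from the first half of the
    computation. *)
Lemma iter_square_ok m v c : Inv c -> eqc (rd v 0) (enc c) ->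
  T v (iter m square R0) <-> eqc (rd v 1) (enc (iter (2 ^ m) step c)).
Proof.
elim: m v c => [|m IH] v c hc h0; first exact: R0_ok.
have w := dwf_iter_square m R0_wf.
have wc : dwf nvoc [::] (DK (agent 2) (dimp copy (iter m square R0))) by rewrite /= !dwf_eq_blocks.
have w1 : dwf nvoc [::] (dimp choice (DK (agent 2) (dimp copy (iter m square R0)))).
  by rewrite /= !dwf_eq_blocks.
have va a : a < 4 -> nat_of_ord (agent a) = a by move=> la; rewrite /agent inordK.
set mid := iter (2 ^ m) step c.
have hm : Inv mid by apply: Inv_iter.
have -> : iter (2 ^ m.+1) step c = iter (2 ^ m) step mid by rewrite /mid -iterD expnS mul2n addnn.
have inner v1 : T v1 (DK (agent 2) (dimp copy (iter m square R0))) ->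
    forall u x, eqc (rd v1 3) u -> eqc (rd v1 4) x ->
    exists v2, [/\ eqc (rd v2 0) u, eqc (rd v2 1) x & T v2 (iter m square R0)].
  rewrite (T_K _ _ (phi := dimp copy _)) // => H u x hu hx.
  exists (setb (setb v1 0 u) 1 x); have a0 := rd_setb (setb v1 0 u) x (isT : 1 < 5).
  have a1 : eqc (rd (setb (setb v1 0 u) 1 x) 0) u.
    by apply: eqc_trans (rd_setb _ _ _); [apply: rd_setb_neq|].
  have a3 : eqc (rd (setb (setb v1 0 u) 1 x) 3) (rd v1 3).
    by apply: eqc_trans (rd_setb_neq _ _ _ _) _ => //; apply: rd_setb_neq.
  have a4 : eqc (rd (setb (setb v1 0 u) 1 x) 4) (rd v1 4).
    by apply: eqc_trans (rd_setb_neq _ _ _ _) _ => //; apply: rd_setb_neq.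
  split=> //; have := H (setb (setb v1 0 u) 1 x); rewrite T_imp va // => /(_ _ _)/implyP; apply.
  - by move=> b k i lb lk li; rewrite !inE negb_or => /andP[/negbTE n0 /negbTE n1]; rewrite !setb_cell // n0 n1.
  - by move=> p np; rewrite !setb_out.
  - rewrite T_and; apply/andP; split; apply/T_eq_blocks.
      by apply: eqc_trans a1 _; apply: eqc_trans (eqc_sym hu) (eqc_sym a3).
    by apply: eqc_trans a0 _; apply: eqc_trans (eqc_sym hx) (eqc_sym a4).
have outer v1 u x : T v1 (DK (agent 1) (dimp choice (DK (agent 2) (dimp copy (iter m square R0))))) ->
    (eqc u (rd v1 0) /\ eqc x (rd v1 2)) \/ (eqc u (rd v1 2) /\ eqc x (rd v1 1)) ->
    exists v2, [/\ eqc (rd v2 0) u, eqc (rd v2 1) x & T v2 (iter m square R0)].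
  rewrite (T_K _ _ (phi := dimp choice _)) // => H hux.
  pose v2 := setb (setb v1 3 u) 4 x.
  have b4 : eqc (rd v2 4) x by apply: rd_setb.
  have b3 : eqc (rd v2 3) u by apply: eqc_trans (rd_setb _ _ _); [apply: rd_setb_neq|].
  have bo b : b < 3 -> eqc (rd v2 b) (rd v1 b).
    move=> lb; have n3 : b != 3 by rewrite neq_ltn lb.
    have n4 : b != 4 by rewrite neq_ltn (ltn_trans lb).
    have l5 : b < 5 by apply: ltn_trans lb _.
    by apply: eqc_trans (rd_setb_neq _ _ _ _) _ => //; apply: rd_setb_neq.
  apply: (inner v2) (b3) (b4); have := H v2; rewrite T_imp va // => /(_ _ _)/implyP; apply.
  - by move=> b k i lb lk li; rewrite !inE negb_or => /andP[/negbTE n0 /negbTE n1]; rewrite /v2 !setb_cell // n0 n1.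
  - by move=> p np; rewrite /v2 !setb_out.
  - rewrite T_or !T_and; case: hux => -[e1 e2]; apply/orP; [left|right]; apply/andP; split; apply/T_eq_blocks.
    + by apply: eqc_trans b3 _; apply: eqc_trans e1 (eqc_sym (bo 0 isT)).
    + by apply: eqc_trans b4 _; apply: eqc_trans e2 (eqc_sym (bo 2 isT)).
    + by apply: eqc_trans b3 _; apply: eqc_trans e1 (eqc_sym (bo 2 isT)).
    + by apply: eqc_trans b4 _; apply: eqc_trans e2 (eqc_sym (bo 1 isT)).
rewrite iterS T_neg; split.
  move=> /negP H0 k0 i0 lk0 li0; apply/eqP; apply: contraT => nE; exfalso; apply: H0.
  rewrite (T_K _ _ (phi := DNeg _)) // => v1; rewrite va // => e1 _; rewrite T_neg; apply/negP => H.
  suff E : eqc (rd v 1) (enc (iter (2 ^ m) step mid)) by rewrite E ?eqxx in nE.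
  have o0 : eqc (rd v1 0) (rd v 0) by move=> k i lk li; apply: e1.
  have o1 : eqc (rd v1 1) (rd v 1) by move=> k i lk li; apply: e1.
  (* The pair (U, Z) shows that Z encodes the middle configuration. *)
  have [v2 [c0 c1 c2]] := outer v1 (rd v1 0) (rd v1 2) H (or_introl (conj (@eqc_refl _) (@eqc_refl _))).
  have c0' : eqc (rd v2 0) (enc c) by apply: eqc_trans c0 (eqc_trans o0 h0).
  have z : eqc (rd v1 2) (enc mid) by apply: eqc_trans (eqc_sym c1) _; apply/(IH _ _ hc c0').
  (* Now Z is known to encode a configuration, and the pair (Z, V) gives the second half. *)
  have [v3 [d0 d1 d2]] := outer v1 (rd v1 2) (rd v1 1) H (or_intror (conj (@eqc_refl _) (@eqc_refl _))).
  have d0' : eqc (rd v3 0) (enc mid) by apply: eqc_trans d0 z.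
  by apply: eqc_trans (eqc_sym o1) _; apply: eqc_trans (eqc_sym d1) _; apply/(IH _ _ hm d0').
(* Conversely, Z is chosen as the encoding of the middle configuration; either choice of the pair is
   then one half of the computation. *)
move=> h1; apply/negP; rewrite (T_K _ _ (phi := DNeg _)) // => /(_ (setb v 2 (enc mid))).
rewrite va // T_neg => /(_ _ _)/negP; apply.
- by move=> b k i lb lk li; rewrite inE => /negbTE n; rewrite setb_cell // n.
- by move=> p np; rewrite setb_out.
set v1 := setb v 2 _.
have z0 : eqc (rd v1 0) (rd v 0) by apply: rd_setb_neq.
have z1 : eqc (rd v1 1) (rd v 1) by apply: rd_setb_neq.
have z2 : eqc (rd v1 2) (enc mid) by apply: rd_setb.
rewrite (T_K _ _ (phi := dimp choice _)) // => v2; rewrite va // => e2 _; rewrite T_imp; apply/implyP => hch.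
have y0 : eqc (rd v2 0) (rd v1 0) by move=> k i lk li; apply: e2.
have y1 : eqc (rd v2 1) (rd v1 1) by move=> k i lk li; apply: e2.
have y2 : eqc (rd v2 2) (rd v1 2) by move=> k i lk li; apply: e2.
rewrite (T_K _ _ (phi := dimp copy _)) // => v3; rewrite va // => e3 _; rewrite T_imp T_and; apply/implyP.
case/andP=> /T_eq_blocks q0 /T_eq_blocks q1.
have x3 : eqc (rd v3 3) (rd v2 3) by move=> k i lk li; apply: e3.
have x4 : eqc (rd v3 4) (rd v2 4) by move=> k i lk li; apply: e3.
have w0 : eqc (rd v3 0) (rd v2 3) by apply: eqc_trans q0 x3.
have w4 : eqc (rd v3 1) (rd v2 4) by apply: eqc_trans q1 x4.
move: hch; rewrite T_or !T_and => /orP[] /andP[/T_eq_blocks p1 /T_eq_blocks p2].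
  have f0 : eqc (rd v3 0) (enc c).
    by apply: eqc_trans w0 _; apply: eqc_trans p1 _; apply: eqc_trans y0 _; apply: eqc_trans z0 h0.
  apply/(IH _ _ hc f0).
  by apply: eqc_trans w4 _; apply: eqc_trans p2 _; apply: eqc_trans y2 z2.
have f0 : eqc (rd v3 0) (enc mid).
  by apply: eqc_trans w0 _; apply: eqc_trans p1 _; apply: eqc_trans y2 z2.
apply/(IH _ _ hm f0).
by apply: eqc_trans w4 _; apply: eqc_trans p2 _; apply: eqc_trans y1 _; apply: eqc_trans z1 h1.
Qed.

Variables (acc : dform 'I_4) (accepting halted : C -> bool).
Hypothesis acc_wf : dwf nvoc [::] acc.
Hypothesis acc_ok : forall v c, Inv c -> eqc (rd v 1) (enc c) -> T v acc = accepting c.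
Hypothesis halted_enc : forall c c', eqc (enc c) (enc c') -> halted c = halted c'.
Hypothesis halted_step : forall c, halted c -> step c = c.

Definition reach_goal m : dform 'I_4 := DK (agent 3) (dimp (iter m square R0) acc).

Lemma dwf_reach_goal m : dwf nvoc [::] (reach_goal m).
Proof. by rewrite /= dwf_iter_square. Qed.

Lemma reach_goal_ok m v c : Inv c -> eqc (rd v 0) (enc c) ->
  T v (reach_goal m) = accepting (iter (2 ^ m) step c).
Proof.
move=> hc h0; have w := dwf_iter_square m R0_wf; have hm := Inv_iter (2 ^ m) hc.
have w1 : dwf nvoc [::] (dimp (iter m square R0) acc) by rewrite /= w.
have va : nat_of_ord (agent 3) = 3 by rewrite /agent inordK.
apply/idP/idP.
  rewrite (T_K _ _ w1) va => /(_ (setb v 1 (enc (iter (2 ^ m) step c)))) H.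
  rewrite -(acc_ok (v := setb v 1 (enc (iter (2 ^ m) step c))) hm); last exact: rd_setb.
  have := H _ _; rewrite T_imp => /(_ _ _)/implyP; apply.
  - by move=> b k i lb lk li; rewrite inE => /negbTE n; rewrite setb_cell // n.
  - by move=> p np; rewrite setb_out.
  - apply/(iter_square_ok _ hc); last exact: rd_setb.
    by apply: eqc_trans h0; apply: rd_setb_neq.
move=> ha; rewrite (T_K _ _ w1) va => v' e _; rewrite T_imp; apply/implyP => h.
have h0' : eqc (rd v' 0) (enc c) by move=> k i lk li; rewrite /rd e //; apply: h0.
by rewrite (acc_ok hm) //; apply/(iter_square_ok _ hc h0').
Qed.

(** Obtained from the transition formula itself: its truth depends only on the two encodings, and it
    determines the second one from the first. *)
Lemma step_enc c c' : Inv c -> Inv c' -> eqc (enc c) (enc c') -> eqc (enc (step c)) (enc (step c')).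
Proof.
move=> hc hc' e; pose v := setb (setb (fun=> false) 0 (enc c)) 1 (enc (step c)).
have v1 : eqc (rd v 1) (enc (step c)) by apply: rd_setb.
have v0 : eqc (rd v 0) (enc c).
  by apply: eqc_trans (rd_setb _ _ _); [apply: rd_setb_neq|].
have : T v R0 by apply/(R0_ok hc v0).
by move/(R0_ok hc' (eqc_trans v0 e)); apply: eqc_trans; apply: eqc_sym.
Qed.

Lemma halted_iter c n m : halted (iter n step c) -> n <= m -> iter m step c = iter n step c.
Proof.
move=> h le; rewrite -(subnK le) iterD; elim: (m - n) => //= j ->; exact: halted_step.
Qed.

(** If the computation has not halted within [t] steps, two of the first [t + 1] configurations have
    the same encoding. From there on the encodings are periodic, and since halting is visible in the
    encoding it never occurs. *)
Lemma halted_bound c n : Inv c -> halted (iter n step c) -> halted (iter (2 ^ (K * N.+2)) step c).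
Proof.
move=> hc hn; set t := 2 ^ _; apply/negPn/negP => nt.
pose e (i : 'I_t.+1) := [ffun x : 'I_K * 'I_N.+2 => enc (iter i step c) x.1 x.2].
have /injectivePn[i [j nij eij]] : ~~ injectiveb e.
  apply/negP => /injectiveP /leq_card; rewrite card_ffun card_prod !card_ord card_bool.
  by rewrite -/t ltnn.
wlog lij : i j nij eij / i < j.
  move=> H; case: (ltngtP i j) => [lt|lt|/val_inj eq]; first exact: (H i j).
    by apply: (H j i) => //; rewrite eq_sym.
  by rewrite eq eqxx in nij.
have per d : eqc (enc (iter (d + i) step c)) (enc (iter (d + j) step c)).
  elim: d => [|d IH]; last by rewrite !addSn; apply: step_enc => //; apply: Inv_iter.
  by move=> k x lk lx; move/ffunP/(_ (Ordinal lk, Ordinal lx)): eij; rewrite !ffunE.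
(* Times beyond [t] are moved back by the period [j - i]; times up to [t] are not halting because a
   halting configuration would persist until [t]. *)
have none q : ~~ halted (iter q step c).
  elim/ltn_ind: q => q IH; case: (leqP q t) => lq.
    by apply/negP => h; move: nt; rewrite (halted_iter h lq) h.
  have lj : j <= q by apply: leq_trans (ltnW lq); rewrite -ltnS.
  rewrite -(subnK lj) -(halted_enc (per _)); apply: IH.
  by move: lj lij; clear; lia.
by move: (none n); rewrite hn.
Qed.

Lemma reach_goal_halted v c n : Inv c -> eqc (rd v 0) (enc c) -> halted (iter n step c) ->
  T v (reach_goal (K * N.+2)) = accepting (iter n step c).
Proof.
move=> hc h0 hn; rewrite (reach_goal_ok _ hc h0); congr accepting.
have ht := halted_bound hc hn.
by case: (leqP n (2 ^ (K * N.+2))) => le; [apply: halted_iter|apply/esym/halted_iter => //; apply: ltnW].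
Qed.

Lemma sat_reach_goal (s : seq atom) c n : {subset s <= nvoc} -> Inv c ->
  eqc (rd (fun p => p \in s) 0) (enc c) -> halted (iter n step c) ->
  sat nstr s (reach_goal (K * N.+2)) <-> accepting (iter n step c).
Proof.
move=> sV hc h0 hn.
have np : nonprime nvoc by move=> p /(allP nvoc_names) /name_nonprime.
have fk := @hist_fok _ nstr nvoc_names isT nobs_sub [::] [::] I isT.
rewrite (sat_trans np fk (dwf_reach_goal _) sV) bsatE.
by rewrite -(reach_goal_halted hc h0 hn).
Qed.
End Squaring.

(** * Space bounded machines *)

Section Machine.
Variable M : tm.
Notation St := (tm_state M).
Notation Sym := (bool + tm_aux M)%type.
Notation Tp := 'I_(tm_tapes M).+1.

(* A configuration is stored relative to the heads: every tape has a track for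
   each symbol on each side, [true] being the right side with the scanned cell
   at index 0, and each state has a track carrying one bit at index 0. *)
Definition kind : finType := (St + Tp * bool * Sym)%type.
Definition kinds : seq kind := enum kind.
Definition nkinds := size kinds.
Definition kid (x : kind) : nat := index x kinds.
Definition kd (k : nat) : kind := nth (inl (tm_start M)) kinds k.

Lemma kid_lt x : kid x < nkinds. Proof. by rewrite index_mem mem_enum. Qed.
Lemma kidK x : kd (kid x) = x. Proof. by rewrite /kd nth_index // mem_enum. Qed.
Lemma kdK k : k < nkinds -> kid (kd k) = k.
Proof. by move=> lk; rewrite /kid index_uniq // enum_uniq. Qed.
Lemma kid_inj : injective kid. Proof. exact: can_inj kidK. Qed.
Lemma nkinds_gt0 : 0 < nkinds. Proof. exact: leq_trans (kid_lt (inl (tm_start M))). Qed.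

Definition tcell (t : tape Sym) (side : bool) (i : nat) : option Sym :=
  nth None (if side then t_cur t :: t_right t else t_left t) i.

Definition enc1 (c : config M) (x : kind) (i : nat) : bool :=
  match x with
  | inl q => (i == 0) && (c_state c == q)
  | inr (j, side, b) => tcell (c_tapes c j) side i == Some b
  end.
Definition enc (c : config M) (k i : nat) : bool := enc1 c (kd k) i.

Inductive source := Bit (b : bool) | Old (x : kind).

Definition srcv (c : config M) (s : source) : bool :=
  match s with Bit b => b | Old x => enc1 c x 0 end.

(* The first new entries of a track; the others are the old ones, shifted. *)
Definition rule (q : St) (g : {ffun Tp -> option Sym}) (x : kind) : seq source * nat :=
  if tm_verdict q is Some _ then ([::], 0) else
  let: (q', act) := tm_delta q g in
  match x with
  | inl q1 => ([:: Bit (q' == q1)], 1)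
  | inr (j, side, b) =>
      let a := Bit ((act j).1 == Some b) in
      match (act j).2 with
      | MStay => if side then ([:: a], 1) else ([::], 0)
      | MLeft => if side then ([:: Old (inr (j, false, b)); a], 1) else ([::], 1)
      | MRight => if side then ([::], 1) else ([:: a], 0)
      end
  end.

Definition scan (c : config M) : {ffun Tp -> option Sym} := [ffun j => t_cur (c_tapes c j)].

(** Unvisited cells read as blank, which makes every track false there. So moves at the ends of the
    visited part follow the same shift as all others. *)
Lemma rule_ok c x i : enc1 (tm_step c) x i =
  if i < size (rule (c_state c) (scan c) x).1
  then srcv c (nth (Bit false) (rule (c_state c) (scan c) x).1 i)
  else enc1 c x (i - size (rule (c_state c) (scan c) x).1 + (rule (c_state c) (scan c) x).2).
Proof.
rewrite /rule /tm_step -/(scan c); case: (tm_verdict _) => [_|]; first by rewrite subn0 addn0.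
case: (tm_delta _ _) => q' act; case: x => [q1|[[j side] b]].
  by case: i => [|i] //=; rewrite subSS subn0 addn1.
rewrite /= ffunE; case e: (c_tapes c j) => [l u r]; case: (act j) => a [] /=; case: side;
  rewrite /tcell /=.
- by case: i => [|[|i]]; rewrite /= /tcell ?e; case: (l) => [|y l'] //=; rewrite ?subSS ?subn0 ?addn1.
- by case: (l) => [|y l']; rewrite subn0 addn1 ?nth_nil.
- by case: i => [|i] //=; rewrite subSS subn0 addn1.
- by rewrite subn0 addn0.
- by case: (r) => [|y r']; rewrite subn0 addn1 //=; case: i => [|i] //=; rewrite nth_nil.
- by case: (r) => [|y r']; case: i => [|i] //=; rewrite subSS subn0 addn0.
Qed.

Lemma rule_size q g x : size (rule q g x).1 <= 2 /\ (rule q g x).2 <= 1.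
Proof.
rewrite /rule; case: (tm_verdict q) => //; case: (tm_delta q g) => q' act.
by case: x => // -[[j side] b]; case: (act j).2; case: side.
Qed.

Variable N : nat.
Notation cell := (cell nkinds).
Notation nvoc := (nvoc nkinds N).
Notation T := (T nkinds N).
Notation rd := (rd nkinds).
Notation eqc := (eqc nkinds N).
Notation form := (dform 'I_4).

Definition bounded (c : config M) : Prop :=
  forall n j, tape_size (c_tapes (iter n (@tm_step M) c) j) <= N.

Lemma bounded_step c : bounded c -> bounded (tm_step c).
Proof. by move=> h n j; have := h n.+1 j; rewrite iterSr. Qed.

Lemma enc1_far c x i : bounded c -> N <= i -> enc1 c x i = false.
Proof.
move=> hc hi; case: x => [q|[[j side] b]] /=.
  have := hc 0 ord0; rewrite /tape_size => h; case: i hi => // h0.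
  by rewrite leqn0 in h0; move: h; rewrite (eqP h0).
have := hc 0 j; rewrite /= /tape_size /tcell => h.
by case: side; rewrite nth_default //=; move: h hi; clear; lia.
Qed.

Definition U x i : form := DAtom (cell 0 (kid x) i).
Definition V x i : form := DAtom (cell 1 (kid x) i).

Definition lit (x : kind) (b : bool) : form := if b then U x 0 else DNeg (U x 0).
Definition srcF (s : source) : form :=
  match s with Bit b => if b then DTop else DBot | Old x => U x 0 end.

(** A blank under a head has no track of its own: it is expressed by the absence of every symbol. *)
Definition cond (q : St) (g : {ffun Tp -> option Sym}) : form :=
  dconj ([seq lit (inl q1) (q1 == q) | q1 <- enum St] ++
         [seq lit (inr (y.1, true, y.2)) (g y.1 == Some y.2) | y <- enum {: Tp * Sym}]).
(** The [N.+2] entries of a track are split into [p] new ones, [N] shifted ones and [2 - p] that lie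
    beyond the space bound. Only the middle group depends on [N] in length, and its members have a
    uniform shape that a loop can print; a shift by at most 1 stays within the track. *)
Definition trackF q g x : seq form :=
  let p := size (rule q g x).1 in
  [seq diff (V x i) (srcF (nth (Bit false) (rule q g x).1 i)) | i <- iota 0 p] ++
  [seq diff (V x (i + p)) (U x (i + (rule q g x).2)) | i <- iota 0 N] ++
  [seq DNeg (V x (N + (p + i))) | i <- iota 0 (2 - p)].
Definition concl q g : form := dconj (flatten [seq trackF q g x | x <- kinds]).
Definition trans_form : form :=
  dconj [seq dimp (cond y.1 y.2) (concl y.1 y.2) | y <- enum {: St * {ffun Tp -> option Sym}}].
Definition acc_form : form :=
  DNeg (dconj [seq DNeg (V (inl q) 0) | q <- enum St & tm_verdict q == Some true]).

Lemma wf_U x i : i < N.+2 -> dwf nvoc [::] (U x i).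
Proof. by move=> li; rewrite /= cats0; apply: cell_voc; rewrite ?nkinds_gt0 ?kid_lt. Qed.

Lemma wf_V x i : i < N.+2 -> dwf nvoc [::] (V x i).
Proof. by move=> li; rewrite /= cats0; apply: cell_voc; rewrite ?nkinds_gt0 ?kid_lt. Qed.

Lemma all_track (a : pred form) q g x : all a (trackF q g x) <->
  [/\ forall i, i < size (rule q g x).1 -> a (diff (V x i) (srcF (nth (Bit false) (rule q g x).1 i))),
      forall i, i < N -> a (diff (V x (i + size (rule q g x).1)) (U x (i + (rule q g x).2))) &
      forall i, i < 2 - size (rule q g x).1 -> a (DNeg (V x (N + (size (rule q g x).1 + i))))].
Proof.
rewrite /trackF !all_cat !all_map; split.
  case/and3P=> /allP h1 /allP h2 /allP h3.
  by split=> i li; [have := h1 i|have := h2 i|have := h3 i]; rewrite mem_iota add0n li /=; apply.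
move=> [h1 h2 h3]; apply/and3P; split; apply/allP => i; rewrite mem_iota add0n /= => li.
- exact: h1.
- exact: h2.
- exact: h3.
Qed.

Lemma trans_form_wf : dwf nvoc [::] trans_form.
Proof.
rewrite dwf_conj all_map; apply/allP => -[q g] _ /=; apply/andP; split.
  rewrite dwf_conj all_cat !all_map; apply/andP; split; apply/allP => y _ /=; rewrite /lit.
    by case: ifP => _; apply: wf_U.
  by case: ifP => _; apply: wf_U.
rewrite dwf_conj all_flatten all_map; apply/allP => x _ /=; apply/all_track.
have [hp hs] := rule_size q g x.
have wd p r : dwf nvoc [::] p -> dwf nvoc [::] r -> dwf nvoc [::] (diff p r) by move=> h1 h2 /=; rewrite h1 h2.
split=> i li.
- apply: wd; first by apply: wf_V; lia.
  by case: (nth _ _ _) => [[]|y] //; apply: wf_U.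
- by apply: wd; [apply: wf_V|apply: wf_U]; lia.
- by apply: wf_V; lia.
Qed.

Lemma trans_form_ok v c : bounded c -> eqc (rd v 0) (enc c) ->
  T v trans_form <-> eqc (rd v 1) (enc (tm_step c)).
Proof.
move=> hc h0.
have vU x i : i < N.+2 -> T v (U x i) = enc1 c x i.
  by move=> li; have := h0 (kid x) i (kid_lt x) li; rewrite /enc kidK.
have vlit x b : T v (lit x b) = (enc1 c x 0 == b).
  by rewrite /lit; case: b; rewrite ?T_neg vU //; case: (enc1 c x 0).
have vsrc s : T v (srcF s) = srcv c s by case: s => [[]|x] //; rewrite /= vU.
have vcond q g : T v (cond q g) -> q = c_state c /\ g = scan c.
  rewrite T_conj all_cat all_map [X in _ && X]all_map => /andP[/allP h1 /allP h2]; split.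
    have := h1 q (mem_enum _ _); rewrite /= vlit /= eqxx; by move/eqP/eqP.
  apply/ffunP => j; rewrite ffunE.
  have h b : (t_cur (c_tapes c j) == Some b) = (g j == Some b).
    by have := h2 (j, b) (mem_enum _ _); rewrite /= vlit /= /tcell /= => /eqP.
  case e1: (t_cur _) => [b|]; first by have := h b; rewrite e1 eqxx => /esym/eqP.
  by case e2: (g j) => [b|] //; have := h b; rewrite e1 e2 eqxx.
have ccond : T v (cond (c_state c) (scan c)).
  rewrite T_conj all_cat !all_map; apply/andP; split; apply/allP => y _ /=; rewrite vlit /=.
    by rewrite [c_state c == y]eq_sym.
  by rewrite /tcell /= ffunE.
have vconcl : T v (concl (c_state c) (scan c)) <-> eqc (rd v 1) (enc (tm_step c)).
  rewrite T_conj all_flatten all_map; split.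
    move=> /allP h k i lk li; rewrite /enc; set x := kd k.
    have ek : k = kid x by rewrite /x kdK.
    have := h x (mem_enum _ _) => /= /all_track[a1 a2 a3].
    rewrite rule_ok; have [hp hs] := rule_size (c_state c) (scan c) x.
    set ru := rule _ _ x in a1 a2 a3 hp hs *.
    have eV j : T v (V x j) = rd v 1 k j by rewrite ek.
    case: ltnP => lp.
      by have := a1 i lp; rewrite T_iff eV vsrc => /eqP.
    case: (ltnP (i - size ru.1) N) => lN.
      have := a2 _ lN; rewrite T_iff subnK // eV vU; last by lia.
      by move=> /eqP.
    have := a3 (i - (N + size ru.1)); rewrite T_neg.
    have -> : N + (size ru.1 + (i - (N + size ru.1))) = i by lia.
    rewrite eV => /(_ _)/negbTE ->; last by lia.
    by rewrite enc1_far //; lia.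
  move=> h; apply/allP => x _ /=; apply/all_track.
  have [hp hs] := rule_size (c_state c) (scan c) x.
  have eV j : j < N.+2 -> T v (V x j) = enc1 (tm_step c) x j.
    by move=> lj; have := h (kid x) j (kid_lt x) lj; rewrite /enc kidK.
  split=> i li.
  - by rewrite T_iff vsrc eV ?rule_ok ?li //; lia.
  - rewrite T_iff eV; last by lia.
    rewrite vU; last by lia.
    by rewrite rule_ok ltnNge leq_addl /= addnK.
  - rewrite T_neg eV; last by lia.
    by rewrite enc1_far ?leq_addr //; apply: bounded_step.
rewrite -vconcl T_conj all_map; split.
  by move=> /allP /(_ (c_state c, scan c) (mem_enum _ _)); rewrite /= T_imp ccond.
move=> h; apply/allP => -[q g] _; rewrite /= T_imp; apply/implyP => /vcond[-> ->].
exact: h.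
Qed.

Lemma acc_form_wf : dwf nvoc [::] acc_form.
Proof.
by rewrite [dwf _ _ _]dwf_conj all_map; apply/allP => q _; apply: wf_V.
Qed.

Definition accepting (c : config M) := tm_verdict (c_state c) == Some true.
Definition halted (c : config M) := isSome (tm_verdict (c_state c)).

Lemma acc_form_ok v c : bounded c -> eqc (rd v 1) (enc c) -> T v acc_form = accepting c.
Proof.
move=> hc h1; rewrite T_neg T_conj all_map -has_predC.
have vV q : T v (V (inl q) 0) = (c_state c == q).
  by have := h1 (kid (inl q)) 0 (kid_lt _) isT; rewrite /enc kidK.
apply/hasP/idP => [[q]|h].
  rewrite mem_filter => /andP[hq _].
  by rewrite -[predC _ _]/(~~ T v (DNeg (V (inl q) 0))) T_neg negbK vV => /eqP e; rewrite /accepting e.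
exists (c_state c); first by rewrite mem_filter mem_enum andbT.
by rewrite -[predC _ _]/(~~ T v (DNeg (V (inl (c_state c)) 0))) T_neg negbK vV.
Qed.

Lemma halted_enc c c' : eqc (enc c) (enc c') -> halted c = halted c'.
Proof.
move=> h; suff e : c_state c = c_state c' by rewrite /halted e.
have := h (kid (inl (c_state c))) 0 (kid_lt _) isT; rewrite /enc kidK /= eqxx.
by move/esym/eqP.
Qed.

Lemma halted_step c : halted c -> tm_step c = c.
Proof. by rewrite /halted /tm_step; case: (tm_verdict _). Qed.

Definition in_kind (b : bool) : kind := inr (ord0, true, inl b).
Fixpoint inits (i : nat) (w : seq bool) : seq atom :=
  if w is b :: w' then cell 0 (kid (in_kind b)) i :: inits i.+1 w' else [::].
Definition init_state (w : seq bool) : seq atom := cell 0 (kid (inl (tm_start M))) 0 :: inits 0 w.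

Lemma inits_sub i w p : p \in inits i w -> exists b j, [/\ p = cell 0 (kid (in_kind b)) j, i <= j & j < i + size w].
Proof.
elim: w i => //= b w IH i; rewrite inE => /orP[/eqP ->|/IH[b' [j [-> h1 h2]]]].
  by exists b, i; split=> //; lia.
by exists b', j; split=> //; lia.
Qed.

Lemma mem_inits x i i0 w : (cell 0 (kid x) (i0 + i) \in inits i0 w) =
  (i < size w) && (x == in_kind (nth false w i)).
Proof.
elim: w i i0 => [|b w IH] [|i] i0 //=; rewrite inE.
  rewrite addn0; have -> : (cell 0 (kid x) i0 \in inits i0.+1 w) = false.
    apply/negP => /inits_sub[b' [j [+ lj _]]].
    by move/(cell_inj nkinds_gt0 (kid_lt _) (kid_lt _)) => [_ _ e]; rewrite e ltnn in lj.
  rewrite orbF; apply/eqP/eqP => [/(cell_inj nkinds_gt0 (kid_lt _) (kid_lt _))[_ /kid_inj]|->] //.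
rewrite addnS -addSn IH; case: eqP => // /(cell_inj nkinds_gt0 (kid_lt _) (kid_lt _))[_ _ e].
by exfalso; move: e; clear; lia.
Qed.

Lemma init_state_uniq w : uniq (init_state w).
Proof.
apply/andP; split.
  apply/negP => /inits_sub[b [j [/(cell_inj nkinds_gt0 (kid_lt _) (kid_lt _))[_ /kid_inj]]]] //.
elim: w 0 => //= b w IH i; rewrite IH andbT; apply/negP => /inits_sub[b' [j [+ lj _]]].
by move/(cell_inj nkinds_gt0 (kid_lt _) (kid_lt _)) => [_ _ e]; rewrite e ltnn in lj.
Qed.

Lemma size_input w : bounded (tm_init M w) -> size w <= N.
Proof.
move=> /(_ 0 ord0); rewrite /= ffunE eqxx /tape_size.
by case: w => //= b w; rewrite !size_map.
Qed.

Lemma init_state_sub w : size w <= N -> {subset init_state w <= nvoc}.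
Proof.
move=> hw p; rewrite inE => /orP[/eqP ->|/inits_sub[b [j [-> _ lj]]]]; apply: cell_voc => //.
- exact: nkinds_gt0.
- exact: kid_lt.
- exact: nkinds_gt0.
- exact: kid_lt.
- by rewrite add0n in lj; apply: leq_trans lj _; apply: leq_trans hw _; clear; lia.
Qed.

Lemma init_state_enc w : eqc (rd (fun p => p \in init_state w) 0) (enc (tm_init M w)).
Proof.
move=> k i lk li; rewrite /rd /enc -{1}(kdK lk); move: (kd k) => x.
rewrite inE -[i in X in _ || X]add0n mem_inits.
case: x => [q|[[j side] b]] /=.
  rewrite andbF orbF; apply/eqP/andP => [|[/eqP -> /eqP <-]] //.
  by move/(cell_inj nkinds_gt0 (kid_lt _) (kid_lt _)) => [_ /kid_inj[->] ->]; rewrite !eqxx.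
have -> : (cell 0 (kid (inr (j, side, b))) i == cell 0 (kid (inl (tm_start M))) 0) = false.
  by apply/eqP => /(cell_inj nkinds_gt0 (kid_lt _) (kid_lt _))[_ /kid_inj].
rewrite /= ffunE /in_kind.
have inE' c : (inr (j, side, b) == inr (ord0, true, inl c) :> kind) = [&& j == ord0, side & b == inl c].
  by apply/eqP/and3P => [[-> -> ->]|[/eqP -> -> /eqP ->]].
rewrite inE' /tcell; case: eqP => _ /=.
  case: side {inE'} => /=; last by case: w => [|b0 w]; rewrite /= nth_nil ?andbF.
  have -> : t_cur (tape_of (map inl w)) :: t_right (tape_of (map inl w)) =
      if w is [::] then [:: None] else map Some (map (@inl bool (tm_aux M)) w) by case: (w).
  case: (ltnP i (size w)) => lw.
    case: w lw => // b0 w lw; rewrite (nth_map (inl false)) ?size_map // (nth_map false) // eq_sym.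
  case: w lw => [|b0 w] lw; last by rewrite andFb (@nth_default _ None) // !size_map.
  by case: i {lw li} => [|i] //=; rewrite nth_nil.
by rewrite andbF; case: side {inE'}; case: i {li} => //= i; rewrite nth_nil.
Qed.

Lemma sat_machine w n : bounded (tm_init M w) -> halted (tm_run M w n) ->
  sat (nstr nkinds N) (init_state w) (reach_goal nkinds N trans_form acc_form (nkinds * N.+2)) <->
  accepting (tm_run M w n).
Proof.
move=> hb hn.
apply: (sat_reach_goal nkinds_gt0 bounded_step trans_form_wf trans_form_ok acc_form_wf acc_form_ok
  halted_enc halted_step (init_state_sub (size_input hb)) hb (init_state_enc w) hn).
Qed.
End Machine.

(** * The reduction *)

Notation form := (dform 'I_4).

Definition scat (l : seq sexp) : sexp := foldr SCat (SConst [::]) l.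

Lemma den_SCat a b env : den (SCat a b) env = den a env ++ den b env. Proof. by []. Qed.
Lemma den_SConst s env : den (SConst s) env = s. Proof. by []. Qed.

Lemma den_scat l env : den (scat l) env = flatten [seq den e env | e <- l].
Proof. by elim: l => //= e l ->. Qed.

Lemma den_scat4 a b c e env :
  den (scat [:: a; b; c; e]) env = den a env ++ den b env ++ den c env ++ den e env.
Proof. by rewrite den_scat /= cats0. Qed.

Lemma den_scat5 a b c e f env :
  den (scat [:: a; b; c; e; f]) env = den a env ++ den b env ++ den c env ++ den e env ++ den f env.
Proof. by rewrite den_scat /= cats0. Qed.

Lemma enc_neg (A : finType) (p : dform A) : enc_dform (DNeg p) = enc_nat 3 ++ enc_dform p.
Proof. by []. Qed.
Lemma enc_and (A : finType) (p q : dform A) :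
  enc_dform (DAnd p q) = enc_nat 4 ++ enc_dform p ++ enc_dform q.
Proof. by []. Qed.
Lemma enc_K (A : finType) (p : dform A) i :
  enc_dform (DK i p) = enc_nat 5 ++ enc_nat (enum_rank i) ++ enc_dform p.
Proof. by []. Qed.

Definition srep d e := SFor d e e.

Lemma den_srep d e env : den (srep d e) env =
  flatten [seq den e (nseq i false :: env) | i <- iota 0 (size (nth [::] env d))].
Proof. by rewrite /=; elim: (nth _ _ _) 0 => //= b l IH i; rewrite IH if_same. Qed.

Lemma flatten_const T (s : seq T) (l : seq nat) : flatten [seq s | _ <- l] = flatten (nseq (size l) s).
Proof. by elim: l => //= _ l ->. Qed.

Lemma enc_seqE T (e : T -> seq bool) l : enc_seq e l = flatten [seq true :: e a | a <- l] ++ [:: false].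
Proof. by elim: l => //= a l ->; rewrite catA. Qed.

(* Templates of formulas in which the indices of atoms are offsets from the
   length of a word of the environment. *)
Inductive tform := TC (phi : form) | TA (a off : nat) | TNeg (t : tform) | TAnd (t u : tform).

Fixpoint inst (n : nat) (t : tform) : form :=
  match t with
  | TC phi => phi
  | TA a off => DAtom (name a (n + off))
  | TNeg t => DNeg (inst n t)
  | TAnd t u => DAnd (inst n t) (inst n u)
  end.

Definition timp t u := TNeg (TAnd t (TNeg u)).
Definition tiff t u := TAnd (timp t u) (timp u t).

(** In the code of a name each bit is preceded by a continuation bit [true], so a unary index is a
    repetition of the word 11, and the length of word [d] supplies the variable part of it. *)
Definition satom (d a off : nat) : sexp :=
  scat [:: SConst (false :: flatten (nseq a [:: true; true]) ++ [:: true; false]);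
           srep d (SConst [:: true; true]); SConst (flatten (nseq off [:: true; true]) ++ [:: false])].

Lemma den_satom d a off env :
  den (satom d a off) env = enc_atom (name a (size (nth [::] env d) + off)).
Proof.
rewrite den_scat /= -/(srep d (SConst [:: true; true])).
rewrite -[sloop _ _ _]/(den (srep d (SConst [:: true; true])) env) den_srep /= flatten_const size_iota cats0.
rewrite enc_seqE map_cat flatten_cat map_nseq /= map_nseq -!catA /= nseqD flatten_cat.
by rewrite -!catA.
Qed.

Fixpoint stform (d : nat) (t : tform) : sexp :=
  match t with
  | TC phi => SConst (enc_dform phi)
  | TA a off => SCat (SConst (enc_nat 2)) (satom d a off)
  | TNeg t => SCat (SConst (enc_nat 3)) (stform d t)
  | TAnd t u => SCat (SConst (enc_nat 4)) (SCat (stform d t) (stform d u))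
  end.

Lemma den_stform d t env : den (stform d t) env = enc_dform (inst (size (nth [::] env d)) t).
Proof.
elim: t => [phi|a off|t IH|t IHt u IHu] //.
- by rewrite -[stform _ _]/(SCat (SConst (enc_nat 2)) (satom d a off)) den_SCat den_satom.
- by rewrite -[stform _ _]/(SCat (SConst (enc_nat 3)) (stform d t)) den_SCat IH.
- rewrite -[stform _ _]/(SCat (SConst (enc_nat 4)) (SCat (stform d t) (stform d u))).
  by rewrite den_SCat den_SCat IHt IHu.
Qed.

(** In prefix notation a right-nested conjunction is the concatenation of its members, each preceded
    by the tag of conjunction, followed by the code of [DTop]. Hence conjunctions can be printed
    piecewise and by loops. *)
Definition encl (l : seq form) : seq bool := flatten [seq enc_nat 4 ++ enc_dform f | f <- l].

Lemma encl_cat l l' : encl (l ++ l') = encl l ++ encl l'.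
Proof. by rewrite /encl map_cat flatten_cat. Qed.

Lemma encl1 f : encl [:: f] = enc_nat 4 ++ enc_dform f.
Proof. by rewrite /encl /= cats0. Qed.

Lemma encl_flatten ls : encl (flatten ls) = flatten (map encl ls).
Proof. by elim: ls => //= l ls IH; rewrite encl_cat IH. Qed.

Lemma enc_conj l : enc_dform (dconj l) = encl l ++ enc_nat 0.
Proof. by elim: l => // f l IH; rewrite /dconj /= -/(dconj l) IH /encl /= -catA. Qed.

Definition sitem d t := SCat (SConst (enc_nat 4)) (stform d t).

Lemma den_sitem d t env : den (sitem d t) env = encl [:: inst (size (nth [::] env d)) t].
Proof. by rewrite /encl den_SCat den_stform /= cats0. Qed.

Lemma den_sitems d ts env :
  den (scat [seq sitem d t | t <- ts]) env = encl [seq inst (size (nth [::] env d)) t | t <- ts].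
Proof.
rewrite den_scat -map_comp /encl -map_comp; congr flatten; apply: eq_map => t.
by rewrite /= den_stform.
Qed.

Lemma den_sloop d t env : den (srep d (sitem 0 t)) env =
  encl [seq inst i t | i <- iota 0 (size (nth [::] env d))].
Proof.
rewrite den_srep /encl -map_comp; congr flatten; apply: eq_map => i.
by rewrite [LHS]den_sitem /encl /= size_nseq cats0.
Qed.

Definition sdimp (A B : sexp) := scat [:: SConst (enc_nat 3 ++ enc_nat 4); A; SConst (enc_nat 3); B].

Lemma den_imp A B env (p q : form) : den A env = enc_dform p -> den B env = enc_dform q ->
  den (sdimp A B) env = enc_dform (dimp p q).
Proof. by move=> hA hB; rewrite /sdimp den_scat4 !den_SConst hA hB /dimp enc_neg enc_and enc_neg -!catA. Qed.

Definition sconj (l : seq sexp) := SCat (scat l) (SConst (enc_nat 0)).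

Lemma den_conj l env ls : [seq den e env | e <- l] = map encl ls ->
  den (sconj l) env = enc_dform (dconj (flatten ls)).
Proof. by move=> h; rewrite enc_conj [LHS]/= den_scat h encl_flatten. Qed.

Lemma map_iota2 T (f : nat -> T) n : [seq f i | i <- iota 0 n.+2] = [seq f i | i <- iota 0 n] ++ [:: f n; f n.+1].
Proof. by rewrite -addn2 iotaD map_cat /= add0n. Qed.

Lemma enum_rank_agent a : a < 4 -> enum_rank (agent a) = a :> nat.
Proof. by move=> la; rewrite enum_rank_ord /= /agent inordK. Qed.

(** * Printing the formulas of the reduction *)

Section Generate.
Variable M : tm.
Notation K := (nkinds M).
Variable (d : nat) (env : seq (seq bool)).
Notation N := (size (nth [::] env d)).

(** In the loop body word 0 is the current position, in unary. The two remaining indices, N and N +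
    1, are printed outside the loop as offsets from the length of word [d]. *)
Definition seq_track d b b' k : sexp :=
  let t o := tiff (TA (b * K + k) o) (TA (b' * K + k) o) in
  SCat (srep d (sitem 0 (t 0))) (scat [seq sitem d u | u <- [:: t 0; t 1]]).

Lemma den_eq_track b b' k : den (seq_track d b b' k) env = encl (eq_track K N b b' k).
Proof.
rewrite /eq_track map_iota2 encl_cat /seq_track den_SCat den_sloop den_sitems; congr (encl _ ++ encl _).
  by apply: eq_map => i; rewrite /= addn0.
by rewrite /= addn0 addn1.
Qed.

Definition seq_blocks d b b' : sexp := sconj [seq seq_track d b b' k | k <- iota 0 K].

Lemma den_eq_blocks b b' : den (seq_blocks d b b') env = enc_dform (eq_blocks K N b b').
Proof.
apply: den_conj; rewrite -!map_comp; apply: eq_map => k; exact: den_eq_track.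
Qed.

Definition sand A B := scat [:: SConst (enc_nat 4); A; B].
Definition schoice d := scat [:: SConst (enc_nat 3 ++ enc_nat 4 ++ enc_nat 3);
  sand (seq_blocks d 3 0) (seq_blocks d 4 2); SConst (enc_nat 3);
  sand (seq_blocks d 3 2) (seq_blocks d 4 1)].

Lemma den_sand A B : den (sand A B) env = enc_nat 4 ++ den A env ++ den B env.
Proof. by rewrite den_scat /= cats0. Qed.

Lemma den_choice : den (schoice d) env = enc_dform (choice K N).
Proof.
rewrite /schoice den_scat4 !den_SConst !den_sand !den_eq_blocks.
by rewrite /choice /dor enc_neg enc_and !enc_neg !enc_and -!catA.
Qed.

Definition sprefix d : sexp := scat [:: SConst (enc_nat 3 ++ enc_nat 5 ++ enc_nat 0 ++ enc_nat 3 ++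
    enc_nat 5 ++ enc_nat 1 ++ enc_nat 3 ++ enc_nat 4); schoice d;
  SConst (enc_nat 3 ++ enc_nat 5 ++ enc_nat 2 ++ enc_nat 3 ++ enc_nat 4);
  sand (seq_blocks d 0 3) (seq_blocks d 1 4); SConst (enc_nat 3)].

(** The argument of [square] stands last in prefix notation, so iterated squaring is a power of a
    fixed word in front of the code of the innermost formula. *)
Lemma den_prefix phi : enc_dform (square K N phi) = den (sprefix d) env ++ enc_dform phi.
Proof.
rewrite /sprefix den_scat5 !den_SConst den_sand !den_eq_blocks den_choice /square /dimp.
rewrite /copy; move: (choice K N) (eq_blocks K N 0 3) (eq_blocks K N 1 4) => ch e1 e2.
rewrite enc_neg enc_K enc_neg enc_K enc_neg enc_and enc_neg enc_K enc_neg enc_and enc_neg enc_and.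
by rewrite !enum_rank_agent // -!catA.
Qed.

Definition strack d q g (x : kind M) : sexp :=
  let p := size (rule q g x).1 in
  SCat (SConst (encl [seq diff (V x i) (srcF (nth (Bit M false) (rule q g x).1 i)) | i <- iota 0 p]))
   (SCat (srep d (sitem 0 (tiff (TA (1 * K + kid x) p) (TA (0 * K + kid x) (rule q g x).2))))
     (scat [seq sitem d u | u <- [seq TNeg (TA (1 * K + kid x) (p + i)) | i <- iota 0 (2 - p)]])).

Lemma den_track q g x : den (strack d q g x) env = encl (trackF N q g x).
Proof.
rewrite /strack den_SCat den_SCat den_SConst den_sloop den_sitems -map_comp.
by rewrite /trackF !encl_cat.
Qed.

Definition sconcl d q g : sexp := sconj [seq strack d q g x | x <- kinds M].

Lemma den_concl q g : den (sconcl d q g) env = enc_dform (concl N q g).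
Proof. by apply: den_conj; rewrite -!map_comp; apply: eq_map => x; apply: den_track. Qed.

Definition strans d : sexp :=
  sconj [seq SCat (SConst (enc_nat 4)) (sdimp (SConst (enc_dform (cond y.1 y.2))) (sconcl d y.1 y.2))
        | y <- enum {: tm_state M * {ffun 'I_(tm_tapes M).+1 -> option (bool + tm_aux M)}}].

Lemma den_trans : den (strans d) env = enc_dform (trans_form M N).
Proof.
have flat1 (T U : Type) (f : T -> U) l : [seq f y | y <- l] = flatten [seq [:: f y] | y <- l].
  by elim: l => //= y l ->.
rewrite /trans_form flat1; apply: den_conj; rewrite -!map_comp; apply: eq_map => y.
rewrite -[RHS]/(encl [:: dimp (cond y.1 y.2) (concl N y.1 y.2)]) encl1.
rewrite -[LHS]/(enc_nat 4 ++ den (sdimp (SConst (enc_dform (cond y.1 y.2))) (sconcl d y.1 y.2)) env).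
by rewrite (@den_imp _ _ _ (cond y.1 y.2) (concl N y.1 y.2)) //; apply: den_concl.
Qed.
End Generate.

(** Inside a loop the word that gives N has moved from index 0 to index 1. Both generators print the
    code of a squared [DTop] up to its last bit, so they agree. *)
Lemma den_prefix_shift M x i env : den (sprefix M 1) (i :: x :: env) = den (sprefix M 0) (x :: env).
Proof.
have e0 := den_prefix M 0 (x :: env) DTop; have e1 := den_prefix M 1 (i :: x :: env) DTop.
have e : rcons (den (sprefix M 1) (i :: x :: env)) false = rcons (den (sprefix M 0) (x :: env)) false.
  by rewrite -!cats1; apply: etrans (esym e1) e0.
exact: (congr1 fst (rcons_inj e)).
Qed.

Lemma flatten_nseq_mul T (s : seq T) n k : flatten (nseq n (flatten (nseq k s))) = flatten (nseq (n * k) s).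
Proof. by elim: n => //= n ->; rewrite mulSn nseqD flatten_cat. Qed.

Section Instance.
Variables (M : tm) (x w : seq bool).
Notation K := (nkinds M).
Notation N := (size x).
Notation env := [:: x; w].

(** The number of squarings is [K * N.+2]: [K] prefixes in each of N rounds, and [2 * K] more. *)
Definition slevels : sexp :=
  SCat (srep 0 (scat (nseq K (sprefix M 1)))) (scat (nseq (2 * K) (sprefix M 0))).

Lemma den_levels phi : den slevels env ++ enc_dform phi = enc_dform (iter (K * N.+2) (square K N) phi).
Proof.
set P := den (sprefix M 0) env.
have -> : den slevels env = flatten (nseq (K * N.+2) P).
  rewrite /slevels den_SCat den_srep den_scat map_nseq -/P.
  rewrite (eq_map (g := fun=> flatten (nseq K P))); last first.
    by move=> i; rewrite den_scat map_nseq den_prefix_shift.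
  rewrite flatten_const size_iota flatten_nseq_mul -flatten_cat -nseqD; congr (flatten (nseq _ _)).
  by rewrite [nth _ _ _]/= -mulnDl addn2 mulnC.
elim: (K * _) => [|n IH] //; rewrite iterS -[nseq n.+1 P]/(P :: nseq n P) -[flatten (P :: _)]/(P ++ flatten (nseq n P)) -catA IH.
by rewrite (den_prefix M 0 env).
Qed.

Definition sgoal : sexp := scat [:: SConst (enc_nat 5 ++ enc_nat 3 ++ enc_nat 3 ++ enc_nat 4);
  slevels; strans M 0; SConst (enc_nat 3 ++ enc_dform (acc_form M))].

Lemma den_goal : den sgoal env =
  enc_dform (reach_goal K N (trans_form M N) (acc_form M) (K * N.+2)).
Proof.
rewrite /sgoal den_scat4 !den_SConst (den_trans M 0 env).
rewrite [X in _ ++ X]catA (den_levels (trans_form M N)) /reach_goal enc_K.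
by rewrite enum_rank_agent // /dimp.
Qed.

Definition strue d a off := SCat (SConst [:: true]) (satom d a off).

Lemma den_strue d a off e : den (strue d a off) e = true :: enc_atom (name a (size (nth [::] e d) + off)).
Proof. by rewrite /strue den_SCat den_satom. Qed.

Definition strk a := SCat (srep 0 (strue 0 a 0)) (SCat (strue 0 a 0) (strue 0 a 1)).

Lemma den_strk a : den (strk a) env = flatten [seq true :: enc_atom p | p <- [seq name a i | i <- iota 0 N.+2]].
Proof.
rewrite map_iota2 map_cat flatten_cat /strk den_SCat den_srep [den (SCat (strue _ _ _) _) _]den_SCat !den_strue.
rewrite -map_comp -[nth _ _ 0]/x addn0 addn1; congr (flatten _ ++ _); last first.
  by rewrite -[map _ [:: _; _]]/[:: true :: enc_atom (name a N); true :: enc_atom (name a N.+1)] /flatten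
     -[foldr _ _ _]/((true :: enc_atom (name a N)) ++ ((true :: enc_atom (name a N.+1)) ++ [::])) cats0.
by apply: eq_map => i; rewrite den_strue -[nth _ _ 0]/(nseq i false) size_nseq addn0.
Qed.

Definition stracks (l : seq nat) : sexp := SCat (scat (map strk l)) (SConst [:: false]).

Lemma tracks_cons a l : tracks_atoms N (a :: l) = [seq name a i | i <- iota 0 N.+2] ++ tracks_atoms N l.
Proof. by []. Qed.

Lemma den_tracks l : den (stracks l) env = enc_seq enc_atom (tracks_atoms N l).
Proof.
rewrite /stracks den_SCat den_scat -map_comp enc_seqE den_SConst; congr (_ ++ _).
elim: l => [|a l IH] //; rewrite tracks_cons map_cat flatten_cat -IH -den_strk.
by [].
Qed.

Definition sstate : sexp :=
  SCat (SConst (true :: enc_atom (cell K 0 (kid (inl (tm_start M) : kind M)) 0)))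
    (SCat (SFor 1 (strue 0 (0 * K + kid (in_kind M false)) 0) (strue 0 (0 * K + kid (in_kind M true)) 0))
      (SConst [:: false])).

Lemma den_state : den sstate env = enc_seq enc_atom (init_state M w).
Proof.
pose f (b : bool) i := if b then den (strue 0 (0 * K + kid (in_kind M true)) 0) (nseq i false :: env)
  else den (strue 0 (0 * K + kid (in_kind M false)) 0) (nseq i false :: env).
have fE b i : f b i = true :: enc_atom (cell K 0 (kid (in_kind M b)) i).
  by rewrite /f; case: b; rewrite den_strue -[nth _ _ 0]/(nseq i false) size_nseq addn0.
have gen i v : sloop f i v ++ [:: false] = enc_seq enc_atom (inits M i v).
  elim: v i => [|b v IH] i //.
  rewrite -[sloop _ _ _]/(f b i ++ sloop f i.+1 v) -catA IH fE.
  by rewrite -[inits M i _]/(cell K 0 (kid (in_kind M b)) i :: inits M i.+1 v).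
rewrite /sstate den_SCat den_SCat -[den (SFor _ _ _) _]/(sloop f 0 w) !den_SConst gen.
by [].
Qed.

Definition sinst : sexp :=
  scat [:: SConst (enc_nat 4); stracks (iota 0 (5 * K)); SConst (enc_seq enc_bnode [:: BLeaf true]);
    scat [seq stracks (obs_tracks K a) | a <- iota 0 4]; sstate; sgoal].

Definition machine_instance : instance :=
  Instance (nvoc K N) [:: BLeaf true] (nobs K N) (init_state M w)
    (reach_goal K N (trans_form M N) (acc_form M) (K * N.+2)).

Lemma den_inst : den sinst env = enc_instance machine_instance.
Proof.
have e6 a b c d e f : den (scat [:: a; b; c; d; e; f]) env =
    den a env ++ den b env ++ den c env ++ den d env ++ den e env ++ den f env.
  by rewrite den_scat -[map _ _]/[:: den a env; den b env; den c env; den d env; den e env; den f env] /= cats0.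
have eo : den (scat [seq stracks (obs_tracks K a) | a <- iota 0 4]) env = enc_obs (nobs K N).
  rewrite den_scat -map_comp /enc_obs -val_enum_ord -map_comp; congr flatten; apply: eq_map => i.
  by rewrite ffunE -den_tracks.
by rewrite /sinst e6 !den_SConst den_tracks eo den_state den_goal.
Qed.

Lemma machine_instance_ok : size w <= N -> instance_ok machine_instance.
Proof.
move=> hw; split.
- by split; [apply: uniq_tracks; exact: iota_uniq|exact: nvoc_names].
- by [].
- move=> i; split; last exact: nobs_sub.
  by rewrite ffunE; apply: uniq_tracks; apply: filter_uniq; exact: iota_uniq.
- by split; [exact: init_state_uniq|split; [exact: init_state_sub|]].
- by apply: dwf_reach_goal; [exact: nkinds_gt0|exact: trans_form_wf|exact: acc_form_wf].
Qed.
End Instance.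

(** * The space bound in unary, and hardness *)

Fixpoint spow (c j k : nat) : sexp := if k is k'.+1 then srep j (spow c j.+1 k') else SConst (nseq c true).

(** The [k] nested loops all run over the same word. Each of them puts its position in front of the
    environment, so the index of the word goes up by one per level. *)
Lemma size_spow c j k env : size (den (spow c j k) env) = c * size (nth [::] env j) ^ k.
Proof.
elim: k j env => [|k IH] j env; first by rewrite /= size_nseq muln1.
rewrite -[spow _ _ _]/(srep j (spow c j.+1 k)) den_srep.
set n := size (nth _ _ _).
have gen l : size (flatten [seq den (spow c j.+1 k) (nseq i false :: env) | i <- l]) = size l * (c * n ^ k).
  elim: l => [|i l IHl] //.
  rewrite -[map _ (i :: l)]/(den (spow c j.+1 k) (nseq i false :: env) :: map _ l).
  by rewrite [flatten _]/= size_cat IHl IH -[nth _ _ j.+1]/(nth [::] env j) -/n [size (i :: l)]/= mulSn.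
by rewrite gen size_iota expnS mulnCA.
Qed.

Theorem DEL_PSPACE_hard : PSPACE_hard DEL_model_checking.
Proof.
move=> L [M [c [k dec]]].
(* The length of this word is exactly the space bound of the machine, so that it can serve as N. *)
pose eN := SCat (spow c 0 k) (SConst (nseq c true)).
exists (fun w => den (sinst M) [:: rev (den eN [:: w]); w]); split; first exact: polytime_den.
move=> w; have [[n [b [hv hL]]] hsp] := dec w.
set x := rev _; have szx : size x = c * size w ^ k + c.
  by rewrite /x size_rev /eN den_SCat size_cat size_spow den_SConst size_nseq.
have bd : bounded (size x) (tm_init M w).
  move=> i j; rewrite szx; apply: leq_trans (hsp i); rewrite /config_space (bigD1 j) //=.
  exact: leq_addr.
have hn : halted (tm_run M w n) by rewrite /halted hv.
have hs := sat_machine bd hn.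
have ha : accepting (tm_run M w n) = b by rewrite /accepting hv; case: (b).
rewrite ha in hs; rewrite -hL -hs den_inst; split=> [h|].
  exists (machine_instance M x w); split=> //.
  exact: machine_instance_ok (size_input bd).
(* A word determines its instance, so satisfaction for some instance with this code is satisfaction
   for the constructed one. *)
by move=> [I [_ /enc_instance_inj -> h]].
Qed.

Theorem theorem10 : PSPACE_complete DEL_model_checking.
Proof. exact: conj DEL_in_PSPACE DEL_PSPACE_hard. Qed.
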